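(* Let $N=(N_1,\dots,N_d)$ be a multivariate Hawkes process with parameters $\mu\in[0,\infty)^d$ and $\boldsymbol{\varphi}=(\varphi_{ij})_{1\le i,j\le d}$, $\varphi_{ij}:[0,\infty)\to[0,\infty)$. Assume that $\int_0^\infty\varphi_{ij}(t)\,dt<\infty$ for all $i,j$ and that the spectral radius of $\mathbf K=\int_0^\infty\boldsymbol{\varphi}(t)\,dt$ satisfies $\rho(\mathbf K)<1$. Then for all $t\ge 0$ $$E(N_t)=t\mu+\Bigl(\int_0^t\boldsymbol\psi(t-s)\,s\,ds\Bigr)\mu,$$ where $\boldsymbol\psi=\sum_{n\ge1}\boldsymbol\varphi_n\in L^1(dt)$. Moreover, the processes $$\frac1{\sqrt T}\bigl(N_{Tv}-E(N_{Tv})\bigr),\quad v\in[0,1],$$ converge in law for the Skorokhod topology, as $T\to\infty$, to $$(\mathbf{Id}-\mathbf K)^{-1}\mathbf\Sigma^{1/2}W_v,\quad v\in[0,1],$$ where $(W_v)_{v\in[0,1]}$ is a standard $d$-dimensional Brownian motion and $\mathbf\Sigma$ is the $d\times d$ diagonal matrix with $\mathbf\Sigma_{ii}=\bigl((\mathbf{Id}-\mathbf K)^{-1}\mu\bigr)_i$.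
   Context: A multivariate Hawkes process with parameters $(\mu,\boldsymbol\varphi)$ is defined as follows. Let $(T_n)_{n\ge1}$ be a non-decreasing sequence of random variables with values in $(0,\infty]$ with $T_n<T_{n+1}$ on $\{T_n<\infty\}$, and $(Z_n)_{n\ge1}$ random variables with values in $\{1,\dots,d\}$. Put $N_{i,t}=\sum_{n\ge1}\mathbf 1_{\{T_n\le t\}\cap\{Z_n=i\}}$ for $t\ge0$ (so $N_{i,0}=0$ and no two components jump simultaneously) and let $\mathscr F_t=\sigma(N_{i,s}:s\le t,\,1\le i\le d)$. Let $\mu_i\ge 0$ and let $\varphi_{ij}:[0,\infty)\to[0,\infty)$ be (Borel) functions. $N$ is a Hawkes process under $P$ if for all $n\ge1$ and $i$ the process $N_{i,t\wedge T_n}-\int_0^{t\wedge T_n}\lambda_{i,s}\,ds$ is an $(\mathscr F_t)$-martingale, where $$\lambda_{i,t}=\mu_i+\int_{(0,t)}\sum_{j=1}^d\varphi_{ij}(t-s)\,dN_{j,s}.$$ No stationarity is assumed. $\mu$ and $N_t$ are regarded as column vectors, integrals of matrices are componentwise, $\mathbf{Id}$ is the identity matrix. The matrix-valued functions $\boldsymbol\varphi_n$ on $[0,\infty)$ (entries in $[0,\infty]$) are defined by $\boldsymbol\varphi_1=\boldsymbol\varphi$ and $\boldsymbol\varphi_{n+1}(t)=\int_0^t\boldsymbol\varphi(t-s)\boldsymbol\varphi_n(s)\,ds$ for $n\ge1$; since $\int_0^\infty\boldsymbol\varphi_n(t)\,dt=\mathbf K^n$, the series $\sum_{n\ge1}\boldsymbol\varphi_n$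 converges in $L^1(dt)$. *)

(* Defs.v *)
From HB Require Import structures.
From mathcomp Require Import all_boot all_order all_algebra.
From mathcomp Require Import complex.
From mathcomp Require Import all_classical all_reals all_analysis.
From mathcomp Require Import measurable_realfun.
Set Implicit Arguments.
Unset Strict Implicit.
Unset Printing Implicit Defensive.
Import Order.TTheory GRing.Theory Num.Theory.
Import numFieldNormedType.Exports.
Local Open Scope classical_set_scope.
Local Open Scope ring_scope.

(* The supremum of the moduli of the complex eigenvalues (0 when n = 0). *)
Definition spectral_radius (R : realType) (n : nat) (A : 'M[R]_n) : R :=
  sup [set ComplexField.Normc.normc z | z in
        [set z : R[i] | eigenvalue (map_mx (real_complex R) A) z]].

Section HawkesProcess.
Context (R : realType) (d : nat).

Section Kernels.
Variable phi : R -> 'M[R]_d.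

Definition kernel_mass : 'M[R]_d :=
  \matrix_(i, j) \int[lebesgue_measure]_(t in `[0, +oo[) phi t i j.

(* The index is shifted by one: [kernel_conv n] is the (n+1)-fold convolution
   power phi_{n+1}. *)
Fixpoint kernel_conv (n : nat) (t : R) : 'M[\bar R]_d :=
  if n is m.+1 then
    \matrix_(i, j) (\sum_(k < d) \int[lebesgue_measure]_(s in `[0%R, t])
        ((phi (t - s)%R i k)%:E * kernel_conv m s k j))%E
  else \matrix_(i, j) (phi t i j)%:E.

Definition kernel_psi (t : R) : 'M[\bar R]_d :=
  \matrix_(i, j) (\sum_(0 <= n <oo) kernel_conv n t i j)%E.

End Kernels.

Context (dO : measure_display) (Om : measurableType dO) (P : probability Om R).

(* [tau n] and [Z n] are the time and the component of the (n+1)-st jump. *)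
Definition marked_times (tau : nat -> Om -> \bar R) (Z : nat -> Om -> 'I_d) :
    Prop :=
  [/\ forall n, measurable_fun [set: Om] (tau n),
      forall n i, measurable (Z n @^-1` [set i]),
      forall n w, (0 < tau n w)%E,
      forall n w, (tau n w <= tau n.+1 w)%E &
      forall n w, (tau n w < +oo)%E -> (tau n w < tau n.+1 w)%E].

Section Jumps.
Variables (tau : nat -> Om -> \bar R) (Z : nat -> Om -> 'I_d).

(* The value +oo (accumulation of jumps) is not excluded a priori. *)
Definition jump_count (i : 'I_d) (t : R) (w : Om) : \bar R :=
  (\sum_(0 <= n <oo) (((tau n w <= t%:E)%E && (Z n w == i))%:R : R)%:E)%E.

(* \int_{(0, t)} f(s) dN_{j, s}, the measure dN_j being the sum of the unit
   masses at the jump times of the j-th component. *)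
Definition jump_integral (j : 'I_d) (t : R) (f : R -> R) (w : Om) : \bar R :=
  (\sum_(0 <= n <oo)
     (if (tau n w < t%:E)%E && (Z n w == j)
      then (f (fine (tau n w)))%:E else 0))%E.

Definition intensity (mu : 'cV[R]_d) (phi : R -> 'M[R]_d) (i : 'I_d) (t : R)
    (w : Om) : \bar R :=
  ((mu i 0)%:E + \sum_(j < d) jump_integral j t (fun s => phi (t - s)%R i j) w)%E.

Definition history (t : R) : set (set Om) :=
  <<s [set A | exists i s B,
         [/\ 0 <= s <= t, measurable B & A = jump_count i s @^-1` B] ]>>.

End Jumps.

(* The last clause is the defining property of E(M_t | F_s) = M_s. *)
Definition martingale (F : R -> set (set Om)) (M : R -> Om -> \bar R) : Prop :=
  [/\ forall t B, 0 <= t -> measurable B -> F t (M t @^-1` B),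
      forall t, 0 <= t -> P.-integrable [set: Om] (M t) &
      forall s t A, 0 <= s <= t -> F s A ->
        (\int[P]_(w in A) M t w = \int[P]_(w in A) M s w)%E].

Definition stopped_time (tau : nat -> Om -> \bar R) (n : nat) (t : R)
    (w : Om) : R := fine (Order.min t%:E (tau n w)).

Definition hawkes_process (mu : 'cV[R]_d) (phi : R -> 'M[R]_d)
    (tau : nat -> Om -> \bar R) (Z : nat -> Om -> 'I_d) : Prop :=
  marked_times tau Z /\
  forall n i, martingale (history tau Z) (fun t w =>
    jump_count tau Z i (stopped_time tau n t w) w -
    \int[lebesgue_measure]_(s in `[0%R, stopped_time tau n t w])
       intensity tau Z mu phi i s w)%E.

Definition mean_count (tau : nat -> Om -> \bar R) (Z : nat -> Om -> 'I_d)
    (i : 'I_d) (t : R) : \bar R := (\int[P]_w jump_count tau Z i t w)%E.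

Definition rescaled_count (tau : nat -> Om -> \bar R) (Z : nat -> Om -> 'I_d)
    (T v : R) (w : Om) : 'cV[R]_d :=
  (Num.sqrt T)^-1 *:
    \col_i (fine (jump_count tau Z i (T * v) w) -
            fine (mean_count tau Z i (T * v))).

Definition increment (W : R -> Om -> 'cV[R]_d) (s t : R) (i : 'I_d) (w : Om) :
    R := W t w i 0 - W s w i 0.

(* A standard d-dimensional Brownian motion indexed by [0, 1]: all the
   one-dimensional increments of all the coordinates over successive intervals
   are mutually independent, and centred Gaussian of variance the length of the
   interval. [normal_prob] takes the standard deviation. *)
Definition standard_brownian_motion (W : R -> Om -> 'cV[R]_d) : Prop :=
  [/\ forall t i, 0 <= t <= 1 -> measurable_fun [set: Om] (fun w => W t w i 0),
      forall w, W 0 w = 0,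
      forall w, {within `[0, 1], continuous (fun t => W t w)},
      forall s t i B, 0 <= s -> s < t -> t <= 1 -> measurable B ->
        P (increment W s t i @^-1` B) =
        normal_prob 0 (Num.sqrt (t - s)) B &
      forall (n : nat) (t : nat -> R) (B : nat -> 'I_d -> set R),
        (forall k, 0 <= t k <= 1) -> (forall k, t k <= t k.+1) ->
        (forall k i, measurable (B k i)) ->
        P [set w | forall (k : 'I_n) (i : 'I_d),
                     B k i (increment W (t k) (t k.+1) i w)] =
        (\prod_(k < n) \prod_(i < d)
           P (increment W (t k) (t k.+1) i @^-1` B k i))%E].

End HawkesProcess.

Section Skorokhod.
Context (R : realType) (d : nat).

Definition cadlag (x : R -> 'cV[R]_d) : Prop :=
  (forall t, 0 <= t < 1 -> x s @[s --> t^'+] --> x t) /\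
  (forall t, 0 < t <= 1 -> cvg (x s @[s --> t^'-])).

(* D([0,1], R^d). Elements are functions on R of which only the values on
   [0, 1] matter: two of them that agree on [0, 1] are at distance 0 below and
   hence are not separated by any continuous function. *)
Record skorokhod_space := SkorokhodSpace {
  skorokhod_path :> R -> 'cV[R]_d ;
  skorokhod_cadlag : cadlag skorokhod_path }.

(* Increasing surjections of [0, 1] onto itself; they are continuous. *)
Definition time_change (l : R -> R) : Prop :=
  {in `[0, 1] &, {homo l : s t / s < t}} /\ l @` `[0, 1] = `[0, 1]%classic.

(* The open balls of the distance
     d(x, y) = inf_l max (sup_t |l t - t|) (sup_t |x (l t) - y t|),
   which metrizes the Skorokhod (J1) topology. *)
Definition skorokhod_ball (x : skorokhod_space) (e : R) (y : skorokhod_space) :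
    Prop :=
  exists l : R -> R, exists2 e' : R, e' < e &
    time_change l /\
    forall t, 0 <= t <= 1 -> `|l t - t| <= e' /\ `|x (l t) - y t| <= e'.

Lemma time_changeP (l : R -> R) : time_change l ->
  forall t, 0 <= t <= 1 -> 0 <= l t <= 1.
Proof.
move=> [_ lE] t t01; have : (l @` `[0, 1]%classic) (l t) by exists t; rewrite //= in_itv.
by rewrite lE /= in_itv.
Qed.

Lemma skorokhod_ball_center x (e : R) : 0 < e -> skorokhod_ball x e x.
Proof.
move=> e0; exists id, 0 => //; split; last by move=> t _; rewrite !subrr !normr0.
by split => //; rewrite image_id.
Qed.

Lemma skorokhod_ball_sym x y (e : R) :
  skorokhod_ball x e y -> skorokhod_ball y e x.
Proof.
move=> [l [e' e'e [lT le]]]; have [lmono lE] := lT.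
have inv t : exists s, 0 <= t <= 1 -> 0 <= s <= 1 /\ l s = t.
  have [t01|] := boolP (0 <= t <= 1); last by exists 0.
  have : `[0, 1]%classic t by rewrite /= in_itv.
  by rewrite -lE => -[s /=]; rewrite in_itv/= => s01 <-; exists s.
have [g gP] := choice inv.
exists g, e' => //; split; last first.
  move=> t t01; have [g01 gt] := gP t t01.
  by have [] := le _ g01; rewrite gt => h1 h2; split; rewrite distrC.
split=> [s t|].
  rewrite !in_itv/= => s01 t01 st.
  have [[gs01 gs] [gt01 gt]] := (gP _ s01, gP _ t01).
  have [//|] := ltP (g s) (g t); rewrite le_eqVlt => /orP[/eqP gst|gts].
    by move: st; rewrite -gs -gt gst ltxx.
  have := lmono _ _ _ _ gts; rewrite !in_itv/= => /(_ gt01 gs01).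
  by rewrite gs gt ltNge (ltW st).
apply/seteqP; split=> [_ [t /= t01 <-]|s /=].
  by move: t01; rewrite !in_itv/= => /gP[].
rewrite in_itv/= => s01; have ls01 := time_changeP lT s01.
exists (l s); first by rewrite /= in_itv.
have [gls01 glsE] := gP _ ls01.
have [h|h|//] := ltgtP (g (l s)) s.
- by have := lmono _ _ _ _ h; rewrite !in_itv/= glsE ltxx => /(_ gls01 s01).
- by have := lmono _ _ _ _ h; rewrite !in_itv/= glsE ltxx => /(_ s01 gls01).
Qed.

Lemma skorokhod_ball_triangle x y z (e1 e2 : R) :
  skorokhod_ball x e1 y -> skorokhod_ball y e2 z -> skorokhod_ball x (e1 + e2) z.
Proof.
move=> [l [a ae [lT le]]] [m [b be [mT me]]].
exists (l \o m), (a + b); first exact: ltrD.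
split=> [|t t01 /=].
  case: (lT) (mT) => [l1 l2] [m1 m2]; split; last by rewrite -image_comp m2 l2.
  move=> s t; rewrite !in_itv/= => s01 t01 st.
  apply: l1; rewrite ?in_itv/= ?(time_changeP mT)//.
  by apply: m1; rewrite ?in_itv.
have [h1 h2] := me t t01; have [h3 h4] := le _ (time_changeP mT t01).
split; first by rewrite (le_trans (ler_distD (m t) _ _))// lerD.
by rewrite (le_trans (ler_distD (y (m t)) _ _))// lerD.
Qed.

HB.instance Definition _ := gen_eqMixin skorokhod_space.
HB.instance Definition _ := gen_choiceMixin skorokhod_space.
HB.instance Definition _ :=
  hasNbhs.Build skorokhod_space (nbhs_ (entourage_ skorokhod_ball)).
HB.instance Definition _ := Nbhs_isPseudoMetric.Build R skorokhod_space
  erefl skorokhod_ball_center skorokhod_ball_sym skorokhod_ball_triangle erefl.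

Lemma cadlag0 : cadlag (fun=> 0).
Proof. by split=> t _; [exact: cvg_cst|exact: is_cvg_cst]. Qed.

(* The path itself if it is cadlag on [0, 1], the zero path otherwise. *)
Definition to_skorokhod (x : R -> 'cV[R]_d) : skorokhod_space :=
  if pselect (cadlag x) is left xD then SkorokhodSpace xD
  else SkorokhodSpace cadlag0.

(* Convergence in law, in D([0,1], R^d), of the processes X T on (Om, P) to the
   process Y on (Om', Q) as T tends to +oo. The paths are only required to be
   cadlag almost surely, so [to_skorokhod] alters them on null sets only. As the
   Borel sets of D are generated by the evaluations, the variables whose
   expectations are taken are measurable, up to null sets, as soon as X T v and
   Y v are for every v. *)
Definition cvg_in_law_skorokhod
    (dO dO' : measure_display) (Om : measurableType dO)
    (Om' : measurableType dO') (P : probability Om R) (Q : probability Om' R)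
    (X : R -> R -> Om -> 'cV[R]_d) (Y : R -> Om' -> 'cV[R]_d) : Prop :=
  [/\ \forall T \near +oo%R, {ae P, forall w, cadlag (fun v => X T v w)},
      {ae Q, forall w, cadlag (fun v => Y v w)} &
      forall f : skorokhod_space -> R,
        continuous f -> (exists C, forall x, `|f x| <= C) ->
        ('E_P[fun w => f (to_skorokhod (fun v => X T v w))]
           @[T --> +oo%R] -->
         'E_Q[fun w => f (to_skorokhod (fun v => Y v w))])%E].

End Skorokhod.

(* Main.v *)
(* Write X = N - E N, K for the kernel mass and M for the compensated martingale. The
   intensity being a convolution with the past, E N solves a renewal equation, and
   X = M + phi * X. The matrix K is a contraction for a weighted maximum norm, which
   bounds the increments of X in L^2 and L^4; moreover (Id - K) X = M + o(sqrt T) in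
   L^1, since phi * X differs from K X only through increments of X over distances
   weighted by phi. The quadratic variation of M is N, of mean asymptotic to
   (Id - K)^-1 mu t, so that over a fine partition the characteristic function of M
   is multiplied by 1 - |th|^2 h / 2 up to O(h^(3/2)); this yields the convergence of the
   characteristic functions of the finite dimensional distributions. Bounded
   Lipschitz functions being approximated by trigonometric polynomials, these
   distributions converge. The bounds in L^4 and a dyadic chaining show that the
   paths are uniformly close to their values on a fixed grid, with a small mean
   error. Finally a continuous f on D is squeezed, near the continuous paths of the
   limit, between the monotone limits of Lipschitz functions for the uniform
   distance, which need only be evaluated at step paths. *)
Require Import Defs.
From HB Require Import structures.
From mathcomp Require Import all_boot all_order all_algebra.
From mathcomp Require Import complex.
From mathcomp Require Import all_classical all_reals all_analysis.
From mathcomp Require Import measurable_realfun.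
From mathcomp Require Import ring lra zify.
Set Implicit Arguments.
Unset Strict Implicit.
Unset Printing Implicit Defensive.
Import Order.TTheory GRing.Theory Num.Theory.
Import numFieldNormedType.Exports.
Local Open Scope classical_set_scope.
Local Open Scope ring_scope.

(** * Elementary inequalities and trigonometric approximation *)

(** The martingale property is given only up to a jump time, where the count and its compensator are
    bounded. Every identity is therefore proved first for the stopped processes, with bounds uniform
    in the number of jumps; Fatou and dominated convergence do the rest, once the first moments have
    excluded explosion. Conditional expectations are replaced by bounded test variables depending on
    the past, stochastic calculus by squared increments along uniform partitions, and the fourth
    moments come from a deterministic inequality for finite sequences. Fourth moments of increments
    over a time h grow like h + h^2. The linear term, due to isolated jumps, defeats Kolmogorov's
    criterion below unit time (before rescaling); there the chaining stops and the monotonicity of N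
    takes over. A continuous f on D evaluated along a path is not known to be measurable, so its
    integrals are squeezed between integrals of measurable functions, and Prokhorov's theorem is not
    invoked. *)

Section CvgDist.
Context {R : realType} {T : Type} (F : set_system T) {FF : Filter F}.

Lemma cvgr_distP (f : T -> R) (l : R) :
  (forall e : R, 0 < e -> \forall x \near F, `|l - f x| <= e) -> f x @[x --> F] --> l.
Proof. by move=> h; apply/cvgrPdist_le. Qed.

Lemma cvgr_dist (f : T -> R) (l : R) : f x @[x --> F] --> l ->
  forall e : R, 0 < e -> \forall x \near F, `|l - f x| <= e.
Proof. by move=> /cvgrPdist_le. Qed.

End CvgDist.

Section TrigTaylor.
Context {R : realType}.
Implicit Types (x y u : R).

(** The ladder behind the Taylor bounds: [u - sin u], [cos u - 1 + u ^+ 2 / 2] and their two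
    successors vanish at 0 and each is the derivative of the next, so that nonnegativity
    propagates. *)
Lemma derive_ge0_from0 (f f' : R -> R) :
  (forall x, is_derive x 1 f (f' x)) -> f 0 = 0 ->
  (forall x, 0 <= x -> 0 <= f' x) -> forall x, 0 <= x -> 0 <= f x.
Proof.
move=> df f0 f'0 x x0.
have [c + ->] : exists2 c, c \in `[0, x]%R & f x = f' c * x.
  have [|c c0x e] := @MVT_segment R f f' 0 x x0.
    apply: continuous_subspaceT => y; apply/differentiable_continuous.
    by apply/derivable1_diffP; have [] := df y.
  by exists c => //; rewrite f0 !subr0 in e.
by rewrite in_itv/= => /andP[c0 _]; rewrite mulr_ge0// f'0.
Qed.

Lemma ge0_subr_sin u : 0 <= u -> 0 <= u - sin u.
Proof.
apply: (@derive_ge0_from0 (fun u => u - sin u) (fun u => 1 - cos u)).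
- by rewrite sin0 subr0.
- by move=> x _; rewrite subr_ge0 cos_le1.
Qed.

Lemma ge0_cos_sqr u : 0 <= u -> 0 <= cos u - 1 + u ^+ 2 / 2.
Proof.
apply: (@derive_ge0_from0 (fun u => cos u - 1 + u ^+ 2 / 2) (fun u => u - sin u)).
- move=> x; apply: is_derive_eq; rewrite /GRing.scale/=; lra.
- by rewrite cos0 expr0n/= mul0r addr0 subrr.
- exact: ge0_subr_sin.
Qed.

Lemma ge0_sin_cube u : 0 <= u -> 0 <= u ^+ 3 / 6 - (u - sin u).
Proof.
apply: (@derive_ge0_from0 (fun u => u ^+ 3 / 6 - (u - sin u)) (fun u => cos u - 1 + u ^+ 2 / 2)).
- move=> x; apply: is_derive_eq; rewrite /GRing.scale/=; lra.
- by rewrite sin0 expr0n/= mul0r subr0 subrr.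
- exact: ge0_cos_sqr.
Qed.

Lemma ge0_cos_quart u : 0 <= u -> 0 <= u ^+ 4 / 24 - (cos u - 1 + u ^+ 2 / 2).
Proof.
apply: (@derive_ge0_from0 (fun u => u ^+ 4 / 24 - (cos u - 1 + u ^+ 2 / 2))
   (fun u => u ^+ 3 / 6 - (u - sin u))).
- move=> x; apply: is_derive_eq; rewrite /GRing.scale/=; lra.
- by rewrite cos0 !expr0n/= !mul0r addr0 subrr subrr.
- exact: ge0_sin_cube.
Qed.

Lemma sin_taylor u : `|sin u - u| <= `|u| ^+ 3 / 6.
Proof.
wlog u0 : u / 0 <= u.
  move=> H; have [/H//|u0] := leP 0 u.
  have := H (- u); rewrite sinN opprK normrN oppr_ge0 => /(_ (ltW u0)).
  by rewrite addrC => h; rewrite distrC.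
have := ge0_subr_sin u0; have := ge0_sin_cube u0.
rewrite (ger0_norm u0) => ? ?; rewrite ler_norml; apply/andP; split; lra.
Qed.

Lemma cos_taylor u : `|cos u - 1 + u ^+ 2 / 2| <= `|u| ^+ 3.
Proof.
wlog u0 : u / 0 <= u.
  move=> H; have [/H//|u0] := leP 0 u.
  by have := H (- u); rewrite cosN normrN sqrrN oppr_ge0 => /(_ (ltW u0)).
have h1 := ge0_cos_sqr u0; have h2 := ge0_cos_quart u0.
rewrite (ger0_norm u0) ger0_norm//.
(* Up to 1 the quartic bound lies below the cube; beyond 1, [cos u <= 1] and [u ^+ 2 <= u ^+ 3]
   suffice. *)
have [u1|u1] := leP u 1.
  have : u ^+ 4 <= u ^+ 3 by rewrite exprSr ler_piMr// exprn_ge0.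
  have : 0 <= u ^+ 3 by rewrite exprn_ge0.
  lra.
have := cos_le1 u.
have : u ^+ 2 <= u ^+ 3 by rewrite [leRHS]exprSr ler_peMr ?sqr_ge0// ltW.
have : 0 <= u ^+ 2 by rewrite sqr_ge0.
lra.
Qed.

(** Expansion for one step of a characteristic function: [x] stands for the past and [u] for the new
    increment. The remainder is cubic, hence controlled by second and fourth moments. *)
Lemma cosD_taylor x u :
  `|cos (x + u) - cos x + u * sin x + u ^+ 2 / 2 * cos x| <= 2 * `|u| ^+ 3.
Proof.
have -> : cos (x + u) - cos x + u * sin x + u ^+ 2 / 2 * cos x =
    cos x * (cos u - 1 + u ^+ 2 / 2) - sin x * (sin u - u) by rewrite cosD; ring.
rewrite (le_trans (ler_normB _ _))// !normrM.
have : `|sin x| * `|sin u - u| <= 1 * (`|u| ^+ 3 / 6).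
  by rewrite ler_pM// ?sin_max ?sin_taylor.
have : `|cos x| * `|cos u - 1 + u ^+ 2 / 2| <= 1 * (`|u| ^+ 3).
  by rewrite ler_pM// ?cos_max ?cos_taylor.
have : 0 <= `|u| ^+ 3 by rewrite exprn_ge0.
lra.
Qed.

(** Weaker than the cubic bound near 0, but quadratic for all [u]: replacing [x] by [c sin (x / c)]
    will cost a second moment only. *)
Lemma subr_sin_le u : `|sin u - u| <= 2 * u ^+ 2.
Proof.
have [u1|u1] := leP `|u| 1.
  rewrite (le_trans (sin_taylor _))// -[u ^+ 2]real_normK ?num_real//.
  have : `|u| ^+ 3 <= `|u| ^+ 2 by rewrite exprSr ler_piMr// sqr_ge0.
  have : 0 <= `|u| ^+ 2 by rewrite sqr_ge0.
  lra.
rewrite (le_trans (ler_normB _ _))// -[u ^+ 2]real_normK ?num_real//.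
have := sin_max u; have : `|u| * 1 <= `|u| * `|u| by rewrite ler_pM2l; lra.
rewrite -expr2; lra.
Qed.

End TrigTaylor.

(** * Pathwise maximal and fourth moment inequalities *)

Section PathwiseBDG.
Context {R : realType}.
Variable S : nat -> R.
Hypothesis S0 : S 0%N = 0.

Fixpoint running_max (n : nat) : R :=
  if n is m.+1 then Num.max (running_max m) `|S n| else `|S 0%N|.

Lemma running_max_ge0 n : 0 <= running_max n.
Proof. by case: n => //= n; rewrite le_max normr_ge0 orbT. Qed.

Lemma norm_le_running_max n : `|S n| <= running_max n.
Proof. by case: n => //= n; rewrite le_max lexx orbT. Qed.

Lemma running_maxS n : running_max n <= running_max n.+1.
Proof. by rewrite /= le_max lexx. Qed.

Let X k := S k.+1 - S k.

(* Doob's maximal inequality in L^4, in a trajectorial form: the sum has mean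
   zero for a martingale. *)
Lemma pathwise_doob n : running_max n ^+ 4 +
  8 * \sum_(k < n) running_max k ^+ 2 * S k * X k <= 4 * S n ^+ 4.
Proof.
(* In effect a summation by parts: the maximum M grows only at indices where it equals [|S|], so the
   complementary sum is that of [M_{k+1}^2 (M_{k+1}^2 - M_k^2)], at least [M_n^4 / 2]. *)
have H : 2 * \sum_(k < n) running_max k ^+ 2 * (S k.+1 ^+ 2 - S k ^+ 2) <=
    2 * (running_max n ^+ 2 * S n ^+ 2) - running_max n ^+ 4.
  elim: n => [|n ih]; first by rewrite big_ord0/= S0 normr0 !expr0n/=; lra.
  rewrite big_ord_recr/= mulrDr.
  have := running_max_ge0 n; set M := running_max n in ih *.
  rewrite /Num.max; case: ltP => MS M0.
    have e : `|S n.+1| ^+ 2 = S n.+1 ^+ 2 by rewrite real_normK ?num_real.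
    have -> : `|S n.+1| ^+ 4 = S n.+1 ^+ 4 by rewrite -[4%N]/(2 * 2)%N exprM e -exprM.
    rewrite e; have := sqr_ge0 (M ^+ 2 - S n.+1 ^+ 2).
    move: ih; set a := \sum_(k < n) _ => ih ?.
    nra.
  move: ih; set a := \sum_(k < n) _ => ih; nra.
have h k : running_max k ^+ 2 * (S k * X k) * 2 <=
    running_max k ^+ 2 * (S k.+1 ^+ 2 - S k ^+ 2).
  rewrite -mulrA ler_wpM2l ?sqr_ge0//; rewrite /X.
  have := sqr_ge0 (S k.+1 - S k); nra.
have : (\sum_(k < n) running_max k ^+ 2 * S k * X k) * 2 <=
    \sum_(k < n) running_max k ^+ 2 * (S k.+1 ^+ 2 - S k ^+ 2).
  by rewrite mulr_suml; apply: ler_sum => k _; rewrite -[_ * S k * _]mulrA h.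
(* This square gives [4 M^2 S^2 <= M^4 + 4 S^4], which absorbs the cross term. *)
have := sqr_ge0 (running_max n ^+ 2 - 2 * S n ^+ 2).
move: H; set a := \sum_(k < n) _; set b := \sum_(k < n) _ => *; nra.
Qed.

(** Let A be the sum of the [S k ^+ 3 * X k], B the sum in Doob's inequality, Q the sum of squares
    and M the maximum. Expanding fourth powers gives [S^4 <= 4 A + 6 M^2 Q], Doob gives
    [M^4 + 8 B <= 4 S^4], and [48 M^2 Q <= M^4 + 24^2 Q^2]; together,
    [M^4 <= 576 Q^2 + 32 A - 16 B]. The coefficient of [X k] depends on [S] up to index k only, so
    for a martingale the last sum has mean zero. *)
Lemma pathwise_bdg n : S n ^+ 4 <= 576 * (\sum_(k < n) X k ^+ 2) ^+ 2 +
  \sum_(k < n) (32 * S k ^+ 3 - 16 * running_max k ^+ 2 * S k) * X k.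
Proof.
have H : S n ^+ 4 <= 4 * (\sum_(k < n) S k ^+ 3 * X k) +
    6 * running_max n ^+ 2 * \sum_(k < n) X k ^+ 2.
  elim: n => [|n ih]; first by rewrite S0 !big_ord0 expr0n/= !mulr0 addr0.
  rewrite !big_ord_recr/= -/(running_max n.+1).
  have m1 := running_maxS n; have m2 := norm_le_running_max n.+1.
  have m3 := norm_le_running_max n; have m4 := running_max_ge0 n.
  have Q0 : 0 <= \sum_(k < n) X k ^+ 2 by rewrite sumr_ge0// => *; rewrite sqr_ge0.
  have e1 : 6 * running_max n ^+ 2 * (\sum_(k < n) X k ^+ 2) <=
      6 * running_max n.+1 ^+ 2 * (\sum_(k < n) X k ^+ 2).
    by rewrite ler_wpM2r// ler_wpM2l// ler_sqr ?nnegrE// ?running_max_ge0.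
  have e2 : S n.+1 ^+ 4 - S n ^+ 4 - 4 * (S n ^+ 3 * X n) <=
     6 * running_max n.+1 ^+ 2 * X n ^+ 2.
    have -> : S n.+1 ^+ 4 - S n ^+ 4 - 4 * (S n ^+ 3 * X n) =
       (3 * S n ^+ 2 + 2 * (S n * S n.+1) + S n.+1 ^+ 2) * X n ^+ 2 by rewrite /X; ring.
    rewrite ler_wpM2r ?sqr_ge0//.
    have a1 : S n ^+ 2 <= running_max n.+1 ^+ 2.
      rewrite -[S n ^+ 2]real_normK ?num_real// ler_sqr ?nnegrE ?running_max_ge0//.
      exact: le_trans m1.
    have a2 : S n.+1 ^+ 2 <= running_max n.+1 ^+ 2.
      by rewrite -[S n.+1 ^+ 2]real_normK ?num_real// ler_sqr ?nnegrE ?running_max_ge0.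
    have := sqr_ge0 (S n - S n.+1); nra.
  move: ih e1 e2; set a := \sum_(k < n) _; set b := \sum_(k < n) _.
  move: (S n ^+ 3 * X n) (X n ^+ 2) (running_max n.+1 ^+ 2) (running_max n ^+ 2).
  move: (S n.+1 ^+ 4) (S n ^+ 4) a b => *; lra.
have D := pathwise_doob n.
have M0 := running_max_ge0 n.
have SM : S n ^+ 4 <= running_max n ^+ 4.
  have -> : S n ^+ 4 = `|S n| ^+ 4.
    by rewrite -[4%N]/(2 * 2)%N [RHS]exprM real_normK ?num_real// -exprM.
  by rewrite lerXn2r ?nnegrE// norm_le_running_max.
have -> : \sum_(k < n) (32 * S k ^+ 3 - 16 * running_max k ^+ 2 * S k) * X k =
    32 * (\sum_(k < n) S k ^+ 3 * X k) - 16 * \sum_(k < n) running_max k ^+ 2 * S k * X k.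
  rewrite !mulr_sumr -sumrB; apply: eq_bigr => k _; ring.
move: H D SM; set A := \sum_(k < n) _; set Q := \sum_(k < n) _; set B := \sum_(k < n) _.
set M := running_max n in M0 * => H D SM.
have : 0 <= (M ^+ 2 - 24 * Q) ^+ 2 by rewrite sqr_ge0.
nra.
Qed.

End PathwiseBDG.

(** * Trigonometric polynomials in several variables *)

Section TrigPolynomials.
Context {R : realType} {I : finType}.
Implicit Types (u v : (I -> R) -> R) (x : I -> R) (l : seq (R * (I -> R) * R)).

(** A triple is an amplitude, a frequency vector and a phase. The phase stands in for complex
    exponentials: it includes the sines and keeps products in the class. *)
Definition trig_sum l x : R :=
  \sum_(e <- l) e.1.1 * cos (\sum_i e.1.2 i * x i + e.2).

Definition trig_poly u : Prop := exists l, forall x, u x = trig_sum l x.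

Lemma trig_poly_cst c : trig_poly (fun=> c).
Proof.
exists [:: (c, (fun=> 0), 0)] => x; rewrite /trig_sum big_seq1/= big1 ?addr0.
  by rewrite cos0 mulr1.
by move=> i _; rewrite mul0r.
Qed.

Lemma trig_polyD u v : trig_poly u -> trig_poly v -> trig_poly (fun x => u x + v x).
Proof.
by move=> [l ul] [m vm]; exists (l ++ m) => x; rewrite /trig_sum big_cat ul vm.
Qed.

Lemma trig_polyM u v : trig_poly u -> trig_poly v -> trig_poly (fun x => u x * v x).
Proof.
move=> [l ul] [m vm].
exists ([seq (e.1.1 * f.1.1 / 2, (fun i => e.1.2 i - f.1.2 i), e.2 - f.2) | e <- l, f <- m] ++
  [seq (e.1.1 * f.1.1 / 2, (fun i => e.1.2 i + f.1.2 i), e.2 + f.2) | e <- l, f <- m]) => x.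
rewrite ul vm /trig_sum big_cat !big_allpairs_dep/= -big_split/=.
rewrite mulr_suml; apply: eq_bigr => e _.
rewrite mulr_sumr -big_split/=; apply: eq_bigr => f _.
set a := \sum_i e.1.2 i * x i; set b := \sum_i f.1.2 i * x i.
have -> : \sum_i (e.1.2 i - f.1.2 i) * x i = a - b.
  by rewrite -sumrB; apply: eq_bigr => i _; rewrite mulrBl.
have -> : \sum_i (e.1.2 i + f.1.2 i) * x i = a + b.
  by rewrite -big_split; apply: eq_bigr => i _; rewrite mulrDl.
have -> : a - b + (e.2 - f.2) = (a + e.2) - (b + f.2) by ring.
have -> : a + b + (e.2 + f.2) = (a + e.2) + (b + f.2) by ring.
rewrite [cos (a + e.2 - _)]cosB [cos (a + e.2 + (b + f.2))]cosD.
by field.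
Qed.

Lemma trig_poly_sin (c : R) i : trig_poly (fun x => sin (c * x i)).
Proof.
exists [:: (1, (fun j => c *+ (i == j)), - (pi / 2))] => x.
rewrite /trig_sum big_seq1/= mul1r (bigD1 i)//= eqxx big1 ?addr0 ?cosBpihalf//.
by move=> j; rewrite eq_sym => /negbTE ->; rewrite mul0r.
Qed.

End TrigPolynomials.

(** * Bernstein operators and approximation of Lipschitz functions *)

Section Bernstein.
Context {R : realType} {I : finType}.
Implicit Types (f : nat -> R).

(* The expectation of f under the binomial distribution of parameters n, p. *)
Fixpoint bernstein (n : nat) f (p : R) : R :=
  if n is m.+1 then p * bernstein m (f \o S) p + (1 - p) * bernstein m f p
  else f 0%N.

Lemma le_bernstein n f g p : 0 <= p <= 1 -> (forall k, f k <= g k) ->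
  bernstein n f p <= bernstein n g p.
Proof.
move=> /andP[p0 p1]; elim: n f g => [|n ih] f g fg; first exact: fg.
by rewrite /= lerD// ler_wpM2l ?subr_ge0// ih// => k; exact: fg.
Qed.

Lemma bernsteinD n f g p : bernstein n (fun k => f k + g k) p = bernstein n f p + bernstein n g p.
Proof.
elim: n f g => //= n ih f g; rewrite ih (ih (f \o S) (g \o S)); ring.
Qed.

Lemma bernsteinZ n c f p : bernstein n (fun k => c * f k) p = c * bernstein n f p.
Proof.
elim: n f => //= n ih f; rewrite ih (ih (f \o S)); ring.
Qed.

Lemma bernstein_cst n c p : bernstein n (fun=> c) p = c.
Proof. elim: n => //= n ih; rewrite [X in p * X]ih ih; ring. Qed.

(** The shift [c] lets the induction close; for [c = - n p] the right side is the variance of the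
    binomial distribution. *)
Lemma bernstein_sqr n (c p : R) : bernstein n (fun k => (k%:R + c) ^+ 2) p =
  n%:R * (p * (1 - p)) + (n%:R * p + c) ^+ 2.
Proof.
elim: n c => [|n ih] c; first by rewrite /= !mul0r !add0r.
rewrite /= ih -[X in p * bernstein n X p]/(fun k : nat => (k.+1%:R + c) ^+ 2).
have -> : (fun k : nat => (k.+1%:R + c) ^+ 2) = (fun k : nat => (k%:R + (c + 1)) ^+ 2 : R).
  by apply/funext => k; rewrite -natr1; ring.
by rewrite ih -natr1; ring.
Qed.

Lemma bernstein_dist n p : 0 <= p <= 1 ->
  bernstein n.+1 (fun k => `|k%:R / n.+1%:R - p|) p <= (Num.sqrt n.+1%:R)^-1.
Proof.
move=> p01; set s := Num.sqrt _; have /andP[p0 p1] := p01.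
have s0 : 0 < s by rewrite sqrtr_gt0.
have ss : s ^+ 2 = n.+1%:R by rewrite sqr_sqrtr.
have n0 : n.+1%:R != 0 :> R by rewrite pnatr_eq0.
(* [a <= s a^2 / 2 + 1 / (2 s)] replaces Cauchy-Schwarz: the mean of [a^2] is [p (1 - p) / s^2], so
   that each half is at most [1 / (2 s)]. *)
apply: (@le_trans _ _ (bernstein n.+1
  (fun k => s / 2 * ((n.+1%:R)^-2 * (k%:R + - (n.+1%:R * p)) ^+ 2) + s^-1 / 2) p)).
  apply: le_bernstein => // k.
  have -> : n.+1%:R^-2 * (k%:R + - (n.+1%:R * p)) ^+ 2 = `|k%:R / n.+1%:R - p| ^+ 2.
    by rewrite real_normK ?num_real//; field.
  set a := `|_|; have -> : s / 2 * a ^+ 2 + s^-1 / 2 = a + s / 2 * (a - s^-1) ^+ 2.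
    by field; rewrite gt_eqF.
  by rewrite lerDl mulr_ge0 ?sqr_ge0// divr_ge0// ltW.
rewrite bernsteinD bernsteinZ bernsteinZ bernstein_cst bernstein_sqr subrr expr0n/= addr0.
rewrite -ss.
have -> : s / 2 * ((s ^+ 2) ^- 2 * (s ^+ 2 * (p * (1 - p)))) = s^-1 / 2 * (p * (1 - p)).
  by field; rewrite gt_eqF.
have : s^-1 / 2 * (p * (1 - p)) <= s^-1 / 2 * 1.
  by rewrite ler_pM2l ?divr_gt0 ?invr_gt0//; nra.
lra.
Qed.

Definition subst_coord (y : I -> R) i (a : R) : I -> R := fun j => if j == i then a else y j.

(** The coordinates are randomized one after the other: [s] lists those still to be drawn and [y]
    records the values already drawn. *)
Fixpoint multi_bernstein (n : nat) (s : seq I) (g : (I -> R) -> R) (y p : I -> R) : R :=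
  if s is i :: s' then
    bernstein n (fun k => multi_bernstein n s' g (subst_coord y i (k%:R / n%:R)) p) (p i)
  else g y.

(** Each coordinate costs one use of [bernstein_dist], by the Lipschitz bound, and the errors add up
    because the averages are linear and monotone. The target mixes [p] and [y], the coordinates
    outside [s] being frozen. *)
Lemma multi_bernstein_approx n s g y p (L : R) : 0 <= L ->
  (forall x x', `|g x - g x'| <= L * \sum_i `|x i - x' i|) ->
  (forall i, 0 <= p i <= 1) ->
  `|multi_bernstein n.+1 s g y p - g (fun i => if i \in s then p i else y i)| <=
     (size s)%:R * (L / Num.sqrt n.+1%:R).
Proof.
move=> L0 gL p01; elim: s y => [|i s ih] y; first by rewrite /= subrr normr0 mul0r.
set G := g _; set e := (size s)%:R * _ in ih.
have key k : `|multi_bernstein n.+1 s g (subst_coord y i (k%:R / n.+1%:R)) p - G| <=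
    e + L * `|k%:R / n.+1%:R - p i|.
  apply: le_trans (ler_distD (g (fun j => if j \in s then p j else
     subst_coord y i (k%:R / n.+1%:R) j)) _ _) _.
  rewrite lerD ?ih// (le_trans (gL _ _))// ler_wpM2l//.
  rewrite (bigD1 i)//= big1 ?addr0.
    rewrite inE eqxx/=; case: ifP => _; first by rewrite subrr normr0.
    by rewrite /subst_coord eqxx.
  move=> j ji; rewrite inE (negbTE ji)/= /subst_coord (negbTE ji).
  by case: ifP => _; rewrite subrr normr0.
have eS : (size (i :: s))%:R * (L / Num.sqrt n.+1%:R) = e + L / Num.sqrt n.+1%:R.
  by rewrite /= -natr1 mulrDl mul1r.
have bd : bernstein n.+1 (fun k => e + L * `|k%:R / n.+1%:R - p i|) (p i) <=
    e + L / Num.sqrt n.+1%:R.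
  by rewrite bernsteinD bernstein_cst bernsteinZ lerD2l ler_wpM2l// bernstein_dist.
rewrite eS.
have -> : multi_bernstein n.+1 (i :: s) g y p = bernstein n.+1 (fun k =>
     multi_bernstein n.+1 s g (subst_coord y i (k%:R / n.+1%:R)) p) (p i) by [].
move: bd; set c := bernstein n.+1 _ _; set a := bernstein n.+1 _ _ => bd.
have lo : G <= a + c.
  rewrite -bernsteinD -[leLHS](bernstein_cst n.+1 G (p i)); apply: le_bernstein => // k.
  by have := key k; rewrite ler_norml => /andP[+ _]; lra.
have hi : a <= G + c.
  rewrite -[X in X + c](bernstein_cst n.+1 G (p i)) -bernsteinD; apply: le_bernstein => // k.
  by have := key k; rewrite ler_norml => /andP[_]; lra.
rewrite ler_norml; apply/andP; split; lra.
Qed.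

Lemma trig_poly_bernstein n (f : nat -> (I -> R) -> R) (p : (I -> R) -> R) :
  trig_poly p -> (forall k, trig_poly (f k)) ->
  trig_poly (fun x => bernstein n (f^~ x) (p x)).
Proof.
move=> tp; elim: n f => [|n ih] f tf; first exact: tf.
apply: trig_polyD; apply: trig_polyM => //; first by apply: (ih (fun k => f k.+1)).
- have -> : (fun x => 1 - p x) = (fun x => 1 + -1 * p x) by apply/funext => x; ring.
  by apply: trig_polyD; [exact: trig_poly_cst|apply: trig_polyM => //; exact: trig_poly_cst].
- exact: ih.
Qed.

(** The operator is a polynomial in the [p i] whose coefficients come from finitely many values of
    [g], and trigonometric polynomials form an algebra. *)
Lemma trig_poly_multi_bernstein n s g y (p : I -> (I -> R) -> R) :
  (forall i, trig_poly (p i)) ->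
  trig_poly (fun x => multi_bernstein n s g y (p^~ x)).
Proof.
move=> tp; elim: s y => [|i s ih] y; first exact: trig_poly_cst.
by apply: (@trig_poly_bernstein n (fun k x => multi_bernstein n s g (subst_coord y i (k%:R / n%:R)) (p^~ x))).
Qed.

(* Replace each coordinate x by c sin (x / c), then apply Bernstein's theorem to
   the resulting function of the sines. *)
Lemma trig_poly_approx (g : (I -> R) -> R) (L c e : R) : 0 <= L -> 0 < c -> 0 < e ->
  (forall x x', `|g x - g x'| <= L * \sum_i `|x i - x' i|) ->
  exists2 u, trig_poly u &
    forall x, `|u x - g x| <= e + L * \sum_i 2 * x i ^+ 2 / c.
Proof.
move=> L0 c0 e0 gL.
pose h (p : I -> R) := g (fun i => c * (2 * p i - 1)).
pose p i (x : I -> R) := 2^-1 * (1 + sin (c^-1 * x i)).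
have tp i : trig_poly (p i).
  apply: trig_polyM; first exact: trig_poly_cst.
  by apply: trig_polyD; [exact: trig_poly_cst|exact: trig_poly_sin].
have L'0 : 0 <= L * (2 * c) by rewrite mulr_ge0// mulr_ge0// ltW.
have hL x x' : `|h x - h x'| <= L * (2 * c) * \sum_i `|x i - x' i|.
  rewrite (le_trans (gL _ _))// -mulrA ler_wpM2l// mulr_sumr ler_sum// => i _.
  have -> : c * (2 * x i - 1) - c * (2 * x' i - 1) = 2 * c * (x i - x' i) by ring.
  by rewrite normrM gtr0_norm// mulr_gt0.
have [n nP] : exists n : nat, #|I|%:R * (L * (2 * c) / Num.sqrt n.+1%:R) <= e.
  set a := #|I|%:R * (L * (2 * c)).
  have a0 : 0 <= a by rewrite mulr_ge0.
  exists (Num.truncn ((a / e) ^+ 2)); rewrite mulrA -/a.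
  rewrite ler_pdivrMr ?sqrtr_gt0// mulrC -ler_pdivrMr//.
  rewrite -[leLHS]ger0_norm ?divr_ge0 ?(ltW e0)// -sqrtr_sqr ler_sqrt//.
  by rewrite ltW// truncnS_gt.
exists (fun x => multi_bernstein n.+1 (enum I) h (fun=> 0) (p^~ x)).
  exact: trig_poly_multi_bernstein.
move=> x.
apply: le_trans (ler_distD (h (p^~ x)) _ _) _; apply: lerD.
  apply: le_trans nP.
  have p01 i : 0 <= p i x <= 1.
    rewrite /p; have := sin_le1 (c^-1 * x i); have := sin_geN1 (c^-1 * x i).
    by move=> *; apply/andP; split; lra.
  have := @multi_bernstein_approx n (enum I) h (fun=> 0) (p^~ x) _ L'0 hL p01.
  have -> : (fun i => if i \in enum I then p i x else 0) = p^~ x.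
    by apply/funext => i; rewrite mem_enum.
  by rewrite -cardE.
rewrite (le_trans (gL _ _))// ler_wpM2l// ler_sum// => i _.
have -> : c * (2 * p i x - 1) - x i = c * (sin (c^-1 * x i) - c^-1 * x i).
  by rewrite /p; field; rewrite gt_eqF.
rewrite normrM gtr0_norm//.
have -> : 2 * x i ^+ 2 / c = c * (2 * (c^-1 * x i) ^+ 2) by field; rewrite gt_eqF.
by rewrite ler_pM2l// subr_sin_le.
Qed.

End Bernstein.

(** * Expectations *)

Section BoundedVariables.
Context {R : realType} d (T : measurableType d).
Implicit Types X Y : T -> R.

(** Stated for any measurable type, so that the same closure lemmas serve for a smaller
    sigma-algebra on the same space, that is, for variables depending on the past. *)
Definition bounded_mfun X : Prop :=
  measurable_fun [set: T] X /\ exists C, forall w, `|X w| <= C.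

Lemma bounded_mfun_cst (c : R) : bounded_mfun (fun=> c).
Proof. by split => //; exists `|c|. Qed.

Lemma bounded_mfunD X Y : bounded_mfun X -> bounded_mfun Y -> bounded_mfun (fun w => X w + Y w).
Proof.
move=> [mX [a Xa]] [mY [b Yb]]; split; first exact: measurable_funD.
by exists (a + b) => w; rewrite (le_trans (ler_normD _ _))// lerD.
Qed.

Lemma bounded_mfunM X Y : bounded_mfun X -> bounded_mfun Y -> bounded_mfun (fun w => X w * Y w).
Proof.
move=> [mX [a Xa]] [mY [b Yb]]; split; first exact: measurable_funM.
by exists (a * b) => w; rewrite normrM ler_pM.
Qed.

Lemma bounded_mfunZ (c : R) X : bounded_mfun X -> bounded_mfun (fun w => c * X w).
Proof. exact/bounded_mfunM/bounded_mfun_cst. Qed.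

Lemma bounded_mfunB X Y : bounded_mfun X -> bounded_mfun Y -> bounded_mfun (fun w => X w - Y w).
Proof.
move=> bX bY; have -> : (fun w => X w - Y w) = (fun w => X w + -1 * Y w).
  by apply/funext => w; rewrite mulN1r.
by apply: bounded_mfunD => //; exact: bounded_mfunZ.
Qed.

Lemma bounded_mfunX X n : bounded_mfun X -> bounded_mfun (fun w => X w ^+ n).
Proof.
move=> bX; elim: n => [|n ih]; first exact: bounded_mfun_cst.
by under eq_fun do rewrite exprS; exact: bounded_mfunM.
Qed.

Lemma bounded_mfun_sum (I : Type) (s : seq I) (F : I -> T -> R) :
  (forall i, bounded_mfun (F i)) -> bounded_mfun (fun w => \sum_(i <- s) F i w).
Proof.
move=> bF; elim: s => [|i s ih].
  by under eq_fun do rewrite big_nil; exact: bounded_mfun_cst.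
by under eq_fun do rewrite big_cons; exact: bounded_mfunD.
Qed.

Lemma bounded_mfun_prod (I : Type) (s : seq I) (F : I -> T -> R) :
  (forall i, bounded_mfun (F i)) -> bounded_mfun (fun w => \prod_(i <- s) F i w).
Proof.
move=> bF; elim: s => [|i s ih].
  by under eq_fun do rewrite big_nil; exact: bounded_mfun_cst.
by under eq_fun do rewrite big_cons; exact: bounded_mfunM.
Qed.

Lemma bounded_mfun_norm X : bounded_mfun X -> bounded_mfun (fun w => `|X w|).
Proof.
move=> [mX [a Xa]]; split; first exact: measurableT_comp.
by exists a => w; rewrite normr_id.
Qed.

Lemma bounded_mfun_max X Y : bounded_mfun X -> bounded_mfun Y ->
  bounded_mfun (fun w => Num.max (X w) (Y w)).
Proof.
move=> [mX [a Xa]] [mY [b Yb]]; split; first exact: measurable_maxr.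
exists (Num.max a b) => w; rewrite maxEle; case: ifP => _.
  by rewrite (le_trans (Yb w))// le_max lexx orbT.
by rewrite (le_trans (Xa w))// le_max lexx.
Qed.

Lemma bounded_mfun_cos X : measurable_fun [set: T] X -> bounded_mfun (fun w => cos (X w)).
Proof.
move=> mX; split; last by exists 1 => w; exact: cos_max.
by apply: measurableT_comp => //; by apply: continuous_measurable_fun; exact: continuous_cos.
Qed.

Lemma bounded_mfun_sin X : measurable_fun [set: T] X -> bounded_mfun (fun w => sin (X w)).
Proof.
move=> mX; split; last by exists 1 => w; exact: sin_max.
by apply: measurableT_comp => //; by apply: continuous_measurable_fun; exact: continuous_sin.
Qed.

Lemma bounded_mfun_indic (A : set T) : measurable A -> bounded_mfun (\1_A : T -> R).
Proof.
move=> mA; split; first exact: measurable_indic.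
by exists 1 => w; rewrite indicE; case: (_ \in _); rewrite ?normr1 ?normr0.
Qed.

Lemma measurable_fun_sumr (I : Type) (s : seq I) (F : I -> T -> R) :
  (forall i, measurable_fun [set: T] (F i)) ->
  measurable_fun [set: T] (fun w => \sum_(i <- s) F i w).
Proof. by move=> mF; exact: measurable_sum. Qed.

End BoundedVariables.

Section Expectation.
Context {R : realType} d (T : measurableType d) (P : probability T R).
Implicit Types X Y : T -> R.

Local Notation integ X := (P.-integrable [set: T] (EFin \o X)).
Local Notation "'Ex' X" := (Rintegral P [set: T] X) (at level 10).

Lemma bounded_integrable X : bounded_mfun X -> integ X.
Proof.
move=> [mX [C XC]]; apply: measurable_bounded_integrable => //.
  by rewrite [X in (X < _)%E]probability_setT ltry.
by exists C; split; [exact: num_real|move=> x Cx w _; rewrite /= (le_trans (XC _))// ltW].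
Qed.

Lemma integrable_mfun X : integ X -> measurable_fun [set: T] X.
Proof. by move=> /integrableP[/measurable_EFinP]. Qed.

Lemma integD X Y : integ X -> integ Y -> integ (fun w => X w + Y w).
Proof. by move=> iX iY; exact: (integrableD measurableT iX iY). Qed.

Lemma integZ (c : R) X : integ X -> integ (fun w => c * X w).
Proof. by move=> iX; exact: (integrableZl measurableT c iX). Qed.

Lemma integB X Y : integ X -> integ Y -> integ (fun w => X w - Y w).
Proof. by move=> iX iY; exact: (integrableB measurableT iX iY). Qed.

Lemma integ_sum (I : Type) (s : seq I) (F : I -> T -> R) :
  (forall i, integ (F i)) -> integ (fun w => \sum_(i <- s) F i w).
Proof.
move=> iF; elim: s => [|i s ih].
  by under eq_fun do rewrite big_nil; exact/bounded_integrable/bounded_mfun_cst.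
by under eq_fun do rewrite big_cons; exact: integD.
Qed.

Lemma integ_norm X : integ X -> integ (fun w => `|X w|).
Proof. by move=> iX; exact: (integrable_norm iX). Qed.

Lemma integ_le X Y : measurable_fun [set: T] X -> (forall w, `|X w| <= Y w) -> integ Y -> integ X.
Proof.
move=> mX XY iY; apply: (le_integrable measurableT _ _ iY).
  exact/measurable_EFinP.
by move=> w _ /=; rewrite lee_fin (le_trans (XY w))// ler_norm.
Qed.

Lemma integMb X Y : integ X -> bounded_mfun Y -> integ (fun w => Y w * X w).
Proof.
move=> iX [mY [C YC]].
apply: (@integ_le _ (fun w => C * `|X w|)).
- by apply: measurable_funM => //; exact: integrable_mfun.
- by move=> w; rewrite normrM ler_wpM2r.
- exact/integZ/integ_norm.
Qed.

Lemma ExD X Y : integ X -> integ Y -> Ex (fun w => X w + Y w) = Ex X + Ex Y.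
Proof. exact: RintegralD. Qed.

Lemma ExB X Y : integ X -> integ Y -> Ex (fun w => X w - Y w) = Ex X - Ex Y.
Proof. exact: RintegralB. Qed.

Lemma ExZ (c : R) X : integ X -> Ex (fun w => c * X w) = c * Ex X.
Proof. exact: RintegralZl. Qed.

Lemma Ex_cst (c : R) : Ex (fun=> c) = c.
Proof. by rewrite /Rintegral integral_cst// [X in (_ * X)%E]probability_setT mule1. Qed.

Lemma Ex_sum (I : Type) (s : seq I) (F : I -> T -> R) :
  (forall i, integ (F i)) -> Ex (fun w => \sum_(i <- s) F i w) = \sum_(i <- s) Ex (F i).
Proof.
move=> iF; elim: s => [|i s ih].
  by under eq_fun do rewrite big_nil; rewrite Ex_cst big_nil.
under eq_fun do rewrite big_cons.
by rewrite ExD ?ih ?big_cons//; exact: integ_sum.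
Qed.

Lemma Ex_le X Y : integ X -> integ Y -> (forall w, X w <= Y w) -> Ex X <= Ex Y.
Proof. by move=> iX iY XY; exact: le_Rintegral. Qed.

Lemma Ex_ge0 X : (forall w, 0 <= X w) -> 0 <= Ex X.
Proof. by move=> X0; exact: Rintegral_ge0. Qed.

Lemma Ex_norm X : integ X -> `|Ex X| <= Ex (fun w => `|X w|).
Proof. by move=> iX; exact: le_normr_Rintegral. Qed.

Lemma Ex_EFin X : integ X -> (Ex X)%:E = (\int[P]_w (X w)%:E)%E.
Proof. by move=> iX; rewrite fineK//; exact: integrable_fin_num. Qed.

Lemma Ex_ae_eq X Y : measurable_fun [set: T] X -> measurable_fun [set: T] Y ->
  {ae P, forall w, X w = Y w} -> Ex X = Ex Y.
Proof.
move=> mX mY XY; congr fine; apply: ae_eq_integral => //; try exact/measurable_EFinP.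
by apply: filterS XY => w -> _.
Qed.

(** The variance of [|X|] is nonnegative. *)
Lemma Ex_sqr_le X : integ X -> integ (fun w => X w ^+ 2) ->
  (Ex (fun w => `|X w|)) ^+ 2 <= Ex (fun w => X w ^+ 2).
Proof.
move=> iX iX2; set c := Ex _; rewrite -subr_ge0.
have -> : Ex (fun w => X w ^+ 2) - c ^+ 2 = Ex (fun w => (`|X w| - c) ^+ 2).
  have -> : (fun w => (`|X w| - c) ^+ 2) = (fun w => X w ^+ 2 - 2 * c * `|X w| + c ^+ 2).
    by apply/funext => w; rewrite sqrrB real_normK ?num_real//; ring.
  have i1 := integZ (2 * c) (integ_norm iX).
  have ic (a : R) : integ (fun=> a) by exact/bounded_integrable/bounded_mfun_cst.
  have i2 := integB iX2 i1.
  by rewrite (ExD i2 (ic _)) (ExB iX2 i1) (ExZ _ (integ_norm iX)) Ex_cst -/c; ring.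
by apply: Ex_ge0 => w; exact: sqr_ge0.
Qed.

(** [x^3 <= a x^2 + x^4 / a], with [a] left free: for second and fourth moments of orders h and h^2
    it is later taken as [Num.sqrt h], which balances the two terms. *)
Lemma Ex_cube_le (a : R) X : 0 < a -> integ (fun w => X w ^+ 2) -> integ (fun w => X w ^+ 4) ->
  integ (fun w => `|X w| ^+ 3) /\
  Ex (fun w => `|X w| ^+ 3) <= a * Ex (fun w => X w ^+ 2) + a^-1 * Ex (fun w => X w ^+ 4).
Proof.
move=> a0 i2 i4.
have bnd w : `|X w| ^+ 3 <= a * X w ^+ 2 + a^-1 * X w ^+ 4.
  rewrite -[X w ^+ 2]real_normK ?num_real//.
  have -> : X w ^+ 4 = `|X w| ^+ 4.
    by rewrite -[4%N]/(2 * 2)%N [RHS]exprM real_normK ?num_real// -exprM.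
  set x := `|X w|; have x0 : 0 <= x by exact: normr_ge0.
  have -> : a * x ^+ 2 + a^-1 * x ^+ 4 = x ^+ 3 + (x ^+ 3 + a^-1 * x ^+ 2 * (x - a) ^+ 2).
    by field; rewrite gt_eqF.
  by rewrite lerDl addr_ge0 ?exprn_ge0// mulr_ge0 ?sqr_ge0// mulr_ge0 ?sqr_ge0// invr_ge0 ltW.
have iY : integ (fun w => a * X w ^+ 2 + a^-1 * X w ^+ 4).
  by apply: integD; exact: integZ.
have i3 : integ (fun w => `|X w| ^+ 3).
  apply: integ_le iY => [|w]; last by rewrite ger0_norm// exprn_ge0.
  (* Only powers of [X] are known to be measurable, so [|X|] is recovered from the square. *)
  have -> : (fun w => `|X w| ^+ 3) = (fun w => Num.sqrt (X w ^+ 2) ^+ 3).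
    by apply/funext => w; rewrite sqrtr_sqr.
  apply: measurable_funX; apply: measurableT_comp; last exact: integrable_mfun i2.
  by apply: continuous_measurable_fun; exact: sqrt_continuous.
by split => //; rewrite -!ExZ// -ExD ?Ex_le//; exact: integZ.
Qed.

Lemma Ex_dominated (X_ : nat -> T -> R) X Y :
  (forall n, measurable_fun [set: T] (X_ n)) -> measurable_fun [set: T] X ->
  {ae P, forall w, X_ n w @[n --> \oo] --> X w} ->
  integ Y -> (forall n w, `|X_ n w| <= Y w) ->
  integ X /\ Ex (X_ n) @[n --> \oo] --> Ex X.
Proof.
move=> mX_ mX cX iY XY.
have := @dominated_convergence _ T R P setT measurableT (fun n w => (X_ n w)%:E)
  (EFin \o X) (EFin \o Y).
case.
- by move=> n; exact/measurable_EFinP.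
- exact/measurable_EFinP.
- apply: filterS cX => w cw _; apply: cvg_EFin => //.
  by apply: nearW => n.
- by [].
- by apply: aeW => w n _ /=; rewrite lee_fin.
move=> iX _ c; split => //.
apply: (@fine_cvg _ _ _ _ (fun n => \int[P]_w (X_ n w)%:E)%E).
by rewrite fineK//; exact: integrable_fin_num.
Qed.

Lemma Ex_bounded_cvg (X_ : nat -> T -> R) X (C : R) :
  (forall n, measurable_fun [set: T] (X_ n)) -> measurable_fun [set: T] X ->
  {ae P, forall w, X_ n w @[n --> \oo] --> X w} ->
  (forall n w, `|X_ n w| <= C) -> Ex (X_ n) @[n --> \oo] --> Ex X.
Proof.
move=> mX_ mX cX XC.
have iC : integ (fun=> C) by exact/bounded_integrable/bounded_mfun_cst.
by have [] := Ex_dominated mX_ mX cX iC XC.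
Qed.

End Expectation.

(** * Nonnegative matrices of spectral radius less than one *)

Section NonnegMatrix.
Context (R : realType) (d : nat).
Implicit Types (K : 'M[R]_d) (x b : 'I_d -> R).

Lemma eigenvalue_le_spectral_radius K (r : R) :
  0 <= r -> eigenvalue K r -> r <= spectral_radius K.
Proof.
move=> r0 Kr; apply: ub_le_sup; last first.
  exists (real_complex R r); first by have := eigenvalue_map (real_complex R) K r => /= ->.
  by rewrite /= expr0n/= addr0 sqrtr_sqr ger0_norm.
have [s ps] := closed_field_poly_normal (char_poly (map_mx (real_complex R) K)).
(* The supremum is meaningful because eigenvalues are roots of the characteristic polynomial: the
   sum of the moduli of all its roots is an upper bound. *)
exists (\sum_(z <- s) ComplexField.Normc.normc z) => w [z /= + <-].
have normc_ge0 (y : R[i]) : 0 <= ComplexField.Normc.normc y.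
  by case: y => a b; exact: sqrtr_ge0.
rewrite eigenvalue_root_char ps (monicP (char_poly_monic _)) scale1r root_prod_XsubC => zs.
elim: s zs {ps} => // y s ih; rewrite inE big_cons => /predU1P[->|/ih h].
  by rewrite lerDl sumr_ge0.
by rewrite (le_trans h)// lerDr.
Qed.

(** Minimum principle: at an index where [x] is smallest, [x i >= (\sum_j C i j) * x i], which a
    negative [x i] forbids when the row sum is below 1. *)
Lemma nonneg_fixpoint (C : 'I_d -> 'I_d -> R) x b :
  (forall i j, 0 <= C i j) -> (forall i, \sum_j C i j < 1) ->
  (forall i, 0 <= b i) -> (forall i, x i = b i + \sum_j C i j * x j) ->
  forall i, 0 <= x i.
Proof.
move=> C0 C1 b0 xE i0; rewrite leNgt; apply/negP => xi0.
have [i _ imin] := @Order.TotalTheory.arg_minP _ _ 'I_d i0 xpredT x isT.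
have xi : x i < 0 by apply: le_lt_trans xi0; exact: imin.
have : (\sum_j C i j) * x i <= x i.
  rewrite [leRHS]xE mulr_suml -[leLHS]add0r lerD// ler_sum// => j _.
  by rewrite ler_wpM2l// imin.
by rewrite ger_nMl// leNgt C1.
Qed.

Let nrm (A : 'M[R]_d) : R := \sum_i \sum_j `|A i j|.

Lemma le_entry_sum_norm (A : 'M[R]_d) i j : `|A i j| <= nrm A.
Proof.
rewrite /nrm (bigD1 i)//= (bigD1 j)//= -addrA lerDl addr_ge0// sumr_ge0// => *.
by rewrite sumr_ge0.
Qed.

Lemma row_sum_norm_le (A : 'M[R]_d) i : \sum_j `|A i j| <= nrm A.
Proof.
by rewrite /nrm [leRHS](bigD1 i)//= lerDl sumr_ge0// => *; rewrite sumr_ge0.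
Qed.

Lemma row_sum_le (A : 'M[R]_d) i : \sum_j A i j <= nrm A.
Proof.
by rewrite (le_trans _ (row_sum_norm_le A i))// ler_sum// => j _; exact: ler_norm.
Qed.

Lemma sum_normM (A B : 'M[R]_d) : nrm (A *m B) <= nrm A * nrm B.
Proof.
rewrite {1}/nrm mulr_suml ler_sum// => i _.
apply: (@le_trans _ _ (\sum_j \sum_k `|A i k| * `|B k j|)).
  apply: ler_sum => j _; rewrite mxE (le_trans (ler_norm_sum _ _ _))//.
  by apply: ler_sum => k _; rewrite normrM.
rewrite exchange_big/= mulr_suml; apply: ler_sum => k _.
by rewrite -mulr_sumr ler_wpM2l// row_sum_norm_le.
Qed.

Variable K : 'M[R]_d.
Hypotheses (K_ge0 : forall i j, 0 <= K i j) (rho_lt1 : spectral_radius K < 1).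

Lemma resolvent_unitmx (r : R) : 1 <= r -> r%:M - K \in unitmx.
Proof.
move=> r1; apply/negPn/negP => nu.
have : eigenvalue K r.
  rewrite /eigenvalue /eigenspace kermx_eq0 row_free_unit.
  by apply: contra nu => h; rewrite -opprB unitmxE -scaleN1r detZ unitrM unitrX ?unitrN1// -unitmxE.
move=> /(eigenvalue_le_spectral_radius (le_trans ler01 r1)).
by move=> /le_lt_trans /(_ rho_lt1); rewrite ltNge r1.
Qed.

Let res (r : R) := invmx (r%:M - K).

Lemma resolvent_identity (r s : R) : 1 <= r -> 1 <= s ->
  res r = res s + (s - r) *: (res s *m res r).
Proof.
move=> r1 s1; have ru := resolvent_unitmx r1; have su := resolvent_unitmx s1.
have <- : res s *m ((s%:M - K) - (r%:M - K)) *m res r = (s - r) *: (res s *m res r).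
  rewrite opprB addrA subrK -raddfB/= mul_mx_scalar.
  by rewrite -scalemxAl.
by rewrite mulmxBr mulmxBl mulVmx// mul1mx -mulmxA mulmxV// mulmx1 addrC subrK.
Qed.

(** Read column by column, the resolvent identity is a fixed point equation with coefficients
    [(s - r) * res s], whose row sums are below 1: nonnegativity moves from [s] to nearby smaller
    [r]. *)
Lemma resolvent_ge0_step (r s : R) : 1 <= r -> 1 <= s ->
  (forall i j, 0 <= res s i j) -> r <= s -> (s - r) * nrm (res s) < 1 ->
  forall i j, 0 <= res r i j.
Proof.
move=> r1 s1 s0 rs sr i j.
apply: (@nonneg_fixpoint (fun i k => (s - r) * res s i k)
   (fun i => res r i j) (fun i => res s i j)) => //.
- by move=> k l; rewrite mulr_ge0// subr_ge0.
- move=> k; apply: le_lt_trans sr; rewrite -mulr_sumr ler_wpM2l ?subr_ge0//.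
  exact: row_sum_le.
- move=> k; rewrite {1}(resolvent_identity r1 s1) 3!mxE; congr (_ + _).
  by rewrite mulr_sumr; apply: eq_bigr => l _; rewrite mulrA.
Qed.

Lemma resolvent_ge0_large (r : R) : 1 <= r -> nrm K < r ->
  forall i j, 0 <= res r i j.
Proof.
move=> r1 Kr i j; have r0 : 0 < r by rewrite (lt_le_trans ltr01).
apply: (@nonneg_fixpoint (fun i k => r^-1 * K i k)
   (fun i => res r i j) (fun i => r^-1 * (i == j)%:R)) => //.
- by move=> k l; rewrite mulr_ge0// invr_ge0 ltW.
- move=> k; rewrite -mulr_sumr mulrC ltr_pdivrMr// mul1r; apply: le_lt_trans Kr.
  exact: row_sum_le.
- by move=> k; rewrite mulr_ge0// invr_ge0 ltW.
- move=> k; have := mulmxV (resolvent_unitmx r1) => /matrixP/(_ k j).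
  rewrite mulmxBl mul_scalar_mx !mxE -/(res r) => /eqP; rewrite subr_eq => /eqP e.
  have -> : res r k j = r^-1 * (r * res r k j) by rewrite mulrA mulVf ?mul1r// gt_eqF.
  rewrite e mulrDr; congr (_ + _).
  by rewrite mulr_sumr; apply: eq_bigr => l _; rewrite mulrA.
Qed.

Lemma resolvent_ge0_closed (s : R) : 1 <= s ->
  (forall r, s < r -> forall i j, 0 <= res r i j) -> forall i j, 0 <= res s i j.
Proof.
move=> s1 H i j; rewrite leNgt; apply/negP => neg.
pose c := nrm (res s).
have c0 : 0 <= c by rewrite sumr_ge0// => *; rewrite sumr_ge0.
(* The first term keeps the norm of [res (s + e)] below [2 * c]; the second makes the change of the
   entry at most half of its negative value, which therefore stays negative. *)
pose e := Num.min ((2 * (c + 1))^-1) (- res s i j / (4 * (c + 1) ^+ 2)).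
have c1 : 0 < c + 1 by rewrite ltr_wpDl.
have e0 : 0 < e.
  by rewrite lt_min invr_gt0 mulr_gt0//= divr_gt0 ?oppr_gt0// mulr_gt0 ?exprn_gt0.
have re1 : 1 <= s + e by rewrite (le_trans s1)// lerDl ltW.
have E := resolvent_identity re1 s1.
have eE : s - (s + e) = - e by rewrite opprD addrA subrr add0r.
rewrite eE in E.
have ce : e * c <= 2^-1.
  have e1 : e <= (2 * (c + 1))^-1 by rewrite ge_min lexx.
  apply: (@le_trans _ _ ((2 * (c + 1))^-1 * (c + 1))).
    by rewrite ler_pM ?(ltW e0)// lerDl.
  by rewrite invfM -mulrA mulVf ?mulr1// gt_eqF.
have bnd : nrm (res (s + e)) <= 2 * c.
  have : nrm (res (s + e)) <= c + e * (c * nrm (res (s + e))).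
    rewrite {1}E; apply: (@le_trans _ _ (nrm (res s) + e * nrm (res s *m res (s + e)))).
      rewrite /nrm mulr_sumr -big_split ler_sum//= => k _.
      rewrite mulr_sumr -big_split ler_sum//= => l _; rewrite [X in X <= _]/= !mxE.
      rewrite (le_trans (ler_normD _ _))// lerD2l normrM normrN (ger0_norm (ltW e0))//.
    by rewrite lerD2l ler_pM2l// sum_normM.
  rewrite mulrA; set n := nrm (res (s + e)).
  have n0 : 0 <= n by rewrite sumr_ge0// => *; rewrite sumr_ge0.
  have : e * c * n <= 2^-1 * n by rewrite ler_wpM2r.
  lra.
have := H (s + e); rewrite ltrDl => /(_ e0 i j).
rewrite E mxE [X in 0 <= _ + X]mxE.
have : `|(res s *m res (s + e)) i j| <= c * (2 * c).
  by rewrite (le_trans (le_entry_sum_norm _ _ _))// (le_trans (sum_normM _ _))// ler_wpM2l.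
rewrite ler_norml => /andP[lo _].
have e2 : e * (4 * (c + 1) ^+ 2) <= - res s i j.
  by rewrite -ler_pdivlMr ?mulr_gt0 ?exprn_gt0// ge_min lexx orbT.
set y := (_ *m _) i j in lo *.
have : e * (- y) <= e * (c * (2 * c)) by rewrite ler_pM2l// lerNl.
have : e * (c * (2 * c)) <= e * (2 * (c + 1) ^+ 2) by rewrite ler_pM2l// expr2; nra.
lra.
Qed.

(** Continuation from large [r] down to 1, in place of the Neumann series, whose convergence would
    rest on the spectral radius formula. At the supremum of the exceptional set the resolvent is
    nonnegative by closedness, and then so it is slightly to the left, where exceptional values must
    exist. *)
Lemma resolvent_ge0 (r : R) : 1 <= r -> forall i j, 0 <= res r i j.
Proof.
move=> r1; apply: contrapT => neg.
pose S := [set s | 1 <= s /\ ~ forall i j, 0 <= res s i j].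
have Sr : S r by [].
have Sub : has_ubound S.
  exists (1 + nrm K) => s [s1 ns]; rewrite leNgt; apply/negP => h; apply: ns.
  by apply: resolvent_ge0_large => //; rewrite (le_lt_trans _ h)// lerDr.
pose s := sup S.
have s1 : 1 <= s by rewrite (le_trans r1)// ub_le_sup.
have s0 : forall i j, 0 <= res s i j.
  apply: resolvent_ge0_closed => // t st; apply: contrapT => nt.
  have : S t by split => //; rewrite (le_trans s1)// ltW.
  by move=> /(ub_le_sup Sub); rewrite leNgt st.
pose c := nrm (res s) + 1.
have n0 : 0 <= nrm (res s) by rewrite sumr_ge0// => *; rewrite sumr_ge0.
have c0 : 0 < c by rewrite ltr_wpDl.
have [t [t1 nt] st] : exists2 t, S t & s - c^-1 < t.
  have hs : has_sup S by split => //; exists r.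
  by apply: (sup_adherent _ hs); rewrite invr_gt0.
have ts : t <= s by apply: (ub_le_sup Sub).
apply: nt; apply: (@resolvent_ge0_step t s) => //.
apply: (@le_lt_trans _ _ (c^-1 * nrm (res s))).
  by rewrite ler_wpM2r//; lra.
by rewrite mulrC ltr_pdivrMr// mul1r /c ltrDl.
Qed.

Lemma subinvmx_unitmx : 1%:M - K \in unitmx.
Proof. exact: resolvent_unitmx. Qed.

Lemma invmx_sub_ge0 i j : 0 <= invmx (1%:M - K) i j.
Proof. exact: resolvent_ge0. Qed.

(** Comparison principle: [(Id - K) x <= b] may be multiplied by the inverse, which is nonnegative.
    The first moments, the Lipschitz bound on the means and the pathwise bound of counts by
    martingales all come from it. *)
Lemma le_invmx_sub x b : (forall i, x i <= b i + \sum_j K i j * x j) ->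
  forall i, x i <= \sum_j invmx (1%:M - K) i j * b j.
Proof.
move=> xb i; set I1 := invmx _.
have -> : x i = \sum_j I1 i j * (x j - \sum_k K j k * x k).
  have /matrixP/(_ i 0) : I1 *m (1%:M - K) *m (\col_j x j) = \col_j x j.
    by rewrite mulVmx ?subinvmx_unitmx// mul1mx.
  rewrite -mulmxA mxE mxE => {1}<-; apply: eq_bigr => j _; congr (_ * _).
  rewrite mulmxBl mul1mx !mxE; congr (_ - _).
  by apply: eq_bigr => k _; rewrite mxE.
apply: ler_sum => j _; rewrite ler_wpM2l ?invmx_sub_ge0// lerBlDr.
exact: xb.
Qed.

(** [v = (Id - K)^-1 1] satisfies [K v = v - 1], and [1 >= v i / V] as soon as [V] exceeds every
    [v i]. *)
Lemma contraction_weight : exists (v : 'I_d -> R) (q : R),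
  [/\ forall i, 1 <= v i, 0 <= q < 1 & forall i, \sum_j K i j * v j <= q * v i].
Proof.
pose v i := \sum_j invmx (1%:M - K) i j.
have vE i : v i = 1 + \sum_j K i j * v j.
  pose y : 'cV[R]_d := invmx (1%:M - K) *m const_mx 1.
  have yE k : y k 0 = v k by rewrite mxE; apply: eq_bigr => l _; rewrite mxE mulr1.
  have : (1%:M - K) *m y = const_mx 1.
    by rewrite mulmxA mulmxV ?subinvmx_unitmx// mul1mx.
  move: y yE => y yE /matrixP/(_ i 0); rewrite mulmxBl mul1mx !mxE yE.
  move=> /eqP; rewrite subr_eq => /eqP ->; congr (_ + _).
  by apply: eq_bigr => k _; rewrite yE.
have v1 i : 1 <= v i.
  rewrite vE lerDl sumr_ge0// => j _; rewrite mulr_ge0//.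
  by apply: sumr_ge0 => k _; exact: invmx_sub_ge0.
pose V := 1 + \sum_i v i.
have V1 : 1 <= V by rewrite lerDl sumr_ge0// => i _; rewrite (le_trans ler01).
have V0 : 0 < V by rewrite (lt_le_trans ltr01).
exists v, (1 - V^-1); split => //.
  by rewrite subr_ge0 invf_le1// V1/= ltrBlDr ltrDl invr_gt0.
move=> i; have -> : \sum_j K i j * v j = v i - 1 by rewrite [in RHS]vE addrAC subrr add0r.
rewrite mulrBl mul1r lerD2l lerN2 mulrC ler_pdivrMr// mul1r /V (bigD1 i)//=.
have : 0 <= \sum_(j | j != i) v j by rewrite sumr_ge0// => j _; rewrite (le_trans ler01).
lra.
Qed.

(** The partial sums satisfy [x <= Id + K x], so that the comparison principle bounds them without
    any prior convergence. *)
Lemma sum_powers_le (A : nat -> 'M[R]_d) :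
  A 0%N = 1%:M -> (forall n, A n.+1 = K *m A n) ->
  forall N i j, \sum_(n < N) A n i j <= invmx (1%:M - K) i j.
Proof.
move=> A0 AS.
have Age n i j : 0 <= A n i j.
  elim: n i j => [|n ih] i j; first by rewrite A0 mxE ler0n.
  by rewrite AS mxE sumr_ge0// => k _; rewrite mulr_ge0.
move=> N i j.
have bnd k : \sum_(n < N) A n k j <= (k == j)%:R + \sum_l K k l * (\sum_(n < N) A n l j).
  have -> : \sum_l K k l * (\sum_(n < N) A n l j) = \sum_(n < N) A n.+1 k j.
    under eq_bigr do rewrite mulr_sumr.
    by rewrite exchange_big/=; apply: eq_bigr => n _; rewrite AS mxE.
  have -> : (k == j)%:R = A 0%N k j by rewrite A0 mxE.
  have : \sum_(n < N.+1) A n k j = A 0%N k j + \sum_(n < N) A n.+1 k j.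
    by rewrite big_ord_recl.
  by move=> <-; rewrite big_ord_recr//= lerDl.
apply: le_trans (@le_invmx_sub (fun k => \sum_(n < N) A n k j) (fun k => (k == j)%:R) bnd i) _.
rewrite (bigD1 j)//= eqxx mulr1 big1 ?addr0// => k kj.
by rewrite (negbTE kj) mulr0.
Qed.

End NonnegMatrix.

(** * Convolutions *)

Section LebesgueInvariance.
Context {R : realType}.
Local Notation mu := (@lebesgue_measure R).
Local Open Scope ereal_scope.

(** The image measure gives half-open intervals their length, which characterizes Lebesgue
    measure. *)
Lemma lebesgue_measureD (a : R) (A : set R) : measurable A ->
  pushforward mu (fun x : measurableTypeR R => (x + a)%R : measurableTypeR R) A = mu A.
Proof.
move=> mA.
have ma : measurable_fun setT (fun x : measurableTypeR R => (x + a)%R : measurableTypeR R).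
  exact: measurable_funD.
pose f : {mfun measurableTypeR R >-> measurableTypeR R} :=
  HB.pack (fun x : measurableTypeR R => (x + a)%R : measurableTypeR R)
  (isMeasurableFun.Build _ _ _ _ _ ma).
apply/esym; apply: (@lebesgue_measure_unique R (pushforward mu f)) => //= _ [[b c]] _ <-.
rewrite /pushforward (_ : _ @^-1` _ = `](b - a)%R, (c - a)%R]%classic).
  rewrite !lebesgue_measure_itv/= !lte_fin ltrD2r.
  by case: ifPn => // _; rewrite -!EFinB; congr (_%:E); ring.
by apply/seteqP; split=> x /=; rewrite !in_itv/= ltrBlDr lerBrDr.
Qed.

Lemma ge0_integral_shift (f : R -> \bar R) (a : R) : measurable_fun setT f ->
  (forall x, 0 <= f x) -> \int[mu]_x f (x + a)%R = \int[mu]_x f x.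
Proof.
move=> mf f0.
have ma : measurable_fun setT (fun x : measurableTypeR R => (x + a)%R : measurableTypeR R).
  exact: measurable_funD.
rewrite -(@ge0_integral_pushforward _ _ _ _ R _ ma mu setT f)//.
by apply: eq_measure_integral => A mA _; exact: lebesgue_measureD.
Qed.

Lemma ge0_integral_opp (f : R -> \bar R) : measurable_fun setT f ->
  (forall x, 0 <= f x) -> \int[mu]_x f (- x)%R = \int[mu]_x f x.
Proof.
move=> mf f0.
have ma : measurable_fun setT (fun x : measurableTypeR R => (- x)%R : measurableTypeR R).
  exact: measurable_funN.
rewrite -(@ge0_integral_pushforward _ _ _ _ R _ ma mu setT f)//.
by apply: eq_measure_integral => A mA _; exact: lebesgue_measureN.
Qed.

Lemma ge0_integral_subl (f : R -> \bar R) (a : R) : measurable_fun setT f ->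
  (forall x, 0 <= f x) -> \int[mu]_x f (a - x)%R = \int[mu]_x f x.
Proof.
move=> mf f0; rewrite -[RHS](ge0_integral_shift a mf f0).
rewrite -[RHS]ge0_integral_opp//.
  by apply: eq_integral => x _; rewrite addrC.
by apply: measurableT_comp mf _; exact: measurable_funD.
Qed.

End LebesgueInvariance.

Section Convolution.
Context {R : realType}.
Local Notation mu := (@lebesgue_measure R).
Local Open Scope ereal_scope.
Implicit Types f g h : R -> \bar R.

(** Taken over the whole line, so that translation and Tonelli apply without boundary terms; for
    functions vanishing on the negative reals it is the integral over [0, t]. *)
Definition conv f g (t : R) : \bar R := \int[mu]_s (f (t - s)%R * g s).

Lemma conv_ge0 f g : (forall x, 0 <= f x) -> (forall x, 0 <= g x) ->
  forall t, 0 <= conv f g t.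
Proof. by move=> f0 g0 t; apply: integral_ge0 => s _; rewrite mule_ge0. Qed.

Lemma measurable_conv_fun f g : measurable_fun setT f -> measurable_fun setT g ->
  measurable_fun setT (fun z : measurableTypeR R * measurableTypeR R => f (z.1 - z.2)%R * g z.2).
Proof.
move=> mf mg; apply: emeasurable_funM.
  apply: measurableT_comp mf _; exact: measurable_funB.
exact: measurableT_comp.
Qed.

Lemma measurable_conv f g : measurable_fun setT f -> measurable_fun setT g ->
  (forall x, 0 <= f x) -> (forall x, 0 <= g x) -> measurable_fun setT (conv f g).
Proof.
move=> mf mg f0 g0.
have := @measurable_fun_fubini_tonelli_F _ _ _ _ R mu
  (fun z : measurableTypeR R * measurableTypeR R => f (z.1 - z.2)%R * g z.2)
  (measurable_conv_fun mf mg).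
by apply => z; rewrite mule_ge0.
Qed.

Lemma measurable_fun_shiftr f (t : R) : measurable_fun setT f ->
  measurable_fun setT (fun s : R => f (t - s)%R).
Proof. by move=> mf; apply: measurableT_comp mf _; exact: measurable_funB. Qed.

Lemma conv_symE f g t : measurable_fun setT f -> measurable_fun setT g ->
  (forall x, 0 <= f x) -> (forall x, 0 <= g x) ->
  conv f g t = \int[mu]_u (f u * g (t - u)%R).
Proof.
move=> mf mg f0 g0.
rewrite -(@ge0_integral_subl R (fun u => f u * g (t - u)%R) t).
- by apply: eq_integral => s _; congr (_ * g _); ring.
- by apply: emeasurable_funM => //; exact: measurable_fun_shiftr.
- by move=> u; rewrite mule_ge0.
Qed.

Lemma integral_conv f g : measurable_fun setT f -> measurable_fun setT g ->
  (forall x, 0 <= f x) -> (forall x, 0 <= g x) ->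
  \int[mu]_t conv f g t = (\int[mu]_t f t) * (\int[mu]_t g t).
Proof.
move=> mf mg f0 g0.
rewrite (@fubini_tonelli _ _ _ _ R mu mu (fun z : measurableTypeR R * measurableTypeR R =>
  f (z.1 - z.2)%R * g z.2) (measurable_conv_fun mf mg))/=; last by move=> z; rewrite mule_ge0.
rewrite -ge0_integralZl//; last by rewrite integral_ge0.
apply: eq_integral => s _; rewrite ge0_integralZr//; last first.
  by apply: measurableT_comp mf _; exact: measurable_funB.
by congr (_ * _); exact: ge0_integral_shift.
Qed.

Lemma convA f g h : measurable_fun setT f -> measurable_fun setT g -> measurable_fun setT h ->
  (forall x, 0 <= f x) -> (forall x, 0 <= g x) -> (forall x, 0 <= h x) ->
  forall t, conv f (conv g h) t = conv (conv f g) h t.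
Proof.
move=> mf mg mh f0 g0 h0 t; rewrite /conv.
transitivity (\int[mu]_r \int[mu]_s (f (t - r)%R * (g (r - s)%R * h s))).
  apply: eq_integral => r _; rewrite ge0_integralZl//.
  - by apply: emeasurable_funM => //; exact: measurable_fun_shiftr.
  - by move=> s _; rewrite mule_ge0.
rewrite (@fubini_tonelli _ _ _ _ R mu mu (fun z : measurableTypeR R * measurableTypeR R =>
  f (t - z.1)%R * (g (z.1 - z.2)%R * h z.2)))/=.
- apply: eq_integral => s _.
  under eq_integral do rewrite muleA.
  rewrite ge0_integralZr//.
  + congr (_ * _).
    rewrite -[LHS](@ge0_integral_shift R (fun x => f (t - x)%R * g (x - s)%R) s).
    * by apply: eq_integral => x _; congr (f _ * g _); ring.
    * apply: emeasurable_funM; first exact: measurable_fun_shiftr.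
      by apply: measurableT_comp mg _; exact: measurable_funB.
    * by move=> x; rewrite mule_ge0.
  + apply: emeasurable_funM; first exact: measurable_fun_shiftr.
    by apply: measurableT_comp mg _; exact: measurable_funB.
  + by move=> x _; rewrite mule_ge0.
- apply: emeasurable_funM; last exact: measurable_conv_fun.
  by apply: measurableT_comp mf _; exact: measurable_funB.
- by move=> z; rewrite mule_ge0// mule_ge0.
Qed.

Lemma convDr f g h : measurable_fun setT f -> measurable_fun setT g -> measurable_fun setT h ->
  (forall x, 0 <= f x) -> (forall x, 0 <= g x) -> (forall x, 0 <= h x) ->
  forall t, conv f (fun s => g s + h s) t = conv f g t + conv f h t.
Proof.
move=> mf mg mh f0 g0 h0 t; rewrite /conv -ge0_integralD//.
- by apply: eq_integral => s _; rewrite ge0_muleDr.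
- by move=> s _; rewrite mule_ge0.
- by apply: emeasurable_funM => //; exact: measurable_fun_shiftr.
- by move=> s _; rewrite mule_ge0.
- by apply: emeasurable_funM => //; exact: measurable_fun_shiftr.
Qed.

Lemma conv_sumr (I : finType) f (g : I -> R -> \bar R) : measurable_fun setT f ->
  (forall i, measurable_fun setT (g i)) ->
  (forall x, 0 <= f x) -> (forall i x, 0 <= g i x) ->
  forall t, conv f (fun s => \sum_i g i s) t = \sum_i conv f (g i) t.
Proof.
move=> mf mg f0 g0 t; rewrite /conv -ge0_integral_sum//.
- by apply: eq_integral => s _; rewrite ge0_sume_distrr.
- by move=> i; apply: emeasurable_funM (measurable_fun_shiftr t mf) (mg i).
- by move=> i s _; rewrite mule_ge0.
Qed.

Lemma conv_suml (I : finType) (f : I -> R -> \bar R) g : measurable_fun setT g ->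
  (forall i, measurable_fun setT (f i)) ->
  (forall x, 0 <= g x) -> (forall i x, 0 <= f i x) ->
  forall t, conv (fun s => \sum_i f i s) g t = \sum_i conv (f i) g t.
Proof.
move=> mg mf g0 f0 t; rewrite /conv -ge0_integral_sum//.
- by apply: eq_integral => s _; rewrite ge0_sume_distrl.
- by move=> i; apply: emeasurable_funM => //; exact: measurable_fun_shiftr.
- by move=> i s _; rewrite mule_ge0.
Qed.

Lemma conv_nneseriesl (f : nat -> R -> \bar R) (g : R -> R) :
  measurable_fun setT (EFin \o g) ->
  (forall i, measurable_fun setT (f i)) ->
  (forall x, (0 <= g x)%R) -> (forall i x, 0 <= f i x) ->
  forall t, conv (fun s => \sum_(0 <= n <oo) f n s) (EFin \o g) t =
            \sum_(0 <= n <oo) conv (f n) (EFin \o g) t.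
Proof.
move=> mg mf g0 f0 t; rewrite /conv -integral_nneseries//.
- apply: eq_integral => s _.
  by rewrite muleC -nneseriesZl//; apply: eq_eseriesr => n _; rewrite muleC.
- by move=> i; apply: emeasurable_funM => //; exact: measurable_fun_shiftr.
- by move=> i s _; rewrite mule_ge0// lee_fin.
Qed.

Lemma conv_le f g (a : \bar R) t : measurable_fun setT f -> measurable_fun setT g ->
  (forall x, 0 <= f x) -> (forall x, (x < 0)%R -> f x = 0) -> (forall x, 0 <= g x) ->
  (forall s, (s <= t)%R -> g s <= a) -> conv f g t <= (\int[mu]_x f x) * a.
Proof.
move=> mf mg f0 fN g0 ga.
have a0 : 0 <= a by exact: le_trans (g0 t) (ga t (lexx t)).
rewrite -(@ge0_integral_subl R f t)// -ge0_integralZr//; last exact: measurable_fun_shiftr.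
apply: ge0_le_integral => //.
- by move=> s _; rewrite mule_ge0.
- by apply: emeasurable_funM => //; exact: measurable_fun_shiftr.
- by apply: emeasurable_funM => //; exact: measurable_fun_shiftr.
- move=> s _; have [st|ts] := leP s t; first by rewrite lee_wpmul2l// ga.
  by rewrite fN ?mul0e// subr_lt0.
Qed.

End Convolution.

Section KernelConvolution.
Context {R : realType} {d : nat}.
Local Notation mu := (@lebesgue_measure R).
Variable phi : R -> 'M[R]_d.
Hypothesis phi_ge0 : forall (t : R) i j, 0 <= t -> 0 <= phi t i j.
Hypothesis phi_meas : forall i j, measurable_fun (`[0, +oo[ : set R) (fun t => phi t i j).
Hypothesis phi_int : forall i j,
  (\int[lebesgue_measure]_(t in `[0%R, +oo[) (phi t i j)%:E < +oo)%E.

(** Nothing is known of [phi] at negative arguments; the extension by 0 turns integrals over [0, t]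
    into convolutions on the line. *)
Definition causal (i j : 'I_d) (t : R) : R := if 0 <= t then phi t i j else 0.

Lemma causal_ge0 i j t : 0 <= causal i j t.
Proof. by rewrite /causal; case: ifPn => // /phi_ge0. Qed.

Lemma causal_neg i j t : t < 0 -> causal i j t = 0.
Proof. by rewrite /causal leNgt => ->. Qed.

Lemma restrict_ge0E (g : R -> R) : (fun t => if 0 <= t then g t else 0) = g \_ `[0, +oo[.
Proof.
apply/funext => t; rewrite /patch mem_setE/= in_itv/= andbT.
by case: ifP.
Qed.

Lemma measurable_causal i j : measurable_fun setT (causal i j).
Proof.
have -> : causal i j = (fun t => phi t i j) \_ `[0, +oo[ by exact: restrict_ge0E.
exact/(measurable_restrictT _ _).1.
Qed.

Lemma causal_integral i j :
  (\int[mu]_t (causal i j t)%:E = (kernel_mass phi i j)%:E)%E.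
Proof.
rewrite mxE /Rintegral fineK; last first.
  rewrite ge0_fin_numE ?phi_int//; apply: integral_ge0 => t /=.
  by rewrite in_itv/= andbT => t0; rewrite lee_fin phi_ge0.
rewrite [RHS]integral_mkcond; apply: eq_integral => t _.
by rewrite restrict_EFin -restrict_ge0E.
Qed.

Lemma kernel_mass_ge0 i j : 0 <= kernel_mass phi i j.
Proof.
rewrite -lee_fin -causal_integral; apply: integral_ge0 => t _.
by rewrite lee_fin causal_ge0.
Qed.

Fixpoint causal_conv (n : nat) (i j : 'I_d) (t : R) : \bar R :=
  if n is m.+1 then (\sum_(k < d) conv (EFin \o causal i k) (causal_conv m k j) t)%E
  else (causal i j t)%:E.

Let mE i j : measurable_fun setT (EFin \o causal i j).
Proof. by apply/measurable_EFinP; exact: measurable_causal. Qed.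

Let E0 i j x : (0 <= (EFin \o causal i j) x)%E.
Proof. by rewrite /= lee_fin causal_ge0. Qed.

Lemma causal_conv_ge0 n i j t : (0 <= causal_conv n i j t)%E.
Proof.
elim: n i j t => [|n ih] i j t /=; first by rewrite lee_fin causal_ge0.
by apply: sume_ge0 => k _; exact: conv_ge0.
Qed.

Lemma measurable_causal_conv n i j : measurable_fun setT (causal_conv n i j).
Proof.
elim: n i j => [|n ih] i j /=; first exact: mE.
apply: emeasurable_sum => k; apply: measurable_conv (mE _ _) (ih _ _) (E0 _ _) _.
exact: causal_conv_ge0.
Qed.

Lemma causal_conv_neg n i j t : t < 0 -> causal_conv n i j t = 0%E.
Proof.
elim: n i j t => [|n ih] i j t t0 /=; first by rewrite causal_neg.
rewrite big1// => k _; rewrite /conv integral0_eq// => s _ /=.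
have [s0|s0] := ltP s 0; first by rewrite ih// mule0.
by rewrite causal_neg ?mul0e// subr_lt0 (lt_le_trans t0).
Qed.

Lemma kernel_convE n i j t : 0 <= t -> kernel_conv phi n t i j = causal_conv n i j t.
Proof.
elim: n i j t => [|n ih] i j t t0 /=; rewrite mxE; first by rewrite /causal t0.
apply: eq_bigr => k _; rewrite /conv integral_mkcond; apply: eq_integral => s _.
rewrite /patch mem_setE/= in_itv/=; case: ifPn => [/andP[s0 st]|].
  by rewrite ih//= /causal subr_ge0 st.
rewrite negb_and -!ltNge => /orP[s0|ts]; first by rewrite causal_conv_neg// mule0.
by rewrite /= causal_neg ?mul0e// subr_lt0.
Qed.

Fixpoint mass_power (n : nat) : 'M[R]_d :=
  if n is m.+1 then kernel_mass phi *m mass_power m else 1%:M.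

(** The mass of a convolution is the product of the masses. The exponent is [n.+1] because
    [causal_conv n] is the (n+1)-fold power. *)
Lemma causal_conv_integral n i j :
  (\int[mu]_t causal_conv n i j t = (mass_power n.+1 i j)%:E)%E.
Proof.
elim: n i j => [|n ih] i j; first by rewrite /= mulmx1; exact: causal_integral.
rewrite [RHS]/= mxE -sumEFin /= ge0_integral_sum//.
- by apply: eq_bigr => k _; rewrite integral_conv//;
    [rewrite causal_integral ih|exact: measurable_causal_conv|exact: causal_conv_ge0].
- by move=> k; apply: measurable_conv => //; [exact: measurable_causal_conv|exact: causal_conv_ge0].
- by move=> k t _; apply: conv_ge0 => //; exact: causal_conv_ge0.
Qed.

End KernelConvolution.

(** * The renewal equation *)

Section Renewal.
Context {R : realType} {d : nat}.
Local Notation leb := (@lebesgue_measure R).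
Variables (phi : R -> 'M[R]_d).
Hypothesis phi_ge0 : forall (t : R) i j, 0 <= t -> 0 <= phi t i j.
Hypothesis phi_meas : forall i j, measurable_fun (`[0, +oo[ : set R) (fun t => phi t i j).
Hypothesis phi_int : forall i j,
  (\int[lebesgue_measure]_(t in `[0%R, +oo[) (phi t i j)%:E < +oo)%E.
Hypothesis rho_lt1 : spectral_radius (kernel_mass phi) < 1.

Local Notation K := (kernel_mass phi).
Local Notation cc := (causal_conv phi).
Local Notation mp := (mass_power phi).

Let K0 := @kernel_mass_ge0 R d phi phi_ge0 phi_int.

Lemma mass_power_ge0 n i j : 0 <= mp n i j.
Proof.
elim: n i j => [|n ih] i j; first by rewrite mxE ler0n.
by rewrite /= mxE sumr_ge0// => k _; rewrite mulr_ge0.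
Qed.

Lemma sum_mass_power_le N i j : \sum_(n < N) mp n.+1 i j <= invmx (1%:M - K) i j.
Proof.
apply: le_trans (sum_powers_le K0 rho_lt1 (A := mp) erefl (fun=> erefl) N.+1 i j).
by rewrite big_ord_recl lerDr mass_power_ge0.
Qed.

(** General term of a nonnegative series with bounded partial sums. *)
Lemma mass_power_cvg0 i j : mp n.+1 i j @[n --> \oo] --> 0.
Proof.
apply: (@cvg_series_cvg_0 _ R^o (fun n => mp n.+1 i j)).
apply: nondecreasing_is_cvgn.
  by apply: nondecreasing_series => n _ _; exact: mass_power_ge0.
exists (invmx (1%:M - K) i j) => _ [n _ <-].
by rewrite /series/= big_mkord sum_mass_power_le.
Qed.

Definition causal_psi i j (t : R) : \bar R := (\sum_(0 <= n <oo) cc n i j t)%E.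

Lemma causal_psi_ge0 i j t : (0 <= causal_psi i j t)%E.
Proof. by apply: nneseries_ge0 => n _ _; exact: causal_conv_ge0. Qed.

Lemma measurable_causal_psi i j : measurable_fun setT (causal_psi i j).
Proof.
apply: ge0_emeasurable_sum => [n t _ _|n _]; first exact: causal_conv_ge0.
exact: measurable_causal_conv.
Qed.

Lemma kernel_psiE i j t : 0 <= t -> kernel_psi phi t i j = causal_psi i j t.
Proof. by move=> t0; rewrite mxE; apply: eq_eseriesr => n _; rewrite kernel_convE. Qed.

Lemma causal_psi_neg i j t : t < 0 -> causal_psi i j t = 0%E.
Proof. by move=> t0; rewrite /causal_psi eseries0// => n _ _; rewrite causal_conv_neg. Qed.

Lemma integral_causal_psi i j :
  (\int[leb]_t causal_psi i j t <= (invmx (1%:M - K) i j)%:E)%E.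
Proof.
rewrite integral_nneseries//; last 2 first.
- by move=> n; exact: measurable_causal_conv.
- by move=> n t _; exact: causal_conv_ge0.
apply: lime_le.
  by apply: is_cvg_nneseries => n _ _; apply: integral_ge0 => t _; exact: causal_conv_ge0.
apply: nearW => N; under eq_bigr do rewrite causal_conv_integral//.
by rewrite sumEFin lee_fin big_mkord sum_mass_power_le.
Qed.

Lemma integrable_kernel_psi i j :
  leb.-integrable (`[0, +oo[ : set R) (fun t => kernel_psi phi t i j).
Proof.
apply: (@eq_integrable _ _ _ leb _ _ (causal_psi i j)) => //.
  by move=> t; rewrite inE/= in_itv/= andbT => t0; rewrite kernel_psiE.
apply/integrableP; split; first by apply: measurable_funTS; exact: measurable_causal_psi.
apply: le_lt_trans (ltry (invmx (1%:M - K) i j)).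
apply: le_trans (integral_causal_psi i j).
under eq_integral do rewrite gee0_abs ?causal_psi_ge0//.
by apply: ge0_subset_integral => //; [exact: measurable_causal_psi|
  move=> t _; exact: causal_psi_ge0].
Qed.

Definition iterated_conv (n : nat) (f : 'I_d -> R -> R) i (t : R) : \bar R :=
  (\sum_j conv (cc n i j) (EFin \o f j) t)%E.

Section Iterate.
Variable f : 'I_d -> R -> R.
Hypothesis f0 : forall i t, 0 <= f i t.
Hypothesis mf : forall i, measurable_fun setT (f i).

Let mE i : measurable_fun setT (EFin \o f i). Proof. exact/measurable_EFinP. Qed.
Let E0 i x : (0 <= (EFin \o f i) x)%E. Proof. by rewrite lee_fin. Qed.
Let mc n i j := @measurable_causal_conv R d phi phi_ge0 phi_meas n i j.
Let c0 n i j t := @causal_conv_ge0 R d phi phi_ge0 n i j t.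

Lemma iterated_conv_ge0 n i t : (0 <= iterated_conv n f i t)%E.
Proof. by apply: sume_ge0 => j _; exact: conv_ge0. Qed.

Lemma measurable_iterated_conv n i : measurable_fun setT (iterated_conv n f i).
Proof. by apply: emeasurable_sum => j; exact: measurable_conv. Qed.

Lemma iterated_convS n i t :
  (\sum_k conv (cc 0 i k) (iterated_conv n f k) t)%E = iterated_conv n.+1 f i t.
Proof.
transitivity (\sum_k \sum_j conv (conv (cc 0 i k) (cc n k j)) (EFin \o f j) t)%E.
  apply: eq_bigr => k _; rewrite conv_sumr//.
  - by apply: eq_bigr => j _; rewrite convA.
  - by move=> j; exact: measurable_conv.
  - by move=> j x; exact: conv_ge0.
rewrite exchange_big/=; apply: eq_bigr => j _; rewrite -conv_suml//.
- by move=> k; exact: (measurable_conv (mc 0 i k) (mc n k j) (c0 0 i k) (c0 n k j)).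
- by move=> k x; exact: (conv_ge0 (c0 0 i k) (c0 n k j)).
Qed.

Lemma iterated_conv_le n i t : (forall i s s', s <= s' -> f i s <= f i s') ->
  (iterated_conv n f i t <= (\sum_j mp n.+1 i j * f j t)%:E)%E.
Proof.
move=> fnd; rewrite -sumEFin; apply: lee_sum => j _; rewrite EFinM -causal_conv_integral//.
apply: conv_le => //; first by move=> x; exact: causal_conv_neg.
by move=> s st; rewrite lee_fin fnd.
Qed.

End Iterate.

Variables (mu : 'cV[R]_d) (m : 'I_d -> R -> R).
Hypothesis mu_ge0 : forall i, 0 <= mu i 0.
Hypothesis m_ge0 : forall i t, 0 <= m i t.
Hypothesis m_nd : forall i s t, s <= t -> m i s <= m i t.

Let g (i : 'I_d) (t : R) : R := mu i 0 * Num.max t 0.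

Hypothesis m_renewal : forall i t,
  ((m i t)%:E = (g i t)%:E + iterated_conv 0 m i t)%E.

Lemma measurable_ndfun (f : R -> R) : (forall s t, s <= t -> f s <= f t) ->
  measurable_fun setT f.
Proof. by move=> fnd; apply: nondecreasing_measurable => // x y _ _; exact: fnd. Qed.

Let mm i : measurable_fun setT (m i). Proof. by apply: measurable_ndfun; exact: m_nd. Qed.

Let g0 i t : 0 <= g i t. Proof. by rewrite mulr_ge0// le_max lexx orbT. Qed.

Let mg i : measurable_fun setT (g i).
Proof. by apply: measurable_funM => //; exact: measurable_maxr. Qed.

Lemma renewal_unfold N i t : ((m i t)%:E =
  (g i t)%:E + \sum_(n < N) iterated_conv n g i t + iterated_conv N m i t)%E.
Proof.
elim: N i t => [|N ih] i t; first by rewrite big_ord0 adde0.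
rewrite m_renewal {1}/iterated_conv.
have mcv n k := @measurable_iterated_conv g g0 mg n k.
have cv0 n k x := @iterated_conv_ge0 g g0 n k x.
have -> : (\sum_j conv (cc 0 i j) (EFin \o m j) t =
  \sum_j (conv (cc 0 i j) (EFin \o g j) t +
     \sum_(n < N) conv (cc 0 i j) (iterated_conv n g j) t +
     conv (cc 0 i j) (iterated_conv N m j) t))%E.
  apply: eq_bigr => j _.
  have -> : EFin \o m j = (fun s => (EFin \o g j) s + \sum_(n < N) iterated_conv n g j s + iterated_conv N m j s)%E.
    by apply/funext => s; exact: ih.
  have mc : measurable_fun setT (cc 0 i j) by exact: measurable_causal_conv.
  have c0 x : (0 <= cc 0 i j x)%E by exact: causal_conv_ge0.
  have mgE : measurable_fun setT (EFin \o g j) by exact/measurable_EFinP.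
  have mS : measurable_fun setT (fun s => \sum_(n < N) iterated_conv n g j s)%E.
    by apply: emeasurable_sum => n.
  have S0 x : (0 <= \sum_(n < N) iterated_conv n g j x)%E by apply: sume_ge0.
  have E0 x : (0 <= (EFin \o g j) x)%E by rewrite lee_fin.
  rewrite convDr//; last 4 first.
  - exact: emeasurable_funD.
  - exact: measurable_iterated_conv.
  - by move=> x; rewrite adde_ge0.
  - by move=> x; exact: iterated_conv_ge0.
  by rewrite convDr// conv_sumr//.
have split3 (a b c : 'I_d -> \bar R) :
    (\sum_j (a j + b j + c j) = \sum_j a j + \sum_j b j + \sum_j c j)%E by rewrite !big_split.
rewrite split3 exchange_big.
have -> : (\sum_j conv (cc 0 i j) (iterated_conv N m j) t = iterated_conv N.+1 m i t)%E.
  exact: (iterated_convS m_ge0 mm).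
have -> : (\sum_(n < N) \sum_j conv (cc 0 i j) (iterated_conv n g j) t =
    \sum_(n < N) iterated_conv n.+1 g i t)%E.
  by apply: eq_bigr => n _; exact: (iterated_convS g0 mg).
by rewrite big_ord_recl addeA.
Qed.

(** After N iterations the remainder is at most [K^(N+1) m(t)], since [m] is nondecreasing, and it
    tends to 0. Subtraction is legitimate among extended reals because each nonnegative term is
    bounded by the finite [m i t]. *)
Lemma renewal_series i t :
  ((m i t)%:E = (g i t)%:E + \sum_(0 <= n <oo) iterated_conv n g i t)%E.
Proof.
have cv0 n k x := @iterated_conv_ge0 g g0 n k x.
have cvm0 n k x := @iterated_conv_ge0 m m_ge0 n k x.
pose T N := (\sum_(n < N) iterated_conv n g i t)%E.
have T0 N : (0 <= T N)%E by exact: sume_ge0.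
have EN N := renewal_unfold N i t.
have finT N : T N \is a fin_num.
  rewrite ge0_fin_numE//; apply: le_lt_trans (ltry (m i t)); rewrite (EN N).
  by rewrite addeAC leeDr// adde_ge0// lee_fin.
have finE N : iterated_conv N m i t \is a fin_num.
  rewrite ge0_fin_numE//; apply: le_lt_trans (ltry (m i t)); rewrite (EN N).
  by apply: leeDr; apply: adde_ge0; [rewrite lee_fin|exact: T0].
have TE N : T N = (m i t - g i t - fine (iterated_conv N m i t))%:E.
  have := EN N; rewrite -/(T N) -(fineK (finT N)) -(fineK (finE N)) -!EFinD.
  by move=> [] ->; congr (_%:E); rewrite /=; ring.
have e0 : fine (iterated_conv N m i t) @[N --> \oo] --> 0.
  apply: (@squeeze_cvgr _ _ _ _ (fun=> 0) (fun N => \sum_j mp N.+1 i j * m j t)).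
  - apply: nearW => N; rewrite fine_ge0//= -lee_fin fineK//.
    exact: iterated_conv_le.
  - exact: cvg_cst.
  - rewrite -[X in _ --> X](_ : \sum_(j < d) 0 * m j t = 0); last first.
      by rewrite big1// => j _; rewrite mul0r.
    apply: cvg_big => // [|j _]; first exact: add_continuous.
    by apply: cvgMl; exact: mass_power_cvg0.
have : T N @[N --> \oo] --> (m i t - g i t)%:E.
  under eq_fun do rewrite TE.
  apply: cvg_EFin; first exact: nearW.
  by rewrite -[X in _ --> X]subr0; apply: cvgB => //; exact: cvg_cst.
move=> /cvg_lim TL.
have -> : (\sum_(0 <= n <oo) iterated_conv n g i t = (m i t - g i t)%:E)%E.
  by rewrite -TL//; congr (limn _); apply/funext => N; rewrite /T big_mkord.
by rewrite -EFinD addrC subrK.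
Qed.

Lemma renewal_solution i t : 0 <= t ->
  ((m i t)%:E = (t * mu i 0)%:E +
     \sum_(j < d) (\int[leb]_(s in `[0%R, t]) (kernel_psi phi (t - s)%R i j * s%:E)) * (mu j 0)%:E)%E.
Proof.
move=> t0; rewrite renewal_series; congr (_ + _)%E.
  by rewrite /g max_l// mulrC.
have mc n k j := @measurable_causal_conv R d phi phi_ge0 phi_meas n k j.
have c0 n k j x := @causal_conv_ge0 R d phi phi_ge0 n k j x.
have mgE j : measurable_fun setT (EFin \o g j) by exact/measurable_EFinP.
rewrite /iterated_conv nneseries_sum//; last first.
  by move=> j n _; apply: conv_ge0 => // x; rewrite lee_fin.
apply: eq_bigr => j _.
rewrite -(@conv_nneseriesl R (fun n => cc n i j) (g j))//.
rewrite -ge0_integralZr//; last 3 first.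
- apply: emeasurable_funM; last exact/measurable_EFinP.
  apply: (@eq_measurable_fun _ _ _ _ _ (fun s : R => causal_psi i j (t - s)%R)).
    by move=> s; rewrite inE/= in_itv/= => /andP[_ st]; rewrite kernel_psiE// subr_ge0.
  apply: measurable_funTS; apply: measurable_fun_shiftr; exact: measurable_causal_psi.
- move=> s /=; rewrite in_itv/= => /andP[s0 st]; rewrite mule_ge0// ?lee_fin//.
  by rewrite kernel_psiE ?subr_ge0// causal_psi_ge0.
- by rewrite lee_fin.
rewrite [RHS]integral_mkcond; apply: eq_integral => s _.
rewrite /patch mem_setE/= in_itv/=; case: ifPn => [/andP[s0 st]|h].
  rewrite kernel_psiE ?subr_ge0// -muleA; congr (_ * _)%E.
  by rewrite -EFinM /g max_l// mulrC.
have [s0|s0] := ltP s 0.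
  by rewrite /g max_r ?mulr0 ?mule0// ltW.
have ts : t - s < 0 by rewrite subr_lt0 ltNge; apply: contra h; rewrite s0.
by rewrite -[X in (X * _)%E]/(causal_psi i j (t - s)) causal_psi_neg// mul0e.
Qed.

End Renewal.

(** * Gaussian characteristic functions *)

Section LinearExtension.
Context {R : realType} d (T : measurableType d).
Implicit Types X Y : T -> R.

(** Layer cake with steps of height [e]: the staircase below [y] misses at most one step. *)
Lemma layer_approx (e : R) (M : nat) (y : R) : 0 < e -> 0 <= y <= M%:R * e ->
  0 <= y - \sum_(k < M) e * (k.+1%:R * e <= y)%R%:R <= e.
Proof.
move=> e0; elim: M y => [|M ih] y.
  by rewrite mul0r big_ord0 subr0 -eq_le => /eqP <-; rewrite lexx ltW.
move=> /andP[y0 yM]; rewrite big_ord_recr/=.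
have [yMe|Mey] := leP y (M%:R * e).
  have /negbTE -> : ~~ (M.+1%:R * e <= y).
    by rewrite -ltNge (le_lt_trans yMe)// ltr_pM2r// ltr_nat.
  by rewrite mulr0 addr0 ih// y0.
have -> : \sum_(k < M) e * (k.+1%:R * e <= y)%R%:R = M%:R * e.
  rewrite (eq_bigr (fun=> e)) ?sumr_const ?card_ord ?mulr_natl// => k _.
  rewrite (_ : (_ <= y)%R = true) ?mulr1//.
  by rewrite (le_trans _ (ltW Mey))// ler_pM2r// ler_nat.
move: yM; rewrite -natr1 mulrDl mul1r => yM.
case: (leP (M%:R * e + e) y) => h; rewrite ?mulr1 ?mulr0; apply/andP; split; lra.
Qed.

(** Bounded measurable functions are uniform limits of combinations of indicators. This carries
    identities from events to bounded variables: for normal laws, for independence and for the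
    martingale property. *)
Lemma bounded_mfun_ext (L : (T -> R) -> R) (K : R) :
  (forall X Y, bounded_mfun X -> bounded_mfun Y -> L (fun w => X w + Y w) = L X + L Y) ->
  (forall c X, bounded_mfun X -> L (fun w => c * X w) = c * L X) ->
  (forall X C, bounded_mfun X -> (forall w, `|X w| <= C) -> `|L X| <= K * C) ->
  (forall A, measurable A -> L \1_A = 0) ->
  forall X, bounded_mfun X -> L X = 0.
Proof.
move=> LD LZ LK L1 X [mX [C XC]].
have L0 : L (fun=> 0) = 0.
  by have -> : (fun=> 0) = (\1_set0 : T -> R); [apply/funext => w; rewrite indic0|exact: L1].
have Lc (c : R) : L (fun=> c) = 0.
  have -> : (fun=> c) = (fun w => c * (\1_setT : T -> R) w).
    by apply/funext => w; rewrite indicT mulr1.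
  by rewrite LZ ?L1 ?mulr0//; exact: bounded_mfun_indic.
apply/eqP; rewrite -normr_eq0 eq_le normr_ge0 andbT; apply/ler_addgt0Pr => e e0.
rewrite add0r.
pose K1 := `|K| + 1; have K10 : 0 < K1 by rewrite ltr_wpDl.
pose e1 := e / K1; have e10 : 0 < e1 by rewrite divr_gt0.
pose M := (Num.truncn (2 * `|C| / e1)).+1.
pose A k := X @^-1` `[k.+1%:R * e1 - `|C|, +oo[.
have mA k : measurable (A k) by rewrite -[A k]setTI; exact: mX.
pose S w := \sum_(k < M) e1 * (\1_(A k) : T -> R) w + - `|C|.
have bS0 (s : seq nat) : bounded_mfun (fun w => \sum_(k <- s) e1 * (\1_(A k) : T -> R) w) /\
    L (fun w => \sum_(k <- s) e1 * (\1_(A k) : T -> R) w) = 0.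
  split.
    by apply: bounded_mfun_sum => k; apply: bounded_mfunZ; exact: bounded_mfun_indic.
  elim: s => [|k s ih]; first by under eq_fun do rewrite big_nil.
  under eq_fun do rewrite big_cons.
  rewrite LD ?ih ?LZ ?L1 ?mulr0 ?addr0//.
  - exact: bounded_mfun_indic.
  - by apply: bounded_mfunZ; exact: bounded_mfun_indic.
  - by apply: bounded_mfun_sum => j; apply: bounded_mfunZ; exact: bounded_mfun_indic.
have [bSs LSs] := bS0 (index_iota 0 M).
have SE : S = (fun w => \sum_(k <- index_iota 0 M) e1 * (\1_(A k) : T -> R) w + - `|C|).
  by apply/funext => w; rewrite /S big_mkord.
have bS : bounded_mfun S by rewrite SE; apply: bounded_mfunD => //; exact: bounded_mfun_cst.
have LS : L S = 0 by rewrite SE LD ?LSs ?Lc ?addr0//; exact: bounded_mfun_cst.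
have bX : bounded_mfun X by split => //; exists C.
have bXS : bounded_mfun (fun w => X w - S w) by exact: bounded_mfunB.
have -> : L X = L (fun w => X w - S w).
  have -> : L X = L (fun w => (X w - S w) + S w).
    by congr L; apply/funext => w; rewrite subrK.
  by rewrite LD// LS addr0.
have XSe w : `|X w - S w| <= e1.
  have := @layer_approx e1 M (X w + `|C|) e10.
  have /andP[Cl Cr] : - `|C| <= X w <= `|C|.
    by rewrite -ler_norml (le_trans (XC w))// ler_norm.
  have -> : \sum_(k < M) e1 * (k.+1%:R * e1 <= X w + `|C|)%R%:R = S w + `|C|.
    rewrite /S subrK; apply: eq_bigr => k _; rewrite indicE /A/=; congr (_ * (nat_of_bool _)%:R).
    by apply/idP/idP => [h|/set_mem]; [apply/mem_set|]; rewrite /= in_itv/= andbT lerBlDr.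
  move=> /(_ _)/andP[|h1 h2].
    apply/andP; split; first lra.
    apply: (@le_trans _ _ (2 * `|C|)); first lra.
    by rewrite -ler_pdivrMr// ltW// truncnS_gt.
  rewrite ler_norml; apply/andP; split; lra.
apply: le_trans (LK _ _ bXS XSe) _.
apply: (@le_trans _ _ (K1 * e1)); last by rewrite /e1 mulrC divfK// gt_eqF.
by rewrite ler_pM2r// (le_trans (ler_norm K))// lerDl.
Qed.

End LinearExtension.

Section GaussianCharacteristic.
Context {R : realType}.
Local Notation mu := (@lebesgue_measure R).
Variable s : R.
Hypothesis s0 : 0 < s.

Let p := normal_pdf 0 s.

Let pE x : p x = normal_peak s * expR (- x ^+ 2 / (s ^+ 2 *+ 2)).
Proof.
rewrite /p normal_pdfE ?gt_eqF//.
by change (normal_peak s * normal_fun 0 s x = normal_peak s * expR (- x ^+ 2 / (s ^+ 2 *+ 2)));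
  rewrite /normal_fun subr0.
Qed.

Let p_ge0 x : 0 <= p x. Proof. exact: normal_pdf_ge0. Qed.

Let is_derive_p (x : R) : is_derive x 1 p (- (x / s ^+ 2) * p x).
Proof.
have -> : p = (fun x => normal_peak s * expR (- x ^+ 2 / (s ^+ 2 *+ 2))).
  by apply/funext => y; rewrite pE.
apply: is_derive_eq; rewrite /GRing.scale/=.
by field; rewrite gt_eqF.
Qed.

Let int_p : mu.-integrable setT (EFin \o p). Proof. exact: integrable_normal_pdf. Qed.

Let mp : measurable_fun setT p. Proof. exact: measurable_normal_pdf. Qed.

Let int_xp : mu.-integrable setT (EFin \o (fun x => `|x| * p x)).
Proof.
(* The Gaussian density of standard deviation [s'] dominates [x^2 p(x)]: with [y = x^2 / (4 s^2)],
   this is [y exp(-2 y) <= exp(- y)]. *)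
pose s' := Num.sqrt 2 * s; pose c := 4 * s ^+ 2 * normal_peak s / normal_peak s'.
have s'0 : s' != 0 by rewrite mulf_neq0// gt_eqF// sqrtr_gt0.
have q0 : 0 < normal_peak s' by exact: normal_peak_gt0.
have iY : mu.-integrable setT (EFin \o (fun x => p x + c * normal_pdf 0 s' x)).
  have i1 : mu.-integrable setT (EFin \o normal_pdf 0 s') by exact: integrable_normal_pdf.
  exact: (integrableD measurableT int_p (integrableZl measurableT c i1)).
apply: le_integrable iY => //.
  apply/measurable_EFinP; apply: measurable_funM => //; exact: measurableT_comp.
move=> x _ /=; rewrite lee_fin ger0_norm ?mulr_ge0// (le_trans _ (ler_norm _))//.
have h1 : `|x| * p x <= p x + x ^+ 2 * p x.
  rewrite -{2}[p x]mul1r -mulrDl ler_wpM2r// -[x ^+ 2]real_normK ?num_real//.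
  have := sqr_ge0 (`|x| - 1); rewrite sqrrB1; have := normr_ge0 x; nra.
apply: (le_trans h1); rewrite lerD2l pE normal_pdfE//.
rewrite /normal_fun subr0.
rewrite /c; set q := normal_peak s'.
have -> : 4 * s ^+ 2 * normal_peak s / q * (q * expR (- x ^+ 2 / (s' ^+ 2 *+ 2))) =
   normal_peak s * (4 * s ^+ 2 * expR (- x ^+ 2 / (s' ^+ 2 *+ 2))).
  by field; rewrite gt_eqF.
rewrite mulrCA ler_wpM2l ?normal_peak_ge0//.
have -> : s' ^+ 2 *+ 2 = 4 * s ^+ 2 by rewrite exprMn sqr_sqrtr// -mulr_natr; ring.
set y := x ^+ 2 / (4 * s ^+ 2).
have xy : x ^+ 2 = 4 * s ^+ 2 * y by rewrite /y; field; rewrite gt_eqF.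
have -> : - x ^+ 2 / (4 * s ^+ 2) = - y by rewrite /y mulNr.
have -> : - x ^+ 2 / (s ^+ 2 *+ 2) = - y - y by rewrite xy -mulr_natr; field; rewrite gt_eqF.
rewrite xy -[leLHS]mulrA ler_pM2l ?mulr_gt0 ?exprn_gt0// expRD mulrA -[leRHS]mul1r.
rewrite ler_pM2r ?expR_gt0// expRN ler_pdivrMr ?expR_gt0// mul1r.
by rewrite (le_trans _ (expR_ge1Dx _))// lerDr.
Qed.

(** The characteristic function in real form: the phase [b] covers its real and imaginary parts at
    once. *)
Let phase (b a : R) := \int[mu]_x (cos (a * x + b) * p x).

Let mcos a b : measurable_fun setT (fun x : R => cos (a * x + b)).
Proof.
apply: (measurableT_comp (f := @cos R)).
  by apply: continuous_measurable_fun; exact: continuous_cos.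
by apply: measurable_funD => //; exact: measurable_funM.
Qed.

Let msin a b : measurable_fun setT (fun x : R => sin (a * x + b)).
Proof.
apply: (measurableT_comp (f := @sin R)).
  by apply: continuous_measurable_fun; exact: continuous_sin.
by apply: measurable_funD => //; exact: measurable_funM.
Qed.

Let int_cosp a b : mu.-integrable setT (EFin \o (fun x => cos (a * x + b) * p x)).
Proof.
apply: (le_integrable measurableT _ _ int_p).
  by apply/measurable_EFinP; exact: (measurable_funM (mcos a b) mp).
by move=> x _ /=; rewrite lee_fin normrM ler_piMl// cos_max.
Qed.

Let int_xsinp a b : mu.-integrable setT (EFin \o (fun x => x * sin (a * x + b) * p x)).
Proof.
apply: (le_integrable measurableT _ _ int_xp).
  apply/measurable_EFinP; apply: measurable_funM => //.
  by apply: measurable_funM; [exact: measurable_id|exact: msin].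
move=> x _ /=; rewrite lee_fin !normrM normr_id (ger0_norm (p_ge0 x)) ler_wpM2r//.
by rewrite ler_piMr// sin_max.
Qed.

Let p_le (n : nat) : p n%:R <= normal_peak s * (1 + s ^+ 2 *+ 2) * n.+1%:R^-1.
Proof.
rewrite pE -mulrA ler_wpM2l ?normal_peak_ge0// mulNr expRN.
set c := s ^+ 2 *+ 2; have c0 : 0 < c by rewrite mulrn_wgt0// exprn_gt0.
rewrite -[leLHS]mul1r ler_pdivrMr ?expR_gt0//.
apply: (@le_trans _ _ ((1 + c) / n.+1%:R * (1 + n%:R ^+ 2 / c))); last first.
  have h : 0 < (1 + c) / n.+1%:R by rewrite divr_gt0// addr_gt0.
  by rewrite ler_pM2l// expR_ge1Dx.
rewrite mulrAC ler_pdivlMr// mul1r mulrDl mul1r -natr1.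
have -> : c * (1 + n%:R ^+ 2 / c) = c + n%:R ^+ 2.
  by rewrite mulrDr mulr1 mulrCA divff ?mulr1// gt_eqF.
have : (n%:R : R) <= n%:R ^+ 2 by rewrite -natrX ler_nat; case: n => // n; rewrite expnS leq_pmulr.
have : 0 <= n%:R ^+ 2 / c by rewrite divr_ge0 ?sqr_ge0// ltW.
move: (n%:R ^+ 2 / c) => z; move: (n%:R : R) => y; lra.
Qed.

Let pN x : p (- x) = p x. Proof. by rewrite !pE sqrrN. Qed.

(** Integration by parts (Stein's identity): the derivative of [sin (a * x + b) * p x] is
    integrable, and its integral over growing symmetric intervals tends to 0 by the decay of [p]. *)
Let gauss_stein a b : a * phase b a = s ^- 2 * \int[mu]_x (x * sin (a * x + b) * p x).
Proof.
pose F x := sin (a * x + b) * p x.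
pose h x := a * (cos (a * x + b) * p x) - s ^- 2 * (x * sin (a * x + b) * p x).
have dF (x : R) : is_derive x 1 F (h x).
  have dp := is_derive_p x.
  by apply: is_derive_eq; rewrite /h /GRing.scale/=; field; rewrite gt_eqF.
have i1 : mu.-integrable setT (EFin \o (fun x => a * (cos (a * x + b) * p x))).
  exact: (integrableZl measurableT a (int_cosp a b)).
have i2 : mu.-integrable setT (EFin \o (fun x => s ^- 2 * (x * sin (a * x + b) * p x))).
  exact: (integrableZl measurableT (s ^- 2) (int_xsinp a b)).
have ih : mu.-integrable setT (EFin \o h) by exact: (integrableB measurableT i1 i2).
have cF : continuous F.
  by move=> x; apply/differentiable_continuous/derivable1_diffP; have [] := dF x.
have ch : continuous h.
  have cp : continuous p.
    by move=> x; apply/differentiable_continuous/derivable1_diffP; have [] := is_derive_p x.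
  have caff : continuous (fun x : R => a * x + b).
    by move=> x; apply: cvgD; [apply: cvgM; [exact: cvg_cst|exact: cvg_id]|exact: cvg_cst].
  have ccos : continuous (fun x : R => cos (a * x + b)).
    by move=> x; apply: (@continuous_comp _ _ _ (fun x => a * x + b) cos); [exact: caff|exact: continuous_cos].
  have csin : continuous (fun x : R => sin (a * x + b)).
    by move=> x; apply: (@continuous_comp _ _ _ (fun x => a * x + b) sin); [exact: caff|exact: continuous_sin].
  move=> x; apply: cvgB; apply: cvgM; try exact: cvg_cst.
    by apply: cvgM; [exact: ccos|exact: cp].
  by apply: cvgM; [apply: cvgM; [exact: cvg_id|exact: csin]|exact: cp].
pose nn (n : nat) : R := n.+1%:R.
pose I (n : nat) : set R := `[- nn n, nn n]%classic.
have FE (n : nat) : (\int[mu]_(x in I n) (h x)%:E =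
    (F n.+1%:R - F (- n.+1%:R))%:E)%E.
  rewrite /I (@continuous_FTC2 _ h F)//.
  - by rewrite (lt_trans (y := 0))// oppr_lt0.
  - exact: continuous_subspaceT.
  - split; first by move=> x _; have [] := dF x.
    + exact/cvg_at_right_filter/cF.
    + exact/cvg_at_left_filter/cF.
  - by move=> x _; rewrite derive1E; have [_ ->] := dF x.
have lim0 : (\int[mu]_(x in I n) (h x)%:E)%E @[n --> \oo] --> 0%E.
  under eq_fun do rewrite FE.
  apply: cvg_EFin; first exact: nearW.
  apply: (@cvgr_distP _ _ _ _ (fun n : nat => F n.+1%:R - F (- n.+1%:R))) => e e0.
  pose D := 2 * (normal_peak s * (1 + s ^+ 2 *+ 2)).
  have D0 : 0 <= D by rewrite mulr_ge0// mulr_ge0 ?normal_peak_ge0// addr_ge0// mulrn_wge0// sqr_ge0.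
  near=> n; rewrite sub0r normrN (le_trans (ler_normB _ _))//.
  have Fle x : `|F x| <= p x.
    by rewrite normrM (ger0_norm (p_ge0 _)) ler_piMl// sin_max.
  apply: (@le_trans _ _ (D / n.+2%:R)).
    have h1 := Fle n.+1%:R; have h2 := Fle (- n.+1%:R); rewrite pN in h2.
    have h3 := p_le n.+1; move: h1 h2 h3; rewrite /D -!mulrA.
    move: `|F n.+1%:R| `|F (- n.+1%:R)| (p n.+1%:R) (normal_peak s * _) => *; lra.
  rewrite ler_pdivrMr// -ler_pdivrMl// mulrC.
  near: n; exists (Num.truncn (D / e)) => // n /= hn.
  by rewrite (le_trans (ltW (truncnS_gt _)))// ler_nat ltnS ltnW.
have limh : (\int[mu]_(x in I n) (h x)%:E)%E @[n --> \oo] --> (\int[mu]_x (h x)%:E)%E.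
  under eq_fun do rewrite integral_mkcond/=.
  have := @dominated_convergence _ _ R mu setT measurableT
    (fun (n : nat) (x : R) => ((EFin \o h) \_ (I n)) x) (EFin \o h) (abse \o (EFin \o h)).
  case.
  - move=> n; apply/(measurable_restrictT _ _).1; first exact: measurable_itv.
    by apply: measurable_funS (measurable_int mu ih).
  - exact: (measurable_int mu).
  - apply: aeW => x _; apply: cvg_near_cst; near=> n.
    rewrite /patch ifT// inE/I/= in_itv/= -ler_norml.
    near: n; exists (Num.truncn `|x|) => // n /= hn.
    by rewrite (le_trans (ltW (truncnS_gt _)))// ler_nat ltnS.
  - exact: integrable_abse.
  - by apply: aeW => x n _; rewrite /patch; case: ifP => //=; rewrite normr0 lee_fin.
  by [].
have : \int[mu]_x h x = 0 by rewrite /Rintegral (cvg_unique _ limh lim0).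
rewrite /h (RintegralB measurableT i1 i2) (RintegralZl a measurableT (int_cosp a b)).
rewrite (RintegralZl (s ^- 2) measurableT (int_xsinp a b)).
by move=> /eqP; rewrite subr_eq0 => /eqP.
Unshelve. all: by end_near. Qed.

Let is_derive_phase b (a : R) : is_derive a 1 (phase b) (- (s ^+ 2 * a * phase b a)).
Proof.
have dcos (a' y : R) : is_derive a' 1 (fun a => cos (a * y + b) * p y) (- (y * sin (a' * y + b) * p y)).
  by apply: is_derive_eq; rewrite /GRing.scale/=; ring.
have Ia : (`](a - 1), (a + 1)[%classic : set R) a by rewrite /= in_itv/=; apply/andP; split; lra.
have H1 x : (`](a - 1), (a + 1)[%classic : set R) x -> mu.-integrable setT (EFin \o (fun y => cos (x * y + b) * p y)).
  by move=> _; exact: int_cosp.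
have H2 (x y : R) : (`](a - 1), (a + 1)[%classic : set R) x -> setT y -> derivable (fun a : R => cos (a * y + b) * p y) x 1.
  by move=> _ _; have [] := dcos x y.
have G0 y : 0 <= `|y| * p y by rewrite mulr_ge0.
have H3 x y : (`](a - 1), (a + 1)[%classic : set R) x -> setT y ->
    `|partial1of2 (fun a y => cos (a * y + b) * p y) x y| <= `|y| * p y.
  move=> _ _; rewrite partial1of2E; have [_ ->] := dcos x y.
  rewrite normrN !normrM (ger0_norm (p_ge0 _)) ler_wpM2r//.
  by rewrite ler_piMr// sin_max.
have D := @derivable_under_integral R _ _ mu (fun a y => cos (a * y + b) * p y) setT measurableT
  a (a - 1) (a + 1) Ia H1 H2 _ G0 int_xp H3.
have E := @differentiation_under_integral R _ _ mu (fun a y => cos (a * y + b) * p y) setT measurableT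
  a (a - 1) (a + 1) Ia H1 H2 _ G0 int_xp H3.
split; first exact: D.
rewrite -derive1E E.
have -> : (fun y => partial1of2 (fun a y => cos (a * y + b) * p y) a y) =
   (fun y => - (y * sin (a * y + b) * p y)).
  by apply/funext => y; rewrite partial1of2E; have [_ ->] := dcos a y.
have -> : \int[mu]_y (- (y * sin (a * y + b) * p y)) = - \int[mu]_y (y * sin (a * y + b) * p y).
  rewrite -mulN1r -(RintegralZl (-1) measurableT (int_xsinp a b)).
  by apply: eq_Rintegral => y _; rewrite mulN1r.
congr (- _); rewrite -mulrA gauss_stein mulrA divff ?mul1r// gt_eqF// exprn_gt0//.
Qed.

(** Differentiation under the integral and Stein's identity give [phase' = - s^2 a phase] in the
    variable [a], so that [phase * expR (s^2 a^2 / 2)] is constant, equal to its value at 0. *)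
Lemma normal_cos (a b : R) :
  \int[mu]_x (cos (a * x + b) * normal_pdf 0 s x) = expR (- (a * s) ^+ 2 / 2) * cos b.
Proof.
pose G (a : R) := phase b a * expR (s ^+ 2 * a ^+ 2 / 2).
have dG (x : R) : is_derive x 1 G 0.
  have := is_derive_phase b x => dp.
  by apply: is_derive_eq; rewrite /GRing.scale/=; field.
have GE : G a = G 0 by apply: is_derive_0_is_cst.
have p0 : phase b 0 = cos b.
  rewrite /phase; under eq_Rintegral do rewrite mul0r add0r.
  rewrite (RintegralZl (cos b) measurableT int_p).
  by rewrite /Rintegral integral_normal_pdf mulr1.
move: GE; rewrite /G p0 expr0n/= mulr0 mul0r expR0 mulr1 -/(phase b a) => <-.
rewrite mulrCA -expRD [X in expR X](_ : _ = 0) ?expR0 ?mulr1//.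
by field.
Qed.

End GaussianCharacteristic.

Section NormalLaw.
Context {R : realType} d (T : measurableType d) (P : probability T R).
Variables (G : T -> R) (s : R).
Hypotheses (s0 : 0 < s) (mG : measurable_fun setT G).
Hypothesis G_normal : forall B, measurable B -> P (G @^-1` B) = normal_prob 0 s B.

Lemma normal_law_transfer (f : measurableTypeR R -> R) : bounded_mfun f ->
  \int[P]_w f (G w) = \int[lebesgue_measure]_x (f x * normal_pdf 0 s x).
Proof.
move=> bf; apply/eqP; rewrite -subr_eq0; apply/eqP.
pose L (f : measurableTypeR R -> R) :=
  \int[P]_w f (G w) - \int[lebesgue_measure]_x (f x * normal_pdf 0 s x).
have ip : lebesgue_measure.-integrable setT (EFin \o normal_pdf 0 s) by exact: integrable_normal_pdf.
have bG X : bounded_mfun X -> bounded_mfun (X \o G).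
  by move=> [mX [C XC]]; split; [exact: measurableT_comp|exists C => w; exact: XC].
have iG X : bounded_mfun X -> P.-integrable setT (EFin \o (X \o G)).
  by move=> bX; exact/bounded_integrable/bG.
have ipX (X : measurableTypeR R -> R) : bounded_mfun X ->
    lebesgue_measure.-integrable setT (EFin \o (fun x => X x * normal_pdf 0 s x)).
  move=> [mX [C XC]].
  apply: (le_integrable measurableT _ _ (integrableZl measurableT C ip)).
    by apply/measurable_EFinP; apply: measurable_funM => //; exact: measurable_normal_pdf.
  move=> x _ /=; rewrite lee_fin !normrM ler_wpM2r// (le_trans (XC x))//.
  exact: ler_norm.
apply: (@bounded_mfun_ext R _ (measurableTypeR R) L 2) => //.
- move=> X Y bX bY; rewrite /L.
  rewrite (ExD (iG _ bX) (iG _ bY)).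
  under [X in _ - X]eq_Rintegral do rewrite mulrDl.
  by rewrite RintegralD//; [ring|exact: ipX|exact: ipX].
- move=> c X bX; rewrite /L (ExZ c (iG _ bX)).
  under [X in _ - X]eq_Rintegral do rewrite -mulrA.
  by rewrite RintegralZl//; [ring|exact: ipX].
- move=> X C bX XC; rewrite /L (le_trans (ler_normB _ _))// mulr_natl mulr2n.
  have C0 : 0 <= C by rewrite (le_trans _ (XC 0)).
  apply: lerD.
    rewrite (le_trans (Ex_norm (iG _ bX)))// -[leRHS](Ex_cst P).
    apply: Ex_le => [||w]; [exact/integ_norm/iG|exact/bounded_integrable/bounded_mfun_cst|exact: XC].
  rewrite (le_trans (le_normr_Rintegral _ (ipX _ bX)))//.
  have -> : C = \int[lebesgue_measure]_x (C * normal_pdf 0 s x).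
    by rewrite RintegralZl// /Rintegral integral_normal_pdf mulr1.
  apply: le_Rintegral => //.
  - exact: (integrable_norm (ipX _ bX)).
  - exact: (integrableZl measurableT C ip).
  - by move=> x _; rewrite normrM (ger0_norm (normal_pdf_ge0 _ _ _)) ler_wpM2r ?normal_pdf_ge0.
- move=> A mA; rewrite /L.
  have -> : \int[P]_w \1_A (G w) = fine (P (G @^-1` A)).
    rewrite /Rintegral (eq_integral (fun w => (\1_(G @^-1` A) w)%:E))//.
    rewrite integral_indic ?setIT//.
    by rewrite -[X in measurable X]setTI; exact: mG.
  have -> : \int[lebesgue_measure]_x (\1_A x * normal_pdf 0 s x) = fine (normal_prob 0 s A).
    rewrite /Rintegral /normal_prob [in RHS]integral_mkcond; congr fine.
    apply: eq_integral => x _; rewrite indicE /patch; case: ifP => _; by rewrite ?mul1r ?mul0r.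
  by rewrite G_normal// subrr.
Qed.

Lemma normal_law_cos (a b : R) :
  \int[P]_w cos (a * G w + b) = expR (- (a * s) ^+ 2 / 2) * cos b.
Proof.
rewrite -normal_cos//; apply: (@normal_law_transfer (fun x => cos (a * x + b))).
by apply: bounded_mfun_cos; apply: measurable_funD => //; exact: measurable_funM.
Qed.

End NormalLaw.

Section Independence.
Context {R : realType} d (T : measurableType d) (P : probability T R) (J : finType).
Variable G : J -> T -> R.
Hypothesis mG : forall j, measurable_fun setT (G j).
Hypothesis G_indep : forall B : J -> set R, (forall j, measurable (B j)) ->
  P [set w | forall j, B j (G j w)] = (\prod_j P (G j @^-1` B j))%E.

Let bG j (f : measurableTypeR R -> R) : bounded_mfun f -> bounded_mfun (f \o G j).
Proof.
by move=> [mf [C fC]]; split; [exact: (measurableT_comp mf (mG j))|exists C => w; exact: fC].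
Qed.

Lemma indep_prod_indic (B : J -> set R) : (forall j, measurable (B j)) ->
  \int[P]_w \prod_j (\1_(B j) (G j w)) = \prod_j \int[P]_w \1_(B j) (G j w).
Proof.
move=> mB.
have E1 j : \int[P]_w \1_(B j) (G j w) = fine (P (G j @^-1` B j)).
  rewrite /Rintegral (eq_integral (fun w => (\1_(G j @^-1` B j) w)%:E))//.
  rewrite integral_indic ?setIT//.
  by rewrite -[X in measurable X]setTI; exact: mG.
under [RHS]eq_bigr do rewrite E1.
have mS : measurable [set w | forall j, B j (G j w)].
  rewrite (_ : [set _ | _] = \bigcap_(j in setT) (G j @^-1` B j)); last first.
    by apply/seteqP; split => w /= h j; [move=> _|]; exact: h.
  apply: fin_bigcap_measurable => // j _.
  by rewrite -[X in measurable X]setTI; exact: mG.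
rewrite /Rintegral (eq_integral (fun w => (\1_[set w | forall j, B j (G j w)] w)%:E)); last first.
  move=> w _; congr (_%:E); rewrite indicE; case: (asboolP (forall j, B j (G j w))) => [h|h].
    rewrite mem_set//= big1// => j _; rewrite indicE mem_set//.
  rewrite memNset//=; apply/eqP; rewrite prodf_seq_eq0; apply/hasP.
  have [j nj] : exists j, ~ B j (G j w) by exact/existsNP.
  by exists j; rewrite ?mem_index_enum//= indicE memNset.
transitivity (fine (P [set w | forall j, B j (G j w)])).
  by rewrite integral_indic// setIT.
rewrite G_indep//.
rewrite (eq_bigr (fun j => (fine (P (G j @^-1` B j)))%:E)); last first.
  by move=> j _; rewrite fineK// fin_num_measure// -[X in measurable X]setTI; exact: mG.
by rewrite prodEFin.
Qed.

Lemma indep_prod (f : J -> measurableTypeR R -> R) : (forall j, bounded_mfun (f j)) ->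
  \int[P]_w \prod_j f j (G j w) = \prod_j \int[P]_w f j (G j w).
Proof.
suff H (s : seq J) (g : J -> measurableTypeR R -> R) :
    (forall j, j \notin s -> exists2 B, measurable B & g j = \1_B) ->
    (forall j, bounded_mfun (g j)) ->
    \int[P]_w \prod_j g j (G j w) = \prod_j \int[P]_w g j (G j w).
  by move=> bf; apply: (H (enum J)) => // j; rewrite mem_enum.
elim: s g => [|i s ih] g gB bg.
  have /choice[B BP] (j : J) : exists B, measurable B /\ g j = \1_B.
    by have [//|B mB gE] := gB j; exists B.
  have gE j w : g j (G j w) = \1_(B j) (G j w) by have [_ ->] := BP j.
  under eq_Rintegral do under eq_bigr do rewrite gE.
  rewrite indep_prod_indic; last by move=> j; have [] := BP j.
  by apply: eq_bigr => j _; apply: eq_Rintegral => w _; rewrite gE.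
pose A w := \prod_(j | j != i) g j (G j w).
have bA : bounded_mfun A.
  rewrite /A; under eq_fun do rewrite big_mkcond.
  apply: (@bounded_mfun_prod R _ T J (index_enum J) (fun j w => if j != i then g j (G j w) else 1)) => j.
  by case: (j != i); [exact: bG|exact: bounded_mfun_cst].
pose c := \prod_(j | j != i) \int[P]_w g j (G j w).
pose L (h : measurableTypeR R -> R) := \int[P]_w (h (G i w) * A w) - (\int[P]_w h (G i w)) * c.
have splitL h : (forall j, bounded_mfun (if j == i then h else g j)) ->
    \int[P]_w \prod_j (if j == i then h else g j) (G j w) -
    \prod_j \int[P]_w (if j == i then h else g j) (G j w) = L h.
  move=> _; rewrite /L; congr (_ - _).
    apply: eq_Rintegral => w _; rewrite (bigD1 i)//= eqxx; congr (_ * _).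
    by apply: eq_bigr => j /negbTE ->.
  rewrite (bigD1 i)//= eqxx; congr (_ * _).
  by apply: eq_bigr => j /negbTE ->.
have -> : g = (fun j => if j == i then g i else g j).
  by apply/funext => j; case: eqP => [->|].
apply/eqP; rewrite -subr_eq0 splitL; last by move=> j; case: ifP.
apply/eqP; apply: (@bounded_mfun_ext R _ (measurableTypeR R) L
   (xget 0 [set C | forall w, `|A w| <= C] + `|c|)) => //.
- move=> X Y bX bY; rewrite /L.
  have iX := bounded_integrable P (bG i bX); have iY := bounded_integrable P (bG i bY).
  under [X in X - _]eq_Rintegral do rewrite mulrDl.
  rewrite (ExD iX iY).
  rewrite (ExD (X := fun w => X (G i w) * A w) (Y := fun w => Y (G i w) * A w)).
  + ring.
  + exact/bounded_integrable/bounded_mfunM/bA/bG.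
  + exact/bounded_integrable/bounded_mfunM/bA/bG.
- move=> k X bX; rewrite /L.
  under [X in X - _]eq_Rintegral do rewrite -mulrA.
  rewrite (ExZ k (bounded_integrable P (bG i bX))).
  have iXA : P.-integrable setT (EFin \o (fun w => X (G i w) * A w)).
    exact/bounded_integrable/bounded_mfunM/bA/bG.
  by rewrite (ExZ k iXA) mulrBr mulrA.
- move=> X C bX XC; rewrite /L.
  have iX := bounded_integrable P (bG i bX).
  have iXA : P.-integrable setT (EFin \o (fun w => X (G i w) * A w)).
    exact/bounded_integrable/bounded_mfunM/bA/bG.
  set D := xget _ _.
  have AD w : `|A w| <= D.
    rewrite /D; case: xgetP => [y _ /= ->//|h].
    by have [_ [C' C'P]] := bA; have := h C' => /(_ C'P).
  rewrite mulrDl (le_trans (ler_normB _ _))//; apply: lerD.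
    rewrite (le_trans (Ex_norm iXA))// -[leRHS](Ex_cst P).
    apply: Ex_le => [||w]; [exact: integ_norm|exact/bounded_integrable/bounded_mfun_cst|].
    by rewrite normrM mulrC ler_pM.
  rewrite normrM mulrC ler_wpM2l// (le_trans (Ex_norm iX))// -[leRHS](Ex_cst P).
  by apply: Ex_le => [||w]; [exact: integ_norm|exact/bounded_integrable/bounded_mfun_cst|exact: XC].
- move=> B mB; rewrite -splitL; last first.
    by move=> j; case: ifP => // _; exact: bounded_mfun_indic.
  apply/eqP; rewrite subr_eq0; apply/eqP; apply: (ih (fun j => if j == i then \1_B else g j)).
    move=> j js; case: ifP => [_|/negbT ji]; first by exists B.
    by apply: gB; rewrite inE negb_or ji.
  by move=> j; case: ifP => // _; exact: bounded_mfun_indic.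
Qed.

Variable v : J -> R.
Hypothesis G_cos : forall j a b,
  \int[P]_w cos (a * G j w + b) = expR (- a ^+ 2 * v j / 2) * cos b.

(** The variables leave the cosine one by one and join a product of bounded factors, so the
    induction carries such a product along. The addition formula yields a cosine term and a sine
    term, both written as shifted cosines; the sine term has mean zero because the induction
    hypothesis produces [cos (pi / 2)]. *)
Lemma indep_cos (c : J -> R) (a : R) :
  \int[P]_w cos (\sum_j c j * G j w + a) = expR (- (\sum_j c j ^+ 2 * v j) / 2) * cos a.
Proof.
suff H (s : seq J) (f : J -> measurableTypeR R -> R) b : uniq s -> (forall j, bounded_mfun (f j)) ->
    \int[P]_w (cos (\sum_(j <- s) c j * G j w + b) * \prod_(j | j \notin s) f j (G j w)) =
    expR (- (\sum_(j <- s) c j ^+ 2 * v j) / 2) * cos b * \prod_(j | j \notin s) \int[P]_w f j (G j w).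
  have := H (index_enum J) (fun _ _ => 1) a (index_enum_uniq J) (fun=> bounded_mfun_cst _ 1).
  rewrite [X in _ = _ * X]big1 => [|j _]; last exact: Ex_cst.
  rewrite mulr1 => <-; by apply: eq_Rintegral => w _; rewrite [X in _ * X]big1 ?mulr1.
elim: s f b => [|i s ih] f b.
  move=> _ bf; rewrite big_nil oppr0 mul0r expR0 mul1r -indep_prod//.
  under eq_Rintegral do rewrite big_nil add0r.
  by rewrite ExZ//; apply: bounded_integrable; apply: bounded_mfun_prod => j; exact: bG.
move=> /= /andP[ni us] bf.
pose f1 j := if j == i then (fun x : measurableTypeR R => cos (c i * x + b)) else f j.
pose f2 j := if j == i then (fun x : measurableTypeR R => cos (c i * x + (b - pi / 2))) else f j.
have bcos (e : R) : @bounded_mfun R _ (measurableTypeR R) (fun x => cos (c i * x + e)).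
  by apply: bounded_mfun_cos; apply: measurable_funD => //; exact: measurable_funM.
have bf1 j : bounded_mfun (f1 j) by rewrite /f1; case: ifP.
have bf2 j : bounded_mfun (f2 j) by rewrite /f2; case: ifP.
have prodE (F : J -> R) : \prod_(j | j \notin s) F j = F i * \prod_(j | j \notin i :: s) F j.
  rewrite (bigD1 i)//=; congr (_ * _); apply: eq_bigl => j.
  by rewrite inE negb_or andbC.
pose S w := \sum_(j <- s) c j * G j w.
have cosE w : cos (\sum_(j <- i :: s) c j * G j w + b) * \prod_(j | j \notin i :: s) f j (G j w) =
   cos (S w + 0) * (\prod_(j | j \notin s) f1 j (G j w)) -
   (-1) * (cos (S w + pi / 2) * (\prod_(j | j \notin s) f2 j (G j w))).
  rewrite !prodE /f1 /f2 eqxx.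
  rewrite (eq_bigr (fun j => f j (G j w)) (P := fun j => j \notin i :: s) (F1 := fun j => (if j == i then _ else f j) (G j w))); last first.
    by move=> j; rewrite inE negb_or => /andP[/negbTE ->].
  rewrite [in X in _ = _ - X](eq_bigr (fun j => f j (G j w)) (P := fun j => j \notin i :: s)); last first.
    by move=> j; rewrite inE negb_or => /andP[/negbTE ->].
  rewrite big_cons -/(S w) addr0 cosDpihalf addrA cosBpihalf.
  have -> : c i * G i w + S w + b = S w + (c i * G i w + b) by ring.
  rewrite cosD; ring.
have mS : measurable_fun setT S.
  by apply: measurable_fun_sumr => j; exact: measurable_funM.
have b1 (F : J -> measurableTypeR R -> R) e : (forall j, bounded_mfun (F j)) ->
    P.-integrable setT (EFin \o (fun w => cos (S w + e) * (\prod_(j | j \notin s) F j (G j w)))).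
  move=> bF; apply/bounded_integrable/bounded_mfunM.
    by apply: bounded_mfun_cos; exact: measurable_funD.
  under eq_fun do rewrite big_mkcond.
  apply: (@bounded_mfun_prod R _ T J (index_enum J) (fun j w => if j \notin s then F j (G j w) else 1)) => j.
  by case: (j \notin s); [exact: bG|exact: bounded_mfun_cst].
under eq_Rintegral do rewrite cosE.
rewrite (ExB (b1 f1 0 bf1) (integZ (-1) (b1 f2 (pi / 2) bf2))) (ExZ (-1) (b1 f2 (pi / 2) bf2)).
rewrite (ih f1 0 us bf1) (ih f2 (pi / 2) us bf2) cos0 cos_pihalf mulr0 mul0r mulr0 subr0 mulr1.
rewrite prodE /f1 eqxx G_cos.
have -> : \prod_(j | j \notin i :: s) \int[P]_w (if j == i then
     fun x : measurableTypeR R => cos (c i * x + b) else f j) (G j w) =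
   \prod_(j | j \notin i :: s) \int[P]_w f j (G j w).
  apply: eq_bigr => j.
  by rewrite inE negb_or => /andP[/negbTE ->].
rewrite big_cons !mulrA; congr (_ * _).
rewrite -expRD; congr (expR _ * _); ring.
Qed.

End Independence.

(** * Convergence in law of random vectors *)

Section LevyContinuity.
Context {R : realType} {I : finType}.

Lemma le_eighthD (a b : R) : b <= a / 8 -> a / 8 + b <= a / 4.
Proof. lra. Qed.

Lemma dist_three_quarters (ga gb ua ub e : R) : 0 < e ->
  `|ub - gb| <= e / 4 -> `|ua - ga| <= e / 4 -> `|ua - ub| <= e / 4 -> `|ga - gb| <= e.
Proof.
rewrite !ler_norml => ? /andP[? ?] /andP[? ?] /andP[? ?].
by apply/andP; split; lra.
Qed.

Lemma measurable_trig_poly d (T : measurableType d) (F : I -> T -> R) (u : (I -> R) -> R) :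
  (forall i, measurable_fun [set: T] (F i)) -> trig_poly u ->
  bounded_mfun (fun w => u (F^~ w)).
Proof.
move=> mF [l ul]; under eq_fun do rewrite ul.
rewrite /trig_sum; apply: bounded_mfun_sum => e; apply: bounded_mfunZ.
apply: bounded_mfun_cos; apply: measurable_funD => //.
by apply: measurable_fun_sumr => i; exact: measurable_funM.
Qed.

(** [g] lives on functions [I -> R], where no sigma-algebra is fixed; measurability of the
    composition comes from pointwise approximation by trigonometric polynomials. *)
Lemma measurable_lipschitz d (T : measurableType d) (F : I -> T -> R)
    (g : (I -> R) -> R) (L : R) :
  (forall i, measurable_fun [set: T] (F i)) -> 0 <= L ->
  (forall x x', `|g x - g x'| <= L * \sum_i `|x i - x' i|) ->
  measurable_fun [set: T] (fun w => g (F^~ w)).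
Proof.
move=> mF L0 gL.
have n0 (n : nat) : 0 < n.+1%:R :> R by [].
have n1 (n : nat) : 0 < n.+1%:R^-1 :> R by rewrite invr_gt0.
have /choice[u uP] (n : nat) : exists u, trig_poly u /\ forall x,
    `|u x - g x| <= n.+1%:R^-1 + L * \sum_i 2 * x i ^+ 2 / n.+1%:R.
  by have [u tu ub] := trig_poly_approx L0 (n0 n) (n1 n) gL; exists u.
apply: (@measurable_fun_cvg _ _ _ _ (fun n w => u n (F^~ w))).
  by move=> n; have [tu _] := uP n; have [] := measurable_trig_poly mF tu.
move=> w _; set x := F^~ w; set D := 1 + L * \sum_i 2 * x i ^+ 2.
apply/cvgrPdist_le => e e0.
have D0 : 0 < D by rewrite ltr_pwDl// mulr_ge0// sumr_ge0// => i _; rewrite mulr_ge0 ?sqr_ge0.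
near=> n; rewrite distrC; have [_ /(_ x) h] := uP n; apply: le_trans h _.
have -> : n.+1%:R^-1 + L * \sum_i 2 * x i ^+ 2 / n.+1%:R = D / n.+1%:R.
  by rewrite -mulr_suml /D mulrDl mul1r mulrA.
rewrite ler_pdivrMr// -ler_pdivrMl// mulrC.
near: n; exists (Num.truncn (D / e)) => // n /= hn.
by rewrite (le_trans (ltW (truncnS_gt _)))// ler_nat ltnS.
Unshelve. all: by end_near. Qed.

Context d d' (T : measurableType d) (T' : measurableType d').
Context (P : probability T R) (Q : probability T' R).

(* The second moments control the error of the approximation of g by a
   trigonometric polynomial, which is small only on bounded sets. *)
Lemma levy_continuity (X : R -> I -> T -> R) (Y : I -> T' -> R) (C : R) :
  (forall t i, measurable_fun [set: T] (X t i)) ->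
  (forall i, measurable_fun [set: T'] (Y i)) ->
  (\forall t \near +oo, forall i, P.-integrable [set: T] (EFin \o (fun w => X t i w ^+ 2)) /\
     \int[P]_w X t i w ^+ 2 <= C) ->
  (forall i, Q.-integrable [set: T'] (EFin \o (fun w => Y i w ^+ 2)) /\
     \int[Q]_w Y i w ^+ 2 <= C) ->
  (forall (xi : I -> R) a,
     \int[P]_w cos (\sum_i xi i * X t i w + a) @[t --> +oo] -->
     \int[Q]_w cos (\sum_i xi i * Y i w + a)) ->
  forall (g : (I -> R) -> R) (L B : R), 0 <= L ->
  (forall x x', `|g x - g x'| <= L * \sum_i `|x i - x' i|) ->
  (forall x, `|g x| <= B) ->
  \int[P]_w g (X t ^~ w) @[t --> +oo] --> \int[Q]_w g (Y ^~ w).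
Proof.
move=> mX mY X2 Y2 cXY g L B L0 gL gB.
apply: cvgr_distP => e e0.
(* With [c = 8 S / e], the second moments contribute at most [e / 8] to the approximation error; the
   added 1 keeps [S] positive. *)
pose S := L * \sum_(i in I) 2 * C + 1.
have C0 (i : I) : 0 <= C.
  by have [_ +] := Y2 i; apply: le_trans; apply: Ex_ge0 => w; exact: sqr_ge0.
have S0 : 0 < S.
  rewrite /S ltr_wpDl// mulr_ge0// sumr_ge0// => i _; rewrite mulr_ge0//; exact: C0 i.
pose c := 8 * S / e.
have c0 : 0 < c by rewrite divr_gt0// mulr_gt0.
have e8 : 0 < e / 8 by rewrite divr_gt0.
have [u tu uP] := trig_poly_approx L0 c0 e8 gL.
have key dd (V : measurableType dd) (W : probability V R) (F : I -> V -> R) :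
    (forall i, measurable_fun [set: V] (F i)) ->
    (forall i, W.-integrable [set: V] (EFin \o (fun w => F i w ^+ 2)) /\
     \int[W]_w F i w ^+ 2 <= C) ->
    `|\int[W]_w u (F^~ w) - \int[W]_w g (F^~ w)| <= e / 4.
  move=> mF F2.
  have bu := measurable_trig_poly mF tu.
  have bg : bounded_mfun (fun w => g (F^~ w)).
    by split; [exact: measurable_lipschitz gL|exists B].
  have iS : W.-integrable [set: V] (EFin \o (fun w => \sum_i 2 / c * F i w ^+ 2)).
    by apply: integ_sum => i; apply: integZ; have [] := F2 i.
  rewrite -ExB; try exact: bounded_integrable.
  rewrite (le_trans (Ex_norm _))//; first exact/bounded_integrable/bounded_mfunB.
  have ic (a : R) : W.-integrable [set: V] (EFin \o (fun=> a)).
    exact/bounded_integrable/bounded_mfun_cst.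
  apply: (@le_trans _ _ (\int[W]_w (e / 8 + L * \sum_i 2 / c * F i w ^+ 2))).
    apply: Ex_le.
    - exact/bounded_integrable/bounded_mfun_norm/bounded_mfunB.
    - by apply: integD => //; exact: integZ.
    - move=> w; rewrite (le_trans (uP _))// lerD2l ler_wpM2l// ler_sum// => i _.
      by rewrite mulrAC.
  rewrite ExD//; last exact: integZ.
  rewrite (ExZ L iS) Ex_cst Ex_sum; last by move=> i; apply: integZ; have [] := F2 i.
  have : L * (\sum_i \int[W]_w (2 / c * F i w ^+ 2)) <= e / 8.
    apply: (@le_trans _ _ (L * \sum_(i in I) 2 / c * C)).
      rewrite ler_wpM2l// ler_sum// => i _; have [iF FC] := F2 i.
      by rewrite ExZ// ler_wpM2l// divr_ge0// ltW.
    have -> : L * \sum_(i in I) 2 / c * C = (S - 1) / c.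
      rewrite /S addrK -[RHS]mulrA mulr_suml; congr (_ * _).
      by apply: eq_bigr => i _; rewrite mulrAC.
    rewrite /c ler_pdivrMr// [leRHS](_ : _ = S) ?gerBl//.
    by field; rewrite gt_eqF.
  exact: le_eighthD.
have cu : \int[P]_w u (X t ^~ w) @[t --> +oo] --> \int[Q]_w u (Y ^~ w).
  have [l ul] := tu.
  have ulE dd (V : measurableType dd) (W : probability V R) (F : I -> V -> R) :
      (forall i, measurable_fun [set: V] (F i)) -> \int[W]_w u (F^~ w) =
      \sum_(e <- l) e.1.1 * \int[W]_w cos (\sum_i e.1.2 i * F i w + e.2).
    move=> mF; under eq_Rintegral do rewrite ul.
    have mc e' : W.-integrable [set: V] (EFin \o (fun w => cos (\sum_i e'.1.2 i * F i w + e'.2) : R)).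
      apply/bounded_integrable/bounded_mfun_cos/measurable_funD => //.
      by apply: measurable_fun_sumr => i; exact: measurable_funM.
    rewrite /trig_sum Ex_sum; last by move=> e'; exact: integZ.
    by apply: eq_bigr => e' _; rewrite ExZ.
  rewrite ulE//; under eq_fun do rewrite ulE//.
  apply: cvg_big => // [|e' _]; first exact: add_continuous.
  by apply: cvgMr; exact: cXY.
have e4 : 0 < e / 4 by rewrite divr_gt0.
apply: filterS2 X2 (cvgr_dist cu e4) => t Xt.
by apply: dist_three_quarters => //; [exact: (key _ _ P)|exact: (key _ _ Q)].
Qed.

End LevyContinuity.

(** * Jump paths and their compensators *)

Section CausalPrimitive.
Context {R : realType} {d : nat}.
Local Notation leb := (@lebesgue_measure R).
Variable phi : R -> 'M[R]_d.
Hypothesis phi_ge0 : forall (t : R) i j, 0 <= t -> 0 <= phi t i j.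
Hypothesis phi_meas : forall i j, measurable_fun (`[0, +oo[ : set R) (fun t => phi t i j).
Hypothesis phi_int : forall i j,
  (\int[lebesgue_measure]_(t in `[0%R, +oo[) (phi t i j)%:E < +oo)%E.

Local Notation K := (kernel_mass phi).
Local Notation cau := (causal phi).

Let mcau i j : measurable_fun setT (EFin \o cau i j).
Proof. by apply/measurable_EFinP; exact: measurable_causal. Qed.

Lemma causal_integrable i j : leb.-integrable setT (EFin \o cau i j).
Proof.
apply/integrableP; split; first exact: mcau.
under eq_integral do rewrite gee0_abs ?lee_fin ?causal_ge0//.
by rewrite causal_integral// ltry.
Qed.

Definition cut (x u : R) : R := (u <= x)%R%:R.

Lemma measurable_cut x : measurable_fun setT (cut x).
Proof.
have -> : cut x = \1_(`]-oo, x]%classic) :> (R -> R).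
  by apply/funext => u; rewrite /cut indicE mem_setE/= in_itv.
exact: measurable_indic.
Qed.

Definition causal_prim i j (x : R) : R := \int[leb]_u (cau i j u * cut x u).

Lemma causal_cut_integrable i j x : leb.-integrable setT (EFin \o (fun u => cau i j u * cut x u)).
Proof.
apply: (le_integrable measurableT _ _ (causal_integrable i j)).
  apply/measurable_EFinP; apply: measurable_funM; last exact: measurable_cut.
  exact: measurable_causal.
move=> u _ /=; rewrite lee_fin normrM ler_piMr// /cut.
by case: (u <= x); rewrite ?normr1 ?normr0.
Qed.

Lemma causal_prim_EFin i j x :
  (causal_prim i j x)%:E = (\int[leb]_u (cau i j u * cut x u)%:E)%E.
Proof. by rewrite /causal_prim fineK//; exact: integrable_fin_num (causal_cut_integrable i j x). Qed.

Lemma causal_prim_ge0 i j x : 0 <= causal_prim i j x.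
Proof. by apply: Rintegral_ge0 => u _; rewrite mulr_ge0 ?causal_ge0// ler0n. Qed.

Lemma causal_prim_nd i j x y : x <= y -> causal_prim i j x <= causal_prim i j y.
Proof.
move=> xy; apply: le_Rintegral => //; try exact: causal_cut_integrable.
move=> u _; rewrite ler_wpM2l ?causal_ge0// /cut ler_nat.
by case: (leP u x) => // ux; rewrite (le_trans ux xy).
Qed.

Lemma causal_prim_le i j x : causal_prim i j x <= K i j.
Proof.
rewrite -lee_fin causal_prim_EFin -causal_integral//.
apply: ge0_le_integral => //.
- by move=> u _; rewrite lee_fin mulr_ge0 ?causal_ge0// ler0n.
- exact: (measurable_int leb (causal_cut_integrable i j x)).
- exact: mcau.
- by move=> u _; rewrite lee_fin ler_piMr ?causal_ge0// /cut; case: (u <= x).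
Qed.

Lemma causal_prim_le0 i j x : x <= 0 -> causal_prim i j x = 0.
Proof.
move=> x0; apply: EFin_inj; rewrite causal_prim_EFin.
have -> : (\int[leb]_u (cau i j u * cut x u)%:E = \int[leb]_(u in [set 0%R]) (cau i j u * cut x u)%:E)%E.
  rewrite [RHS]integral_mkcond; apply: eq_integral => u _; rewrite /patch.
  case: ifPn => // /negP; rewrite inE/= => u0.
  have [ul|ul] := leP 0 u; last by rewrite causal_neg// mul0r.
  rewrite /cut leNgt (le_lt_trans x0) ?mulr0//.
  by rewrite lt_neqAle ul andbT eq_sym; apply/eqP.
by rewrite integral_set1.
Qed.

(** The kernel may be unbounded: its part above a height n has integral at most [e / 2], and the
    rest contributes at most n times the length. The modulus is uniform over the line. *)
Lemma causal_prim_modulus i j (e : R) : 0 < e -> exists2 h, 0 < h &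
  forall x y, x <= y -> y - x <= h -> causal_prim i j y - causal_prim i j x <= e.
Proof.
move=> e0.
pose f (n : nat) u : R := cau i j u * (n%:R < cau i j u)%R%:R.
have mf n : measurable_fun setT (f n).
  apply: measurable_funM; first exact: measurable_causal.
  have -> : (fun u => (n%:R < cau i j u)%R%:R) = \1_(cau i j @^-1` `]n%:R, +oo[) :> (R -> R).
    by apply/funext => u; rewrite indicE; congr (nat_of_bool _)%:R;
      apply/idP/idP => [h|/set_mem]; [apply/mem_set|]; rewrite /= in_itv/= andbT.
  apply: measurable_indic; rewrite -[X in measurable X]setTI.
  by apply: (measurable_causal phi_meas).
have f_le n u : `|f n u| <= cau i j u.
  rewrite /f; case: (n%:R < cau i j u); rewrite ?mulr1 ?mulr0 ?normr0 ?causal_ge0//.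
  by rewrite ger0_norm// causal_ge0.
have fc : (\int[leb]_u (f n u)%:E)%E @[n --> \oo] --> (\int[leb]_(u in setT) (0%:E : \bar R))%E.
  have := @dominated_convergence _ _ R leb setT measurableT (fun n u => (f n u)%:E)
    (fun=> 0%:E) (EFin \o cau i j).
  case => //.
  - by move=> n; apply/measurable_EFinP; exact: mf.
  - apply: aeW => u _; apply: cvg_near_cst.
    exists (Num.truncn (cau i j u)).+1 => // n /= hn.
    have -> : f n u = 0 => //; rewrite /f (_ : (n%:R < cau i j u) = false) ?mulr0//.
    by apply/negbTE; rewrite -leNgt (le_trans (ltW (truncnS_gt _)))// ler_nat.
  - exact: causal_integrable.
  - by apply: aeW => u n _ /=; rewrite lee_fin f_le.
have fi n : leb.-integrable setT (EFin \o f n).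
  apply: (le_integrable measurableT _ _ (causal_integrable i j)).
    by apply/measurable_EFinP; exact: mf.
  by move=> u _ /=; rewrite lee_fin (le_trans (f_le n u))// ler_norm.
have fcR : \int[leb]_u f n u @[n --> \oo] --> 0.
  apply: (@fine_cvg _ _ _ _ (fun n => \int[leb]_u (f n u)%:E)%E).
  by rewrite -[X in _ --> X](@integral0 _ _ R leb setT).
have e2 : 0 < e / 2 by rewrite divr_gt0.
have [n _ nP] := cvgr_dist fcR e2.
pose h := e / 2 / n.+1%:R.
have h0 : 0 < h by rewrite divr_gt0.
exists h => // x y xy xyh.
have cutE u : cut y u - cut x u = \1_(`]x, y]%classic) u.
  rewrite indicE mem_setE /= in_itv/= /cut.
  case: (leP u x) => ux /=; last by rewrite subr0.
  by rewrite (le_trans ux xy) subrr.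
have ic : leb.-integrable setT (EFin \o \1_(`]x, y]%classic)).
  exact: integrable_indic_itv.
have ic2 := integrableZl measurableT n%:R ic.
rewrite /causal_prim -(RintegralB measurableT (causal_cut_integrable i j y) (causal_cut_integrable i j x)).
apply: (@le_trans _ _ (\int[leb]_u (f n u + n%:R * \1_(`]x, y]%classic) u))).
  apply: le_Rintegral => //.
  - exact: (integrableB measurableT (causal_cut_integrable i j y) (causal_cut_integrable i j x)).
  - exact: (integrableD measurableT (fi n) ic2).
  - move=> u _; rewrite -mulrBr cutE indicE /f.
    have c0 := causal_ge0 phi_ge0 i j u.
    case: (u \in _); case: (ltP n%:R (cau i j u)) => h1;
      rewrite ?mulr1 ?mulr0 ?addr0 ?add0r// ?lerDl ?ler0n//.
rewrite (RintegralD measurableT (fi n) ic2) (RintegralZl n%:R measurableT ic).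
have -> : \int[leb]_u \1_(`]x, y]%classic) u = y - x.
  rewrite /Rintegral integral_indic ?setIT//= lebesgue_measure_itv/= lte_fin.
  case: ltP => //= yx; apply/esym/eqP; rewrite subr_eq0; apply/eqP/le_anti.
  by rewrite xy yx.
have h2 := nP n (leqnn n); rewrite /= sub0r normrN in h2.
have h3 : \int[leb]_u f n u <= e / 2 by exact: le_trans (ler_norm _) h2.
have h4 : n%:R * (y - x) <= e / 2.
  apply: (@le_trans _ _ (n.+1%:R * h)).
    by rewrite ler_pM ?subr_ge0// ler_nat.
  by rewrite /h mulrC divfK// pnatr_eq0.
by rewrite [leRHS]splitr lerD.
Qed.

End CausalPrimitive.

(** * Paths with finitely many jumps and their quadratic variation *)

Section JumpPaths.
Context {R : realType} {d : nat}.
Implicit Types (tau : nat -> \bar R) (Z : nat -> 'I_d).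

Definition jumps tau Z (n : nat) (i : 'I_d) (t : R) : R :=
  \sum_(k < n) ((tau k <= t%:E)%E && (Z k == i))%:R.

Lemma jumps_ge0 tau Z n i t : 0 <= jumps tau Z n i t.
Proof. by rewrite sumr_ge0. Qed.

Lemma jumps_le tau Z n i t : jumps tau Z n i t <= n%:R.
Proof.
rewrite /jumps -[leRHS](_ : \sum_(k < n) 1 = _); last by rewrite sumr_const card_ord.
by apply: ler_sum => k _; case: (_ && _).
Qed.

Lemma jumps_nd tau Z n i s t : s <= t -> jumps tau Z n i s <= jumps tau Z n i t.
Proof.
move=> st; apply: ler_sum => k _; rewrite ler_nat.
case: (leP (tau k) s%:E) => //= ts; rewrite (le_trans ts)//= lee_fin//.
Qed.

Lemma jumpsB tau Z n i s t : s <= t -> jumps tau Z n i t - jumps tau Z n i s =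
  \sum_(k < n) ((s%:E < tau k)%E && (tau k <= t%:E)%E && (Z k == i))%:R.
Proof.
move=> st; rewrite -sumrB; apply: eq_bigr => k _.
case: (leP (tau k) s%:E) => ts /=; last by rewrite subr0.
by rewrite (le_trans ts) ?lee_fin//= subrr.
Qed.

Variables (tau : nat -> \bar R) (Z : nat -> 'I_d).
Hypothesis tau_gt0 : forall n, (0 < tau n)%E.
Hypothesis tau_nd : forall n, (tau n <= tau n.+1)%E.
Hypothesis tau_inc : forall n, (tau n < +oo)%E -> (tau n < tau n.+1)%E.

Lemma tau_le m n : (m <= n)%N -> (tau m <= tau n)%E.
Proof.
move=> /subnKC <-; elim: (n - m)%N => [|k ih]; first by rewrite addn0.
by rewrite addnS (le_trans ih).
Qed.

(** Finite jump times increase strictly, and finitely many gaps have a positive lower bound;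
    infinite times impose nothing. *)
Lemma jumps_gap n : exists2 h : R, 0 < h &
  forall k l, (k < l)%N -> (l < n)%N -> (tau l < +oo)%E -> (tau k + h%:E <= tau l)%E.
Proof.
elim: n => [|n [h h0 ih]]; first by exists 1.
have [ny|ny] := ltP (tau n) +oo%E; last first.
  exists h => // k l kl; rewrite ltnS leq_eqVlt => /predU1P[-> |ln]; last exact: ih.
  by rewrite ltNge ny.
case: n ih ny => [|n] ih ny.
  by exists 1 => // k l; case: l.
have fn m : (m <= n.+1)%N -> exists2 x : R, tau m = x%:E & 0 < x.
  move=> mn; have := tau_gt0 m; have := le_lt_trans (tau_le mn) ny.
  by case: (tau m) => // x _; rewrite lte_fin; exists x.
have [x xE x0] := fn n (leqnSn _); have [y yE y0] := fn n.+1 (leqnn _).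
have xy : x < y by rewrite -lte_fin -xE -yE tau_inc// xE ltry.
exists (Num.min h (y - x)); first by rewrite lt_min h0 subr_gt0.
move=> k l kl; rewrite ltnS leq_eqVlt => /predU1P[lE|ln] ly; last first.
  by apply: le_trans (ih k l kl ln ly); rewrite leeD2l// lee_fin ge_min lexx.
move: kl ly; rewrite lE ltnS => kn _.
apply: (@le_trans _ _ (tau n + (y - x)%:E)%E).
  by apply: leeD; [exact: tau_le|rewrite lee_fin ge_min lexx orbT].
by rewrite xE yE -EFinD lee_fin addrC subrK.
Qed.

(** A window shorter than the minimal gap holds at most one of the first [n] jumps, and a jump
    belongs to a single component. *)
Lemma jumpsM_small n i j : exists2 h : R, 0 < h & forall s t, s <= t -> t - s < h ->
  (jumps tau Z n i t - jumps tau Z n i s) * (jumps tau Z n j t - jumps tau Z n j s) =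
  (i == j)%:R * (jumps tau Z n i t - jumps tau Z n i s).
Proof.
have [h h0 hP] := jumps_gap n; exists h => // s t st tsh.
rewrite !jumpsB// mulr_suml mulr_sumr; apply: eq_bigr => k _.
rewrite mulr_sumr (bigD1 k)//= big1 => [|l lk].
  rewrite addr0; have [->|_] := eqVneq (Z k) i; last by rewrite andbF mul0r mulr0.
  by rewrite andbT; case: (_ && _) => /=; rewrite ?mul0r ?mulr0// mul1r mulr1.
suff key a b : (a < b)%N -> (b < n)%N -> (s%:E < tau a)%E -> (tau b <= t%:E)%E -> False.
  case: (ltP s%:E (tau k)) => sk; rewrite ?mul0r//=.
  case: (leP (tau k) t%:E) => tk; rewrite ?mul0r//=.
  case: (ltP s%:E (tau l)) => sl; rewrite ?mulr0//=.
  case: (leP (tau l) t%:E) => tl; rewrite ?mulr0//=.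
  by exfalso; move: lk; rewrite -val_eqE neq_ltn => /orP[] ?; [exact: (key l k)|exact: (key k l)].
move=> ab bn sa bt.
have := hP a b ab bn (le_lt_trans bt (ltry _)); move=> h1.
have : (s%:E + h%:E < t%:E)%E.
  by apply: lt_le_trans (le_trans h1 bt); rewrite lteD2rE.
rewrite -EFinD lte_fin => h2; move: tsh; rewrite ltrBlDl => h3.
by have := lt_trans h2 h3; rewrite ltxx.
Qed.

Definition partition_point (s t : R) (L k : nat) : R := s + (t - s) * k%:R / L%:R.

Lemma partition_point0 s t L : partition_point s t L 0 = s.
Proof. by rewrite /partition_point mulr0 mul0r addr0. Qed.

Lemma partition_point_last s t L : (0 < L)%N -> partition_point s t L L = t.
Proof.
move=> L0; rewrite /partition_point -mulrA divff ?mulr1; first by rewrite addrC subrK.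
by rewrite pnatr_eq0 -lt0n.
Qed.

Lemma partition_pointS s t L k : partition_point s t L k.+1 - partition_point s t L k = (t - s) / L%:R.
Proof. by rewrite /partition_point -natr1; ring. Qed.

Lemma partition_point_le s t L k l : s <= t -> (k <= l)%N ->
  partition_point s t L k <= partition_point s t L l.
Proof.
move=> st kl; rewrite lerD2l ler_wpM2r ?invr_ge0// ler_wpM2l ?subr_ge0// ler_nat//.
Qed.

Lemma partition_mesh (s t h : R) : s <= t -> 0 < h -> \forall L \near \oo, (t - s) / L.+1%:R < h.
Proof.
move=> st h0; exists (Num.truncn ((t - s) / h)) => // L /= hL.
rewrite ltr_pdivrMr// mulrC -ltr_pdivrMr//.
by rewrite (lt_le_trans (truncnS_gt _))// ler_nat ltnS.
Qed.

(* The continuous parts [A i] do not contribute to the limit. *)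
Lemma quadratic_variation n i j (A : 'I_d -> R -> R) s t : s <= t ->
  (forall i x y, s <= x -> x <= y -> A i x <= A i y) ->
  (forall i e, 0 < e -> exists2 h : R, 0 < h & forall x y, s <= x -> x <= y -> y - x < h ->
     A i y - A i x <= e) ->
  let M i x := jumps tau Z n i x - A i x in
  let p L k := partition_point s t L.+1 k in
  \sum_(k < L.+1) (M i (p L k.+1) - M i (p L k)) * (M j (p L k.+1) - M j (p L k)) @[L --> \oo] -->
  (i == j)%:R * (jumps tau Z n i t - jumps tau Z n i s).
Proof.
move=> st And Amod M p.
pose N i x := jumps tau Z n i x.
apply: cvgr_distP => e e0.
(* On each cell the error will be at most [e / D] times the increments of the three monotone
   functions, whose total over the cells is below [D]. *)
pose D := 1 + (N i t - N i s) + (N j t - N j s) + (A i t - A i s).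
have DN k : 0 <= N k t - N k s by rewrite subr_ge0 jumps_nd.
have DA k : 0 <= A k t - A k s by rewrite subr_ge0 And.
have D0 : 0 < D by rewrite /D; have := DN i; have := DN j; have := DA i; lra.
have eD : 0 < e / D by rewrite divr_gt0.
have [h1 h10 h1P] := jumpsM_small n i j.
have [h2 h20 h2P] := Amod i _ eD; have [h3 h30 h3P] := Amod j _ eD.
have h0 : 0 < Num.min h1 (Num.min h2 h3) by rewrite !lt_min h10 h20 h30.
apply: filterS (partition_mesh st h0) => L; rewrite !lt_min => /andP[m1 /andP[m2 m3]].
have tele (F : R -> R) : \sum_(k < L.+1) (F (p L k.+1) - F (p L k)) = F t - F s.
  rewrite -(big_mkord xpredT (fun k => F (p L k.+1) - F (p L k))).
  by rewrite (telescope_sumr (fun k => F (p L k)))// /p partition_point0 partition_point_last.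
have ps k : s <= p L k.
  by rewrite -[leLHS](partition_point0 s t L.+1) partition_point_le.
have pk k : p L k <= p L k.+1 by rewrite partition_point_le.
have pm k : p L k.+1 - p L k = (t - s) / L.+1%:R by rewrite /p partition_pointS.
rewrite -(tele (N i)) mulr_sumr -sumrB.
apply: (@le_trans _ _ (\sum_(k < L.+1) (e / D) * ((N i (p L k.+1) - N i (p L k)) +
    (N j (p L k.+1) - N j (p L k)) + (A i (p L k.+1) - A i (p L k))))); last first.
  have sp (a b c : 'I_L.+1 -> R) : \sum_k (a k + b k + c k) = \sum_k a k + \sum_k b k + \sum_k c k.
    by rewrite !big_split.
  rewrite -mulr_sumr sp (tele (N i)) (tele (N j)) (tele (A i)) mulrAC ler_pdivrMr//.
  by rewrite ler_pM2l// /D; lra.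
rewrite (le_trans (ler_norm_sum _ _ _))//; apply: ler_sum => k _.
have e1 : N i (p L k.+1) - N i (p L k) = jumps tau Z n i (p L k.+1) - jumps tau Z n i (p L k) by [].
rewrite -(h1P (p L k) (p L k.+1)) ?pm// -!/(N _ _) /M -!/(N _ _).
have a1 := h2P (p L k) (p L k.+1) (ps k) (pk k); have a2 := h3P (p L k) (p L k.+1) (ps k) (pk k).
rewrite pm in a1 a2; have {}a1 := a1 m2; have {}a2 := a2 m3.
have b1 := And i _ _ (ps k) (pk k); have b2 := And j _ _ (ps k) (pk k).
have c1 : N i (p L k) <= N i (p L k.+1) by exact: jumps_nd.
have c2 : N j (p L k) <= N j (p L k.+1) by exact: jumps_nd.
rewrite -subr_ge0 in b1; rewrite -subr_ge0 in b2; rewrite -subr_ge0 in c1; rewrite -subr_ge0 in c2.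
move: a1 a2 b1 b2 c1 c2.
set x := A i _ - _; set y := A j _ - _; set u := N i _ - _; set v := N j _ - _.
move=> a1 a2 b1 b2 c1 c2.
have -> : u * v - (N i (p L k.+1) - A i (p L k.+1) - (N i (p L k) - A i (p L k))) *
   (N j (p L k.+1) - A j (p L k.+1) - (N j (p L k) - A j (p L k))) =
   u * y + x * v - x * y by rewrite /u /v /x /y; ring.
have r0 : 0 <= e / D by exact: ltW.
move: (e / D) r0 a1 a2 => r r0 a1 a2.
have q1 : u * y <= u * r by rewrite ler_wpM2l.
have q2 : x * v <= r * v by rewrite ler_wpM2r.
have q3 : x * y <= x * r by rewrite ler_wpM2l.
have q4 : 0 <= u * y by rewrite mulr_ge0.
have q5 : 0 <= x * v by rewrite mulr_ge0.
have q6 : 0 <= x * y by rewrite mulr_ge0.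
have q7 : 0 <= r * u by rewrite mulr_ge0.
have q8 : 0 <= r * v by rewrite mulr_ge0.
have q9 : 0 <= x * r by rewrite mulr_ge0.
have -> : r * (u + v + x) = u * r + r * v + x * r by ring.
rewrite [r * u]mulrC in q7; rewrite ler_norml.
apply/andP; split; lra.
Qed.

End JumpPaths.

(** * The compensator of the process stopped at a jump time *)

Section Compensator.
Context {R : realType} {d : nat}.
Context (dO : measure_display) (Om : measurableType dO).
Local Notation leb := (@lebesgue_measure R).
Variables (mu : 'cV[R]_d) (phi : R -> 'M[R]_d) (tau : nat -> Om -> \bar R) (Z : nat -> Om -> 'I_d).
Hypothesis mu_ge0 : forall i, 0 <= mu i 0.
Hypothesis phi_ge0 : forall (t : R) i j, 0 <= t -> 0 <= phi t i j.
Hypothesis phi_meas : forall i j, measurable_fun (`[0, +oo[ : set R) (fun t => phi t i j).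
Hypothesis phi_int : forall i j,
  (\int[lebesgue_measure]_(t in `[0%R, +oo[) (phi t i j)%:E < +oo)%E.
Hypothesis marked : marked_times tau Z.

Local Notation K := (kernel_mass phi).
Local Notation cau := (causal phi).
Local Notation Phi := (causal_prim phi).

Lemma marked_gt0 n w : (0 < tau n w)%E. Proof. by case: marked. Qed.
Lemma marked_nd n w : (tau n w <= tau n.+1 w)%E. Proof. by case: marked. Qed.
Lemma marked_inc n w : (tau n w < +oo)%E -> (tau n w < tau n.+1 w)%E.
Proof. by case: marked => _ _ _ _; exact. Qed.
Let tau_leq m n w : (m <= n)%N -> (tau m w <= tau n w)%E.
Proof. by move=> mn; apply: (@tau_le R (tau^~ w)) => // k; exact: marked_nd. Qed.

Definition cnt n i t w : R := jumps (tau^~ w) (Z^~ w) n i t.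

Lemma stopped_timeE n t w : 0 <= t -> ((stopped_time tau n t w)%:E = Order.min t%:E (tau n w))%E.
Proof.
move=> t0; rewrite /stopped_time fineK//.
have := marked_gt0 n w; case: (tau n w) => [r r0| |//].
  by rewrite minEle; case: ifP.
by rewrite minEle leey.
Qed.

Lemma stopped_time_ge0 n t w : 0 <= t -> 0 <= stopped_time tau n t w.
Proof. by move=> t0; rewrite -lee_fin stopped_timeE// le_min lee_fin t0 ltW// marked_gt0. Qed.

Lemma stopped_time_le n t w : 0 <= t -> stopped_time tau n t w <= t.
Proof. by move=> t0; rewrite -lee_fin stopped_timeE// ge_min lexx. Qed.

Lemma stopped_time_tau n t w : 0 <= t -> ((stopped_time tau n t w)%:E <= tau n w)%E.
Proof. by move=> t0; rewrite stopped_timeE// ge_min lexx orbT. Qed.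

Lemma stopped_time_nd n s t w : 0 <= s -> s <= t -> stopped_time tau n s w <= stopped_time tau n t w.
Proof.
move=> s0 st; rewrite -lee_fin !stopped_timeE ?(le_trans s0)// le_min !ge_min lexx orbT andbT.
by rewrite lee_fin st.
Qed.

Lemma stopped_time_lip n s t w : 0 <= s -> s <= t ->
  stopped_time tau n t w - stopped_time tau n s w <= t - s.
Proof.
move=> s0 st; have t0 := le_trans s0 st.
rewrite lerBlDr -lee_fin EFinD stopped_timeE// stopped_timeE//.
have [h|h] := leP s%:E (tau n w).
  by rewrite -EFinD subrK ge_min lexx.
rewrite ge_min; apply/orP; right.
by rewrite -[leLHS]add0e leeD2r// lee_fin subr_ge0.
Qed.

Lemma stopped_time_late n t w : 0 <= t -> (t%:E <= tau n w)%E -> stopped_time tau n t w = t.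
Proof. by move=> t0 h; apply: EFin_inj; rewrite stopped_timeE// min_l. Qed.

Lemma jump_count_finite n i t w : (forall k, (n <= k)%N -> (t%:E < tau k w)%E) ->
  jump_count tau Z i t w = (cnt n i t w)%:E.
Proof.
move=> h; rewrite /jump_count (nneseries_split 0%N n); last by move=> k _; rewrite lee_fin ler0n.
rewrite add0n eseries0 ?adde0; last first.
  by move=> k nk _; rewrite leNgt h.
by rewrite big_mkord sumEFin.
Qed.

Lemma tau_late n t w : (t%:E < tau n w)%E -> forall k, (n <= k)%N -> (t%:E < tau k w)%E.
Proof. by move=> h k nk; exact: lt_le_trans h (tau_leq w nk). Qed.

(** [tau n] is the (n+1)-st jump, so stopping at it keeps the jumps 0 to n; such a jump occurs
    before the stopped time exactly when it occurs before [t]. *)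
Lemma jump_count_stopped n i t w : 0 <= t ->
  jump_count tau Z i (stopped_time tau n t w) w = (cnt n.+1 i t w)%:E.
Proof.
move=> t0; set s := stopped_time _ _ _ _.
rewrite (@jump_count_finite n.+1); last first.
  move=> k nk; have sE : (s%:E <= tau n w)%E by exact: stopped_time_tau.
  have [ny|ny] := ltP (tau n w) +oo%E.
    by apply: le_lt_trans sE _; apply: lt_le_trans (tau_leq w nk); exact: marked_inc.
  apply: (lt_le_trans (ltry s)); apply: (le_trans ny); apply: tau_leq; exact: ltnW.
congr (_%:E); apply: eq_bigr => k _; congr (nat_of_bool (_ && _))%:R.
rewrite /s stopped_timeE// le_min (tau_leq w) ?andbT//.
by rewrite -ltnS.
Qed.

(** The integrated intensity in closed form: each jump before [tau n] contributes a primitive of the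
    kernel, while jump n itself, occurring at the stopping time, contributes nothing. The indicator
    is needed because [fine] sends +oo to 0. *)
Definition compens n i t w : R := mu i 0 * stopped_time tau n t w +
  \sum_(k < n) ((tau k w < +oo)%E)%:R * Phi i (Z k w) (stopped_time tau n t w - fine (tau k w)).

Let Phi0 := @causal_prim_ge0 R d phi phi_ge0.
Let Phind := @causal_prim_nd R d phi phi_ge0 phi_meas phi_int.
Let Phile := @causal_prim_le R d phi phi_ge0 phi_meas phi_int.
Let Phile0 := @causal_prim_le0 R d phi phi_ge0 phi_meas phi_int.
Let K0 := @kernel_mass_ge0 R d phi phi_ge0 phi_int.

Lemma compens_nd n i s t w : 0 <= s -> s <= t -> compens n i s w <= compens n i t w.
Proof.
move=> s0 st; have h := stopped_time_nd n w s0 st.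
apply: lerD; first by rewrite ler_wpM2l.
by apply: ler_sum => k _; rewrite ler_wpM2l// Phind// lerB.
Qed.

Lemma compens_ge0 n i t w : 0 <= t -> 0 <= compens n i t w.
Proof.
move=> t0; apply: addr_ge0; first by rewrite mulr_ge0// stopped_time_ge0.
by apply: sumr_ge0 => k _; rewrite mulr_ge0.
Qed.

(** Each jump contributes at most the full mass of its kernel. This linear bound by the counts
    themselves is what makes the comparison principle applicable. *)
Lemma compens_le n i t w : 0 <= t ->
  compens n i t w <= mu i 0 * t + \sum_j K i j * cnt n.+1 j t w.
Proof.
move=> t0; apply: lerD; first by rewrite ler_wpM2l// stopped_time_le.
under [leRHS]eq_bigr do rewrite /cnt /jumps mulr_sumr.
rewrite exchange_big/= [leRHS]big_ord_recr/= -[leLHS]addr0; apply: lerD; last first.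
  by apply: sumr_ge0 => j _; rewrite mulr_ge0.
apply: ler_sum => k _; rewrite (bigD1 (Z k w))//= eqxx andbT -[leLHS]addr0; apply: lerD; last first.
  by apply: sumr_ge0 => j _; rewrite mulr_ge0.
have [ky|ky] := ltP (tau k w) +oo%E; last by rewrite mul0r mulr_ge0.
rewrite mul1r.
have kE : (fine (tau k w))%:E = tau k w by rewrite fineK// gt0_fin_numE ?ky// marked_gt0.
have [kt|tk] := leP (tau k w) t%:E; first by rewrite mulr1 Phile.
rewrite mulr0 Phile0// subr_le0 -lee_fin kE (le_trans _ (ltW tk))// lee_fin stopped_time_le//.
Qed.

Lemma compens_modulus n i w (e : R) : 0 < e -> exists2 h : R, 0 < h & forall s t,
  0 <= s -> s <= t -> t - s < h -> compens n i t w - compens n i s w <= e.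
Proof.
move=> e0.
(* One share of [e] for the baseline and one for each of the [n] jumps. *)
have e1 : 0 < e / (n.+1%:R) by rewrite divr_gt0.
have /choice[h hP] (j : 'I_d) : exists h : R, 0 < h /\
    forall x y, x <= y -> y - x <= h -> Phi i j y - Phi i j x <= e / n.+1%:R.
  by have [h h0 hP] := causal_prim_modulus phi_ge0 phi_meas phi_int i j e1; exists h.
pose m := mu i 0 + 1.
have m0 : 0 < m by rewrite ltr_wpDl.
pose H := Num.min (e / n.+1%:R / m) (\big[Num.min/ (e / n.+1%:R / m)]_j h j).
have H0 : 0 < H.
  rewrite lt_min divr_gt0//=.
  by elim/big_ind: _ => [|x y x0 y0|j _];
    [rewrite divr_gt0|rewrite lt_min x0|have [] := hP j].
have Hle j : H <= h j by rewrite ge_min bigmin_le ?orbT.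
have Hm : H <= e / n.+1%:R / m by rewrite ge_min lexx.
exists H => // s t s0 st tsH; have t0 := le_trans s0 st.
have s1 := stopped_time_nd n w s0 st; have s2 := stopped_time_lip n w s0 st.
set a := stopped_time tau n t w in s1 s2; set b := stopped_time tau n s w in s1 s2.
have abH : a - b <= H by exact: le_trans s2 (ltW tsH).
have -> : compens n i t w - compens n i s w = mu i 0 * (a - b) +
   \sum_(k < n) ((tau k w < +oo)%E)%:R * (Phi i (Z k w) (a - fine (tau k w)) - Phi i (Z k w) (b - fine (tau k w))).
  rewrite /compens -/a -/b opprD addrACA -sumrB mulrBr; congr (_ + _).
  by apply: eq_bigr => k _; rewrite mulrBr.
have -> : e = e / n.+1%:R + n%:R * (e / n.+1%:R).
  rewrite -[X in X + _]mul1r -mulrDl addrC natr1 mulrC divfK//.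
apply: lerD.
  apply: (@le_trans _ _ (m * (e / n.+1%:R / m))); last by rewrite mulrC divfK// gt_eqF.
  apply: ler_pM => //; rewrite ?subr_ge0 ?lerDl//.
  exact: le_trans abH Hm.
rewrite -[leRHS](_ : \sum_(k < n) e / n.+1%:R = _); last first.
  by rewrite sumr_const card_ord mulr_natl.
apply: ler_sum => k _.
have [_ hk] := hP (Z k w).
have h1 : Phi i (Z k w) (a - fine (tau k w)) - Phi i (Z k w) (b - fine (tau k w)) <= e / n.+1%:R.
  apply: hk; first by rewrite lerB.
  by rewrite opprB addrA subrK (le_trans abH).
by case: (_ < _)%E; rewrite ?mul1r// mul0r ltW.
Qed.

(** The intensity sees only jumps strictly before [u], hence the strict inequality; compared with a
    translated kernel, the integrand changes at one point only. *)
Lemma integral_causal_shift i j (x s : R) : 0 < x ->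
  (\int[leb]_(u in `[0%R, s]) (if (x < u)%R then cau i j (u - x) else 0)%:E = (Phi i j (s - x))%:E)%E.
Proof.
move=> x0; rewrite causal_prim_EFin// integral_mkcond.
pose g (v : R) : \bar R := (cau i j v * cut (s - x) v * (0 < v)%R%:R)%:E.
have mg : measurable_fun setT g.
  apply/measurable_EFinP; apply: measurable_funM; last first.
    have -> : (fun v : R => (0 < v)%R%:R) = \1_(`]0, +oo[%classic) :> (R -> R).
      by apply/funext => u; rewrite indicE mem_setE/= in_itv/= andbT.
    exact: measurable_indic.
  by apply: measurable_funM; [exact: measurable_causal|exact: measurable_cut].
have g0 v : (0 <= g v)%E by rewrite lee_fin !mulr_ge0 ?causal_ge0// ler0n.
transitivity (\int[leb]_u g (u + - x)%R)%E.
  apply: eq_integral => u _; rewrite /patch mem_setE/= in_itv/= /g /cut subr_gt0 lerD2r.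
  case: ifPn => [/andP[u0 us]|].
    by rewrite us mulr1; case: ltP => _; rewrite ?mulr1 ?mulr0.
  rewrite negb_and -!ltNge => /orP[u0|su]; last by rewrite [(u <= s)%R]leNgt su mulr0 mul0r.
  by rewrite [(x < u)%R]ltNge (ltW (lt_trans u0 x0)) mulr0.
rewrite ge0_integral_shift//.
have mP : measurable_fun setT (fun u => (cau i j u * cut (s - x) u)%:E).
  apply/measurable_EFinP.
  by apply: measurable_funM; [exact: measurable_causal|exact: measurable_cut].
apply: ae_eq_integral => //.
exists [set 0]; split => //; first exact: (lebesgue_measure_set1 0).
move=> v /= h; apply: contrapT => v0; apply: h => _; rewrite /g.
have [vp|vn|vE] := ltgtP v 0; last by rewrite vE in v0.
  by rewrite causal_neg// !mul0r.
by rewrite mulr1.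
Qed.

Lemma intensity_stopped n i u t w : 0 <= t -> 0 <= u <= stopped_time tau n t w ->
  intensity tau Z mu phi i u w = ((mu i 0)%:E + \sum_(k < n) (((tau k w < +oo)%E)%:R *
     (if fine (tau k w) < u then cau i (Z k w) (u - fine (tau k w)) else 0))%:E)%E.
Proof.
move=> t0 /andP[u0 us]; congr (_ + _)%E.
have ulate k : (n <= k)%N -> (tau k w < u%:E)%E = false.
  move=> nk; apply/negbTE; rewrite -leNgt (le_trans _ (tau_leq w nk))//.
  by rewrite (le_trans _ (stopped_time_tau n w t0))// lee_fin.
have H j : jump_integral tau Z j u (fun s => phi (u - s) i j) w =
   (\sum_(k < n) (if (tau k w < u%:E)%E && (Z k w == j) then (phi (u - fine (tau k w)) i j)%:E else 0))%E.
  rewrite /jump_integral (nneseries_split 0%N n); last first.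
    move=> k _; case: ifP => // /andP[ku _]; rewrite lee_fin phi_ge0// subr_ge0 -lee_fin.
    by rewrite fineK ?ltW// gt0_fin_numE ?marked_gt0// (lt_trans ku)// ltry.
  rewrite add0n eseries0 ?adde0 ?big_mkord//.
  by move=> k nk _; rewrite ulate.
under eq_bigr do rewrite H.
rewrite exchange_big/=; apply: eq_bigr => k _.
rewrite (bigD1 (Z k w))//= eqxx andbT big1 ?adde0; last first.
  by move=> j; rewrite eq_sym => /negbTE ->; rewrite andbF.
have [ky|ky] := ltP (tau k w) +oo%E; last first.
  by rewrite mul0r ltNge (le_trans _ ky)// leey.
have kE : (fine (tau k w))%:E = tau k w by rewrite fineK// gt0_fin_numE ?ky// marked_gt0.
rewrite mul1r -{1}kE lte_fin; case: ltP => // ku.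
by rewrite /causal subr_ge0 (ltW ku).
Qed.

Lemma compensE n i t w : 0 <= t ->
  (\int[leb]_(u in `[0%R, stopped_time tau n t w]) intensity tau Z mu phi i u w = (compens n i t w)%:E)%E.
Proof.
move=> t0; set s := stopped_time _ _ _ _.
have mc (k : 'I_n) : measurable_fun (`[0, s] : set R) (fun u => (((tau k w < +oo)%E)%:R *
     (if fine (tau k w) < u then cau i (Z k w) (u - fine (tau k w)) else 0))%:E).
  apply/measurable_EFinP; apply: measurable_funTS; apply: measurable_funM => //.
  have -> : (fun u : R => if fine (tau k w) < u then cau i (Z k w) (u - fine (tau k w)) else 0) =
     (fun u => \1_(`](fine (tau k w)), +oo[%classic) u * cau i (Z k w) (u - fine (tau k w))).
    apply/funext => u; rewrite indicE mem_setE/= in_itv/= andbT.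
    by case: ifP => _; rewrite ?mul1r ?mul0r.
  apply: measurable_funM; first exact: measurable_indic.
  by apply: (measurableT_comp (measurable_causal phi_meas i (Z k w))); exact: measurable_funB.
have c0 (k : 'I_n) u : (0 <= (((tau k w < +oo)%E)%:R *
     (if (fine (tau k w) < u)%R then cau i (Z k w) (u - fine (tau k w)) else 0)%R)%:E)%E.
  by rewrite lee_fin mulr_ge0//; case: ifP => // _; exact: causal_ge0.
transitivity (\int[leb]_(u in `[0%R, s]) ((mu i 0)%:E + \sum_(k < n) (((tau k w < +oo)%E)%:R *
     (if (fine (tau k w) < u)%R then cau i (Z k w) (u - fine (tau k w)) else 0)%R)%:E))%E.
  by apply: eq_integral => u; rewrite inE/= in_itv/= => us; exact: intensity_stopped t0 us.
rewrite ge0_integralD//; last 3 first.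
- by move=> u _; rewrite lee_fin.
- by move=> u _; apply: sume_ge0 => k _; exact: c0.
- by apply: emeasurable_sum => k; exact: mc.
rewrite integral_cst//= lebesgue_measure_itv/= lte_fin.
have s0 : 0 <= s by exact: stopped_time_ge0.
rewrite (_ : (if (0 < s)%R then _ else _) = s%:E)%E; last first.
  case: ltP => h; first by rewrite oppr0 adde0.
  by congr (_%:E); apply/le_anti; rewrite s0 h.
rewrite /compens EFinD EFinM; congr (_ + _)%E.
rewrite ge0_integral_sum//; rewrite -sumEFin; apply: eq_bigr => k _.
have [ky|ky] := ltP (tau k w) +oo%E; last first.
  by rewrite mul0r; apply: integral0_eq => u _; rewrite mul0r.
rewrite mul1r; under eq_integral do rewrite mul1r.
by rewrite integral_causal_shift// fine_gt0// marked_gt0.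
Qed.

Definition compens_mart n i t w : R := cnt n.+1 i t w - compens n i t w.

Lemma compens_martE n i t w : 0 <= t ->
  (jump_count tau Z i (stopped_time tau n t w) w -
    \int[leb]_(s in `[0%R, stopped_time tau n t w]) intensity tau Z mu phi i s w)%E =
  (compens_mart n i t w)%:E.
Proof. by move=> t0; rewrite compensE// jump_count_stopped. Qed.

Lemma compens_bound n t : 0 <= t -> exists2 C, 0 <= C & forall i s w, 0 <= s <= t ->
  compens n i s w <= C.
Proof.
move=> t0; exists (\sum_i (mu i 0 * t + \sum_j K i j * n.+1%:R)).
  apply: sumr_ge0 => i _; rewrite addr_ge0 ?mulr_ge0//.
  by apply: sumr_ge0 => j _; rewrite mulr_ge0.
move=> i s w /andP[s0 st]; rewrite (le_trans (compens_le n i w s0))//.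
rewrite [leRHS](bigD1 i)//= -[leLHS]addr0; apply: lerD; last first.
  apply: sumr_ge0 => j _; rewrite addr_ge0 ?mulr_ge0//.
  by apply: sumr_ge0 => k _; rewrite mulr_ge0.
apply: lerD; first by rewrite ler_wpM2l.
by apply: ler_sum => j _; rewrite ler_wpM2l// jumps_le.
Qed.

(** The primitive at [t - tau k] is the integral of the kernel over the [u] with [tau k <= t - u];
    summing over the jumps under the integral gives the counts. The extra jump of [cnt n.+1] adds
    nothing since [t < tau n]. *)
Lemma compens_conv n i t w : 0 <= t -> (t%:E < tau n w)%E ->
  ((compens n i t w)%:E = (mu i 0 * t)%:E +
    \sum_j \int[leb]_u (cau i j u * cnt n.+1 j (t - u) w)%:E)%E.
Proof.
move=> t0 tn; rewrite /compens stopped_time_late ?(ltW tn)// EFinD; congr (_ + _)%E.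
have mt (k : 'I_n.+1) j : measurable_fun setT (fun u : R => (cau i j u * ((tau k w <= (t - u)%:E)%E && (Z k w == j))%:R)%:E).
  apply/measurable_EFinP; apply: measurable_funM; first exact: measurable_causal.
  have [ky|ky] := ltP (tau k w) +oo%E; last first.
    rewrite (_ : (fun _ => _) = (fun=> 0))//; apply/funext => u.
    by rewrite leNgt (lt_le_trans (ltry _) ky).
  have kE : (fine (tau k w))%:E = tau k w by rewrite fineK// gt0_fin_numE ?ky// marked_gt0.
  rewrite (_ : (fun _ => _) = (fun u => cut (t - fine (tau k w)) u * (Z k w == j)%:R)).
    by apply: measurable_funM => //; exact: measurable_cut.
  by apply/funext => u; rewrite /cut -kE lee_fin lerBrDl -lerBrDr -natrM mulnb.
have H j : (\int[leb]_u (cau i j u * cnt n.+1 j (t - u) w)%:E =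
    \sum_(k < n.+1) \int[leb]_u (cau i j u * ((tau k w <= (t - u)%:E)%E && (Z k w == j))%:R)%:E)%E.
  under eq_integral do rewrite /cnt /jumps mulr_sumr -sumEFin.
  rewrite ge0_integral_sum//; first by move=> k; exact: mt.
  by move=> k u _; rewrite lee_fin mulr_ge0 ?causal_ge0// ler0n.
under [RHS]eq_bigr do rewrite H.
rewrite [RHS]exchange_big/= [RHS]big_ord_recr/= [X in (_ + X)%E]big1 ?adde0; last first.
  move=> j _; apply: integral0_eq => u _; have [u0|u0] := ltP u 0; first by rewrite causal_neg// mul0r.
  rewrite [(tau n w <= _)%E]leNgt (_ : (_ < tau n w)%E = true) ?mulr0//.
  by rewrite (le_lt_trans _ tn)// lee_fin gerBl.
rewrite -sumEFin; apply: eq_bigr => k _.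
rewrite (bigD1 (Z k w))//= big1 ?adde0; last first.
  move=> j /negbTE jk; apply: integral0_eq => u _.
  by rewrite eq_sym jk andbF mulr0.
have [ky|ky] := ltP (tau k w) +oo%E; last first.
  rewrite mul0r; apply/esym/integral0_eq => u _.
  by rewrite leNgt (lt_le_trans (ltry _) ky) mulr0.
have kE : (fine (tau k w))%:E = tau k w by rewrite fineK// gt0_fin_numE ?ky// marked_gt0.
rewrite mul1r causal_prim_EFin//; apply: eq_integral => u _.
by rewrite eqxx andbT /cut -kE lee_fin lerBrDl lerBrDr addrC.
Qed.

End Compensator.

(** The form in which moment bounds pass from the stopped processes to the limit: a uniform bound on
    the means also yields integrability. *)
Lemma Ex_fatou {R : realType} d (T : measurableType d) (P : probability T R)
    (X_ : nat -> T -> R) (X : T -> R) (C : R) :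
  measurable_fun [set: T] X -> (forall n w, 0 <= X_ n w) -> (forall w, 0 <= X w) ->
  {ae P, forall w, X_ n w @[n --> \oo] --> X w} ->
  (forall n, P.-integrable [set: T] (EFin \o X_ n)) ->
  (forall n, \int[P]_w X_ n w <= C) ->
  P.-integrable [set: T] (EFin \o X) /\ \int[P]_w X w <= C.
Proof.
move=> mX X_0 X0 cX iX_ XC.
have mX_ n : measurable_fun setT (EFin \o X_ n) by exact: measurable_int (iX_ n).
have H : (\int[P]_w (X w)%:E <= C%:E)%E.
  have -> : (\int[P]_w (X w)%:E = \int[P]_w limn_einf (fun n => (X_ n w)%:E))%E.
    apply: ae_eq_integral => //; first exact/measurable_EFinP.
      have -> : (fun w => limn_einf (fun n => (X_ n w)%:E)) =
          (fun w => - limn_esup (fun n => (- X_ n w)%:E))%E.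
        apply/funext => w; rewrite -limn_einfN; congr limn_einf.
        by apply/funext => n /=; rewrite opprK.
      apply: measurableT_comp => //; apply: measurable_fun_limn_esup => n.
      by apply/measurable_EFinP; apply: measurableT_comp => //; exact/measurable_EFinP.
    apply: filterS cX => w cw _; apply/esym.
    have cE : (X_ n w)%:E @[n --> \oo] --> (X w)%:E by apply: cvg_EFin => //; exact: nearW.
    by have [] := cvg_limn_einf_sup cE.
  apply: le_trans (fatou P measurableT mX_ _) _.
    by move=> n w _; rewrite lee_fin.
  rewrite limn_einf_lim; apply: lime_le; first exact: is_cvg_einfs.
  apply: nearW => n; apply: (@le_trans _ _ (\int[P]_w (X_ n w)%:E)%E).
    by apply: ereal_inf_lbound; exists n => /=.
  by rewrite -Ex_EFin// lee_fin.
have iX : P.-integrable [set: T] (EFin \o X).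
  apply/integrableP; split; first exact/measurable_EFinP.
  under eq_integral do rewrite gee0_abs ?lee_fin//.
  by rewrite (le_lt_trans H)// ltry.
by split => //; rewrite -lee_fin Ex_EFin.
Qed.

Lemma Rintegral_fun0 {R : realType} d (T : measurableType d) (m : {measure set T -> \bar R}) (f : T -> R) :
  (forall x, f x = 0) -> \int[m]_x f x = 0.
Proof. by move=> f0; rewrite /Rintegral integral0_eq// => x _; rewrite f0. Qed.

Section CausalIntegral.
Context {R : realType} {d : nat} (phi : R -> 'M[R]_d).
Local Notation leb := (@lebesgue_measure R).
Hypothesis phi_ge0 : forall (t : R) i j, 0 <= t -> 0 <= phi t i j.
Hypothesis phi_meas : forall i j, measurable_fun (`[0, +oo[ : set R) (fun t => phi t i j).
Hypothesis phi_int : forall i j,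
  (\int[lebesgue_measure]_(t in `[0%R, +oo[) (phi t i j)%:E < +oo)%E.
Local Notation cau := (causal phi).
Variables (i j : 'I_d) (f : R -> R) (t C : R).
Hypothesis mf : measurable_fun setT f.

Lemma causal_bounded_integrable : (forall s, s <= t -> `|f s| <= C) ->
  leb.-integrable setT (EFin \o (fun u => cau i j u * f (t - u))).
Proof.
move=> fC.
apply: (le_integrable measurableT _ _ (integrableZl measurableT C (causal_integrable phi_ge0 phi_meas phi_int i j))).
  apply/measurable_EFinP; apply: measurable_funM; first exact: measurable_causal.
  by apply: (measurableT_comp mf); exact: measurable_funB.
move=> u _ /=; rewrite lee_fin !normrM mulrC.
have [u0|u0] := leP 0 u; last by rewrite causal_neg// normr0 !mulr0.
by rewrite ler_wpM2r// (le_trans (fC _ _) (ler_norm _))// gerBl.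
Qed.

Lemma causal_Rintegral_le : leb.-integrable setT (EFin \o (fun u => cau i j u * f (t - u))) ->
  (forall s, s <= t -> f s <= C) -> \int[leb]_u (cau i j u * f (t - u)) <= kernel_mass phi i j * C.
Proof.
move=> fi fC; have ic := causal_integrable phi_ge0 phi_meas phi_int i j.
have <- : \int[leb]_u cau i j u = kernel_mass phi i j by rewrite /Rintegral causal_integral.
rewrite mulrC -(RintegralZl C measurableT ic).
apply: le_Rintegral => //; first exact: (integrableZl measurableT _ ic).
move=> u _; rewrite mulrC; have [u0|u0] := leP 0 u; last by rewrite causal_neg// !mulr0.
by rewrite ler_wpM2r ?causal_ge0// fC// gerBl.
Qed.

End CausalIntegral.

(** * Contraction of causal convolutions *)

Lemma Ex_le_ae {R : realType} d (T : measurableType d) (P : probability T R) (X Y : T -> R) :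
  P.-integrable [set: T] (EFin \o X) -> P.-integrable [set: T] (EFin \o Y) ->
  {ae P, forall w, X w <= Y w} -> \int[P]_w X w <= \int[P]_w Y w.
Proof.
move=> iX iY XY; rewrite -subr_ge0 -ExB//.
rewrite (@Ex_ae_eq _ _ _ _ _ (fun w => `|Y w - X w|)).
- exact: Ex_ge0.
- exact: integrable_mfun (integB iY iX).
- exact: integrable_mfun (integ_norm (integB iY iX)).
- by apply: filterS XY => w XYw; rewrite ger0_norm// subr_ge0.
Qed.

Section Convexity.
Context {R : realType}.

(** Convexity of the square with weights [1 - r] and [r]. Choosing [r] close enough to 1 leaves a
    contraction factor on [b] below 1, which the choice of equal weights would not. *)
Lemma sqrD_convex (r a b : R) : 0 < r < 1 -> (a + b) ^+ 2 <= a ^+ 2 / (1 - r) + b ^+ 2 / r.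
Proof.
move=> /andP[r0 r1]; have s0 : 0 < 1 - r by rewrite subr_gt0.
rewrite -subr_ge0 (_ : _ - _ = (r * a - (1 - r) * b) ^+ 2 / ((1 - r) * r)).
  by rewrite divr_ge0 ?sqr_ge0// mulr_ge0// ltW.
by field; rewrite !gt_eqF.
Qed.

Lemma pow4D_convex (r a b : R) : 0 < r < 1 -> (a + b) ^+ 4 <= a ^+ 4 / (1 - r) ^+ 3 + b ^+ 4 / r ^+ 3.
Proof.
move=> r01; have /andP[r0 r1] := r01; have s0 : 0 < 1 - r by rewrite subr_gt0.
have h := sqrD_convex a b r01.
rewrite -[4%N]/(2 * 2)%N !exprM; apply: (@le_trans _ _ ((a ^+ 2 / (1 - r) + b ^+ 2 / r) ^+ 2)).
  by rewrite ler_sqr ?nnegrE ?sqr_ge0// (le_trans _ h)// sqr_ge0.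
apply: le_trans (sqrD_convex _ _ r01) _.
by rewrite le_eqVlt; apply/orP; left; apply/eqP; field; rewrite !gt_eqF.
Qed.

Lemma sqr_sum_le (I : finType) (a : I -> R) : (\sum_i a i) ^+ 2 <= #|I|%:R * \sum_i a i ^+ 2.
Proof.
have -> : #|I|%:R * \sum_i a i ^+ 2 = \sum_i \sum_j (a i ^+ 2 + a j ^+ 2) / 2.
  under [RHS]eq_bigr => i _.
    rewrite -mulr_suml big_split/= sumr_const; over.
  rewrite -mulr_suml big_split/= sumr_const sumrMnl.
  by set x := \sum_i _; rewrite -[x *+ _]mulr_natl; field.
rewrite expr2 big_distrlr/=; apply: ler_sum => i _; apply: ler_sum => j _.
rewrite ler_pdivlMr// mulr_natr -subr_ge0 (_ : _ - _ = (a i - a j) ^+ 2) ?sqr_ge0//.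
by rewrite sqrrB; ring.
Qed.

Lemma pow4_sum_le (I : finType) (a : I -> R) :
  (\sum_i a i) ^+ 4 <= #|I|%:R ^+ 3 * \sum_i a i ^+ 4.
Proof.
have s1 := sqr_sum_le a; have s2 := sqr_sum_le (fun j => a j ^+ 2).
have E (x : R) : x ^+ 4 = (x ^+ 2) ^+ 2 by rewrite -exprM.
rewrite E; under [X in _ * X]eq_bigr do rewrite E.
apply: (@le_trans _ _ ((#|I|%:R * \sum_i a i ^+ 2) ^+ 2)).
  by rewrite ler_sqr ?nnegrE ?sqr_ge0// (le_trans _ s1)// sqr_ge0.
by rewrite exprMn -[3%N]/(2 + 1)%N exprD expr1 -mulrA ler_wpM2l ?sqr_ge0.
Qed.

Lemma pow4_ge0 (x : R) : 0 <= x ^+ 4.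
Proof. by rewrite -[4%N]/(2 * 2)%N exprM sqr_ge0. Qed.

End Convexity.

Section CausalCauchySchwarz.
Context {R : realType} {d : nat} (phi : R -> 'M[R]_d).
Local Notation leb := (@lebesgue_measure R).
Hypothesis phi_ge0 : forall (t : R) i j, 0 <= t -> 0 <= phi t i j.
Hypothesis phi_meas : forall i j, measurable_fun (`[0, +oo[ : set R) (fun t => phi t i j).
Hypothesis phi_int : forall i j,
  (\int[lebesgue_measure]_(t in `[0%R, +oo[) (phi t i j)%:E < +oo)%E.
Local Notation cau := (causal phi).
Local Notation K := (kernel_mass phi).
Variables (i : 'I_d) (v : 'I_d -> R) (k : R).
Hypotheses (v_gt0 : forall j, 0 < v j) (k_gt0 : 0 < k) (kP : \sum_j K i j * v j <= k).

(* Optimize in [l] the nonnegativity of [\sum_j \int cau (f j - l v j)^2 / v j]. *)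
Lemma causal_cauchy_schwarz (f : 'I_d -> R -> R) (t : R) :
  (forall j, measurable_fun setT (f j)) ->
  (forall j, exists C, forall s, s <= t -> `|f j s| <= C) ->
  (\sum_j \int[leb]_u (cau i j u * f j (t - u))) ^+ 2 <=
  k * \sum_j \int[leb]_u (cau i j u * (f j (t - u) ^+ 2 / v j)).
Proof.
move=> mf bf.
have i1 j : leb.-integrable setT (EFin \o (fun u => cau i j u * f j (t - u))).
  by have [C fC] := bf j; exact: (@causal_bounded_integrable R d phi phi_ge0 phi_meas phi_int i j (f j) t C).
have i2 j : leb.-integrable setT (EFin \o (fun u => cau i j u * (f j (t - u) ^+ 2 / v j))).
  have [C fC] := bf j; apply: (@causal_bounded_integrable R d phi phi_ge0 phi_meas phi_int i j
    (fun s => f j s ^+ 2 / v j) t (C ^+ 2 / v j)).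
    by apply: measurable_funM => //; exact: measurable_funX.
  move=> s st; rewrite normrM normrX (gtr0_norm (x := (v j)^-1)) ?invr_gt0//.
  have C0 : 0 <= C := le_trans (normr_ge0 _) (fC s st).
  by rewrite ler_wpM2r ?invr_ge0 ?(ltW (v_gt0 j))// lerXn2r ?nnegrE// fC.
have i3 j := causal_integrable phi_ge0 phi_meas phi_int i j.
set I1 := \sum_j \int[leb]_u (cau i j u * f j (t - u)).
set I2 := \sum_j \int[leb]_u (cau i j u * (f j (t - u) ^+ 2 / v j)).
have H l : 0 <= I2 - 2 * l * I1 + l ^+ 2 * \sum_j K i j * v j.
  rewrite /I1 /I2 !mulr_sumr -sumrB -big_split/=; apply: sumr_ge0 => j _.
  have <- : \int[leb]_u cau i j u = K i j by rewrite /Rintegral causal_integral.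
  rewrite [l ^+ 2 * (_ * _)]mulrA [l ^+ 2 * _ * _]mulrAC.
  rewrite -(RintegralZl (2 * l) measurableT (i1 j)) -(RintegralZl (l ^+ 2 * v j) measurableT (i3 j)).
  have i4 := integrableZl measurableT (2 * l) (i1 j).
  have i5 := integrableZl measurableT (l ^+ 2 * v j) (i3 j).
  rewrite -(RintegralB measurableT (i2 j) i4) -(RintegralD measurableT (integrableB measurableT (i2 j) i4) i5).
  apply: Rintegral_ge0 => u _.
  rewrite (_ : _ + _ = cau i j u * ((f j (t - u) - l * v j) ^+ 2 / v j)).
    by rewrite mulr_ge0 ?causal_ge0// divr_ge0 ?sqr_ge0// ltW.
  by field; rewrite gt_eqF.
(* The minimizer in [l] once the row sum is replaced by its bound [k]. *)
have := H (I1 / k).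
have h2 : (I1 / k) ^+ 2 * \sum_j K i j * v j <= (I1 / k) ^+ 2 * k by rewrite ler_wpM2l ?sqr_ge0.
have -> : I2 - 2 * (I1 / k) * I1 + (I1 / k) ^+ 2 * \sum_j K i j * v j =
  I2 - 2 * (I1 ^+ 2 / k) + (I1 / k) ^+ 2 * \sum_j K i j * v j.
  by rewrite expr2; ring.
have e : (I1 / k) ^+ 2 * k = I1 ^+ 2 / k by field; rewrite gt_eqF.
rewrite e in h2; move=> h1; rewrite mulrC -ler_pdivrMr//.
move: h1 h2; set a := _ ^+ 2 * _; set b := I1 ^+ 2 / k; lra.
Qed.

End CausalCauchySchwarz.

Section CausalContraction.
Context {R : realType} {d : nat} (phi : R -> 'M[R]_d).
Context (dO : measure_display) (Om : measurableType dO) (P : probability Om R).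
Local Notation leb := (@lebesgue_measure R).
Local Notation "'Ex' X" := (Rintegral P [set: Om] X) (at level 10).
Hypothesis phi_ge0 : forall (t : R) i j, 0 <= t -> 0 <= phi t i j.
Hypothesis phi_meas : forall i j, measurable_fun (`[0, +oo[ : set R) (fun t => phi t i j).
Hypothesis phi_int : forall i j,
  (\int[lebesgue_measure]_(t in `[0%R, +oo[) (phi t i j)%:E < +oo)%E.
Local Notation cau := (causal phi).
Local Notation K := (kernel_mass phi).
Let K0 := @kernel_mass_ge0 R d phi phi_ge0 phi_int.

Section Fubini.
Variables (i j : 'I_d) (W : R -> Om -> R) (t B : R).
Hypotheses (W_ge0 : forall s w, 0 <= W s w)
  (W_meas : measurable_fun setT (fun z : R * Om => W (t - z.1) z.2))
  (W_int : forall s, s <= t -> P.-integrable setT (EFin \o W s))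
  (W_le : forall s, s <= t -> Ex (W s) <= B)
  (W_path : forall w, exists C, forall s, s <= t -> W s w <= C).

Let mW (w : Om) : measurable_fun setT (fun u : R => W (t - u) w).
Proof. exact: measurableT_comp W_meas (pair2_measurable w). Qed.

Let mJ : measurable_fun setT (fun z : R * Om => (cau i j z.1 * W (t - z.1) z.2)%:E).
Proof.
apply/measurable_EFinP; apply: measurable_funM; last exact: W_meas.
by apply: (measurableT_comp (measurable_causal phi_meas i j)); exact: measurable_fst.
Qed.

Let J0 (z : R * Om) : (0 <= (cau i j z.1 * W (t - z.1) z.2)%:E)%E.
Proof. by rewrite lee_fin mulr_ge0 ?causal_ge0. Qed.

Lemma causal_path_integrable w : leb.-integrable setT (EFin \o (fun u => cau i j u * W (t - u) w)).
Proof.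
have [C WC] := W_path w.
apply: (le_integrable measurableT _ _ (integrableZl measurableT C (causal_integrable phi_ge0 phi_meas phi_int i j))).
  by apply/measurable_EFinP; apply: measurable_funM; [exact: measurable_causal|exact: mW].
move=> u _ /=; rewrite lee_fin !normrM mulrC.
have [u0|u0] := leP 0 u; last by rewrite causal_neg// normr0 !mulr0.
by rewrite ler_wpM2r// ger0_norm// (le_trans (WC _ _) (ler_norm _))// gerBl.
Qed.

Lemma causal_Ex_fubini : (\int[P]_w (\int[leb]_u (cau i j u * W (t - u) w))%:E =
  \int[leb]_u (cau i j u * Ex (W (t - u)))%:E)%E.
Proof.
transitivity (\int[P]_w \int[leb]_u (cau i j u * W (t - u) w)%:E)%E.
  apply: eq_integral => w _; rewrite /Rintegral fineK//.
  exact: integrable_fin_num (causal_path_integrable w).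
rewrite -(fubini_tonelli (m1 := leb) (m2 := P) _ mJ J0).
apply: eq_integral => u _; have [u0|u0] := leP 0 u; last first.
  by under eq_integral do rewrite causal_neg// mul0r; rewrite integral0 causal_neg// mul0r.
have iW : P.-integrable setT (EFin \o W (t - u)) by apply: W_int; rewrite gerBl.
rewrite EFinM Ex_EFin// -ge0_integralZl//.
- exact: measurable_int iW.
- by move=> w _; rewrite lee_fin.
- by rewrite lee_fin causal_ge0.
Qed.

Lemma measurable_causal_path : measurable_fun setT (fun w => \int[leb]_u (cau i j u * W (t - u) w)).
Proof.
apply: (measurableT_comp (f := fine)) => //.
exact: (measurable_fun_fubini_tonelli_G (m1 := leb) _ mJ J0).
Qed.

Let fub_le : (\int[leb]_u (cau i j u * Ex (W (t - u)))%:E <= (K i j * B)%:E)%E.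
Proof.
have ic := causal_integrable phi_ge0 phi_meas phi_int i j.
have KE : (K i j * B)%:E = (\int[leb]_u (cau i j u * B)%:E)%E.
  under eq_integral do rewrite mulrC EFinM.
  have := @integralZl _ _ _ leb setT measurableT _ ic B.
  by rewrite causal_integral// -EFinM mulrC => <-.
rewrite KE; apply: ge0_le_integral => //.
- by move=> u _; rewrite lee_fin mulr_ge0 ?causal_ge0// Ex_ge0.
- rewrite (_ : (fun u => _) = (fun u => \int[P]_w (cau i j u * W (t - u) w)%:E)%E).
    exact: (measurable_fun_fubini_tonelli_F (m2 := P) _ mJ J0).
  apply/funext => u; have [u0|u0] := leP 0 u; last first.
    by under eq_integral do rewrite causal_neg// mul0r; rewrite integral0 causal_neg// mul0r.
  have iW : P.-integrable setT (EFin \o W (t - u)) by apply: W_int; rewrite gerBl.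
  rewrite EFinM Ex_EFin// -ge0_integralZl//.
  + exact: measurable_int iW.
  + by move=> w _; rewrite lee_fin.
  + by rewrite lee_fin causal_ge0.
- by apply/measurable_EFinP; apply: measurable_funM => //; exact: measurable_causal.
- move=> u _; rewrite lee_fin; have [u0|u0] := leP 0 u; last by rewrite causal_neg// !mul0r.
  by rewrite ler_wpM2l ?causal_ge0// W_le// gerBl.
Qed.

Lemma integ_causal_path :
  P.-integrable setT (EFin \o (fun w => \int[leb]_u (cau i j u * W (t - u) w))).
Proof.
apply/integrableP; split; first by apply/measurable_EFinP; exact: measurable_causal_path.
under eq_integral => w _.
  rewrite gee0_abs; last first.
    by rewrite lee_fin Rintegral_ge0// => u _; rewrite mulr_ge0 ?causal_ge0.
  over.
by rewrite causal_Ex_fubini (le_lt_trans fub_le)// ltry.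
Qed.

Lemma Ex_causal_path_le : Ex (fun w => \int[leb]_u (cau i j u * W (t - u) w)) <= K i j * B.
Proof. by rewrite -lee_fin (Ex_EFin integ_causal_path) causal_Ex_fubini. Qed.

End Fubini.

Variables (v : 'I_d -> R) (q b : R).
Hypotheses (v_ge1 : forall i, 1 <= v i) (q_ge0 : 0 <= q) (b_ge0 : 0 <= b) (bq_lt1 : b * q < 1)
  (vP : forall i, \sum_j K i j * v j <= q * v i).

(** Let B be the supremum of the means over all components and all times up to [T], finite thanks to
    [B0]. Taking means in the inequality, with the weights [v], gives [B <= c + b q B]. *)
Lemma causal_contraction (W : 'I_d -> R -> Om -> R) (a : 'I_d -> R -> Om -> R) (T c B0 : R) :
  (forall j s w, 0 <= W j s w) ->
  (forall j t, measurable_fun setT (fun z : R * Om => W j (t - z.1) z.2)) ->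
  (forall j s, s <= T -> P.-integrable setT (EFin \o W j s)) ->
  (forall j s, s <= T -> Ex (W j s) <= B0) ->
  (forall j w, exists C, forall s, s <= T -> W j s w <= C) ->
  (forall j s, s <= T -> P.-integrable setT (EFin \o a j s)) ->
  (forall j s, s <= T -> Ex (a j s) <= c) ->
  (forall i s w, s <= T ->
    W i s w <= a i s w + b / v i * \sum_j \int[leb]_u (cau i j u * (v j * W j (s - u) w))) ->
  forall i, Ex (W i T) <= c / (1 - b * q).
Proof.
move=> W0 mW iW WB pW ia ac WE i.
have v0 j : 0 < v j := lt_le_trans ltr01 (v_ge1 j).
pose E := [set x | exists j s, s <= T /\ x = Ex (W j s)].
have supE : has_sup E.
  split; first by exists (Ex (W i T)), i, T.
  by exists B0 => _ [j [s [sT ->]]]; exact: WB.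
have le_sup j s : s <= T -> Ex (W j s) <= sup E.
  by move=> sT; apply: sup_upper_bound => //; exists j, s.
have B0' : 0 <= sup E by apply: le_trans (le_sup i T (lexx T)); exact: Ex_ge0.
have key : sup E <= c + b * q * sup E.
  apply: ge_sup; first exact: supE.1.
  move=> _ [j [s [sT ->]]].
  have path k w : exists C, forall s', s' <= s -> v k * W k s' w <= C.
    have [C hC] := pW k w; exists (v k * C) => s' ss'.
    by rewrite ler_wpM2l ?(ltW (v0 k))// hC// (le_trans ss').
  have W0' k s' w : 0 <= v k * W k s' w by rewrite mulr_ge0// ltW.
  have mW' k : measurable_fun setT (fun z : R * Om => v k * W k (s - z.1) z.2).
    by apply: measurable_funM => //; exact: mW.
  have iW' k s' : s' <= s -> P.-integrable setT (EFin \o (fun w => v k * W k s' w)).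
    by move=> ss'; apply: integZ; apply: iW; exact: le_trans sT.
  have leW' k s' : s' <= s -> Ex (fun w => v k * W k s' w) <= v k * sup E.
    move=> ss'; have s'T := le_trans ss' sT; rewrite ExZ; last exact: iW.
    by rewrite ler_wpM2l ?(ltW (v0 k))// le_sup.
  have i1 k := integ_causal_path j k (W0' k) (mW' k) (iW' k) (leW' k) (path k).
  have l1 k := Ex_causal_path_le j k (W0' k) (mW' k) (iW' k) (leW' k) (path k).
  apply: (@le_trans _ _ (Ex (fun w => a j s w + b / v j *
      \sum_k \int[leb]_u (cau j k u * (v k * W k (s - u) w))))).
    apply: Ex_le; first exact: iW.
      by apply: integD; [exact: ia|apply: integZ; exact: integ_sum].
    by move=> w; exact: WE.
  rewrite ExD; [|exact: ia|by apply: integZ; exact: integ_sum].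
  rewrite ExZ; last exact: integ_sum.
  rewrite Ex_sum//; apply: lerD; first exact: ac.
  have bv : 0 <= b / v j by rewrite divr_ge0// ltW.
  apply: (@le_trans _ _ (b / v j * (q * v j * sup E))); last first.
    by rewrite le_eqVlt; apply/orP; left; apply/eqP; field; rewrite gt_eqF.
  rewrite ler_wpM2l// (le_trans (ler_sum _ (fun k _ => l1 k)))//.
  by under eq_bigr do rewrite mulrA; rewrite -mulr_suml ler_wpM2r.
apply: (le_trans (le_sup i T (lexx T))).
rewrite ler_pdivlMr ?subr_gt0// mulrBr mulr1; move: key; rewrite (mulrC (b * q)).
set x := sup E; set y := x * _; lra.
Qed.

End CausalContraction.

Lemma norm_incr_le {R : realType} (a b c x y z : R) : 0 <= b -> b <= a -> a <= c ->
  0 <= y -> y <= x -> x <= z -> `|a - b - (x - y)| <= c + z.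
Proof. by move=> *; rewrite ler_norml; apply/andP; split; lra. Qed.

(** * Tails of the kernel *)

Lemma EFin_Rintegral_int {R : realType} d (T : measurableType d) (m : {measure set T -> \bar R}) (f : T -> R) :
  m.-integrable setT (EFin \o f) -> (\int[m]_x f x)%:E = (\int[m]_x (f x)%:E)%E.
Proof. by move=> fi; rewrite /Rintegral fineK//; exact: integrable_fin_num fi. Qed.

Section CausalTail.
Context {R : realType} {d : nat} (phi : R -> 'M[R]_d).
Local Notation leb := (@lebesgue_measure R).
Hypothesis phi_ge0 : forall (t : R) i j, 0 <= t -> 0 <= phi t i j.
Hypothesis phi_meas : forall i j, measurable_fun (`[0, +oo[ : set R) (fun t => phi t i j).
Hypothesis phi_int : forall i j,
  (\int[lebesgue_measure]_(t in `[0%R, +oo[) (phi t i j)%:E < +oo)%E.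
Local Notation cau := (causal phi).

Lemma causal_mul_integrable i j (f : R -> R) C : measurable_fun setT f -> (forall u, 0 <= u -> `|f u| <= C) ->
  leb.-integrable setT (EFin \o (fun u => cau i j u * f u)).
Proof.
move=> mf fC.
apply: (le_integrable measurableT _ _ (integrableZl measurableT C (causal_integrable phi_ge0 phi_meas phi_int i j))).
  by apply/measurable_EFinP; apply: measurable_funM => //; exact: measurable_causal.
move=> u _ /=; rewrite lee_fin !normrM mulrC.
have [u0|u0] := leP 0 u; last by rewrite causal_neg// normr0 !mulr0.
by rewrite ler_wpM2r// (le_trans (fC _ _) (ler_norm _)).
Qed.

(** The centred process vanishes at negative times, so its increment from [t - u] to [t] has L^1
    norm of order the square root of [Num.min u t]; divided by the square root of [t], this is the
    weight. *)
Definition tail_weight (t u : R) : R := Num.sqrt (Num.min u t / t).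

Lemma measurable_tail_weight t : measurable_fun setT (tail_weight t).
Proof.
apply: (measurableT_comp (f := @Num.sqrt R)); last first.
  by apply: measurable_funM => //; apply: measurable_minr.
by apply: continuous_measurable_fun; exact: sqrt_continuous.
Qed.

Lemma tail_weight_le1 t u : 0 < t -> tail_weight t u <= 1.
Proof.
by move=> t0; rewrite -sqrtr1 ler_wsqrtr// ler_pdivrMr// mul1r ge_min lexx orbT.
Qed.

Lemma tail_weight_ge0 t u : 0 <= tail_weight t u. Proof. exact: sqrtr_ge0. Qed.

Definition causal_tail i j t : R := \int[leb]_u (cau i j u * tail_weight t u).

Lemma causal_tail_ge0 i j t : 0 <= causal_tail i j t.
Proof. by apply: Rintegral_ge0 => u _; rewrite mulr_ge0 ?causal_ge0// tail_weight_ge0. Qed.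

Lemma causal_tail_integrable i j t : 0 < t ->
  leb.-integrable setT (EFin \o (fun u => cau i j u * tail_weight t u)).
Proof.
move=> t0; apply: (@causal_mul_integrable _ _ _ 1); first exact: measurable_tail_weight.
by move=> u _; rewrite ger0_norm ?tail_weight_ge0// tail_weight_le1.
Qed.

Lemma causal_tail_cvg0 i j : causal_tail i j t @[t --> +oo] --> 0.
Proof.
apply/cvg_pinftyP => t t_y.
have t_gt0 : \forall n \near \oo, 0 < t n by move/cvgryPgt : t_y; apply.
have t_ge A : \forall n \near \oo, A <= t n by move/cvgryPge : t_y; apply.
(* The first terms of the sequence [t] may fail to be positive; the maximum with 1 secures
   domination by the kernel for every n and changes nothing for large n. *)
pose f n u := cau i j u * tail_weight (Num.max 1 (t n)) u.
have f_le n u : `|f n u| <= cau i j u.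
  rewrite ger0_norm; first by rewrite ler_piMr ?causal_ge0// tail_weight_le1// lt_max ltr01.
  by rewrite mulr_ge0 ?causal_ge0// tail_weight_ge0.
have mf n : measurable_fun setT (f n).
  by apply: measurable_funM; [exact: measurable_causal|exact: measurable_tail_weight].
have fc : (\int[leb]_u (f n u)%:E)%E @[n --> \oo] --> (\int[leb]_(u in setT) (0%:E : \bar R))%E.
  have := @dominated_convergence _ _ R leb setT measurableT (fun n u => (f n u)%:E)
    (fun=> 0%:E) (EFin \o cau i j).
  case => //.
  - by move=> n; apply/measurable_EFinP; exact: mf.
  - apply: aeW => u _; apply: cvg_EFin; first exact: nearW.
    apply: cvgr_distP => e e0.
    have [u0|u0] := leP 0 u; last first.
      by apply: nearW => n; rewrite /f causal_neg// mul0r subrr normr0 ltW.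
    have c0 := causal_ge0 phi_ge0 i j u; set c := cau i j u in c0 *.
    have c1 : 0 < c + 1 by rewrite ltr_wpDl.
    pose k := e / (c + 1); have k0 : 0 < k by rewrite divr_gt0.
    apply: filterS (t_ge (u / k ^+ 2)) => n tn.
    have t1 : 0 < Num.max 1 (t n) by rewrite lt_max ltr01.
    have wk : tail_weight (Num.max 1 (t n)) u <= k.
      rewrite [leRHS](_ : k = Num.sqrt (k ^+ 2)); last by rewrite sqrtr_sqr gtr0_norm.
      rewrite ler_wsqrtr//.
      rewrite ler_pdivrMr//; apply: (@le_trans _ _ u); first by rewrite ge_min lexx.
      by rewrite mulrC -ler_pdivrMr ?exprn_gt0// le_max tn orbT.
    rewrite sub0r normrN ger0_norm; last by rewrite mulr_ge0 ?tail_weight_ge0.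
    apply: (@le_trans _ _ (c * k)); first by rewrite ler_wpM2l.
    by rewrite /k mulrA ler_pdivrMr// mulrC ler_wpM2l ?(ltW e0)// lerDl.
  - exact: causal_integrable.
  - by apply: aeW => u n _ /=; rewrite lee_fin f_le.
have fcR : \int[leb]_u f n u @[n --> \oo] --> 0.
  apply: (@fine_cvg _ _ _ _ (fun n => \int[leb]_u (f n u)%:E)%E).
  by rewrite -[X in _ --> X](@integral0 _ _ R leb setT).
apply: cvg_trans fcR; apply: near_eq_cvg.
by apply: filterS (t_ge 1) => n tn; rewrite /causal_tail /f max_r.
Qed.

End CausalTail.

(** * Square integrable variables *)

Section SquareIntegrable.
Context {R : realType} d (T : measurableType d) (P : probability T R).
Local Notation integ X := (P.-integrable [set: T] (EFin \o X)).

Definition square_integrable (X : T -> R) := measurable_fun setT X /\ integ (fun w => X w ^+ 2).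

Lemma square_integrable_bounded X : bounded_mfun X -> square_integrable X.
Proof. by move=> bX; split; [exact: bX.1|apply: bounded_integrable; exact: bounded_mfunX]. Qed.

Lemma square_integrableM X Y : square_integrable X -> square_integrable Y -> integ (fun w => X w * Y w).
Proof.
move=> [mX iX] [mY iY]; apply: (integ_le (Y := fun w => X w ^+ 2 + Y w ^+ 2)).
- exact: measurable_funM.
- move=> w; rewrite normrM -[X w ^+ 2]real_normK ?num_real// -[Y w ^+ 2]real_normK ?num_real//.
  by move: (`|X w|) (`|Y w|) => x y; have := sqr_ge0 (x - y); have := sqr_ge0 (x + y); nra.
- exact: integD.
Qed.

Lemma square_integrableD X Y : square_integrable X -> square_integrable Y ->
  square_integrable (fun w => X w + Y w).
Proof.
move=> sX sY; split; first exact: measurable_funD sX.1 sY.1.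
have -> : (fun w => (X w + Y w) ^+ 2) = (fun w => X w ^+ 2 + 2 * (X w * Y w) + Y w ^+ 2).
  by apply/funext => w; rewrite sqrrD; ring.
apply: integD; last exact: sY.2.
by apply: integD; [exact: sX.2|apply: integZ; exact: square_integrableM].
Qed.

Lemma square_integrableZ c X : square_integrable X -> square_integrable (fun w => c * X w).
Proof.
move=> [mX iX]; split; first exact: measurable_funM.
by under eq_fun do rewrite exprMn; exact: integZ.
Qed.

Lemma square_integrable_sum (I : Type) (r : seq I) (F : I -> T -> R) :
  (forall i, square_integrable (F i)) -> square_integrable (fun w => \sum_(i <- r) F i w).
Proof.
move=> bF; elim: r => [|i s ih].
  by under eq_fun do rewrite big_nil; exact/square_integrable_bounded/bounded_mfun_cst.
by under eq_fun do rewrite big_cons; exact: square_integrableD.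
Qed.

Lemma square_integrable_integ X : square_integrable X -> integ X.
Proof.
move=> sX; have := square_integrableM sX (square_integrable_bounded (bounded_mfun_cst _ 1)).
by under eq_fun do rewrite mulr1.
Qed.

End SquareIntegrable.

(** Compares the factor [1 - c] produced by one step of the martingale with the Gaussian factor. *)
Lemma expR_quadratic {R : realType} (c : R) : 0 <= c -> `|1 - c - expR (- c)| <= c ^+ 2.
Proof.
move=> c0; have h1 := expR_ge1Dx (- c); have h2 := expR_ge1Dx c.
have c1 : 0 < 1 + c by rewrite ltr_pwDl.
have h3 : expR (- c) <= 1 - c + c ^+ 2.
  rewrite expRN; apply: (@le_trans _ _ (1 + c)^-1).
    by rewrite lef_pV2 ?posrE ?expR_gt0.
  rewrite -div1r ler_pdivrMr//.
  have : 0 <= c ^+ 3 by rewrite exprn_ge0.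
  have -> : (1 - c + c ^+ 2) * (1 + c) = 1 + c ^+ 3 by ring.
  by move=> ?; rewrite lerDl.
by rewrite ler_norml; apply/andP; split; move: h1 h3 (sqr_ge0 c); lra.
Qed.

Lemma sum_blocks {R : nmodType} (n L : nat) (F : nat -> R) :
  \sum_(k < n * L) F k = \sum_(k < n) \sum_(l < L) F (k * L + l)%N.
Proof.
elim: n => [|n ih]; first by rewrite mul0n !big_ord0.
rewrite [RHS]big_ord_recr/= -ih -!(big_mkord xpredT F) mulSnr.
rewrite (big_cat_nat _ (n := n * L)) ?leq_addr//=; congr (_ + _).
rewrite -{1}[(n * L)%N]add0n big_addn addKn big_mkord.
by apply: eq_bigr => l _; rewrite addnC.
Qed.

Lemma sum_increments {V : zmodType} (f : nat -> V) L : \sum_(l < L) (f l.+1 - f l) = f L - f 0%N.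
Proof. by rewrite -(big_mkord xpredT (fun l => f l.+1 - f l)) telescope_sumr. Qed.

(** * Brownian motion *)

Section AbelSummation.
Context {R : realType} {d n : nat}.
Variables (xi : 'I_n.+1 * 'I_d -> R) (A : 'M[R]_d).

Definition abel_weight (l : nat) (j : 'I_d) : R :=
  \sum_(k < n.+1 | (l < k)%N) \sum_i xi (k, i) * A i j.

(** Finite dimensional laws involve values on a grid, whereas martingales and Brownian motion are
    handled through increments; [abel_weight l j] is the coefficient received by the increment from
    [l] to [l.+1]. *)
Lemma abel_summation (f : nat -> 'I_d -> R) : (forall j, f 0%N j = 0) ->
  \sum_p xi p * \sum_j A p.2 j * f p.1 j =
  \sum_(l < n) \sum_j abel_weight l j * (f l.+1 j - f l j).
Proof.
move=> f0.
transitivity (\sum_(k < n.+1) \sum_j (\sum_i xi (k, i) * A i j) * f k j).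
  transitivity (\sum_(k < n.+1) \sum_i xi (k, i) * \sum_j A i j * f k j).
    by rewrite pair_bigA; apply: eq_bigr => -[k i] _.
  apply: eq_bigr => k _; under eq_bigr do rewrite mulr_sumr.
  rewrite exchange_big/=; apply: eq_bigr => j _; rewrite mulr_suml.
  by apply: eq_bigr => i _; rewrite mulrA.
transitivity (\sum_(k < n.+1) \sum_j \sum_(l < n | (l < k)%N) (\sum_i xi (k, i) * A i j) * (f l.+1 j - f l j)).
  apply: eq_bigr => k _; apply: eq_bigr => j _; rewrite -mulr_sumr; congr (_ * _).
  have kn : (k <= n)%N by rewrite -ltnS.
  rewrite (big_ord_narrow kn) (eq_bigr (fun l : 'I_k => f l.+1 j - f l j))//.
  by rewrite (sum_increments (fun l => f l j)) f0 subr0.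
transitivity (\sum_(k < n.+1) \sum_(l < n | (l < k)%N) \sum_j (\sum_i xi (k, i) * A i j) * (f l.+1 j - f l j)).
  by apply: eq_bigr => k _; rewrite exchange_big.
rewrite (exchange_big_dep xpredT)//=; apply: eq_bigr => l _.
rewrite exchange_big/=; apply: eq_bigr => j _; by rewrite /abel_weight mulr_suml.
Qed.

End AbelSummation.

Section NormalSecondMoment.
Context {R : realType} d (T : measurableType d) (P : probability T R).
Variables (G : T -> R) (s : R).
Hypotheses (mG : measurable_fun setT G)
  (G_cos : forall a b, \int[P]_w cos (a * G w + b) = expR (- (a * s) ^+ 2 / 2) * cos b).

(* [G ^ 2] is the limit of [2 n^2 (1 - cos (G / n))]. *)
Lemma gaussian_second_moment : P.-integrable setT (EFin \o (fun w => G w ^+ 2)) /\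
  \int[P]_w (G w ^+ 2) <= s ^+ 2.
Proof.
pose X (n : nat) w := 2 * n.+1%:R ^+ 2 * (1 - cos (n.+1%:R^-1 * G w + 0)).
have n0 n : 0 < n.+1%:R :> R by rewrite ltr0n.
have bc n : bounded_mfun (fun w => cos (n.+1%:R^-1 * G w + 0)).
  by apply: bounded_mfun_cos; apply: measurable_funD => //; exact: measurable_funM.
have bX n : bounded_mfun (X n).
  by apply: bounded_mfunZ; apply: bounded_mfunB => //; exact: bounded_mfun_cst.
apply: (@Ex_fatou _ _ _ P X).
- exact: measurable_funX.
- move=> n w; have h : cos (n.+1%:R^-1 * G w + 0) <= 1 by apply: le_trans (ler_norm _) _; exact: cos_max.
  by rewrite /X mulr_ge0 ?mulr_ge0 ?sqr_ge0 ?subr_ge0.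
- by move=> w; rewrite sqr_ge0.
- apply: aeW => w; apply: cvgr_distP => e e0.
  pose A := 4 * `|G w| ^+ 3 / e.
  exists (Num.truncn A) => // n /= hn.
  have hA : A <= n.+1%:R.
    by rewrite (le_trans (ltW (truncnS_gt _)))// ler_nat ltnS.
  have := cosD_taylor 0 (n.+1%:R^-1 * G w).
  rewrite add0r cos0 sin0 mulr0 addr0 mulr1 => h.
  have -> : G w ^+ 2 - X n w = 2 * n.+1%:R ^+ 2 * (cos (n.+1%:R^-1 * G w) - 1 + (n.+1%:R^-1 * G w) ^+ 2 / 2).
    by rewrite /X addr0; field; rewrite gt_eqF.
  rewrite normrM ger0_norm ?mulr_ge0 ?sqr_ge0//.
  apply: (@le_trans _ _ (2 * n.+1%:R ^+ 2 * (2 * `|n.+1%:R^-1 * G w| ^+ 3))).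
    by rewrite ler_wpM2l// mulr_ge0 ?sqr_ge0.
  rewrite normrM (gtr0_norm (x := n.+1%:R^-1)) ?invr_gt0//.
  have -> : 2 * n.+1%:R ^+ 2 * (2 * (n.+1%:R^-1 * `|G w|) ^+ 3) = 4 * `|G w| ^+ 3 / n.+1%:R.
    by move: (`|G w|) => g; field; rewrite gt_eqF.
  by move: hA; rewrite /A !ler_pdivrMr// [e * _]mulrC.
- by move=> n; exact: bounded_integrable.
- move=> n; rewrite ExZ; last by apply/bounded_integrable/bounded_mfunB => //; exact: bounded_mfun_cst.
  rewrite ExB ?Ex_cst ?G_cos ?cos0 ?mulr1; [|exact/bounded_integrable/bounded_mfun_cst|exact: bounded_integrable].
  set c := (n.+1%:R^-1 * s) ^+ 2.
  have h := expR_ge1Dx (- c / 2).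
  apply: (@le_trans _ _ (2 * n.+1%:R ^+ 2 * (c / 2))).
    by rewrite ler_wpM2l ?mulr_ge0 ?sqr_ge0//; move: h; set x := expR _; lra.
  by rewrite le_eqVlt /c; apply/orP; left; apply/eqP; field; rewrite gt_eqF.
Qed.

End NormalSecondMoment.

Section Brownian.
Context {R : realType} {d : nat} d' (T : measurableType d') (Q : probability T R).
Variable W : R -> T -> 'cV[R]_d.
Hypothesis W_bm : standard_brownian_motion Q W.

Lemma measurable_increment s t i : 0 <= s <= 1 -> 0 <= t <= 1 ->
  measurable_fun setT (increment W s t i).
Proof. by move=> s01 t01; case: W_bm => mW _ _ _ _; apply: measurable_funB; exact: mW. Qed.

Lemma brownian_cos s t i a b : 0 <= s -> s < t -> t <= 1 ->
  \int[Q]_w cos (a * increment W s t i w + b) = expR (- (a * Num.sqrt (t - s)) ^+ 2 / 2) * cos b.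
Proof.
move=> s0 st t1; case: W_bm => _ _ _ normalW _.
apply: normal_law_cos.
- by rewrite sqrtr_gt0 subr_gt0.
- by apply: measurable_increment; rewrite ?s0 ?t1 ?(le_trans s0 (ltW st)) ?(le_trans (ltW st) t1).
- by move=> B mB; exact: normalW.
Qed.

Lemma brownian_charfun n (th : nat -> 'I_d -> R) a : (0 < n)%N ->
  \int[Q]_w cos (\sum_(k < n) \sum_i th k i * increment W (k%:R / n%:R) (k.+1%:R / n%:R) i w + a) =
  expR (- ((\sum_(k < n) \sum_i th k i ^+ 2) / n%:R / 2)) * cos a.
Proof.
case: n => // n _; set N : R := n.+1%:R.
have N0 : 0 < N by rewrite ltr0n.
have k01 k : (k <= n.+1)%N -> 0 <= k%:R / N <= 1.
  by move=> kn; rewrite divr_ge0//= ler_pdivrMr// mul1r ler_nat.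
have kS (k : nat) : k.+1%:R / N - k%:R / N = N^-1 by rewrite -mulrBl -natr1 addrC addKr mul1r.
pose G (p : 'I_n.+1 * 'I_d) := increment W (p.1%:R / N) (p.1.+1%:R / N) p.2.
have mG p : measurable_fun setT (G p).
  by apply: measurable_increment; apply: k01; [exact: ltnW|].
have indepG (B : 'I_n.+1 * 'I_d -> set R) : (forall p, measurable (B p)) ->
    Q [set w | forall p, B p (G p w)] = (\prod_p Q (G p @^-1` B p))%E.
  move=> mB; case: W_bm => _ _ _ _ indepW.
  (* The independence clause asks for an infinite sequence of times in [0, 1], so the grid is held
     at 1 after its end. *)
  pose t k : R := Num.min (k%:R / N) 1.
  have tE k : (k <= n.+1)%N -> t k = k%:R / N by move=> kn; rewrite /t min_l//; case/andP: (k01 _ kn).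
  have t01 k : 0 <= t k <= 1 by rewrite /t le_min divr_ge0 ?ler01 ?(ltW N0)//= ge_min lexx orbT.
  have tS k : t k <= t k.+1.
    rewrite /t le_min !ge_min lexx !orbT andbT; apply/orP; left.
    by rewrite ler_pM2r ?invr_gt0// ler_nat.
  have := indepW n.+1 t (fun k i => B (inord k, i)) t01 tS (fun k i => mB _).
  have -> : (\prod_p Q (G p @^-1` B p) = \prod_(k < n.+1) \prod_(i < d) Q (G (k, i) @^-1` B (k, i)))%E.
    by rewrite pair_bigA; apply: eq_bigr => -[k i] _.
  have GE (k : 'I_n.+1) : increment W (t k) (t k.+1) = fun i => G (k, i).
    by rewrite /G/= !tE//; exact: ltnW.
  rewrite (_ : [set w | forall (k : 'I_n.+1) i, B (inord k, i) (increment W (t k) (t k.+1) i w)] =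
     [set w | forall p, B p (G p w)]).
    move=> ->; apply: eq_bigr => k _; apply: eq_bigr => i _.
    by rewrite inord_val GE.
  apply/seteqP; split=> w /= h.
    by move=> [k i]; have := h k i; rewrite inord_val GE.
  by move=> k i; rewrite inord_val GE.
have cosG p a' b : \int[Q]_w cos (a' * G p w + b) = expR (- a' ^+ 2 * N^-1 / 2) * cos b.
  rewrite brownian_cos ?kS; [|by case/andP: (k01 _ (ltnW (ltn_ord p.1)))|
    by rewrite ltr_pM2r ?invr_gt0// ltr_nat|by case/andP: (k01 _ (ltn_ord p.1))].
  by rewrite exprMn sqr_sqrtr ?invr_ge0 ?(ltW N0)// !mulNr.
have := @indep_cos _ _ _ Q _ G mG indepG (fun=> N^-1) cosG (fun p => th p.1 p.2) a.
rewrite -mulr_suml -(pair_bigA _ (fun (k : 'I_n.+1) i => th k i ^+ 2))/= mulNr => <-.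
congr Rintegral; apply/funext => w; congr (cos (_ + _)).
by rewrite (pair_bigA _ (fun (k : 'I_n.+1) i => th k i * increment W (k%:R / N) (k.+1%:R / N) i w)).
Qed.

Lemma brownian_second_moment t i : 0 <= t <= 1 ->
  Q.-integrable setT (EFin \o (fun w => W t w i 0 ^+ 2)).
Proof.
case: (W_bm) => mW W0 _ _ _ /andP[t0 t1].
have [->|tn0] := eqVneq t 0.
  apply/bounded_integrable; split; first by apply: measurable_funX; apply: mW; rewrite lexx ler01.
  by exists 0 => w; rewrite W0 mxE expr0n normr0.
have tp : 0 < t by rewrite lt_neqAle eq_sym tn0.
have -> : (fun w => W t w i 0 ^+ 2) = (fun w => increment W 0 t i w ^+ 2).
  by apply/funext => w; rewrite /increment W0 mxE subr0.
apply: (proj1 (@gaussian_second_moment _ _ _ Q (increment W 0 t i) (Num.sqrt (t - 0)) _ _)).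
  by apply: measurable_increment; rewrite ?lexx ?ler01 ?t0 ?t1.
by move=> a b; exact: brownian_cos.
Qed.

End Brownian.

(** * Convergence in law for the Skorokhod topology *)

Section LowerEnvelope.
Context {R : realType} {d : nat}.
Local Notation D := (skorokhod_space R d).
Variables (f : D -> R) (B : R).
Hypothesis fB : forall x, 0 <= f x <= B.

Definition sup_close (x y : R -> 'cV[R]_d) (e : R) :=
  forall t, 0 <= t <= 1 -> `|x t - y t| <= e.

(* The greatest k-Lipschitz minorant of f for the uniform distance on [0, 1]. The
   value B makes the set nonempty for every x. *)
Definition lower_envelope (k : R) (x : R -> 'cV[R]_d) : R :=
  inf [set a | a = B \/ exists (y : D) (e : R), [/\ 0 <= e, sup_close x y e & a = f y + k * e]].

Variables (k : R) (x : R -> 'cV[R]_d).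
Hypothesis k0 : 0 <= k.

Let B0 : 0 <= B.
Proof. by have /andP[] := fB (SkorokhodSpace (@cadlag0 R d)); exact: le_trans. Qed.

Let lb0 z : lbound [set a | a = B \/ exists (y : D) (e : R),
  [/\ 0 <= e, sup_close z y e & a = f y + k * e]] 0.
Proof.
move=> a /= [->//|[y [e [e0 _ ->]]]].
by rewrite addr_ge0 ?mulr_ge0//; case/andP: (fB y).
Qed.

Lemma lower_envelope_ge0 : 0 <= lower_envelope k x.
Proof. by apply: lb_le_inf; [exists B; left|exact: lb0]. Qed.

Lemma lower_envelope_leB : lower_envelope k x <= B.
Proof. by apply: ge_inf; [exists 0; exact: lb0|left]. Qed.

Lemma lower_envelope_le (y : D) e : 0 <= e -> sup_close x y e ->
  lower_envelope k x <= f y + k * e.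
Proof.
by move=> e0 xy; apply: ge_inf; [exists 0; exact: lb0|right; exists y, e].
Qed.

Lemma lower_envelope_lip z e : 0 <= e -> sup_close x z e ->
  lower_envelope k x <= lower_envelope k z + k * e.
Proof.
move=> e0 xz; rewrite -lerBlDr; apply: lb_le_inf; first by exists B; left.
move=> a /= [->|[y [e' [e'0 zy ->]]]].
  by rewrite lerBlDr (le_trans lower_envelope_leB)// lerDl mulr_ge0.
rewrite lerBlDr -addrA -mulrDr; apply: lower_envelope_le; first exact: addr_ge0.
by move=> t t01; rewrite (le_trans (ler_distD (z t) _ _))// addrC lerD ?xz ?zy.
Qed.

End LowerEnvelope.

(** A competitor uniformly close to [x] is close in D, by the identity time change, so [f] has
    nearly the value [f x] there; a competitor farther than [r / 2] pays at least [n r / 2 >= B]. *)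
Lemma lower_envelope_cvg {R : realType} {d : nat} (f : skorokhod_space R d -> R) (B : R) :
  (forall x, 0 <= f x <= B) -> continuous f -> forall x : skorokhod_space R d,
  lower_envelope f B n%:R x @[n --> \oo] --> f x.
Proof.
move=> fB cf x; apply: cvgr_distP => e e0.
have : nbhs x [set y | `|f x - f y| <= e] by apply: (cvgr_dist (cf x) e0); exact: nbhs_filter.
move=> /nbhs_ballP[r /= r0 hr].
exists (Num.truncn (B / (r / 2))).+1 => // n /= hn.
have nB : B <= n%:R * (r / 2).
  by rewrite -ler_pdivrMr ?divr_gt0// (le_trans (ltW (truncnS_gt _)))// ler_nat.
have le1 : lower_envelope f B n%:R x <= f x.
  have := @lower_envelope_le R d f B fB n%:R x (ler0n _ _) x 0 (lexx 0).
  by rewrite mulr0 addr0; apply => t _; rewrite subrr normr0.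
rewrite ger0_norm ?subr_ge0// lerBlDr -lerBlDl.
apply: lb_le_inf; first by exists B; left.
move=> a /= [->|[y [e' [e'0 xy ->]]]].
  by rewrite lerBlDr (le_trans (proj2 (andP (fB x))))// lerDl ltW.
have [re'|e'r] := leP (r / 2) e'.
  rewrite lerBlDr (le_trans (proj2 (andP (fB x))))// (le_trans nB)//.
  rewrite -addrA addrCA (le_trans (ler_wpM2l (ler0n _ n) re'))// lerDl.
  by rewrite addr_ge0 ?(ltW e0)//; case/andP: (fB y).
have : ball x r y.
  exists id, e'; first by rewrite (lt_trans e'r)// ltr_pdivrMr// ltr_pMr// ltr1n.
  split; first by split => //; rewrite image_id.
  by move=> t t01; rewrite subrr normr0; split => //; exact: xy.
move=> /hr /= h; rewrite lerBlDr -addrA; apply: (@le_trans _ _ (f y + e)).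
  by move: h; rewrite ler_distl => /andP[_]; lra.
by rewrite lerD2l lerDr mulr_ge0.
Qed.

Section StepPaths.
Context {R : realType} {d : nat}.

Lemma truncn_itv01 (n : nat) (t : R) : (0 < n)%N -> 0 <= t <= 1 ->
  [/\ (Num.truncn (t * n%:R) < n.+1)%N, (Num.truncn (t * n%:R))%:R / n%:R <= t &
   t < (Num.truncn (t * n%:R))%:R / n%:R + n%:R^-1].
Proof.
move=> n0 /andP[t0 t1]; have nR : 0 < n%:R :> R by rewrite ltr0n.
have tn0 : 0 <= t * n%:R by rewrite mulr_ge0.
have /andP[h1 h2] := truncn_itv tn0; split.
- rewrite ltnS -(ler_nat R); apply: le_trans h1 _; by rewrite ler_piMl.
- by rewrite ler_pdivrMr.
- by rewrite -[X in _ < _ + X]mul1r -mulrDl natr1 ltr_pdivlMr.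
Qed.

(** Uniform continuity through compactness: near each point, one radius serves for all large [n]. *)
Lemma uniform_step_cvg (V : normedModType R) (y : R -> V) : {within `[0, 1], continuous y} ->
  forall e : R, 0 < e -> \forall n \near \oo, forall t, 0 <= t <= 1 ->
  `|y t - y ((Num.truncn (t * n%:R))%:R / n%:R)| <= e.
Proof.
move=> cy e e0; have e2 : 0 < e / 2 by rewrite divr_gt0.
pose Q n (t : R) := 0 <= t <= 1 -> `|y t - y ((Num.truncn (t * n%:R))%:R / n%:R)| <= e.
have /compact_near_coveringP cov := @segment_compact R 0 1.
suff : \forall n \near \oo, `[0, 1]%classic `<=` Q n.
  by apply: filterS => n h t t01; apply: h => //; rewrite /= in_itv.
apply: (cov nat \oo Q _) => x /= x01.
have /subspace_continuousP/(_ x x01)/cvgr_dist_le/(_ _ e2) := cy.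
move=> /nbhs_ballP[r /= r0 hr].
have r2 : 0 < r / 2 by rewrite divr_gt0.
exists (ball x (r / 2), [set n | (Num.truncn (2 / r) < n)%N]) => /=.
  split; first exact: nbhsx_ballx.
  by exists (Num.truncn (2 / r)).+1.
move=> [t n] /= [xt hn] t01.
have n0 : (0 < n)%N by apply: leq_ltn_trans hn.
have nr : n%:R^-1 < r / 2.
  rewrite invf_plt ?posrE ?ltr0n// invf_div.
  by rewrite (lt_le_trans (truncnS_gt _))// ler_nat.
have [k1 k2 k3] := truncn_itv01 n0 t01.
set s := _%:R / n%:R in k2 k3 *.
have s01 : 0 <= s <= 1.
  by rewrite divr_ge0//=; apply: le_trans k2 _; case/andP: t01.
have h1 : `|y x - y t| <= e / 2.
  apply: hr; last by rewrite /= in_itv.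
  by apply: le_ball xt; rewrite ler_pdivrMr// ler_pMr// ler1n.
have h2 : `|y x - y s| <= e / 2.
  apply: hr; last by rewrite /= in_itv.
  rewrite /ball /= in xt *; apply: le_lt_trans (ler_distD t _ _) _.
  rewrite [ltRHS]splitr ltrD// ger0_norm ?subr_ge0//.
  by apply: lt_trans nr; rewrite ltrBlDr addrC.
rewrite [leRHS]splitr; apply: le_trans (ler_distD (y x) _ _) _; apply: lerD => //.
by rewrite distrC.
Qed.

(** The index [n] is reached only at [t = 1], which explains the [n.+1] grid values. *)
Definition step_path n (g : 'I_n.+1 * 'I_d -> R) (t : R) : 'cV[R]_d :=
  \col_i g (inord (Num.truncn (t * n%:R)), i).

Lemma col_norm_le (x : 'cV[R]_d) (e : R) : 0 <= e -> (forall i, `|x i 0| <= e) -> `|x| <= e.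
Proof.
move=> e0 h; rewrite /Num.norm/= mx_normrE; apply: bigmax_le => // -[i j] _ /=.
by rewrite (ord1 j).
Qed.

Lemma col_norm_ge (x : 'cV[R]_d) i : `|x i 0| <= `|x|.
Proof.
rewrite [leRHS]/Num.norm/= mx_normrE.
by apply: (@le_bigmax _ _ _ 0 (fun p : 'I_d * 'I_1 => `|x p.1 p.2|) (i, 0)).
Qed.

Lemma step_path_close n (g h : 'I_n.+1 * 'I_d -> R) :
  sup_close (step_path g) (step_path h) (\sum_p `|g p - h p|).
Proof.
move=> t _; apply: col_norm_le => [|i]; first exact: sumr_ge0.
by rewrite !mxE (bigD1 (inord (Num.truncn (t * n%:R)), i))//= lerDl sumr_ge0.
Qed.

Lemma step_path_grid n (x : R -> 'cV[R]_d) t : (0 < n)%N -> 0 <= t <= 1 ->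
  step_path (fun p : 'I_n.+1 * 'I_d => x (p.1%:R / n%:R) p.2 0) t =
  x ((Num.truncn (t * n%:R))%:R / n%:R).
Proof.
move=> n0 t01; apply/colP => i; rewrite !mxE/= inordK//.
by have [] := truncn_itv01 n0 t01.
Qed.

End StepPaths.

Section NonmeasurableIntegral.
Context {R : realType} d (T : measurableType d) (P : probability T R).

(** The integral of a nonnegative function is a supremum over simple functions below it, hence
    monotone without any measurability; this is what allows functions of whole paths. *)
Lemma le_integral_ge0 (f g : T -> R) : (forall w, 0 <= f w <= g w) ->
  (\int[P]_w (f w)%:E <= \int[P]_w (g w)%:E)%E.
Proof.
move=> fg; rewrite !ge0_integralTE => [|w|w]; rewrite ?lee_fin; last 2 first.
- by have /andP[h1 h2] := fg w; exact: le_trans h1 h2.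
- by case/andP: (fg w).
apply: ge_ereal_sup => _ /= [h hf <-]; apply: ereal_sup_ubound; exists h => // w /=.
by apply: le_trans (hf w) _; rewrite lee_fin; case/andP: (fg w).
Qed.

End NonmeasurableIntegral.

Lemma chained_dist {R : realFieldType} (a b c x e : R) :
  `|a - b| <= e / 3 -> `|b - c| <= e / 3 -> `|c - x| <= e / 3 -> a - e <= x.
Proof. by rewrite !ler_distl => /andP[_ h1] /andP[_ h2] /andP[_ h3]; lra. Qed.

Lemma continuous_nonexpansive {R : realType} {T : topologicalType} (h : R -> R) (f : T -> R) :
  (forall a b, `|h a - h b| <= `|a - b|) -> continuous f -> continuous (h \o f).
Proof.
move=> hh cf x; apply: cvgr_distP => e e0.
have : nbhs x [set y | `|f x - f y| <= e] by apply: (cvgr_dist (cf x) e0); exact: nbhs_filter.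
by apply: filterS => y /= h1; apply: le_trans h1; exact: hh.
Qed.

(** * From grid laws and uniform closeness to convergence in D *)

Section SkorokhodConvergence.
Context {R : realType} {d : nat}.
Local Notation D := (skorokhod_space R d).
Context d1 d2 (Om : measurableType d1) (Om' : measurableType d2).
Context (P : probability Om R) (Q : probability Om' R).
Variables (X X' : R -> R -> Om -> 'cV[R]_d) (Y : R -> Om' -> 'cV[R]_d) (G : set Om).
Local Notation "'Ex' X" := (Rintegral P [set: Om] X) (at level 10).
Local Notation "'Eq' X" := (Rintegral Q [set: Om'] X) (at level 10).

Hypothesis X_meas : forall T v i, measurable_fun [set: Om] (fun w => X T v w i 0).
Hypothesis Y_meas : forall v i, 0 <= v <= 1 -> measurable_fun [set: Om'] (fun w => Y v w i 0).
Hypothesis Y_cont : forall w, {within `[0, 1], continuous (fun v => Y v w)}.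
Hypothesis G_meas : measurable G.
Hypothesis G_ae : {ae P, forall w, G w}.
Hypothesis X_cadlag : \forall T \near +oo, forall w, G w -> cadlag (fun v => X' T v w).
Hypothesis X_eq : \forall T \near +oo, forall w, G w -> forall v, 0 <= v <= 1 -> X' T v w = X T v w.
Hypothesis X_grid : forall n (g : ('I_n.+1 * 'I_d -> R) -> R) (L B : R), (0 < n)%N -> 0 <= L ->
  (forall x x', `|g x - g x'| <= L * \sum_p `|x p - x' p|) -> (forall x, `|g x| <= B) ->
  Ex (fun w => g (fun p => X T (p.1%:R / n%:R) w p.2 0)) @[T --> +oo] -->
  Eq (fun w => g (fun p => Y (p.1%:R / n%:R) w p.2 0)).
Hypothesis X_tight : forall e : R, 0 < e -> \forall n \near \oo, \forall T \near +oo,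
  exists M : Om -> R, [/\ P.-integrable [set: Om] (EFin \o M), forall w, 0 <= M w, Ex M <= e &
    forall w t i, G w -> 0 <= t <= 1 ->
      `|X T t w i 0 - X T ((Num.truncn (t * n%:R))%:R / n%:R) w i 0| <= M w].

Let Y_cadlag w : cadlag (fun v => Y v w).
Proof.
have /subspace_continuousP cY := @Y_cont w; split=> t /andP[t0 t1].
- have t01 : `[0, 1]%classic t by rewrite /= in_itv/= t0 ltW.
  apply: cvg_trans (cY t t01); apply: cvg_app => A hA.
  have hA' : nbhs t^'+ (fun s => `[0, 1]%classic s -> A s) by apply: cvg_within; exact: hA.
  apply: filterS3 hA' (nbhs_right_gt t) (nbhs_right_lt t1) => s sA ts s1.
  by apply: sA; rewrite /= in_itv/= (le_trans t0) ltW.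
- have t01 : `[0, 1]%classic t by rewrite /= in_itv/= t1 ltW.
  apply/cvg_ex; exists (Y t w).
  apply: cvg_trans (cY t t01); apply: cvg_app => A hA.
  have hA' : nbhs t^'- (fun s => `[0, 1]%classic s -> A s) by apply: cvg_within; exact: hA.
  apply: filterS3 hA' (nbhs_left_gt t0) (nbhs_left_lt t) => s sA s0 st.
  by apply: sA; rewrite /= in_itv/= (ltW s0) (le_trans (ltW st)).
Qed.

Section Envelope.
Variables (f : D -> R) (B : R).
Hypothesis fB : forall x, 0 <= f x <= B.
Hypothesis f_cont : continuous f.

Let B0 : 0 <= B.
Proof. by have /andP[] := fB (SkorokhodSpace (@cadlag0 R d)); exact: le_trans. Qed.

Let env (k : nat) := lower_envelope f B k%:R.
Let grid_env n k (g : 'I_n.+1 * 'I_d -> R) := env k (step_path g).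

Let env_lip k x y e : 0 <= e -> sup_close x y e -> `|env k x - env k y| <= k%:R * e.
Proof.
move=> e0 xy; have yx : sup_close y x e by move=> t t01; rewrite distrC; exact: xy.
have h1 := lower_envelope_lip fB (ler0n _ k) e0 xy.
have h2 := lower_envelope_lip fB (ler0n _ k) e0 yx.
by rewrite ler_norml lerBlDr [k%:R * e + _]addrC h1 andbT lerBrDr addrC lerBlDr.
Qed.

Let env_bound k x : `|env k x| <= B.
Proof. by rewrite ger0_norm ?lower_envelope_ge0 ?lower_envelope_leB. Qed.

Let grid_env_lip n k (g h : 'I_n.+1 * 'I_d -> R) :
  `|grid_env k g - grid_env k h| <= k%:R * \sum_p `|g p - h p|.
Proof. by apply: env_lip; [exact: sumr_ge0|exact: step_path_close]. Qed.

Let gridY n (w : Om') (p : 'I_n.+1 * 'I_d) := Y (p.1%:R / n%:R) w p.2 0.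
Let gridX n T (w : Om) (p : 'I_n.+1 * 'I_d) := X T (p.1%:R / n%:R) w p.2 0.

Let grid01 n (p : 'I_n.+1 * 'I_d) : (0 < n)%N -> 0 <= (p.1%:R / n%:R : R) <= 1.
Proof.
by move=> n0; rewrite divr_ge0//= ler_pdivrMr ?ltr0n// mul1r ler_nat -ltnS.
Qed.

Let measurable_gridY n k : (0 < n)%N -> measurable_fun setT (fun w => grid_env k (@gridY n w)).
Proof.
move=> n0; apply: (measurable_lipschitz (L := k%:R) (F := fun p w => @gridY n w p)) => // p.
by apply: Y_meas; exact: grid01.
Qed.

Let measurable_gridX n k T : measurable_fun setT (fun w => grid_env k (@gridX n T w)).
Proof.
apply: (measurable_lipschitz (L := k%:R) (F := fun p w => @gridX n T w p)) => // p.
exact: X_meas.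
Qed.

Let gridY_cvg k w : grid_env k (@gridY n w) @[n --> \oo] --> env k (fun v => Y v w).
Proof.
apply: cvgr_distP => e e0; have r0 : 0 < e / k.+1%:R by rewrite divr_gt0.
have := uniform_step_cvg (@Y_cont w) r0; apply: filterS2 (nbhs_infty_gt 0%N) => n n0 h.
apply: (@le_trans _ _ (k%:R * (e / k.+1%:R))).
  apply: env_lip; first exact: ltW.
  by move=> t t01; rewrite (step_path_grid (fun v => Y v w))//; exact: h.
by rewrite mulrCA ler_piMr ?(ltW e0)// ler_pdivrMr// mul1r ler_nat.
Qed.

Let measurable_env k : measurable_fun setT (fun w => env k (fun v => Y v w)).
Proof.
apply: (@measurable_fun_cvg _ _ _ _ (fun n w => grid_env k (@gridY n.+1 w))).
  by move=> n; exact: measurable_gridY.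
move=> w _; have := gridY_cvg (k := k) (w := w); rewrite -cvg_shiftS; exact.
Qed.

Let Ex_gridY_cvg k : Eq (fun w => grid_env k (@gridY n w)) @[n --> \oo] -->
  Eq (fun w => env k (fun v => Y v w)).
Proof.
rewrite -cvg_shiftS.
apply: (@Ex_bounded_cvg _ _ _ Q (fun n w => grid_env k (@gridY n.+1 w)) _ B) => //.
- by move=> n; exact: measurable_gridY.
- by apply: aeW => w; have := gridY_cvg (k := k) (w := w); rewrite -cvg_shiftS; exact.
- by move=> n w; exact: env_bound.
Qed.

Let fY w := f (to_skorokhod (fun v => Y v w)).

Let to_skorokhodE (x : R -> 'cV[R]_d) : cadlag x -> to_skorokhod x = x :> (R -> 'cV[R]_d).
Proof. by move=> cx; rewrite /to_skorokhod; case: pselect. Qed.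

Let envY_cvg w : env k (fun v => Y v w) @[k --> \oo] --> fY w.
Proof.
have := @lower_envelope_cvg R d f B fB f_cont (to_skorokhod (fun v => Y v w)).
rewrite (to_skorokhodE (Y_cadlag w)); exact.
Qed.

Lemma measurable_limit : measurable_fun setT fY.
Proof.
by apply: (@measurable_fun_cvg _ _ _ _ (fun k w => env k (fun v => Y v w))).
Qed.

Lemma bounded_limit : bounded_mfun fY.
Proof.
split; first exact: measurable_limit.
by exists B => w; rewrite ger0_norm; case/andP: (fB (to_skorokhod (fun v => Y v w))).
Qed.

Let Ex_envY_cvg : Eq (fun w => env k (fun v => Y v w)) @[k --> \oo] --> Eq fY.
Proof.
apply: (@Ex_bounded_cvg _ _ _ Q _ _ B) => //; first exact: measurable_limit.
by apply: aeW => w; exact: envY_cvg.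
Qed.

(** The order of choices is the envelope parameter [k], then the grid [n], with tightness error at
    most [e / k], then [T]. Here [h] is the envelope at the step path, and passing from the step
    path to the path costs [k] times their distance. *)
Lemma skorokhod_lower_bound (e : R) : 0 < e -> \forall T \near +oo,
  exists h M : Om -> R, [/\ bounded_mfun h, P.-integrable [set: Om] (EFin \o M),
    Ex M <= e, Eq fY - e <= Ex h &
    forall w, G w -> h w <= f (to_skorokhod (fun v => X' T v w)) + M w].
Proof.
move=> e0; have e3 : 0 < e / 3 by rewrite divr_gt0.
near \oo => k.
have hk : `|Eq fY - Eq (fun w => env k (fun v => Y v w))| <= e / 3.
  by near: k; exact: (cvgr_dist Ex_envY_cvg e3).
have k0 : (0 < k)%N by near: k; exact: nbhs_infty_gt.
have ek : 0 < e / k%:R by rewrite divr_gt0// ltr0n.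
near \oo => n.
have n0 : (0 < n)%N by near: n; exact: nbhs_infty_gt.
have hn : `|Eq (fun w => env k (fun v => Y v w)) - Eq (fun w => grid_env k (@gridY n w))| <= e / 3.
  by near: n; exact: (cvgr_dist (Ex_gridY_cvg (k := k)) e3).
have tn : \forall T \near +oo, exists M : Om -> R,
   [/\ P.-integrable [set: Om] (EFin \o M), forall w, 0 <= M w, Ex M <= e / k%:R &
    forall w t i, G w -> 0 <= t <= 1 ->
      `|X T t w i 0 - X T ((Num.truncn (t * n%:R))%:R / n%:R) w i 0| <= M w].
  by near: n; exact: X_tight.
have gc := X_grid n0 (ler0n _ k) (@grid_env_lip n k) (fun g => env_bound k (step_path g)).
apply: filterS3 (filterI tn X_cadlag) X_eq (cvgr_dist gc e3) => T [[M [iM M0 EM hM]] cX] eX hT.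
exists (fun w => grid_env k (@gridX n T w)), (fun w => k%:R * M w); split.
- by split; [exact: measurable_gridX|exists B => w; exact: env_bound].
- exact: integZ.
- by rewrite ExZ// mulrC -ler_pdivlMr// ltr0n.
- exact: (chained_dist hk hn hT).
- move=> w Gw; have h := @lower_envelope_le R d f B fB k%:R (step_path (@gridX n T w)) (ler0n _ k)
    (to_skorokhod (fun v => X' T v w)) (M w) (M0 w).
  apply: h => t t01; rewrite to_skorokhodE ?eX//; last exact: cX.
  rewrite (step_path_grid (fun v => X T v w))// distrC.
  by apply: col_norm_le => // i; rewrite !mxE; exact: hM.
Unshelve. all: by end_near. Qed.
End Envelope.

(** The upper bound is the lower bound for [B - f]. Off [G] the minorant is set to 0 and the
    majorant to [B], which keeps them measurable and valid everywhere. *)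
Lemma skorokhod_nonneg_cvg (f : D -> R) (B : R) : (forall x, 0 <= f x <= B) -> continuous f ->
  (\int[P]_w (f (to_skorokhod (fun v => X' T v w)))%:E)%E @[T --> +oo] -->
  (\int[Q]_w (f (to_skorokhod (fun v => Y v w)))%:E)%E.
Proof.
move=> fB f_cont; pose f' x := B - f x.
have f'B x : 0 <= f' x <= B.
  by have /andP[h1 h2] := fB x; rewrite subr_ge0 h2/= lerBlDr lerDl.
have f'_cont : continuous f'.
  apply: (continuous_nonexpansive (h := fun a => B - a)) f_cont => u v.
  by rewrite opprB addrC subrKA distrC.
have bY := bounded_limit fB f_cont.
rewrite -Ex_EFin; last exact: bounded_integrable.
set a := Eq _.
have EB : Eq (fun w => f' (to_skorokhod (fun v => Y v w))) = B - a.
  by rewrite /f' ExB ?Ex_cst//; [exact/bounded_integrable/bounded_mfun_cst|exact: bounded_integrable].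
have B0 : 0 <= B by have /andP[] := fB (SkorokhodSpace (@cadlag0 R d)); exact: le_trans.
pose I T := (\int[P]_w (f (to_skorokhod (fun v => X' T v w)))%:E)%E.
have key e : 0 < e -> \forall T \near +oo, ((a - e)%:E <= I T <= (a + e)%:E)%E.
  move=> e0; have e2 : 0 < e / 2 by rewrite divr_gt0.
  apply: filterS2 (skorokhod_lower_bound fB f_cont e2) (skorokhod_lower_bound f'B f'_cont e2) => T.
  move=> [h [M [bh iM EM Eh hM]]] [h' [M' [bh' iM' EM' Eh' hM']]].
  apply/andP; split.
  - have il : P.-integrable [set: Om] (EFin \o (fun w => h w - M w)).
      by apply: integB => //; exact: bounded_integrable.
    have ml := integrable_mfun il.
    pose l w := \1_G w * Num.max (h w - M w) 0.
    apply: (@le_trans _ _ (\int[P]_w (l w)%:E)%E); last first.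
      apply: le_integral_ge0 => w; rewrite /l indicE; have /andP[f0 _] := fB (to_skorokhod (fun v => X' T v w)).
      case: (boolP (w \in G)) => [/set_mem Gw|_]; rewrite ?mul0r ?lexx//.
      by rewrite mul1r le_max lexx orbT/= ge_max f0 andbT lerBlDr hM.
    have -> : (\int[P]_w (l w)%:E = \int[P]_w (Num.max (h w - M w) 0)%:E)%E.
      apply: ae_eq_integral => //.
      - apply/measurable_EFinP/measurable_funM; first exact: measurable_indic.
        exact: measurable_maxr.
      - by apply/measurable_EFinP; exact: measurable_maxr.
      - by apply: filterS G_ae => w Gw _; rewrite /l indicE mem_set// mul1r.
    have im : P.-integrable [set: Om] (EFin \o (fun w => Num.max (h w - M w) 0)).
      apply: integ_le (integ_norm il); first exact: measurable_maxr.
      by move=> w; rewrite ger0_norm ?le_max ?lexx ?orbT// ge_max ler_norm normr_ge0.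
    rewrite -Ex_EFin// lee_fin.
    apply: (@le_trans _ _ (Ex (fun w => h w - M w))); last first.
      by apply: Ex_le => // w; rewrite le_max lexx.
    rewrite ExB//; last exact: bounded_integrable.
    by move: Eh EM; set x1 := Ex h; set x2 := Ex M; rewrite -/a; clearbody a x1 x2; lra.
  - have iu : P.-integrable [set: Om] (EFin \o (fun w => B - h' w + M' w)).
      apply: integD => //; apply: integB; last exact: bounded_integrable.
      exact/bounded_integrable/bounded_mfun_cst.
    have mu := integrable_mfun iu.
    pose u w := \1_G w * (B - h' w + M' w) + \1_(~` G) w * B.
    have mcG := measurableC G_meas.
    apply: (@le_trans _ _ (\int[P]_w (u w)%:E)%E).
      apply: le_integral_ge0 => w; have /andP[f0 f1] := fB (to_skorokhod (fun v => X' T v w)).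
      rewrite f0/= /u !indicE in_setC; case: (boolP (w \in G)) => [/set_mem Gw|_]; rewrite ?mul0r ?mul1r ?add0r ?addr0//.
      by have := hM' w Gw; rewrite /f'; lra.
    have -> : (\int[P]_w (u w)%:E = \int[P]_w (B - h' w + M' w)%:E)%E.
      apply: ae_eq_integral => //.
      - apply/measurable_EFinP/measurable_funD; apply: measurable_funM => //.
      - exact/measurable_EFinP.
      - by apply: filterS G_ae => w Gw _; rewrite /u !indicE in_setC mem_set// mul1r mul0r addr0.
    have iB : P.-integrable [set: Om] (EFin \o (fun=> B)) by exact/bounded_integrable/bounded_mfun_cst.
    have ih' := bounded_integrable P bh'.
    rewrite -Ex_EFin// lee_fin (ExD (integB iB ih') iM') (ExB iB ih') Ex_cst.
    move: Eh' EM'; rewrite EB; set x1 := Ex h'; set x2 := Ex M'; clearbody a x1 x2; lra.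
apply: cvg_EFin.
  apply: filterS (key 1 ltr01) => T /andP[h1 h2].
  rewrite fin_numElt (lt_le_trans _ h1) ?ltNyr//=.
  by rewrite (le_lt_trans h2) ?ltry.
apply: cvgr_distP => e e0; apply: filterS (key e e0) => T /= /andP[h1 h2].
have fI : I T \is a fin_num.
  by rewrite fin_numElt (lt_le_trans _ h1) ?ltNyr//= (le_lt_trans h2) ?ltry.
move: h1 h2; rewrite -(fineK fI) !lee_fin -/(I T) => h1 h2.
by rewrite distrC ler_distl h1.
Qed.

Theorem skorokhod_cvg : cvg_in_law_skorokhod P Q X' Y.
Proof.
split.
- by apply: filterS X_cadlag => T cX; apply: filterS G_ae => w; exact: cX.
- by apply: aeW => w; exact: Y_cadlag.
- move=> f f_cont [C fC].
  have C0 : 0 <= C := le_trans (normr_ge0 _) (fC (SkorokhodSpace (@cadlag0 R d))).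
  pose fp x := Num.max (f x) 0; pose fn x := Num.max (- f x) 0.
  have fpB x : 0 <= fp x <= C.
    by rewrite le_max lexx orbT/= ge_max C0 andbT (le_trans (ler_norm _)).
  have fnB x : 0 <= fn x <= C.
    by rewrite le_max lexx orbT/= ge_max C0 andbT (le_trans (ler_norm _))// normrN.
  have max_lip (a b : R) : `|Num.max a 0 - Num.max b 0| <= `|a - b|.
    wlog ab : a b / a <= b => [H|].
      by have [/H//|/ltW/H] := leP a b; rewrite distrC [`|b - a|]distrC.
    rewrite [leRHS]distrC [leRHS]ger0_norm ?subr_ge0// ler_norml.
    by rewrite /Num.max; case: (ltP a 0) => a0; case: (ltP b 0) => b0; apply/andP; lra.
  have fp_cont : continuous fp by exact: (continuous_nonexpansive (h := Num.max^~ 0)) f_cont.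
  have fn_cont : continuous fn.
    apply: (continuous_nonexpansive (h := fun a => Num.max (- a) 0)) f_cont => a b.
    by apply: le_trans (max_lip _ _) _; rewrite opprK addrC distrC.
  (* By definition the expectation is the difference of the integrals of the two parts, measurable
     or not. *)
  have Efn d' (V : measurableType d') (PV : probability V R) (x : V -> D) :
      ('E_PV[fun w => f (x w)] = \int[PV]_w (fp (x w))%:E - \int[PV]_w (fn (x w))%:E)%E.
    by rewrite unlock integralE funerpos funerneg.
  have [cp cn] := (skorokhod_nonneg_cvg fpB fp_cont, skorokhod_nonneg_cvg fnB fn_cont).
  rewrite Efn; under [X in X @ _ --> _]eq_fun do rewrite Efn.
  apply: cvgeB => //.
  by rewrite -!Ex_EFin//; exact: bounded_integrable (bounded_limit _ _).
Qed.

End SkorokhodConvergence.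

(** * Chaining *)

Section Chaining.
Context {R : realType}.
Variables (x : R -> R) (n : nat) (b : nat -> R).
Hypothesis n0 : (0 < n)%N.
Local Notation N l := (n * 2 ^ l)%N.
Local Notation p l t := ((Num.truncn ((t : R) * (N l)%:R))%:R / (N l)%:R).

Let N0 l : 0 < (N l)%:R :> R.
Proof. by rewrite ltr0n muln_gt0 n0 expn_gt0. Qed.

Lemma truncn_double (y : R) : 0 <= y ->
  Num.truncn (2 * y) = (2 * Num.truncn y)%N \/ Num.truncn (2 * y) = (2 * Num.truncn y).+1.
Proof.
move=> y0; have y20 : 0 <= 2 * y by rewrite mulr_ge0.
have /andP[h1 h2] := truncn_itv y0; have /andP[h3 h4] := truncn_itv y20.
set k := Num.truncn y in h1 h2 *; set j := Num.truncn (2 * y) in h3 h4 *.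
have kj : (2 * k < j.+1)%N.
  by rewrite -(ltr_nat R) natrM; apply: le_lt_trans h4; rewrite ler_pM2l.
have jk : (j < 2 * k.+1)%N.
  by rewrite -(ltr_nat R) natrM; apply: le_lt_trans h3 _; rewrite ltr_pM2l.
lia.
Qed.

(** The finer grid point below [t] is the coarser one or its right neighbour, so that a change of
    level crosses at most one fine cell. *)
Lemma chaining_step l (t : R) : 0 <= t <= 1 ->
  (forall j, (j < N l.+1)%N -> `|x (j.+1%:R / (N l.+1)%:R) - x (j%:R / (N l.+1)%:R)| <= b l.+1) ->
  0 <= b l.+1 -> `|x (p l.+1 t) - x (p l t)| <= b l.+1.
Proof.
move=> /andP[t0 t1] hb b0; set y := t * (N l)%:R.
have y0 : 0 <= y by rewrite mulr_ge0.
have NS : (N l.+1)%:R = 2 * (N l)%:R :> R by rewrite expnS mulnCA natrM.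
have yE : t * (N l.+1)%:R = 2 * y by rewrite NS mulrCA.
have ev : (2 * Num.truncn y)%N%:R / (N l.+1)%:R = (Num.truncn y)%:R / (N l)%:R :> R.
  by rewrite NS natrM invfM mulrACA divff// mul1r.
rewrite yE; have [->|E] := truncn_double y0; first by rewrite ev subrr normr0.
rewrite E -ev; apply: hb.
rewrite -ltnS -E ltnS -(ler_nat R); have /andP[h _] := truncn_itv (mulr_ge0 (ler0n R 2) y0).
by apply: le_trans h _; rewrite -yE ler_piMl.
Qed.

Lemma chaining m (t : R) : 0 <= t <= 1 -> (forall l, 0 <= b l) ->
  (forall l j, (l <= m)%N -> (j < N l)%N ->
    `|x (j.+1%:R / (N l)%:R) - x (j%:R / (N l)%:R)| <= b l) ->
  `|x (p m t) - x (p 0 t)| <= \sum_(l < m) b l.+1.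
Proof.
move=> t01 b0; elim: m => [|m ih] hb; first by rewrite subrr normr0 big_ord0.
rewrite big_ord_recr/= addrC; apply: le_trans (ler_distD (x (p m t)) _ _) _.
apply: lerD; last by apply: ih => l j lm; apply: hb; exact: leqW.
by apply: chaining_step => // j; exact: hb.
Qed.

End Chaining.

Lemma norm_le_pow4 {R : realFieldType} (x a : R) : 0 < a -> `|x| <= a + x ^+ 4 / a ^+ 3.
Proof.
move=> a0; have x4 : 0 <= x ^+ 4 by rewrite -[4%N]/(2 * 2)%N exprM sqr_ge0.
have [xa|ax] := leP `|x| a; first by rewrite (le_trans xa)// lerDl divr_ge0// exprn_ge0// ltW.
rewrite ler_wpDl ?(ltW a0)// ler_pdivlMr ?exprn_gt0//.
have -> : x ^+ 4 = `|x| * `|x| ^+ 3.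
  by rewrite -exprS -[4%N]/(2 * 2)%N !exprM real_normK ?num_real.
by rewrite ler_wpM2l// lerXn2r ?nnegrE// ltW.
Qed.

Lemma geometric_sum_le {R : realFieldType} (q : R) m : 0 <= q < 1 ->
  \sum_(l < m) q ^+ l <= (1 - q)^-1.
Proof.
move=> /andP[q0 q1]; have q10 : 0 < 1 - q by rewrite subr_gt0.
rewrite -[leRHS]mul1r ler_pdivlMr// mulrC -opprB mulNr -subrX1 opprB.
by rewrite lerBlDr lerDl exprn_ge0.
Qed.

Section LevelBound.
Context {R : realType} dO (Om : measurableType dO) (P : probability Om R).
Local Notation "'Ex' X" := (Rintegral P [set: Om] X) (at level 10).
Variables (d N : nat) (D : 'I_d -> nat -> Om -> R) (lam c : R).
Hypothesis lam0 : 0 < lam.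
Hypothesis D4 : forall i j, (j < N)%N ->
  P.-integrable [set: Om] (EFin \o (fun w => D i j w ^+ 4)) /\ Ex (fun w => D i j w ^+ 4) <= c.

Let x4_ge0 (x : R) : 0 <= x ^+ 4 := pow4_ge0 x.

(** A random majorant of all increments of one level, from [|x| <= a + x^4 / a^3]; its mean is
    controlled by fourth moments, which replaces a union bound on probabilities. *)
Definition level_bound (w : Om) : R := lam + (\sum_(i < d) \sum_(j < N) D i j w ^+ 4) / lam ^+ 3.

Lemma level_bound_ge0 w : 0 <= level_bound w.
Proof.
rewrite addr_ge0 ?divr_ge0 ?exprn_ge0 ?(ltW lam0)//.
by apply: sumr_ge0 => i _; apply: sumr_ge0.
Qed.

Lemma level_boundP i j w : (j < N)%N -> `|D i j w| <= level_bound w.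
Proof.
move=> jN; apply: le_trans (norm_le_pow4 _ lam0) _.
rewrite lerD2l ler_pM2r ?invr_gt0 ?exprn_gt0//.
rewrite (bigD1 i)// (bigD1 (Ordinal jN))//= -addrA lerDl addr_ge0//; apply: sumr_ge0 => // k _.
exact: sumr_ge0.
Qed.

Lemma integ_level_bound : P.-integrable [set: Om] (EFin \o level_bound) /\
  Ex level_bound <= lam + d%:R * (N%:R * c) / lam ^+ 3.
Proof.
have iN (i : 'I_d) : P.-integrable [set: Om] (EFin \o (fun w => \sum_(j < N) D i j w ^+ 4)).
  by apply: integ_sum => j; have [] := D4 i (ltn_ord j).
have i4 := integ_sum (index_enum 'I_d) iN.
have -> : level_bound = fun w => lam + (lam ^+ 3)^-1 * \sum_(i < d) \sum_(j < N) D i j w ^+ 4.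
  by apply/funext => w; rewrite /level_bound mulrC.
have ic : P.-integrable [set: Om] (EFin \o (fun=> lam)) by exact/bounded_integrable/bounded_mfun_cst.
split; first by apply: integD => //; exact: integZ.
rewrite ExD//; last exact: integZ.
rewrite Ex_cst lerD2l ExZ// Ex_sum// mulrC ler_pM2r ?invr_gt0 ?exprn_gt0//.
have -> : d%:R * (N%:R * c) = \sum_(i < d) \sum_(j < N) c.
  by rewrite !sumr_const !card_ord mulr_natl mulr_natl.
apply: ler_sum => i _; rewrite Ex_sum; last by move=> j; have [] := D4 i (ltn_ord j).
by apply: ler_sum => j _; have [] := D4 i (ltn_ord j).
Qed.

End LevelBound.

Lemma nondecreasing_lipschitz {R : realDomainType} (f : R -> R) (c : R) :
  (forall s t, s <= t -> f s <= f t) -> (forall s t, s <= t -> f t - f s <= c * (t - s)) ->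
  forall s t, `|f s - f t| <= c * `|s - t|.
Proof.
move=> fnd fc s t; wlog ts : s t / t <= s => [H|].
  by have [/H//|/ltW/H] := leP t s; rewrite distrC [`|t - s|]distrC.
by rewrite !ger0_norm ?subr_ge0 ?fnd ?fc.
Qed.

Lemma eq_cvgr {R : realType} {T : Type} {F : set_system T} {FF : Filter F} (f g : T -> R) (l m : R) :
  (forall s, f s = g s) -> l = m -> g s @[s --> F] --> m -> f s @[s --> F] --> l.
Proof. by move=> /funext -> ->. Qed.

Section CadlagPaths.
Context {R : realType} {d : nat}.

Lemma cvg_col {T : Type} {F : set_system T} {FF : Filter F} (f : T -> 'cV[R]_d) (l : 'cV[R]_d) :
  (forall i, f s i 0 @[s --> F] --> l i 0) -> f s @[s --> F] --> l.
Proof.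
move=> h; apply/cvgrPdist_le => e e0.
have : \forall s \near F, forall i, `|l i 0 - f s i 0| <= e.
  by apply: filter_forall => i; have /cvgrPdist_le := h i; exact.
by apply: filterS => s hs; apply: col_norm_le => [|i]; [exact: ltW|rewrite !mxE; exact: hs].
Qed.

Lemma cvg_col_entry {T : Type} {F : set_system T} {FF : Filter F} (f : T -> 'cV[R]_d) (l : 'cV[R]_d) i :
  f s @[s --> F] --> l -> f s i 0 @[s --> F] --> l i 0.
Proof.
move=> /cvgrPdist_le h; apply/cvgrPdist_le => e e0; apply: filterS (h e e0) => s hs.
by apply: le_trans hs; have := col_norm_ge (l - f s) i; rewrite !mxE.
Qed.

Lemma cvg_mulmx {T : Type} {F : set_system T} {FF : Filter F} (A : 'M[R]_d) (f : T -> 'cV[R]_d) (l : 'cV[R]_d) :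
  f s @[s --> F] --> l -> A *m f s @[s --> F] --> A *m l.
Proof.
move=> h; apply: cvg_col => i; rewrite mxE; under eq_fun do rewrite mxE.
by apply: cvg_big => [|j _]; [exact: add_continuous|apply: cvgMr; exact: cvg_col_entry].
Qed.

Lemma near_right_le (a : \bar R) (T v : R) : 0 < T ->
  \forall s \near v^'+, (a <= (T * s)%:E)%E = (a <= (T * v)%:E)%E.
Proof.
move=> T0; case: a => [r| |]; last by apply: nearW => s; rewrite !leNye.
- have [rv|vr] := leP r (T * v).
    apply: filterS (nbhs_right_gt v) => s vs; rewrite !lee_fin rv (le_trans rv)// ler_pM2l//.
    exact: ltW.
  have vr' : v < r / T by rewrite ltr_pdivlMr// mulrC.
  apply: filterS (nbhs_right_lt vr') => s; rewrite ltr_pdivlMr// mulrC => sr.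
  by rewrite !lee_fin !leNgt vr sr.
- by apply: nearW => s; rewrite !leye_eq.
Qed.

Lemma near_left_le (a : \bar R) (T v : R) : 0 < T ->
  \forall s \near v^'-, (a <= (T * s)%:E)%E = (a < (T * v)%:E)%E.
Proof.
move=> T0; case: a => [r| |]; last by apply: nearW => s; rewrite leNye ltNyr.
- have [rv|vr] := ltP r (T * v).
    have rv' : r / T < v by rewrite ltr_pdivrMr// mulrC.
    apply: filterS (nbhs_left_gt rv') => s; rewrite ltr_pdivrMr// mulrC => rs.
    by rewrite lee_fin lte_fin rv ltW.
  apply: filterS (nbhs_left_lt v) => s sv; rewrite lee_fin lte_fin [RHS]ltNge vr/= leNgt.
  by rewrite (lt_le_trans _ vr)// ltr_pM2l.
- by apply: nearW => s; rewrite leye_eq.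
Qed.

End CadlagPaths.

(** * Martingale properties of the stopped process *)

Section HawkesProcess.
Context {R : realType} {d : nat}.
Context (dO : measure_display) (Om : measurableType dO) (P : probability Om R).
Local Notation leb := (@lebesgue_measure R).
Local Notation "'Ex' X" := (Rintegral P [set: Om] X) (at level 10).
Variables (mu : 'cV[R]_d) (phi : R -> 'M[R]_d) (tau : nat -> Om -> \bar R) (Z : nat -> Om -> 'I_d).
Hypothesis mu_ge0 : forall i, 0 <= mu i 0.
Hypothesis phi_ge0 : forall (t : R) i j, 0 <= t -> 0 <= phi t i j.
Hypothesis phi_meas : forall i j, measurable_fun (`[0, +oo[ : set R) (fun t => phi t i j).
Hypothesis phi_int : forall i j,
  (\int[lebesgue_measure]_(t in `[0%R, +oo[) (phi t i j)%:E < +oo)%E.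
Hypothesis N_hawkes : hawkes_process P mu phi tau Z.

Let marked : marked_times tau Z := proj1 N_hawkes.
Let K0 := @kernel_mass_ge0 R d phi phi_ge0 phi_int.
Local Notation K := (kernel_mass phi).
Local Notation M := (compens_mart mu phi tau Z).
Local Notation A := (compens mu phi tau Z).
Local Notation N := (cnt tau Z).

Lemma measurable_jump_indicator k i (t : R) :
  measurable_fun [set: Om] (fun w => ((tau k w <= t%:E)%E && (Z k w == i))%:R : R).
Proof.
have [mtau mZ _ _ _] := marked.
have -> : (fun w => ((tau k w <= t%:E)%E && (Z k w == i))%:R) =
    \1_((tau k @^-1` [set x | (x <= t%:E)%E]) `&` (Z k @^-1` [set i])) :> (Om -> R).
  apply/funext => w; rewrite indicE; congr (nat_of_bool _)%:R.
  apply/idP/idP => [/andP[h /eqP e]|/set_mem[h e]]; first exact/mem_set.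
  by rewrite h /=; apply/eqP.
apply: measurable_indic; apply: measurableI; last exact: mZ.
rewrite -[X in measurable X]setTI; apply: mtau => //.
rewrite (_ : [set x | _] = `]-oo, t%:E]%classic); last by apply/seteqP; split=> x /=; rewrite in_itv.
exact: emeasurable_itv.
Qed.

Lemma measurable_cnt n i t : measurable_fun [set: Om] (N n i t).
Proof. by apply: measurable_fun_sumr => k; exact: measurable_jump_indicator. Qed.

Lemma measurable_jump_count i t : measurable_fun [set: Om] (jump_count tau Z i t).
Proof.
apply: ge0_emeasurable_sum => [k w _ _|k _]; first by rewrite lee_fin.
by apply/measurable_EFinP; exact: measurable_jump_indicator.
Qed.

Definition history_gen (t : R) : set (set Om) := [set B | exists i s C,
  [/\ 0 <= s <= t, measurable C & B = jump_count tau Z i s @^-1` C] ].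

(** Boundedness and measurability for the history at [t]: these test variables play the part of
    conditional expectations. *)
Definition past_mfun (t : R) (X : Om -> R) : Prop :=
  @bounded_mfun R _ (g_sigma_algebraType (history_gen t)) X.

Lemma history_sub t B : history tau Z t B -> measurable B.
Proof.
apply: smallest_sub; first exact: sigma_algebra_measurable.
move=> _ [i [s [C [_ mC ->]]]].
by rewrite -[X in measurable X]setTI; exact: measurable_jump_count.
Qed.

Lemma history_nd s t : s <= t -> history tau Z s `<=` history tau Z t.
Proof.
move=> st; apply: sub_sigma_algebra2 => _ [i [u [C [/andP[u0 us] mC ->]]]].
by exists i, u, C; split => //; rewrite u0 (le_trans us).
Qed.

Lemma past_mfun_bounded t X : past_mfun t X -> bounded_mfun X.
Proof.
move=> [mX bX]; split => // _ B mB; rewrite setTI.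
apply: (@history_sub t); have := mX measurableT B mB; rewrite setTI; exact.
Qed.

Lemma past_mfun_nd s t X : s <= t -> past_mfun s X -> past_mfun t X.
Proof.
move=> st [mX bX]; split => // _ B mB; rewrite setTI.
apply: (history_nd st); have := mX measurableT B mB; rewrite setTI; exact.
Qed.

Lemma compens_mart_bound n t : 0 <= t -> exists2 C, 0 <= C & forall i s w, 0 <= s <= t ->
  `|M n i s w| <= C.
Proof.
move=> t0; have [C C0 hC] := compens_bound mu_ge0 phi_ge0 phi_meas phi_int marked n t0.
exists (n.+1%:R + C); first by rewrite addr_ge0.
move=> i s w st; rewrite (le_trans (ler_normB _ _))// lerD//.
  by rewrite ger0_norm ?jumps_ge0// jumps_le.
by rewrite ger0_norm ?hC// (compens_ge0 mu_ge0 phi_ge0)//; case/andP: st.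
Qed.

Let MartE n i : martingale P (history tau Z) (fun t w =>
    jump_count tau Z i (stopped_time tau n t w) w -
    \int[lebesgue_measure]_(s in `[0%R, stopped_time tau n t w])
       intensity tau Z mu phi i s w)%E := proj2 N_hawkes n i.

Let ME n i t w : 0 <= t -> (jump_count tau Z i (stopped_time tau n t w) w -
    \int[lebesgue_measure]_(s in `[0%R, stopped_time tau n t w])
       intensity tau Z mu phi i s w)%E = (M n i t w)%:E.
Proof. by move=> t0; apply: compens_martE. Qed.

Lemma compens_mart_past n i s t : 0 <= s -> s <= t -> past_mfun t (M n i s).
Proof.
move=> s0 st; apply: (past_mfun_nd st); split; last first.
  by have [C _ hC] := compens_mart_bound n s0; exists C => w; rewrite hC// s0 lexx.
apply/measurable_EFinP => _ B mB; rewrite setTI.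
have [h _ _] := MartE n i.
have := h s B s0 mB; rewrite (_ : _ @^-1` B = (EFin \o M n i s) @^-1` B)//.
by apply/seteqP; split=> w /=; rewrite ME.
Qed.

Lemma bounded_compens_mart n i s : 0 <= s -> bounded_mfun (M n i s).
Proof. by move=> s0; apply: past_mfun_bounded; exact: (compens_mart_past n i s0 (lexx s)). Qed.

Lemma bounded_compens n i s : 0 <= s -> bounded_mfun (A n i s).
Proof.
move=> s0; have -> : A n i s = (fun w => N n.+1 i s w - M n i s w).
  by apply/funext => w; rewrite /compens_mart opprB addrC subrK.
apply: bounded_mfunB; last exact: bounded_compens_mart.
split; first exact: measurable_cnt.
by exists n.+1%:R => w; rewrite ger0_norm ?jumps_ge0// jumps_le.
Qed.

Lemma bounded_cnt n i s : bounded_mfun (N n i s).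
Proof.
split; first exact: measurable_cnt.
by exists n%:R => w; rewrite ger0_norm ?jumps_ge0// jumps_le.
Qed.

Let martingale_increment_indic n i s t (B : set Om) : 0 <= s -> s <= t -> history tau Z s B ->
  Ex (fun w => \1_B w * (M n i t w - M n i s w)) = 0.
Proof.
move=> s0 st hB; have t0 := le_trans s0 st.
have mB' := history_sub hB.
have [_ _ h] := MartE n i.
have sst : 0 <= s <= t by rewrite s0.
have bM u : 0 <= u -> P.-integrable setT (EFin \o (fun w => \1_B w * M n i u w)).
  move=> u0; apply/bounded_integrable/bounded_mfunM; first exact: bounded_mfun_indic.
  exact: bounded_compens_mart.
have E u : 0 <= u -> (\int[P]_(w in B) (jump_count tau Z i (stopped_time tau n u w) w -
  \int[lebesgue_measure]_(s in `[0%R, stopped_time tau n u w])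
     intensity tau Z mu phi i s w) = (Ex (fun w => \1_B w * M n i u w))%:E)%E.
  move=> u0; rewrite Ex_EFin; last exact: bM.
  rewrite integral_mkcond; apply: eq_integral => w _; rewrite patchE ME//.
  by rewrite indicE; case: (w \in B); rewrite ?mul1r ?mul0r.
have hE := EFin_inj (etrans (esym (E t t0)) (etrans (h s t B sst hB) (E s s0))).
transitivity (Ex (fun w => \1_B w * M n i t w) - Ex (fun w => \1_B w * M n i s w)).
  rewrite -ExB; [|exact: bM..].
  by congr Rintegral; apply/funext => w; rewrite mulrBr.
by apply/eqP; rewrite subr_eq0; apply/eqP; exact: hE.
Qed.

(** The definition gives this for indicators; [bounded_mfun_ext], over the sigma-algebra of the
    past, extends it. *)
Lemma martingale_increment n i s t H : 0 <= s -> s <= t -> past_mfun s H ->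
  Ex (fun w => H w * (M n i t w - M n i s w)) = 0.
Proof.
move=> s0 st bH; have t0 := le_trans s0 st.
have bD : bounded_mfun (fun w => M n i t w - M n i s w).
  by apply: bounded_mfunB; exact: bounded_compens_mart.
have [C hC] := bD.2.
apply: (@bounded_mfun_ext R _ (g_sigma_algebraType (history_gen s))
   (fun H => Ex (fun w => H w * (M n i t w - M n i s w))) C) => //.
- move=> X Y /past_mfun_bounded bX /past_mfun_bounded bY.
  rewrite -ExD; try by apply: bounded_integrable; exact: bounded_mfunM.
  by congr Rintegral; apply/funext => w; rewrite mulrDl.
- move=> c X /past_mfun_bounded bX.
  rewrite -ExZ; last by apply: bounded_integrable; exact: bounded_mfunM.
  by congr Rintegral; apply/funext => w; rewrite mulrA.
- move=> X c /past_mfun_bounded bX Xc.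
  have bXD : bounded_mfun (fun w : Om => X w * (M n i t w - M n i s w)) by exact: bounded_mfunM.
  rewrite (le_trans (Ex_norm (bounded_integrable P bXD)))// -[leRHS](Ex_cst P).
  apply: Ex_le.
  + exact/integ_norm/bounded_integrable.
  + exact/bounded_integrable/bounded_mfun_cst.
  + by move=> w; rewrite normrM mulrC ler_pM.
- by move=> B mB; exact: martingale_increment_indic.
Qed.

(** * Covariation and fourth moments along partitions *)

Section Partition.
Variables (n : nat) (s t : R).
Hypotheses (s0 : 0 <= s) (st : s <= t).
Let t0 := le_trans s0 st.
Let p L k := partition_point s t L.+1 k.
Let D i L k w := M n i (p L k.+1) w - M n i (p L k) w.

Let ps L k : s <= p L k.
Proof. by rewrite -(partition_point0 s t L.+1) partition_point_le. Qed.
Let p0 L k : 0 <= p L k. Proof. exact: le_trans (ps L k). Qed.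
Let pt L k : (k <= L.+1)%N -> p L k <= t.
Proof. by move=> kL; rewrite -[leRHS](partition_point_last s t (ltn0Sn L)) partition_point_le. Qed.
Let pS L k : p L k <= p L k.+1. Proof. by rewrite partition_point_le. Qed.

Let pastD i L k : past_mfun (p L k.+1) (D i L k).
Proof. by apply: bounded_mfunB; apply: compens_mart_past. Qed.

Let bD i L k : bounded_mfun (D i L k). Proof. exact: past_mfun_bounded (pastD i L k). Qed.

Let cvgQ i j w : \sum_(k < L.+1) D i L k w * D j L k w @[L --> \oo] -->
  (i == j)%:R * (N n.+1 i t w - N n.+1 i s w).
Proof.
have [_ _ h3 h4 h5] := marked.
apply: (@quadratic_variation R d (tau^~ w) (Z^~ w) _ _ _ n.+1 i j (fun i x => A n i x w) s t) => //.
- by move=> l; exact: h5.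
- move=> l x y sx xy; apply: compens_nd => //; exact: le_trans sx.
- move=> l e e0; have [h h0 hP] := compens_modulus mu_ge0 phi_ge0 phi_meas phi_int marked n l w e0.
  by exists h => // x y sx xy yx; apply: hP => //; exact: le_trans sx.
Qed.

(** In each product one factor is at most an increment of count plus compensator, whose sum
    telescopes, and the other at most twice the bound on the martingale. *)
Let boundQ i j : exists C, forall L w, `|\sum_(k < L.+1) D i L k w * D j L k w| <= C.
Proof.
have [C C0 hC] := compens_mart_bound n t0.
have [c c0 hc] := compens_bound mu_ge0 phi_ge0 phi_meas phi_int marked n t0.
exists ((n.+1%:R + c) * (C + C)) => L w.
rewrite (le_trans (ler_norm_sum _ _ _))//.
apply: (@le_trans _ _ (\sum_(k < L.+1) ((N n.+1 i (p L k.+1) w + A n i (p L k.+1) w) -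
    (N n.+1 i (p L k) w + A n i (p L k) w)) * (C + C))).
  apply: ler_sum => k _; rewrite normrM; apply: ler_pM => //; last first.
    rewrite (le_trans (ler_normB _ _))// lerD// hC// p0//= pt//; exact: ltnW.
  have a1 : N n.+1 i (p L k) w <= N n.+1 i (p L k.+1) w by exact: jumps_nd.
  have a2 : A n i (p L k) w <= A n i (p L k.+1) w by exact: compens_nd.
  by rewrite /D /compens_mart; move: (N _ _ _ _) (N _ _ _ _) (A _ _ _ _) (A _ _ _ _) a1 a2 => *;
    rewrite ler_norml; apply/andP; split; lra.
rewrite -mulr_suml ler_wpM2r ?addr_ge0//.
rewrite -(big_mkord xpredT (fun k => (N n.+1 i (p L k.+1) w + A n i (p L k.+1) w) -
    (N n.+1 i (p L k) w + A n i (p L k) w))) telescope_sumr//.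
rewrite lerBlDr -[leLHS]addr0 lerD//.
  by rewrite lerD// ?jumps_le// hc// p0/= pt.
by rewrite addr_ge0 ?jumps_ge0// compens_ge0.
Qed.

Let S i L k w := M n i (p L k) w - M n i s w.

Let SS i L k w : S i L k.+1 w = S i L k w + D i L k w.
Proof. by rewrite /S /D [RHS]addrC addrA subrK. Qed.

Let pastS i L k : past_mfun (p L k) (S i L k).
Proof. by apply: bounded_mfunB; apply: compens_mart_past. Qed.

Let bS i L k : bounded_mfun (S i L k). Proof. exact: past_mfun_bounded (pastS i L k). Qed.

(** Products over distinct cells have mean zero, so the left side equals the mean of the cellwise
    products for every partition. As the mesh tends to 0 these converge boundedly to the jumps
    common to both components, which occur only for [i = j]. *)
Lemma martingale_covariation i j H : past_mfun s H ->
  Ex (fun w => H w * ((M n i t w - M n i s w) * (M n j t w - M n j s w))) =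
  (i == j)%:R * Ex (fun w => H w * (N n.+1 i t w - N n.+1 i s w)).
Proof.
move=> pH; have bH := past_mfun_bounded pH.
have E L : Ex (fun w => H w * ((M n i t w - M n i s w) * (M n j t w - M n j s w))) =
    Ex (fun w => H w * \sum_(k < L.+1) D i L k w * D j L k w).
  transitivity (Ex (fun w => H w * (S i L L.+1 w * S j L L.+1 w))).
    by rewrite /S /p partition_point_last.
  have Ek k : Ex (fun w => H w * (S i L k w * S j L k w)) =
      Ex (fun w => H w * \sum_(l < k) D i L l w * D j L l w); last exact: Ek.
  elim: k => [|k ih].
    congr Rintegral; apply/funext => w; rewrite big_ord0 /S /p partition_point0.
    by rewrite !subrr !mulr0.
  have pHk : past_mfun (p L k) H by exact: past_mfun_nd (ps L k) pH.
  have Z0 i' j' : Ex (fun w => H w * S i' L k w * D j' L k w) = 0.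
    apply: martingale_increment => //.
    by apply: (@bounded_mfunM R _ (g_sigma_algebraType (history_gen (p L k)))) => //; exact: pastS.
  have b1 : bounded_mfun (fun w => H w * (S i L k w * S j L k w)).
    exact: bounded_mfunM bH (bounded_mfunM (bS _ _ _) (bS _ _ _)).
  have b2 : bounded_mfun (fun w => H w * S i L k w * D j L k w).
    exact: bounded_mfunM (bounded_mfunM bH (bS _ _ _)) (bD _ _ _).
  have b3 : bounded_mfun (fun w => H w * S j L k w * D i L k w).
    exact: bounded_mfunM (bounded_mfunM bH (bS _ _ _)) (bD _ _ _).
  have b4 : bounded_mfun (fun w => H w * (D i L k w * D j L k w)).
    exact: bounded_mfunM bH (bounded_mfunM (bD _ _ _) (bD _ _ _)).
  have b5 : bounded_mfun (fun w => H w * \sum_(l < k) D i L l w * D j L l w).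
    by apply: bounded_mfunM => //; apply: bounded_mfun_sum => l; exact: bounded_mfunM.
  transitivity (Ex (fun w => H w * (S i L k w * S j L k w)) +
     Ex (fun w => H w * S i L k w * D j L k w) + Ex (fun w => H w * S j L k w * D i L k w) +
     Ex (fun w => H w * (D i L k w * D j L k w))).
    rewrite -ExD; [|exact: bounded_integrable..].
    rewrite -ExD; [|exact: bounded_integrable (bounded_mfunD b1 b2)|exact: bounded_integrable].
    rewrite -ExD; [|exact: bounded_integrable (bounded_mfunD (bounded_mfunD b1 b2) b3)|exact: bounded_integrable].
    by congr Rintegral; apply/funext => w; rewrite !SS; ring.
  rewrite Z0 Z0 addr0 addr0 ih -(ExD (bounded_integrable P b5) (bounded_integrable P b4)).
  by congr Rintegral; apply/funext => w; rewrite [in RHS]big_ord_recr [RHS]mulrDr.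
rewrite -ExZ; last by apply/bounded_integrable/bounded_mfunM => //; apply: bounded_mfunB; exact: bounded_cnt.
have [C hC] := boundQ i j; have [h hh] := bH.2.
have C0 : 0 <= C by exact: le_trans (hC 0%N point).
have bQ L : bounded_mfun (fun w => \sum_(k < L.+1) D i L k w * D j L k w).
  by apply: bounded_mfun_sum => l; exact: bounded_mfunM.
have cv : Ex (fun w => H w * \sum_(k < L.+1) D i L k w * D j L k w) @[L --> \oo] -->
    Ex (fun w => (i == j)%:R * (H w * (N n.+1 i t w - N n.+1 i s w))).
  apply: (@Ex_bounded_cvg _ _ _ _ _ _ (h * C)).
  - by move=> L; exact: (bounded_mfunM bH (bQ L)).1.
  - apply: measurable_funM => //; apply: measurable_funM; first exact: bH.1.
    by apply: measurable_funB; exact: measurable_cnt.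
  - apply: aeW => w; under eq_fun do [].
    rewrite mulrCA; apply: cvgMr; exact: cvgQ.
  - by move=> L w; rewrite normrM ler_pM.
apply: (cvg_unique _ _ cv) => //.
by apply: cvg_near_cst; apply: nearW => L; rewrite -(E L).
Qed.

(** [pathwise_bdg] along a partition: its coefficients are known at the left end of each cell, so
    the last sum has mean zero, and the sum of squares tends to the number of jumps. A fourth moment
    of M thus costs only a second moment of N. *)
Lemma martingale_fourth_moment i :
  Ex (fun w => (M n i t w - M n i s w) ^+ 4) <= 576 * Ex (fun w => (N n.+1 i t w - N n.+1 i s w) ^+ 2).
Proof.
have bQ L : bounded_mfun (fun w => \sum_(k < L.+1) D i L k w * D i L k w).
  by apply: bounded_mfun_sum => l; exact: bounded_mfunM.
have E L : Ex (fun w => (M n i t w - M n i s w) ^+ 4) <=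
    576 * Ex (fun w => (\sum_(k < L.+1) D i L k w * D i L k w) ^+ 2).
  pose S' w k := S i L k w.
  pose G k w := 32 * S' w k ^+ 3 - 16 * running_max (S' w) k ^+ 2 * S' w k.
  have pM k : past_mfun (p L k) (fun w => running_max (S' w) k).
    elim: k => [|k ih] /=; first exact: bounded_mfun_norm (pastS _ _ _).
    apply: bounded_mfun_max; first exact: past_mfun_nd (pS L k) ih.
    exact: bounded_mfun_norm (pastS _ _ _).
  have pG k : past_mfun (p L k) (G k).
    apply: bounded_mfunB; first by apply: bounded_mfunZ; apply: bounded_mfunX; exact: pastS.
    by apply: bounded_mfunM; [apply: bounded_mfunZ; apply: bounded_mfunX; exact: pM|exact: pastS].
  have b1 : bounded_mfun (fun w => 576 * (\sum_(k < L.+1) D i L k w * D i L k w) ^+ 2).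
    by apply: bounded_mfunZ; exact: bounded_mfunX.
  have b2 k : bounded_mfun (fun w => G k w * D i L k w).
    by apply: bounded_mfunM => //; exact: past_mfun_bounded (pG k).
  have b3 : bounded_mfun (fun w => \sum_(k < L.+1) G k w * D i L k w).
    exact: bounded_mfun_sum.
  have b4 : bounded_mfun (fun w => (M n i t w - M n i s w) ^+ 4).
    by apply: bounded_mfunX; apply: bounded_mfunB; exact: bounded_compens_mart.
  apply: (@le_trans _ _ (Ex (fun w => 576 * (\sum_(k < L.+1) D i L k w * D i L k w) ^+ 2 +
      \sum_(k < L.+1) G k w * D i L k w))).
    apply: Ex_le; first exact: bounded_integrable.
      by apply: bounded_integrable; exact: bounded_mfunD.
    move=> w; have S0 : S' w 0%N = 0 by rewrite /S' /S /p partition_point0 subrr.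
    have := pathwise_bdg S0 L.+1; rewrite {1}/S' {1}/S /p partition_point_last//.
    have DE k : S' w k.+1 - S' w k = D i L k w by rewrite [S' w k.+1]SS addrC addKr.
    by under eq_bigr do rewrite DE expr2; under [X in _ <= _ + X]eq_bigr do rewrite DE.
  rewrite ExD; [|exact: bounded_integrable..].
  rewrite ExZ; last by apply: bounded_integrable; exact: bounded_mfunX.
  rewrite Ex_sum; last by move=> k; exact: bounded_integrable.
  rewrite [X in _ + X]big1 ?addr0// => k _.
  exact: martingale_increment.
have [C hC] := boundQ i i.
have C0 : 0 <= C by exact: le_trans (hC 0%N point).
have cv : Ex (fun w => (\sum_(k < L.+1) D i L k w * D i L k w) ^+ 2) @[L --> \oo] -->
    Ex (fun w => (N n.+1 i t w - N n.+1 i s w) ^+ 2).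
  apply: (@Ex_bounded_cvg _ _ _ _ _ _ (C ^+ 2)).
  - by move=> L; exact: (bounded_mfunX 2 (bQ L)).1.
  - by apply: measurable_funX; apply: measurable_funB; exact: measurable_cnt.
  - apply: aeW => w; have := @cvgQ i i w; rewrite eqxx mul1r => h.
    by under eq_fun do rewrite expr2; rewrite expr2; exact: cvgM.
  - by move=> L w; rewrite normrX lerXn2r ?nnegrE.
have cv' : 576 * Ex (fun w => (\sum_(k < L.+1) D i L k w * D i L k w) ^+ 2) @[L --> \oo] -->
    576 * Ex (fun w => (N n.+1 i t w - N n.+1 i s w) ^+ 2) by exact: cvgMr.
apply: (ler_cvg_to (cvg_cst _) cv').
by near=> L; exact: E.
Unshelve. all: end_near.
Qed.

End Partition.

(** * Nonexplosion and first moments *)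

Hypothesis rho_lt1 : spectral_radius (kernel_mass phi) < 1.
Local Notation cau := (causal phi).
Local Notation R1 := (invmx (1%:M - K)).
Let tau_gt0 n w : (0 < tau n w)%E. Proof. exact: (marked_gt0 marked). Qed.

(** The long run jump rate, which is the diagonal entry of the limiting covariance matrix. *)
Definition rate (i : 'I_d) : R := \sum_j R1 i j * mu j 0.

Lemma rate_ge0 i : 0 <= rate i.
Proof. by apply: sumr_ge0 => j _; rewrite mulr_ge0// invmx_sub_ge0. Qed.

Lemma cnt_le0 n i t w : t <= 0 -> N n i t w = 0.
Proof.
move=> t0; rewrite /cnt /jumps big1// => k _.
by rewrite leNgt (le_lt_trans _ (tau_gt0 k w)) ?lee_fin.
Qed.

Lemma jump_count_le0 i t w : t <= 0 -> jump_count tau Z i t w = 0%E.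
Proof.
move=> t0; rewrite /jump_count eseries0// => k _ _.
by rewrite leNgt (le_lt_trans _ (tau_gt0 k w)) ?lee_fin.
Qed.

Lemma compens0 n i w : A n i 0 w = 0.
Proof.
have s0 : stopped_time tau n 0 w = 0.
  apply/le_anti; rewrite (stopped_time_le marked)//= (stopped_time_ge0 marked)//.
rewrite /compens s0 mulr0 add0r big1// => k _.
rewrite causal_prim_le0 ?mulr0// sub0r oppr_le0 fine_ge0//; exact/ltW.
Qed.

Lemma compens_mart0 n i w : M n i 0 w = 0.
Proof. by rewrite /compens_mart compens0 cnt_le0// subr0. Qed.

Lemma Ex_compens_mart n i t : 0 <= t -> Ex (M n i t) = 0.
Proof.
move=> t0.
have H1 : past_mfun 0 (fun=> 1) by exact: bounded_mfun_cst.
have := martingale_increment n i (lexx 0) t0 H1.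
by under [X in Rintegral _ _ X]eq_fun do rewrite mul1r compens_mart0 subr0.
Qed.

Let iN n i t := bounded_integrable P (bounded_cnt n i t).
Let iA n i t (t0 : 0 <= t) :=
  bounded_integrable P (bounded_compens n i t0).

Lemma Ex_cnt n i t : 0 <= t -> Ex (N n.+1 i t) = Ex (A n i t).
Proof.
move=> t0; apply/eqP; rewrite -subr_eq0 -ExB; [|exact: iN|exact: iA].
by apply/eqP; exact: Ex_compens_mart.
Qed.

Lemma cnt_leS n i t w : N n i t w <= N n.+1 i t w.
Proof. by rewrite /cnt /jumps [leRHS]big_ord_recr/= lerDl. Qed.

(** For the stopped process the mean count equals the mean compensator, at most [mu t] plus K times
    the mean counts: a finite subsolution, bounded independently of [n]. *)
Lemma Ex_cnt_le n i t : 0 <= t -> Ex (N n i t) <= rate i * t.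
Proof.
move=> t0; apply: (@le_trans _ _ (Ex (N n.+1 i t))).
  by apply: Ex_le => //; exact: cnt_leS.
rewrite /rate mulr_suml; under [leRHS]eq_bigr do rewrite -mulrA.
apply: (@le_invmx_sub R d K K0 rho_lt1 (fun i => Ex (N n.+1 i t)) (fun i => mu i 0 * t)) => {}i.
rewrite Ex_cnt//; under [X in _ <= _ + X]eq_bigr do rewrite -ExZ//.
rewrite -Ex_sum; last by move=> j; exact/integZ.
rewrite -[X in _ <= X + _](Ex_cst P) -ExD.
- apply: Ex_le; first exact: iA.
    by apply: integD; [exact/bounded_integrable/bounded_mfun_cst|apply: integ_sum => j; exact: integZ].
  by move=> w; exact: compens_le.
- exact/bounded_integrable/bounded_mfun_cst.
- by apply: integ_sum => j; exact: integZ.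
Qed.

Let jc0 i t k w : (0 <= (((tau k w <= t%:E)%E && (Z k w == i))%:R : R)%:E)%E.
Proof. by rewrite lee_fin. Qed.

Lemma cnt_le_jump_count n i t w : ((N n i t w)%:E <= jump_count tau Z i t w)%E.
Proof.
by rewrite /cnt /jumps -sumEFin -(big_mkord xpredT (fun k => (((tau k w <= t%:E)%E && (Z k w == i))%:R : R)%:E));
  apply: nneseries_lim_ge => k _ _.
Qed.

Lemma jump_count_ge0 i t w : (0 <= jump_count tau Z i t w)%E.
Proof. by apply: nneseries_ge0 => k _ _. Qed.

Lemma mean_count_le i t : 0 <= t -> (\int[P]_w jump_count tau Z i t w <= (rate i * t)%:E)%E.
Proof.
move=> t0; have mj k : measurable_fun setT (fun w => (((tau k w <= t%:E)%E && (Z k w == i))%:R : R)%:E).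
  by apply/measurable_EFinP; exact: measurable_jump_indicator k i t.
rewrite integral_nneseries//.
apply: lime_le; first by apply: is_cvg_nneseries => k _ _; exact: integral_ge0.
apply: nearW => n; rewrite -ge0_integral_sum//.
have -> : (\int[P]_w (\sum_(0 <= k < n) (((tau k w <= t%:E)%E && (Z k w == i))%:R : R)%:E) = (Ex (N n i t))%:E)%E.
  by rewrite Ex_EFin//; apply: eq_integral => w _; rewrite sumEFin big_mkord.
by rewrite lee_fin Ex_cnt_le.
Qed.

Lemma integrable_jump_count i t : 0 <= t -> P.-integrable setT (jump_count tau Z i t).
Proof.
move=> t0; apply/integrableP; split; first exact: measurable_jump_count i t.
under eq_integral do rewrite gee0_abs ?jump_count_ge0//.
by rewrite (le_lt_trans (mean_count_le i t0))// ltry.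
Qed.

Definition nonexplosive : set Om := [set w | forall m : nat, exists n, ((m%:R : R)%:E < tau n w)%E].

Lemma measurable_nonexplosive : measurable nonexplosive.
Proof.
rewrite (_ : nonexplosive = \bigcap_m \bigcup_n (tau n @^-1` `]((m%:R : R)%:E), +oo[%classic)).
  apply: bigcap_measurableType => m _; apply: bigcup_measurable => n _.
  rewrite -[X in measurable X]setTI; have [mtau _ _ _ _] := marked.
  by apply: mtau => //; exact: emeasurable_itv.
apply/seteqP; split=> w /=.
  by move=> h m _; have [n hn] := h m; exists n => //=; rewrite in_itv/= andbT.
by move=> h m; have [n _ /=] := h m I; rewrite in_itv/= andbT; exists n.
Qed.

(** If all jump times stayed below an integer m, the total count at m would exceed every n, although
    it is almost surely finite by the first moments. *)
Lemma nonexplosive_ae : {ae P, forall w, nonexplosive w}.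
Proof.
have H : {ae P, forall w, forall m : nat, forall i, jump_count tau Z i (m%:R) w \is a fin_num}.
  apply: ae_foralln => m; apply: filter_forall => i.
  have := integrable_ae measurableT (integrable_jump_count i (ler0n R m)).
  by apply: filterS => w /(_ I).
apply: filterS H => w hw m; apply: contrapT => /forallNP tm.
have tle n : (tau n w <= (m%:R)%:E)%E by rewrite leNgt; apply/negP; exact: tm.
pose c : R := \sum_i fine (jump_count tau Z i m%:R w).
pose n := (Num.truncn c).+1.
have : n%:R <= c.
  have -> : (n%:R : R) = \sum_i N n i m%:R w.
    rewrite /cnt /jumps exchange_big/= -[LHS](_ : \sum_(k < n) 1 = _); last first.
      by rewrite sumr_const card_ord.
    apply: eq_bigr => k _; rewrite (bigD1 (Z k w))//= tle eqxx big1 ?addr0// => j /negbTE.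
    by rewrite eq_sym => ->.
  apply: ler_sum => i _; rewrite -lee_fin fineK//; exact: cnt_le_jump_count.
by rewrite leNgt truncnS_gt.
Qed.

Lemma nonexplosive_near w t : nonexplosive w -> \forall n \near \oo, (t%:E < tau n w)%E.
Proof.
move=> /(_ (Num.truncn t).+1)[n hn]; exists n => // k /= nk.
apply: (tau_late marked (n := n)) => //.
by apply: lt_trans hn; rewrite lte_fin truncnS_gt.
Qed.

(** A real version, set to 0 where jumps accumulate, so that its paths are finite and nondecreasing
    for every [w]. *)
Definition count i t w : R := \1_nonexplosive w * fine (jump_count tau Z i t w).

Lemma count_off i t w : ~ nonexplosive w -> count i t w = 0.
Proof. by move=> h; rewrite /count indicE memNset// mul0r. Qed.

Lemma count_cnt n i t w : nonexplosive w -> (t%:E < tau n w)%E -> count i t w = N n i t w.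
Proof.
move=> gw tn; by rewrite /count indicE mem_set// mul1r (jump_count_finite Z i (tau_late marked tn)).
Qed.

Lemma count_near i t w : nonexplosive w -> \forall n \near \oo, count i t w = N n i t w.
Proof. by move=> gw; apply: filterS (nonexplosive_near t gw) => n; exact: count_cnt. Qed.

Lemma jump_count_count i t w : nonexplosive w -> jump_count tau Z i t w = (count i t w)%:E.
Proof.
move=> gw; have [n _ /(_ n (leqnn n)) tn] := nonexplosive_near t gw.
by rewrite (count_cnt i gw tn) (jump_count_finite Z i (tau_late marked tn)).
Qed.

Lemma cntB_leS n i s t w : s <= t -> N n i t w - N n i s w <= N n.+1 i t w - N n.+1 i s w.
Proof. by move=> st; rewrite /cnt !jumpsB// [leRHS]big_ord_recr/= lerDl. Qed.

Lemma cntB_le_count n i s t w : nonexplosive w -> s <= t ->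
  N n i t w - N n i s w <= count i t w - count i s w.
Proof.
move=> gw st; near \oo => k.
rewrite (_ : count i t w = N k i t w); last by near: k; exact: count_near.
rewrite (_ : count i s w = N k i s w); last by near: k; exact: count_near.
apply: (@homo_leq R (fun n => N n i t w - N n i s w) (fun x y => is_true (x <= y))) => //.
- by move=> y x z; exact: le_trans.
- by move=> m; exact: cntB_leS.
- by near: k; exact: nbhs_infty_ge.
Unshelve. all: end_near. Qed.

Lemma count_le0 i t w : t <= 0 -> count i t w = 0.
Proof. by move=> t0; rewrite /count jump_count_le0// mulr0. Qed.

Lemma cnt_le_count n i t w : nonexplosive w -> N n i t w <= count i t w.
Proof.
move=> gw; have [t0|t0] := leP 0 t; last by rewrite cnt_le0 ?count_le0// ltW.
by have := cntB_le_count n i gw t0; rewrite [N n i 0 w]cnt_le0// [count i 0 w]count_le0// !subr0.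
Qed.

Lemma count_ge0 i t w : 0 <= count i t w.
Proof. by rewrite /count mulr_ge0// fine_ge0// jump_count_ge0. Qed.

Lemma count_nd i s t w : s <= t -> count i s w <= count i t w.
Proof.
move=> st; have [gw|gw] := pselect (nonexplosive w); last by rewrite !count_off.
have := cntB_le_count 0 i gw st; rewrite /cnt /jumps !big_ord0 subrr subr_ge0; exact.
Qed.

Lemma measurable_count i t : measurable_fun setT (count i t).
Proof.
apply: measurable_funM; first exact: measurable_indic measurable_nonexplosive.
by apply: measurableT_comp => //; exact: measurable_jump_count i t.
Qed.

(** Required by Tonelli's theorem. The condition [tau k <= t - u] is rewritten as [tau k + u <= t],
    a measurable condition on the pair. *)
Lemma measurable_count_joint i t : measurable_fun setT (fun z : R * Om => count i (t - z.1) z.2).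
Proof.
have mg : measurable_fun setT (fun z : R * Om => \1_nonexplosive z.2 : R).
  have mI : measurable_fun setT (\1_nonexplosive : Om -> R) by exact: measurable_indic measurable_nonexplosive.
  exact: (measurableT_comp mI measurable_snd).
apply: measurable_funM => //.
apply: (measurableT_comp (f := fine)) => //.
apply: ge0_emeasurable_sum => [k z _ _|k _]; first exact: jc0.
apply/measurable_EFinP.
have [mtau mZ _ _ _] := marked.
have -> : (fun z : R * Om => ((tau k z.2 <= (t - z.1)%:E)%E && (Z k z.2 == i))%:R : R) =
  \1_((fun z : R * Om => tau k z.2 + (z.1)%:E)%E @^-1` `]-oo, t%:E]%classic `&` snd @^-1` (Z k @^-1` [set i])) :> (R * Om -> R).
  apply/funext => z; rewrite indicE; congr (nat_of_bool _)%:R.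
  rewrite EFinB leeBrDr//.
  apply/idP/idP => [/andP[h /eqP e]|/set_mem[/=]].
    by apply/mem_set; split => //=; rewrite in_itv.
  by rewrite in_itv/= => -> ->; rewrite eqxx.
apply: measurable_indic; apply: measurableI.
  rewrite -[X in measurable X]setTI.
  have mf : measurable_fun setT (fun z : R * Om => tau k z.2 + (z.1)%:E)%E.
    apply: emeasurable_funD; first exact: (measurableT_comp (mtau k) measurable_snd).
    by apply/measurable_EFinP; exact: measurable_fst.
  by apply: mf => //; exact: emeasurable_itv.
by rewrite -[X in measurable X]setTI; apply: measurable_snd => //; exact: mZ.
Qed.

Lemma integ_count i t : P.-integrable setT (EFin \o count i t).
Proof.
have [t0|t0] := leP 0 t; last first.
  rewrite (_ : count i t = fun=> 0); first exact/bounded_integrable/bounded_mfun_cst.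
  by apply/funext => w; rewrite count_le0// ltW.
apply: (le_integrable measurableT _ _ (integrable_jump_count i t0)).
  by apply/measurable_EFinP; exact: measurable_count.
move=> w _; rewrite /= gee0_abs ?jump_count_ge0//.
have [gw|gw] := pselect (nonexplosive w).
  by rewrite jump_count_count// lee_fin ger0_norm ?count_ge0.
by rewrite count_off// normr0 jump_count_ge0.
Qed.

Definition mean i t : R := Ex (count i t).

Lemma mean_EFin i t : ((mean i t)%:E = \int[P]_w (count i t w)%:E)%E.
Proof. by rewrite /mean Ex_EFin//; exact: integ_count. Qed.

Lemma mean_countE i t : mean_count P tau Z i t = (mean i t)%:E.
Proof.
rewrite /mean Ex_EFin; last exact: integ_count.
apply: ae_eq_integral => //.
- exact: measurable_jump_count i t.
- by apply/measurable_EFinP; exact: measurable_count.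
- by apply: filterS nonexplosive_ae => w gw _; exact: jump_count_count.
Qed.

Lemma mean_ge0 i t : 0 <= mean i t.
Proof. by apply: Ex_ge0 => w; exact: count_ge0. Qed.

Lemma mean_nd i s t : s <= t -> mean i s <= mean i t.
Proof. by move=> st; apply: Ex_le; [exact: integ_count..|move=> w; exact: count_nd]. Qed.

Lemma mean_le0 i t : t <= 0 -> mean i t = 0.
Proof.
move=> t0; rewrite /mean (_ : count i t = fun=> 0) ?Ex_cst//.
by apply/funext => w; rewrite count_le0.
Qed.

Local Opaque count.

Lemma causal_count_integrable i j t w :
  leb.-integrable setT (EFin \o (fun u => cau i j u * count j (t - u) w)).
Proof.
apply: (@causal_bounded_integrable R d phi phi_ge0 phi_meas phi_int i j (fun s => count j s w) t (count j t w)) => // [|s st].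
  by apply: measurable_ndfun => s s'; exact: count_nd.
by rewrite ger0_norm ?count_ge0// count_nd.
Qed.

(** Defined for all real times, and zero before 0, as suits convolutions over the line. *)
Definition compensator i t w : R := mu i 0 * Num.max t 0 +
  \sum_j \int[leb]_u (cau i j u * count j (t - u) w).

Lemma compensator_ge0 i t w : 0 <= compensator i t w.
Proof.
apply: addr_ge0; first by rewrite mulr_ge0// le_max lexx orbT.
apply: sumr_ge0 => j _; apply: Rintegral_ge0 => u _.
by rewrite mulr_ge0 ?causal_ge0// count_ge0.
Qed.

Lemma compensator_le i t w :
  compensator i t w <= mu i 0 * Num.max t 0 + \sum_j K i j * count j t w.
Proof.
rewrite lerD2l; apply: ler_sum => j _.
by apply: (causal_Rintegral_le phi_ge0 phi_meas phi_int (f := fun s => count j s w)) => //; [exact: causal_count_integrable|move=> s; exact: count_nd].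
Qed.

Let mjoint i j t : measurable_fun setT (fun z : R * Om => (cau i j z.1 * count j (t - z.1) z.2)%:E).
Proof.
apply/measurable_EFinP; apply: measurable_funM; last exact: measurable_count_joint.
by apply: (measurableT_comp (measurable_causal phi_meas i j)); exact: measurable_fst.
Qed.

Let joint0 i j t (z : R * Om) : (0 <= (cau i j z.1 * count j (t - z.1) z.2)%:E)%E.
Proof. by rewrite lee_fin mulr_ge0 ?causal_ge0// count_ge0. Qed.

Lemma measurable_compensator i t : measurable_fun setT (compensator i t).
Proof.
apply: measurable_funD => //; apply: measurable_fun_sumr => j.
apply: (measurableT_comp (f := fine)) => //.
exact: (measurable_fun_fubini_tonelli_G (m1 := leb) _ (@mjoint i j t) (@joint0 i j t)).
Qed.

Definition noise i t w : R := count i t w - compensator i t w.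

Lemma noiseE i t w : noise i t w = count i t w - (mu i 0 * Num.max t 0 +
  \sum_j \int[leb]_u (cau i j u * count j (t - u) w)).
Proof. by []. Qed.

Lemma measurable_noise i t : measurable_fun setT (noise i t).
Proof. by apply: measurable_funB; [exact: measurable_count|exact: measurable_compensator]. Qed.

Lemma noise_near i t w : 0 <= t -> nonexplosive w -> \forall n \near \oo, M n i t w = noise i t w.
Proof.
move=> t0 gw; apply: filterS (nonexplosive_near t gw) => n tn.
have late := tau_late marked tn.
have tn1 : (t%:E < tau n.+1 w)%E by exact: late.
rewrite /noise /compens_mart (count_cnt i gw tn1)//; congr (_ - _).
apply: EFin_inj; rewrite compens_conv// /compensator max_l// EFinD -sumEFin.
congr (_ + _)%E; apply: eq_bigr => j _.
rewrite /Rintegral fineK; last exact: integrable_fin_num (causal_count_integrable i j t w).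
apply: eq_integral => u _; have [u0|u0] := leP 0 u; last by rewrite causal_neg// !mul0r.
by rewrite (count_cnt (n := n.+1) j gw)// (le_lt_trans _ tn1)// lee_fin gerBl.
Qed.

Lemma noise_le0 i t w : t <= 0 -> noise i t w = 0.
Proof.
move=> t0; rewrite /noise /compensator count_le0// max_r// mulr0 sub0r add0r big1 ?oppr0// => j _.
apply: Rintegral_fun0 => u; have [u0|u0] := leP 0 u; last by rewrite causal_neg// mul0r.
by rewrite count_le0 ?mulr0// subr_le0 (le_trans t0).
Qed.

Let bnd i t w : R := count i t w + (mu i 0 * Num.max t 0 + \sum_j K i j * count j t w).

Let ibnd i t : P.-integrable setT (EFin \o bnd i t).
Proof.
apply: integD; first exact: integ_count.
apply: integD; first exact/bounded_integrable/bounded_mfun_cst.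
by apply: integ_sum => j; apply: integZ; exact: integ_count.
Qed.

Lemma integ_compensator i t : P.-integrable setT (EFin \o compensator i t).
Proof.
apply: (integ_le (Y := bnd i t)) => //; first exact: measurable_compensator.
move=> w; rewrite ger0_norm ?compensator_ge0// (le_trans (compensator_le i t w))//.
by rewrite lerDr count_ge0.
Qed.

Lemma integ_noise i t : P.-integrable setT (EFin \o noise i t).
Proof. by apply: integB; [exact: integ_count|exact: integ_compensator]. Qed.

(** The stopped martingales have mean zero and are eventually equal to the noise; the count plus the
    linear bound on the compensator dominates them. *)
Lemma Ex_noise i t : Ex (noise i t) = 0.
Proof.
have [t0|t0] := leP 0 t; last first.
  by rewrite (_ : noise i t = fun=> 0) ?Ex_cst//; apply/funext => w; rewrite noise_le0// ltW.
have bM n : bounded_mfun (M n i t) by exact: bounded_compens_mart.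
have b1 : bounded_mfun (\1_nonexplosive : Om -> R) := bounded_mfun_indic measurable_nonexplosive.
have [] := @Ex_dominated R _ _ P (fun n w => \1_nonexplosive w * M n i t w) (noise i t) (bnd i t).
- by move=> n; exact: (bounded_mfunM b1 (bM n)).1.
- exact: measurable_noise.
- apply: filterS nonexplosive_ae => w gw; apply: cvg_near_cst.
  apply: filterS (noise_near i t0 gw) => n ->.
  by rewrite indicE mem_set// mul1r.
- exact: ibnd.
- move=> n w; have [gw|gw] := pselect (nonexplosive w); last first.
    rewrite indicE memNset// mul0r normr0 /bnd addr_ge0 ?count_ge0// addr_ge0//.
      by rewrite mulr_ge0// le_max lexx orbT.
    by apply: sumr_ge0 => j _; rewrite mulr_ge0// count_ge0.
  rewrite indicE mem_set// mul1r (le_trans (ler_normB _ _))// lerD//.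
    by rewrite ger0_norm ?jumps_ge0// cnt_le_count.
  rewrite ger0_norm ?(compens_ge0 mu_ge0 phi_ge0)//.
  rewrite (le_trans (compens_le mu_ge0 phi_ge0 phi_meas phi_int marked n i w t0))//.
  rewrite max_l// lerD2l; apply: ler_sum => j _; rewrite ler_wpM2l//; exact: cnt_le_count.
move=> _ cv; apply: (cvg_unique _ cv) => //.
apply: cvg_near_cst; apply: nearW => n.
rewrite -[RHS](Ex_compens_mart n i t0); apply: Ex_ae_eq.
- exact: (bounded_mfunM b1 (bM n)).1.
- exact: (bM n).1.
- by apply: filterS nonexplosive_ae => w gw; rewrite indicE mem_set// mul1r.
Qed.

Lemma Ex_compensator i t : Ex (compensator i t) = mean i t.
Proof.
apply/eqP; rewrite eq_sym -subr_eq0 -ExB; [|exact: integ_count|exact: integ_compensator].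
by apply/eqP; exact: Ex_noise.
Qed.

Local Opaque mean.

Lemma mean_causal i j t : (\int[leb]_u (cau i j u * mean j (t - u))%:E =
  \int[P]_w (\int[leb]_u (cau i j u * count j (t - u) w))%:E)%E.
Proof.
transitivity (\int[P]_w \int[leb]_u (cau i j u * count j (t - u) w)%:E)%E; last first.
  apply: eq_integral => w _; rewrite /Rintegral fineK//.
  exact: integrable_fin_num (causal_count_integrable i j t w).
rewrite -(fubini_tonelli (m1 := leb) (m2 := P) _ (@mjoint i j t) (@joint0 i j t)).
apply: eq_integral => u _; rewrite EFinM mean_EFin.
rewrite -ge0_integralZl//.
- by apply/measurable_EFinP; exact: measurable_count.
- by move=> w _; rewrite lee_fin count_ge0.
- by rewrite lee_fin causal_ge0.
Qed.

Lemma mean_renewal i t : mean i t = mu i 0 * Num.max t 0 +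
  \sum_j \int[leb]_u (cau i j u * mean j (t - u)).
Proof.
have ic j : P.-integrable setT (EFin \o (fun w => \int[leb]_u (cau i j u * count j (t - u) w))).
  apply: (integ_le (Y := compensator i t)); last exact: integ_compensator.
    apply: (measurableT_comp (f := fine)) => //.
    exact: (measurable_fun_fubini_tonelli_G (m1 := leb) _ (@mjoint i j t) (@joint0 i j t)).
  have r0 k w : 0 <= \int[leb]_u (cau i k u * count k (t - u) w).
    by apply: Rintegral_ge0 => u _; rewrite mulr_ge0 ?causal_ge0// count_ge0.
  move=> w; rewrite ger0_norm// /compensator (bigD1 j)//= addrCA lerDl addr_ge0//.
    by rewrite mulr_ge0// le_max lexx orbT.
  by apply: sumr_ge0 => k _.
rewrite -Ex_compensator ExD; last 2 first.
- exact/bounded_integrable/bounded_mfun_cst.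
- exact: integ_sum.
rewrite Ex_cst Ex_sum//; congr (_ + _); apply: eq_bigr => j _.
by apply: EFin_inj; rewrite Ex_EFin// -mean_causal /Rintegral fineK// mean_causal -Ex_EFin.
Qed.

Lemma mean_solution i t : 0 <= t ->
  mean_count P tau Z i t = ((t * mu i 0)%:E +
     \sum_(j < d) (\int[leb]_(s in `[0%R, t]) (kernel_psi phi (t - s)%R i j * s%:E)) * (mu j 0)%:E)%E.
Proof.
move=> t0; rewrite mean_countE.
move: i t t0; apply: (renewal_solution phi_ge0 phi_meas phi_int rho_lt1 mu_ge0 mean_ge0 mean_nd) => i t.
rewrite mean_renewal EFinD -sumEFin; congr (_ + _)%E.
apply: eq_bigr => j _; rewrite conv_symE//.
- rewrite /Rintegral fineK//; rewrite mean_causal.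
  have ic : P.-integrable setT (EFin \o (fun w => \int[leb]_u (cau i j u * count j (t - u) w))).
    apply: (integ_le (Y := fun w => K i j * count j t w)).
    + apply: (measurableT_comp (f := fine)) => //.
      exact: (measurable_fun_fubini_tonelli_G (m1 := leb) _ (@mjoint i j t) (@joint0 i j t)).
    + move=> w; rewrite ger0_norm; last first.
        by apply: Rintegral_ge0 => u _; rewrite mulr_ge0 ?causal_ge0// count_ge0.
      by apply: (causal_Rintegral_le phi_ge0 phi_meas phi_int (f := fun s => count j s w)) => //; [exact: causal_count_integrable|move=> s; exact: count_nd].
    + by apply: integZ; exact: integ_count.
  by rewrite -Ex_EFin.
- exact: measurable_causal_conv.
- by apply/measurable_EFinP; apply: measurable_ndfun => s s'; exact: mean_nd.
- by move=> x; exact: causal_conv_ge0.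
- by move=> x; rewrite lee_fin mean_ge0.
Qed.

Lemma mean_causal_integrable i j t : leb.-integrable setT (EFin \o (fun u => cau i j u * mean j (t - u))).
Proof.
apply: (@causal_bounded_integrable R d phi phi_ge0 phi_meas phi_int i j (mean j) t (mean j t)) => // [|s st].
  by apply: measurable_ndfun => s s'; exact: mean_nd.
by rewrite (ger0_norm (mean_ge0 j s)); exact: mean_nd.
Qed.

(** For a fixed step [h], the suprema over [x <= s] of the increments of the means satisfy
    [y <= mu h + K y] by the renewal equation. They are finite because such increments are at most
    the means at [t]. *)
Lemma mean_lipschitz i s t : s <= t -> mean i t - mean i s <= rate i * (t - s).
Proof.
move=> st; pose h := t - s; have h0 : 0 <= h by rewrite subr_ge0.
pose D j x := mean j (x + h) - mean j x.
pose E j := [set D j x | x in [set x | x <= s]].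
have D0 j x : 0 <= D j x by rewrite subr_ge0 mean_nd// lerDl.
have supE j : has_sup (E j).
  split; first by exists (D j s), s => /=.
  exists (mean j t) => _ [x /= xs <-]; apply: (@le_trans _ _ (mean j (x + h))).
    by rewrite gerBl; exact: mean_ge0.
  by apply: mean_nd; rewrite /h addrCA gerDl subr_le0.
have DE j x : x <= s -> D j x <= sup (E j).
  by move=> xs; apply: sup_upper_bound => //; exists x.
have -> : mean i t - mean i s = D i s by rewrite /D /h subrKC.
apply: le_trans (DE i s (lexx s)) _.
rewrite /rate mulr_suml; under [leRHS]eq_bigr do rewrite -mulrA.
apply: (@le_invmx_sub R d K K0 rho_lt1 (fun j => sup (E j)) (fun j => mu j 0 * h)) => {}i.
apply: ge_sup; first exact: (supE i).1.
move=> _ [x /= xs <-].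
have ic j y := mean_causal_integrable i j y.
have -> : D i x = mu i 0 * (Num.max (x + h) 0 - Num.max x 0) +
    \sum_j \int[leb]_u (cau i j u * D j (x - u)).
  rewrite /D !mean_renewal opprD addrACA -mulrBr -sumrB; congr (_ + _); apply: eq_bigr => j _.
  rewrite -RintegralB//; apply: eq_Rintegral => u _.
  by rewrite -mulrBr; have -> : x + h - u = x - u + h by rewrite addrAC.
apply: lerD.
  rewrite ler_wpM2l//; have [a|a] := leP 0 (x + h); have [b|b] := leP 0 x;
  rewrite ?(max_l a) ?(max_l b) ?(max_r (ltW a)) ?(max_r (ltW b)); move: h0 a b; lra.
apply: ler_sum => j _; apply: (causal_Rintegral_le phi_ge0 phi_meas phi_int (f := D j)) => //; last by move=> y yx; exact: DE (le_trans yx xs).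
have -> : EFin \o (fun u => cau i j u * D j (x - u)) =
   EFin \o (fun u => cau i j u * mean j (x + h - u) - cau i j u * mean j (x - u)).
  by apply/funext => u /=; rewrite -mulrBr; have -> : x + h - u = x - u + h by rewrite addrAC.
exact: (integrableB measurableT (ic j (x + h)) (ic j x)).
Qed.

(** * Moments of order two and four *)

Local Notation good := nonexplosive.
Local Notation integ X := (P.-integrable [set: Om] (EFin \o X)).

Let good_ae := nonexplosive_ae.
Let iC i t : integ (count i t) := integ_count i t.
Let mC i t : measurable_fun setT (count i t) := measurable_count i t.
Let C0 i t w : 0 <= count i t w := count_ge0 i t w.
Let Cnd i s t w : s <= t -> count i s w <= count i t w := @count_nd i s t w.
Let mean0 i t : 0 <= mean i t := mean_ge0 i t.
Let mean_lip i s t : s <= t -> mean i t - mean i s <= rate i * (t - s) := @mean_lipschitz i s t.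
Let rate0 i : 0 <= rate i := rate_ge0 i.
Let bN n i t := bounded_cnt n i t.
Let bM n i t := @bounded_compens_mart n i t.
Let mnoise i t : measurable_fun setT (noise i t) := measurable_noise i t.
Let inoise i t : integ (noise i t) := integ_noise i t.
Local Opaque cnt compens_mart compens count mean noise compensator.

Lemma Ex_compens_mart_sqr n i s t : 0 <= s -> s <= t ->
  Ex (fun w => (M n i t w - M n i s w) ^+ 2) = Ex (fun w => N n.+1 i t w - N n.+1 i s w).
Proof.
move=> s0 st.
have H1 : past_mfun s (fun=> 1) by exact: bounded_mfun_cst.
have := martingale_covariation n s0 st i i H1.
rewrite eqxx mul1r; under [X in Rintegral _ _ X = _]eq_fun do rewrite mul1r -expr2.
by under [X in _ = Rintegral _ _ X -> _]eq_fun do rewrite mul1r.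
Qed.

(** [N <= M + mu t + K N] holds path by path, so the comparison principle bounds counts by
    martingales. *)
Let cnt_le_mart n i t w : 0 <= t ->
  N n i t w <= \sum_j R1 i j * (M n j t w + mu j 0 * t).
Proof.
move=> t0; apply: le_trans (cnt_leS n i t w) _.
apply: (@le_invmx_sub R d K K0 rho_lt1 (fun i => N n.+1 i t w) (fun j => M n j t w + mu j 0 * t)) => {}i.
have := compens_le mu_ge0 phi_ge0 phi_meas phi_int marked n i w t0.
have -> : M n i t w = N n.+1 i t w - A n i t w by [].
move: (A n i t w) (N n.+1 i t w) (\sum_j _) (mu i 0 * t) => *; lra.
Qed.

(** First stage of a bootstrap, uniform in [n]: first moments of N bound M in L^2, hence N in L^2,
    hence M in L^4, hence N in L^4. *)
Let Ex_cnt_sqr t : 0 <= t -> exists C, forall n i, Ex (fun w => N n i t w ^+ 2) <= C.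
Proof.
move=> t0.
exists (\sum_i d%:R * \sum_j R1 i j ^+ 2 * (2 * (rate j * t) + 2 * (mu j 0 * t) ^+ 2)) => n i.
have sq0 i' : 0 <= d%:R * \sum_j R1 i' j ^+ 2 * (2 * (rate j * t) + 2 * (mu j 0 * t) ^+ 2).
  rewrite mulr_ge0//; apply: sumr_ge0 => j _; rewrite mulr_ge0 ?sqr_ge0// addr_ge0//.
    by rewrite !mulr_ge0.
  by rewrite mulr_ge0// sqr_ge0.
apply: (@le_trans _ _ (d%:R * \sum_j R1 i j ^+ 2 * (2 * (rate j * t) + 2 * (mu j 0 * t) ^+ 2))); last first.
  by rewrite [leRHS](bigD1 i)//= lerDl; exact: sumr_ge0.
have bq j : bounded_mfun (fun w => R1 i j ^+ 2 * (2 * M n j t w ^+ 2 + 2 * (mu j 0 * t) ^+ 2)).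
  apply: bounded_mfunZ; apply: bounded_mfunD; last exact: bounded_mfun_cst.
  by apply: bounded_mfunZ; apply: bounded_mfunX; exact: bM.
apply: (@le_trans _ _ (Ex (fun w => d%:R * \sum_j R1 i j ^+ 2 * (2 * M n j t w ^+ 2 + 2 * (mu j 0 * t) ^+ 2)))).
  apply: Ex_le; first by apply: bounded_integrable; apply: bounded_mfunX; exact: bN.
    by apply: bounded_integrable; apply: bounded_mfunZ; exact: bounded_mfun_sum.
  move=> w; apply: (@le_trans _ _ ((\sum_j R1 i j * (M n j t w + mu j 0 * t)) ^+ 2)).
    by rewrite lerXn2r ?nnegrE ?jumps_ge0 ?(le_trans _ (cnt_le_mart n i w t0)) ?jumps_ge0// cnt_le_mart.
  apply: le_trans (sqr_sum_le _) _; rewrite card_ord ler_wpM2l//.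
  apply: ler_sum => j _; rewrite exprMn ler_wpM2l ?sqr_ge0//.
  move: (M n j t w) (mu j 0 * t) => x y; have := sqr_ge0 (x - y); nra.
rewrite ExZ; last by apply: bounded_integrable; exact: bounded_mfun_sum.
rewrite Ex_sum; last by move=> j; exact: bounded_integrable.
rewrite ler_wpM2l//; apply: ler_sum => j _.
have b2 : bounded_mfun (fun w => M n j t w ^+ 2) by apply: bounded_mfunX; exact: bM.
rewrite ExZ; last first.
  by apply/bounded_integrable/bounded_mfunD; [exact: bounded_mfunZ|exact: bounded_mfun_cst].
rewrite ler_wpM2l ?sqr_ge0// ExD; last 2 first.
- exact/bounded_integrable/bounded_mfunZ.
- exact/bounded_integrable/bounded_mfun_cst.
rewrite Ex_cst ExZ; last exact: bounded_integrable.
rewrite lerD2r ler_wpM2l//.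
have -> : (fun w => M n j t w ^+ 2) = (fun w => (M n j t w - M n j 0 w) ^+ 2).
  by apply/funext => w; rewrite (compens_mart0) subr0.
rewrite Ex_compens_mart_sqr//.
under [X in Rintegral _ _ X]eq_fun do rewrite (cnt_le0 _ _ _ (lexx 0)) subr0.
exact: Ex_cnt_le.
Qed.

Let Ex_mart_pow4 t : 0 <= t -> exists2 c, 0 <= c & forall n j, Ex (fun w => M n j t w ^+ 4) <= c.
Proof.
move=> t0; have [C hC] := Ex_cnt_sqr t0.
exists (576 * Num.max C 0).
  by apply: mulr_ge0; [exact: ler0n|rewrite le_max lexx orbT].
move=> n j; have -> : (fun w => M n j t w ^+ 4) = (fun w => (M n j t w - M n j 0 w) ^+ 4).
  by apply/funext => w; rewrite (compens_mart0) subr0.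
apply: le_trans (martingale_fourth_moment n (lexx 0) t0 j) _.
under [X in Rintegral _ _ X]eq_fun do rewrite (cnt_le0 _ _ _ (lexx 0)) subr0.
by apply: ler_wpM2l; [exact: ler0n|rewrite le_max hC].
Qed.

Let Ex_cnt_pow4 t : 0 <= t -> exists C, forall n i, Ex (fun w => N n i t w ^+ 4) <= C.
Proof.
move=> t0; have [c c0 hc] := Ex_mart_pow4 t0.
have p4 (x : R) : 0 <= x ^+ 4 by rewrite -[4%N]/(2 * 2)%N exprM sqr_ge0.
pose b i := d%:R ^+ 3 * \sum_j R1 i j ^+ 4 * (8 * c + 8 * (mu j 0 * t) ^+ 4).
exists (\sum_i b i) => n i.
have b0 i' : 0 <= b i'.
  apply: mulr_ge0; first by apply: exprn_ge0; exact: ler0n.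
  apply: sumr_ge0 => j _; apply: mulr_ge0; first exact: p4.
  by apply: addr_ge0; apply: mulr_ge0; rewrite ?ler0n ?p4.
apply: (@le_trans _ _ (b i)); last by rewrite [leRHS](bigD1 i)//= lerDl; exact: sumr_ge0.
have bq j : bounded_mfun (fun w => R1 i j ^+ 4 * (8 * M n j t w ^+ 4 + 8 * (mu j 0 * t) ^+ 4)).
  apply: bounded_mfunZ; apply: bounded_mfunD; last exact: bounded_mfun_cst.
  by apply: bounded_mfunZ; apply: bounded_mfunX; exact: bM.
have d3 : 0 <= d%:R ^+ 3 :> R by apply: exprn_ge0; exact: ler0n.
apply: (@le_trans _ _ (Ex (fun w => d%:R ^+ 3 * \sum_j R1 i j ^+ 4 * (8 * M n j t w ^+ 4 + 8 * (mu j 0 * t) ^+ 4)))).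
  apply: Ex_le; first by apply: bounded_integrable; apply: bounded_mfunX; exact: bN.
    by apply: bounded_integrable; apply: bounded_mfunZ; exact: bounded_mfun_sum.
  move=> w; set a := fun j => R1 i j * (M n j t w + mu j 0 * t).
  have N0 : 0 <= N n i t w by exact: jumps_ge0.
  have Na : N n i t w <= \sum_j a j by exact: cnt_le_mart.
  apply: (@le_trans _ _ ((\sum_j a j) ^+ 4)).
    by rewrite lerXn2r ?nnegrE// (le_trans N0).
  apply: (@le_trans _ _ (d%:R ^+ 3 * \sum_j a j ^+ 4)).
    by have := pow4_sum_le a; rewrite card_ord.
  rewrite ler_wpM2l//; apply: ler_sum => j _; rewrite /a exprMn; apply: ler_wpM2l; first exact: p4.
  have h : 0 < (1 / 2 : R) < 1 by apply/andP; split; lra.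
  apply: le_trans (pow4D_convex _ _ h) _.
  by rewrite le_eqVlt; apply/orP; left; apply/eqP; field.
rewrite ExZ; last by apply: bounded_integrable; exact: bounded_mfun_sum.
rewrite Ex_sum; last by move=> j; exact: bounded_integrable.
rewrite /b ler_wpM2l//; apply: ler_sum => j _.
have b2 : bounded_mfun (fun w => M n j t w ^+ 4) by apply: bounded_mfunX; exact: bM.
rewrite ExZ; last first.
  by apply/bounded_integrable/bounded_mfunD; [exact: bounded_mfunZ|exact: bounded_mfun_cst].
apply: ler_wpM2l; first exact: p4.
rewrite ExD; last 2 first.
- exact/bounded_integrable/bounded_mfunZ.
- exact/bounded_integrable/bounded_mfun_cst.
rewrite Ex_cst ExZ; last exact: bounded_integrable.
by rewrite lerD2r; apply: ler_wpM2l; [exact: ler0n|exact: hc].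
Qed.

Let count_near i t w : good w -> \forall n \near \oo, count i t w = N n i t w.
Proof. exact: count_near. Qed.

Lemma integ_count_pow4 i t : integ (fun w => count i t w ^+ 4).
Proof.
have [t0|t0] := leP 0 t; last first.
  rewrite (_ : (fun w => _) = fun=> 0); first exact/bounded_integrable/bounded_mfun_cst.
  by apply/funext => w; rewrite (count_le0 _ _ (ltW t0)) expr0n.
have [C hC] := Ex_cnt_pow4 t0.
have p4 (x : R) : 0 <= x ^+ 4 by rewrite -[4%N]/(2 * 2)%N exprM sqr_ge0.
have [] // := @Ex_fatou _ _ _ P (fun n w => N n i t w ^+ 4) (fun w => count i t w ^+ 4) C.
- exact: measurable_funX.
- apply: filterS good_ae => w gw; apply: cvg_near_cst.
  by apply: filterS (count_near i t gw) => n ->.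
- by move=> n; apply: bounded_integrable; apply: bounded_mfunX; exact: bN.
Qed.

Lemma integ_count_sqr i t : integ (fun w => count i t w ^+ 2).
Proof.
apply: (integ_le (Y := fun w => 1 + count i t w ^+ 4)).
- exact: measurable_funX.
- move=> w; rewrite ger0_norm ?sqr_ge0// -[4%N]/(2 * 2)%N exprM.
  have := sqr_ge0 (count i t w ^+ 2 - 1); move: (count i t w ^+ 2) => x; nra.
- apply: integD; last exact: integ_count_pow4.
  exact/bounded_integrable/bounded_mfun_cst.
Qed.

Let posB (s t : R) : s <= t -> 0 <= Num.max t 0 - Num.max s 0 <= t - s.
Proof.
by move=> st; have [a|a] := leP 0 s; have [b|b] := leP 0 t;
  rewrite ?(max_l a) ?(max_l b) ?(max_r (ltW a)) ?(max_r (ltW b)); apply/andP; split; lra.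
Qed.

Let noise_max i t w : noise i t w = noise i (Num.max t 0) w.
Proof.
have [t0|t0] := leP 0 t; first by [].
by rewrite (noise_le0 _ _ (ltW t0)) (noise_le0 _ _ (lexx 0)).
Qed.

Let count_max i t w : count i t w = count i (Num.max t 0) w.
Proof.
have [t0|t0] := leP 0 t; first by [].
by rewrite (count_le0 _ _ (ltW t0)) (count_le0 _ _ (lexx 0)).
Qed.

Let noise_incr_near i s t w : 0 <= s -> s <= t -> good w ->
  \forall n \near \oo, M n i t w - M n i s w = noise i t w - noise i s w.
Proof.
move=> s0 st gw; have t0 := le_trans s0 st.
have h1 := noise_near i t0 gw.
have h2 := noise_near i s0 gw.
by move: h1 h2; apply: filterS2 => n -> ->.
Qed.

(** For the stopped martingales this moment is the mean number of jumps, at most the increment of a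
    Lipschitz mean; Fatou concludes. Negative times reduce to time 0. *)
Lemma noise_incr_sqr i s t : s <= t -> integ (fun w => (noise i t w - noise i s w) ^+ 2) /\
  Ex (fun w => (noise i t w - noise i s w) ^+ 2) <= rate i * (t - s).
Proof.
wlog s0 : s t / 0 <= s => [H st|st].
  have /andP[h1 h2] := posB st.
  have [||a b] := H (Num.max s 0) (Num.max t 0); [by rewrite le_max lexx orbT|by rewrite -subr_ge0|].
  under eq_fun do rewrite noise_max [noise i s _]noise_max; split => //.
  by rewrite (le_trans b)// ler_wpM2l.
have t0 := le_trans s0 st.
have bX n : bounded_mfun (fun w => (M n i t w - M n i s w) ^+ 2).
  by apply: bounded_mfunX; apply: bounded_mfunB; exact: bM.
apply: (@Ex_fatou _ _ _ P (fun n w => (M n i t w - M n i s w) ^+ 2)).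
- by apply: measurable_funX; apply: measurable_funB.
- by move=> n w; rewrite sqr_ge0.
- by move=> w; rewrite sqr_ge0.
- apply: filterS good_ae => w gw; apply: cvg_near_cst.
  by apply: filterS (noise_incr_near i s0 st gw) => n ->.
- by move=> n; exact: bounded_integrable.
- move=> n; rewrite Ex_compens_mart_sqr//.
  apply: le_trans (mean_lip i st); rewrite -ExB//; apply: Ex_le_ae.
  + by apply: bounded_integrable; apply: bounded_mfunB; exact: bN.
  + exact: integB.
  + by apply: filterS good_ae => w gw; exact: cntB_le_count.
Qed.

Lemma integ_countB_sqr i s t : s <= t -> integ (fun w => (count i t w - count i s w) ^+ 2).
Proof.
move=> st; apply: (integ_le (Y := fun w => count i t w ^+ 2)); last exact: integ_count_sqr.
  by apply: measurable_funX; exact: measurable_funB.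
move=> w; have h := Cnd i w st; rewrite ger0_norm ?sqr_ge0// lerXn2r ?nnegrE ?subr_ge0//.
by rewrite gerBl.
Qed.

Lemma noise_incr_pow4 i s t : s <= t -> integ (fun w => (noise i t w - noise i s w) ^+ 4) /\
  Ex (fun w => (noise i t w - noise i s w) ^+ 4) <= 576 * Ex (fun w => (count i t w - count i s w) ^+ 2).
Proof.
wlog s0 : s t / 0 <= s => [H st|st].
  have /andP[h1 h2] := posB st.
  have [||a b] := H (Num.max s 0) (Num.max t 0); [by rewrite le_max lexx orbT|by rewrite -subr_ge0|].
  under eq_fun do rewrite noise_max [noise i s _]noise_max.
  by under [X in 576 * Rintegral _ _ X]eq_fun do rewrite count_max [count i s _]count_max.
have t0 := le_trans s0 st.
have bX n : bounded_mfun (fun w => (M n i t w - M n i s w) ^+ 4).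
  by apply: bounded_mfunX; apply: bounded_mfunB; exact: bM.
apply: (@Ex_fatou _ _ _ P (fun n w => (M n i t w - M n i s w) ^+ 4)).
- by apply: measurable_funX; apply: measurable_funB.
- by move=> n w; exact: pow4_ge0.
- by move=> w; exact: pow4_ge0.
- apply: filterS good_ae => w gw; apply: cvg_near_cst.
  by apply: filterS (noise_incr_near i s0 st gw) => n ->.
- by move=> n; exact: bounded_integrable.
- move=> n; apply: le_trans (martingale_fourth_moment n s0 st i) _.
  apply: ler_wpM2l; first exact: ler0n.
  apply: Ex_le_ae.
  + by apply: bounded_integrable; apply: bounded_mfunX; apply: bounded_mfunB; exact: bN.
  + exact: integ_countB_sqr.
  + apply: filterS good_ae => w gw; have h := cntB_le_count n.+1 i gw st.
    have h0 : 0 <= N n.+1 i t w - N n.+1 i s w by rewrite subr_ge0; exact: jumps_nd.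
    by rewrite lerXn2r ?nnegrE// (le_trans h0).
Qed.

Definition fluct i t w : R := count i t w - mean i t.

Lemma fluctE i t w : fluct i t w = count i t w - mean i t.
Proof. by []. Qed.

Lemma measurable_fluct i t : measurable_fun setT (fluct i t).
Proof. exact: measurable_funB. Qed.

Lemma integ_fluct i t : integ (fluct i t).
Proof. by apply: integB => //; exact/bounded_integrable/bounded_mfun_cst. Qed.

Let mmean i : measurable_fun setT (mean i).
Proof. by apply: measurable_ndfun => s s'; exact: mean_nd. Qed.

Lemma measurable_fluct_joint i t : measurable_fun setT (fun z : R * Om => fluct i (t - z.1) z.2).
Proof.
apply: measurable_funB; first exact: measurable_count_joint.
apply: (measurableT_comp (mmean i)); apply: measurable_funB => //; exact: measurable_fst.
Qed.

Lemma fluct_le0 i t w : t <= 0 -> fluct i t w = 0.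
Proof. by move=> t0; rewrite /fluct (count_le0)// (mean_le0)// subrr. Qed.

Lemma measurable_fluct_path i w : measurable_fun setT (fun s => fluct i s w).
Proof.
apply: measurable_funB => //; apply: measurable_ndfun => s s'; exact: Cnd.
Qed.

Lemma fluct_path_le i s t w : s <= t -> `|fluct i s w| <= count i t w + mean i t.
Proof.
move=> st; rewrite (le_trans (ler_normB _ _))// lerD//.
  by rewrite (ger0_norm (C0 i s w)); exact: Cnd.
by rewrite (ger0_norm (mean0 i s)); exact: mean_nd.
Qed.

Lemma fluct_causal_integrable i j t w :
  leb.-integrable setT (EFin \o (fun u => cau i j u * fluct j (t - u) w)).
Proof.
apply: (@causal_bounded_integrable R d phi phi_ge0 phi_meas phi_int i j (fun s => fluct j s w) t (count j t w + mean j t)).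
  exact: measurable_fluct_path.
by move=> s; exact: fluct_path_le.
Qed.

Lemma fluct_eq i t w : fluct i t w = noise i t w + \sum_j \int[leb]_u (cau i j u * fluct j (t - u) w).
Proof.
rewrite /fluct (mean_renewal).
rewrite noiseE.
have -> : \sum_j \int[leb]_u (cau i j u * (count j (t - u) w - mean j (t - u))) =
  \sum_j \int[leb]_u (cau i j u * count j (t - u) w) - \sum_j \int[leb]_u (cau i j u * mean j (t - u)).
  rewrite -sumrB; apply: eq_bigr => j _.
  have i1 := causal_count_integrable i j t w.
  have i2 := mean_causal_integrable i j t.
  rewrite -(RintegralB measurableT i1 i2).
  by apply: eq_Rintegral => u _; rewrite mulrBr.
by move: (\sum_j _) (\sum_j _) => x y; ring.
Qed.

Local Opaque fluct.

Let iF i t : integ (fluct i t) := integ_fluct i t.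
Let mF i t : measurable_fun setT (fluct i t) := measurable_fluct i t.

(** Cauchy-Schwarz will be used with the constant [q * v i], which has to be positive even if the
    kernel vanishes. *)
Lemma contraction_weight_gt0 : exists (v : 'I_d -> R) (q : R),
  [/\ forall i, 1 <= v i, 0 < q < 1 & forall i, \sum_j K i j * v j <= q * v i].
Proof.
have [v [q [v1 /andP[q0 q1] vq]]] := contraction_weight K0 rho_lt1.
exists v, (Num.max q (1 / 2)); split => //.
  by rewrite lt_max gt_max q1 /=; apply/andP; split; [apply/orP; right|]; lra.
move=> i; rewrite (le_trans (vq i))// ler_wpM2r ?le_max ?lexx//.
exact: le_trans ler01 (v1 i).
Qed.

Section Fixed.
Variables (v : 'I_d -> R) (q h : R).
Hypotheses (v_ge1 : forall i, 1 <= v i) (q01 : 0 < q < 1)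
  (vP : forall i, \sum_j K i j * v j <= q * v i) (h_ge0 : 0 <= h).

(** The weight of the convolution in the convexity inequalities, strictly between [q] and 1: the
    noise keeps a positive weight and [q / r] stays below 1. *)
Let r := (1 + q) / 2.
Let Y j s w := fluct j (s + h) w - fluct j s w.
Let D j s w := noise j (s + h) w - noise j s w.
Let v_gt0 i : 0 < v i. Proof. exact: lt_le_trans ltr01 (v_ge1 i). Qed.
Let q0 : 0 < q. Proof. by case/andP: q01. Qed.
Let r01 : 0 < r < 1. Proof. by case/andP: q01 => a b; rewrite /r; apply/andP; split; lra. Qed.
Let r0 : 0 < r. Proof. by case/andP: r01. Qed.
Let r1 : 0 < 1 - r. Proof. by case/andP: r01 => _; rewrite subr_gt0. Qed.
Let qr : q < r. Proof. by case/andP: q01 => a b; rewrite /r; lra. Qed.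
Let sh s : s <= s + h. Proof. by rewrite lerDl. Qed.

Let Y_path j w : measurable_fun setT (fun s => Y j s w).
Proof.
apply: measurable_funB; last exact: measurable_fluct_path.
apply: (measurableT_comp (f := fun s => fluct j s w)); last exact: measurable_funD.
exact: measurable_fluct_path.
Qed.

Let Y_joint j t : measurable_fun setT (fun z : R * Om => Y j (t - z.1) z.2).
Proof.
have H := measurable_fluct_joint j.
have E : (fun z : R * Om => fluct j (t - z.1 + h) z.2) = (fun z => fluct j (t + h - z.1) z.2).
  by apply/funext => z; rewrite addrAC.
by apply: measurable_funB; [rewrite E; exact: H|exact: H].
Qed.

Let Y_le j s t w : s <= t -> `|Y j s w| <= count j (t + h) w + mean j (t + h).
Proof.
move=> st; have e : Y j s w = (count j (s + h) w - count j s w) - (mean j (s + h) - mean j s).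
  have -> : Y j s w = (count j (s + h) w - mean j (s + h)) - (count j s w - mean j s) by [].
  by move: (count _ _ _) (count _ _ _) (mean _ _) (mean _ _) => *; ring.
have sth : s + h <= t + h by rewrite lerD2r.
rewrite e; exact: norm_incr_le (C0 j s w) (Cnd j w (sh s)) (Cnd j w sth) (mean0 j s) (mean_nd j (sh s)) (mean_nd j sth).
Qed.

Let Y_bnd j w t : exists C, forall s, s <= t -> `|Y j s w| <= C.
Proof. by exists (count j (t + h) w + mean j (t + h)) => s; exact: Y_le. Qed.

Let Y_eq i s w : Y i s w = D i s w + \sum_j \int[leb]_u (cau i j u * Y j (s - u) w).
Proof.
rewrite /Y !(fluct_eq) opprD addrACA -sumrB.
congr (_ + _); apply: eq_bigr => j _.
have i1 := fluct_causal_integrable i j (s + h) w.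
have i2 := fluct_causal_integrable i j s w.
rewrite -(RintegralB measurableT i1 i2).
congr Rintegral; apply/funext => u; rewrite -mulrBr.
by have -> : s + h - u = s - u + h by rewrite addrAC.
Qed.

Let qv_gt0 i : 0 < q * v i. Proof. exact: mulr_gt0. Qed.

Let I i s w := \sum_j \int[leb]_u (cau i j u * Y j (s - u) w).
Let J i s w := \sum_j \int[leb]_u (cau i j u * (Y j (s - u) w ^+ 2 / v j)).

Let I_sqr i s w : I i s w ^+ 2 <= q * v i * J i s w.
Proof.
by apply: (causal_cauchy_schwarz phi_ge0 phi_meas phi_int v_gt0 (qv_gt0 i) (vP i) (f := fun j s => Y j s w)).
Qed.

Let J_sqr i s w : J i s w ^+ 2 <=
  q * v i * \sum_j \int[leb]_u (cau i j u * ((Y j (s - u) w ^+ 2 / v j) ^+ 2 / v j)).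
Proof.
apply: (causal_cauchy_schwarz phi_ge0 phi_meas phi_int v_gt0 (qv_gt0 i) (vP i) (f := fun j s => Y j s w ^+ 2 / v j)).
  by move=> j; apply: measurable_funM => //; exact: measurable_funX.
move=> j; have [C hC] := Y_bnd j w s; exists (C ^+ 2 / v j) => u us.
have c0 : 0 <= C := le_trans (normr_ge0 _) (hC u us).
rewrite normrM normrX (gtr0_norm (x := (v j)^-1)) ?invr_gt0//.
by rewrite ler_wpM2r ?invr_ge0 ?(ltW (v_gt0 j))// lerXn2r ?nnegrE// hC.
Qed.

(** Convexity separates the noise from the convolution, and Cauchy-Schwarz against the kernel brings
    a factor [q * v i]. This is the hypothesis of [causal_contraction] with [b = q / r]. *)
Let P2 i s w : (Y i s w / v i) ^+ 2 <= D i s w ^+ 2 / (1 - r) +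
  q / r / v i * \sum_j \int[leb]_u (cau i j u * (v j * (Y j (s - u) w / v j) ^+ 2)).
Proof.
have -> : \sum_j \int[leb]_u (cau i j u * (v j * (Y j (s - u) w / v j) ^+ 2)) = J i s w.
  apply: eq_bigr => j _; apply: eq_Rintegral => u _; congr (_ * _).
  by field; rewrite gt_eqF.
have h1 := sqrD_convex (D i s w) (I i s w) r01.
rewrite -/(I i s w) -(Y_eq i s w) in h1.
have h2 := I_sqr i s w.
have vi := v_ge1 i; have vi0 := v_gt0 i.
rewrite exprMn exprVn ler_pdivrMr ?exprn_gt0//.
apply: (le_trans h1).
rewrite mulrDl; apply: lerD.
  by rewrite ler_peMr ?divr_ge0 ?sqr_ge0 ?(ltW r1)// exprn_ege1.
have -> : q / r / v i * J i s w * v i ^+ 2 = q * v i * J i s w / r by field; rewrite !gt_eqF.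
by rewrite ler_pM2r ?invr_gt0.
Qed.

(** The same with Cauchy-Schwarz used twice, for [Y] and then for [Y ^+ 2 / v], whence
    [b = (q / r) ^+ 3]. *)
Let P4 i s w : (Y i s w / v i) ^+ 4 <= D i s w ^+ 4 / (1 - r) ^+ 3 +
  (q / r) ^+ 3 / v i * \sum_j \int[leb]_u (cau i j u * (v j * (Y j (s - u) w / v j) ^+ 4)).
Proof.
have -> : \sum_j \int[leb]_u (cau i j u * (v j * (Y j (s - u) w / v j) ^+ 4)) =
    \sum_j \int[leb]_u (cau i j u * ((Y j (s - u) w ^+ 2 / v j) ^+ 2 / v j)).
  apply: eq_bigr => j _; apply: eq_Rintegral => u _; congr (_ * _).
  by field; rewrite gt_eqF.
set S := \sum_j _.
have h1 := pow4D_convex (D i s w) (I i s w) r01.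
rewrite -/(I i s w) -(Y_eq i s w) in h1.
have h2 := I_sqr i s w; have h3 := J_sqr i s w.
rewrite -/S in h3.
have vi := v_ge1 i; have vi0 := v_gt0 i.
rewrite exprMn exprVn ler_pdivrMr ?exprn_gt0//.
apply: (le_trans h1).
rewrite mulrDl; apply: lerD.
  by rewrite ler_peMr ?divr_ge0 ?pow4_ge0 ?exprn_ge0 ?(ltW r1)// exprn_ege1.
have -> : (q / r) ^+ 3 / v i * S * v i ^+ 4 = (q * v i) ^+ 2 * (q * v i * S) / r ^+ 3 by field; rewrite !gt_eqF.
rewrite ler_pM2r ?invr_gt0 ?exprn_gt0//.
apply: (@le_trans _ _ ((q * v i * J i s w) ^+ 2)).
  by rewrite -[4%N]/(2 * 2)%N exprM lerXn2r ?nnegrE ?sqr_ge0// (le_trans (sqr_ge0 _) h2).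
by rewrite exprMn ler_wpM2l ?sqr_ge0.
Qed.

Let rate_sum := \sum_j rate j.

Let D_sqr j s : integ (fun w => D j s w ^+ 2 / (1 - r)) /\
  Ex (fun w => D j s w ^+ 2 / (1 - r)) <= rate_sum * h / (1 - r).
Proof.
have [a b] := noise_incr_sqr j (sh s).
have -> : (fun w => D j s w ^+ 2 / (1 - r)) = (fun w => (1 - r)^-1 * (noise j (s + h) w - noise j s w) ^+ 2).
  by apply/funext => w; rewrite mulrC.
split; first exact: integZ.
rewrite (ExZ _ a) mulrC ler_pM2r ?invr_gt0//; apply: le_trans b _.
have -> : s + h - s = h by rewrite addrC addKr.
by rewrite ler_wpM2r// /rate_sum (bigD1 j)//= lerDl sumr_ge0.
Qed.

Let Y_sqr_le j s t w : s <= t -> Y j s w ^+ 2 <= 2 * count j (t + h) w ^+ 2 + 2 * mean j (t + h) ^+ 2.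
Proof.
move=> st; have := Y_le j w st; have := C0 j (t + h) w; have := mean0 j (t + h).
rewrite -[Y j s w ^+ 2]real_normK ?num_real//.
have := normr_ge0 (Y j s w); move: (`|Y j s w|) (count _ _ _) (mean _ _) => y a b y0 b0 a0 yab.
apply: (@le_trans _ _ ((a + b) ^+ 2)); first by rewrite lerXn2r ?nnegrE// addr_ge0.
by have := sqr_ge0 (a - b); nra.
Qed.

Let Y_pow4_le j s t w : s <= t -> Y j s w ^+ 4 <= 8 * count j (t + h) w ^+ 4 + 8 * mean j (t + h) ^+ 4.
Proof.
move=> st; have := Y_le j w st; have := C0 j (t + h) w; have := mean0 j (t + h).
have -> : Y j s w ^+ 4 = `|Y j s w| ^+ 4 by rewrite -normrX ger0_norm// pow4_ge0.
have := normr_ge0 (Y j s w); move: (`|Y j s w|) (count _ _ _) (mean _ _) => y a b y0 b0 a0 yab.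
apply: (@le_trans _ _ ((a + b) ^+ 4)); first by rewrite lerXn2r ?nnegrE// addr_ge0.
have H : 0 < (1 / 2 : R) < 1 by apply/andP; split; lra.
apply: le_trans (pow4D_convex _ _ H) _.
by rewrite le_eqVlt; apply/orP; left; apply/eqP; field.
Qed.

Let iC2 j t := integ_count_sqr j t.
Let iC4 j t := integ_count_pow4 j t.

Let ib2 j t : integ (fun w => 2 * count j t w ^+ 2 + 2 * mean j t ^+ 2).
Proof. by apply: integD; [exact: integZ|exact/bounded_integrable/bounded_mfun_cst]. Qed.

Let ib4 j t : integ (fun w => 8 * count j t w ^+ 4 + 8 * mean j t ^+ 4).
Proof. by apply: integD; [exact: integZ|exact/bounded_integrable/bounded_mfun_cst]. Qed.

Let mY j s : measurable_fun setT (Y j s). Proof. exact: measurable_funB. Qed.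

Let iY2 j s : integ (fun w => Y j s w ^+ 2).
Proof.
apply: (integ_le (Y := fun w => 2 * count j (s + h) w ^+ 2 + 2 * mean j (s + h) ^+ 2)) => //.
  exact: measurable_funX.
by move=> w; rewrite ger0_norm ?sqr_ge0// Y_sqr_le.
Qed.

Let iY4 j s : integ (fun w => Y j s w ^+ 4).
Proof.
apply: (integ_le (Y := fun w => 8 * count j (s + h) w ^+ 4 + 8 * mean j (s + h) ^+ 4)) => //.
  exact: measurable_funX.
by move=> w; rewrite ger0_norm ?pow4_ge0// Y_pow4_le.
Qed.

Lemma Ex_fluct_incr_sqr i s : integ (fun w => Y i s w ^+ 2) /\
  Ex (fun w => Y i s w ^+ 2) <= v i ^+ 2 * (rate_sum * h / (1 - r) / (1 - q / r * q)).
Proof.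
split=> //.
have vi0 := v_gt0 i.
have E : Ex (fun w => Y i s w ^+ 2) = v i ^+ 2 * Ex (fun w => (Y i s w / v i) ^+ 2).
  rewrite -ExZ.
    congr Rintegral; apply/funext => w; rewrite exprMn exprVn mulrCA divff ?mulr1//.
    by rewrite gt_eqF// exprn_gt0.
  under eq_fun do rewrite exprMn mulrC; exact: integZ.
rewrite E ler_wpM2l ?sqr_ge0//.
have c1 : 0 <= q / r by rewrite divr_ge0// ltW.
have c2 : q / r * q < 1.
  rewrite mulrAC ltr_pdivrMr// mul1r; case/andP: q01 => _ q1.
  by apply: lt_trans qr; rewrite -subr_gt0 -{1}[q]mulr1 -mulrBr mulr_gt0// subr_gt0.
have H := @causal_contraction R d phi _ _ P phi_ge0 phi_meas phi_int v q (q / r) v_ge1 c1 c2 vP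
  (fun j s w => (Y j s w / v j) ^+ 2) (fun j s w => D j s w ^+ 2 / (1 - r)) s (rate_sum * h / (1 - r))
  (\sum_j Ex (fun w => 2 * count j (s + h) w ^+ 2 + 2 * mean j (s + h) ^+ 2)).
apply: H.
- by move=> j s' w; rewrite sqr_ge0.
- by move=> j t; apply: measurable_funX; apply: measurable_funM => //; exact: Y_joint.
- move=> j s' _; under eq_fun do rewrite exprMn mulrC; exact: integZ.
- move=> j s' ss'; apply: (@le_trans _ _ (Ex (fun w => 2 * count j (s + h) w ^+ 2 + 2 * mean j (s + h) ^+ 2))).
    apply: Ex_le => //.
      by under eq_fun do rewrite exprMn mulrC; exact: integZ.
    move=> w; apply: le_trans (Y_sqr_le j w ss'); rewrite exprMn exprVn ler_pdivrMr ?exprn_gt0//.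
    by rewrite ler_peMr ?sqr_ge0// exprn_ege1.
  rewrite (bigD1 j)//= lerDl; apply: sumr_ge0 => k _; apply: Ex_ge0 => w.
  by rewrite addr_ge0// mulr_ge0// sqr_ge0.
- move=> j w; exists (2 * count j (s + h) w ^+ 2 + 2 * mean j (s + h) ^+ 2) => s' ss'.
  apply: le_trans (Y_sqr_le j w ss'); rewrite exprMn exprVn ler_pdivrMr ?exprn_gt0//.
  by rewrite ler_peMr ?sqr_ge0// exprn_ege1.
- by move=> j s' _; exact: (D_sqr j s').1.
- by move=> j s' _; exact: (D_sqr j s').2.
- by move=> j s' w _; exact: P2.
Qed.

Lemma Ex_fluct_incr_pow4 i s c : (forall j s, Ex (fun w => (count j (s + h) w - count j s w) ^+ 2) <= c) ->
  integ (fun w => Y i s w ^+ 4) /\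
  Ex (fun w => Y i s w ^+ 4) <= v i ^+ 4 * (576 * c / (1 - r) ^+ 3 / (1 - (q / r) ^+ 3 * q)).
Proof.
move=> hc; split=> //.
have vi0 := v_gt0 i.
have r3 : 0 < (1 - r) ^+ 3 by rewrite exprn_gt0.
have D4 j s' : integ (fun w => D j s' w ^+ 4 / (1 - r) ^+ 3) /\
    Ex (fun w => D j s' w ^+ 4 / (1 - r) ^+ 3) <= 576 * c / (1 - r) ^+ 3.
  have [a b] := noise_incr_pow4 j (sh s').
  have -> : (fun w => D j s' w ^+ 4 / (1 - r) ^+ 3) = (fun w => ((1 - r) ^+ 3)^-1 * (noise j (s' + h) w - noise j s' w) ^+ 4).
    by apply/funext => w; rewrite mulrC.
  split; first exact: integZ.
  rewrite (ExZ _ a) mulrC ler_pM2r ?invr_gt0//; apply: le_trans b _.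
  by apply: ler_wpM2l; [exact: ler0n|exact: hc].
have E : Ex (fun w => Y i s w ^+ 4) = v i ^+ 4 * Ex (fun w => (Y i s w / v i) ^+ 4).
  rewrite -ExZ.
    congr Rintegral; apply/funext => w; rewrite exprMn exprVn mulrCA divff ?mulr1//.
    by rewrite gt_eqF// exprn_gt0.
  under eq_fun do rewrite exprMn mulrC; exact: integZ.
rewrite E ler_wpM2l ?pow4_ge0//.
have qr1 : q / r <= 1 by rewrite ler_pdivrMr// mul1r ltW.
have qr0 : 0 <= q / r by rewrite divr_ge0// ltW.
have c1 : 0 <= (q / r) ^+ 3 by rewrite exprn_ge0.
have c2 : (q / r) ^+ 3 * q < 1.
  case/andP: q01 => _ q1; apply: le_lt_trans q1.
  by rewrite ler_piMl ?(ltW q0)// exprn_ile1.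
have H := @causal_contraction R d phi _ _ P phi_ge0 phi_meas phi_int v q ((q / r) ^+ 3) v_ge1 c1 c2 vP
  (fun j s w => (Y j s w / v j) ^+ 4) (fun j s w => D j s w ^+ 4 / (1 - r) ^+ 3) s (576 * c / (1 - r) ^+ 3)
  (\sum_j Ex (fun w => 8 * count j (s + h) w ^+ 4 + 8 * mean j (s + h) ^+ 4)).
apply: H.
- by move=> j s' w; rewrite pow4_ge0.
- by move=> j t; apply: measurable_funX; apply: measurable_funM => //; exact: Y_joint.
- move=> j s' _; under eq_fun do rewrite exprMn mulrC; exact: integZ.
- move=> j s' ss'; apply: (@le_trans _ _ (Ex (fun w => 8 * count j (s + h) w ^+ 4 + 8 * mean j (s + h) ^+ 4))).
    apply: Ex_le => //.
      by under eq_fun do rewrite exprMn mulrC; exact: integZ.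
    move=> w; apply: le_trans (Y_pow4_le j w ss'); rewrite exprMn exprVn ler_pdivrMr ?exprn_gt0//.
    by rewrite ler_peMr ?pow4_ge0// exprn_ege1.
  rewrite (bigD1 j)//= lerDl; apply: sumr_ge0 => k _; apply: Ex_ge0 => w.
  by rewrite addr_ge0// mulr_ge0 ?ler0n ?pow4_ge0.
- move=> j w; exists (8 * count j (s + h) w ^+ 4 + 8 * mean j (s + h) ^+ 4) => s' ss'.
  apply: le_trans (Y_pow4_le j w ss'); rewrite exprMn exprVn ler_pdivrMr ?exprn_gt0//.
  by rewrite ler_peMr ?pow4_ge0// exprn_ege1.
- by move=> j s' _; exact: (D4 j s').1.
- by move=> j s' _; exact: (D4 j s').2.
- by move=> j s' w _; exact: P4.
Qed.

End Fixed.

Lemma fluct_incr_sqr : exists2 C, 0 <= C & forall i s t, s <= t ->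
  integ (fun w => (fluct i t w - fluct i s w) ^+ 2) /\
  Ex (fun w => (fluct i t w - fluct i s w) ^+ 2) <= C * (t - s).
Proof.
have [v [q [v1 q01 vP]]] := contraction_weight_gt0.
pose r := (1 + q) / 2; have /andP[q0 q1] := q01.
pose c := (\sum_j rate j) / (1 - r) / (1 - q / r * q).
have r0 : 0 < r by rewrite /r; lra.
have r1 : 0 < 1 - r by rewrite /r; lra.
have c0 : 0 <= c.
  rewrite !mulr_ge0 ?sumr_ge0// ?invr_ge0 ?(ltW r1)// subr_ge0 mulrAC ler_pdivrMr// mul1r.
  by rewrite (@le_trans _ _ (q * 1))// ?ler_wpM2l ?(ltW q0) ?(ltW q1)// /r; lra.
have v20 j : 0 <= v j ^+ 2 * c by rewrite mulr_ge0// sqr_ge0.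
exists (\sum_j v j ^+ 2 * c); first exact: sumr_ge0.
move=> i s t st; have h0 : 0 <= t - s by rewrite subr_ge0.
have [] := Ex_fluct_incr_sqr v1 q01 vP h0 i s.
rewrite subrKC => a b; split => //; apply: le_trans b _.
rewrite (_ : _ * _ = v i ^+ 2 * c * (t - s)); last by rewrite /c -/r; ring.
by rewrite ler_wpM2r// (bigD1 i)//= lerDl sumr_ge0.
Qed.

(** The fluctuation contributes the linear term and the Lipschitz mean the quadratic one. The fourth
    moment inequality for the noise asks for exactly this moment. *)
Lemma count_incr_sqr : exists2 C, 0 <= C & forall i s t, s <= t ->
  Ex (fun w => (count i t w - count i s w) ^+ 2) <= C * ((t - s) + (t - s) ^+ 2).
Proof.
have [C Cge0 hC] := fluct_incr_sqr.
have r20 j : 0 <= 2 * rate j ^+ 2 by rewrite mulr_ge0// sqr_ge0.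
have S0 : 0 <= \sum_j 2 * rate j ^+ 2 by exact: sumr_ge0.
exists (2 * C + \sum_j 2 * rate j ^+ 2); first by rewrite addr_ge0// mulr_ge0.
move=> i s t st; have h0 : 0 <= t - s by rewrite subr_ge0.
have [i1 l1] := hC i s t st.
apply: (@le_trans _ _ (Ex (fun w => 2 * (fluct i t w - fluct i s w) ^+ 2 + 2 * (mean i t - mean i s) ^+ 2))).
  apply: Ex_le.
  - exact: integ_countB_sqr.
  - by apply: integD; [exact: integZ|exact/bounded_integrable/bounded_mfun_cst].
  - move=> w; have -> : fluct i t w - fluct i s w = (count i t w - mean i t) - (count i s w - mean i s) by [].
    set a := count i t w; set b := count i s w; set x := mean i t; set y := mean i s.
    have := sqr_ge0 ((a - x) - (b - y) - (x - y)); nra.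
rewrite ExD; [|exact: integZ|exact/bounded_integrable/bounded_mfun_cst].
rewrite Ex_cst ExZ// mulrDr; set h := t - s in h0 l1 *.
have m0 : 0 <= mean i t - mean i s by rewrite subr_ge0 mean_nd.
have m1 := mean_lip i st.
have m2 : (mean i t - mean i s) ^+ 2 <= rate i ^+ 2 * h ^+ 2.
  by rewrite -exprMn lerXn2r ?nnegrE// (le_trans m0).
have ri : 2 * rate i ^+ 2 <= \sum_j 2 * rate j ^+ 2 by rewrite (bigD1 i)//= lerDl sumr_ge0.
have hh : 0 <= h ^+ 2 by rewrite sqr_ge0.
have e1 : 2 * Ex (fun w => (fluct i t w - fluct i s w) ^+ 2) <= 2 * C * h.
  by rewrite -mulrA ler_wpM2l.
have e2 : 2 * (mean i t - mean i s) ^+ 2 <= (\sum_j 2 * rate j ^+ 2) * h ^+ 2.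
  by apply: (@le_trans _ _ (2 * rate i ^+ 2 * h ^+ 2)); [rewrite -mulrA ler_wpM2l|rewrite ler_wpM2r].
rewrite -mulrDr; apply: le_trans (lerD e1 e2) _.
rewrite [leRHS]mulrDl; apply: lerD; first by rewrite ler_wpM2l ?lerDl// mulr_ge0.
by rewrite ler_wpM2l// lerDr.
Qed.

Lemma noise_incr_pow4_le : exists2 C, 0 <= C & forall i s t, s <= t ->
  integ (fun w => (noise i t w - noise i s w) ^+ 4) /\
  Ex (fun w => (noise i t w - noise i s w) ^+ 4) <= C * ((t - s) + (t - s) ^+ 2).
Proof.
have [C Cge0 hC] := count_incr_sqr.
exists (576 * C); first by apply: mulr_ge0; [exact: ler0n|].
move=> i s t st; have [a b] := noise_incr_pow4 i st.
split=> //; apply: le_trans b _; rewrite -mulrA; apply: ler_wpM2l; [exact: ler0n|exact: hC].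
Qed.

Lemma fluct_incr_pow4 : exists2 C, 0 <= C & forall i s t, s <= t ->
  integ (fun w => (fluct i t w - fluct i s w) ^+ 4) /\
  Ex (fun w => (fluct i t w - fluct i s w) ^+ 4) <= C * ((t - s) + (t - s) ^+ 2).
Proof.
have [C Cge0 hC] := count_incr_sqr.
have [v [q [v1 q01 vP]]] := contraction_weight_gt0.
pose r := (1 + q) / 2; have /andP[q0 q1] := q01.
pose c := 576 * C / (1 - r) ^+ 3 / (1 - (q / r) ^+ 3 * q).
have r0 : 0 < r by rewrite /r; lra.
have r1 : 0 < 1 - r by rewrite /r; lra.
have qr1 : q / r <= 1 by rewrite ler_pdivrMr// mul1r /r; lra.
have qr0 : 0 <= q / r by rewrite divr_ge0// ltW.
have c0 : 0 <= c.
  apply: mulr_ge0; last first.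
    by rewrite invr_ge0 subr_ge0 (le_trans _ (ltW q1))// ler_piMl ?(ltW q0)// exprn_ile1.
  apply: mulr_ge0; last by rewrite invr_ge0 exprn_ge0// ltW.
  by apply: mulr_ge0; [exact: ler0n|].
have v20 j : 0 <= v j ^+ 4 * c by rewrite mulr_ge0// pow4_ge0.
exists (\sum_j v j ^+ 4 * c); first exact: sumr_ge0.
move=> i s t st; have h0 : 0 <= t - s by rewrite subr_ge0.
set h := t - s in h0 *.
have hc j s' : Ex (fun w => (count j (s' + h) w - count j s' w) ^+ 2) <= C * (h + h ^+ 2).
  have ss' : s' <= s' + h by rewrite lerDl.
  by have := hC j s' (s' + h) ss'; rewrite [s' + h - s']addrC addKr.
have [] := Ex_fluct_incr_pow4 v1 q01 vP h0 i s hc.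
rewrite /h subrKC -/h => a b; split => //; apply: le_trans b _.
have H0 : 0 <= h + h ^+ 2 by rewrite addr_ge0// sqr_ge0.
set e := h + h ^+ 2 in H0 *.
rewrite (_ : _ * _ = v i ^+ 4 * c * e); last by rewrite /c -/r; move: (576 : R) => x; ring.
by rewrite ler_wpM2r// (bigD1 i)//= lerDl sumr_ge0.
Qed.

(** * Long time asymptotics *)

Local Notation tail := (causal_tail phi).
Let tail0 i j t : 0 <= tail i j t := causal_tail_ge0 phi_ge0 i j t.
Let R10 i j : 0 <= R1 i j := invmx_sub_ge0 K0 rho_lt1 i j.

Let solve (x b : 'I_d -> R) : (forall i, x i = b i + \sum_j K i j * x j) ->
  forall i, x i = \sum_j R1 i j * b j.
Proof.
move=> xb i; apply/le_anti/andP; split.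
  by apply: (@le_invmx_sub R d K K0 rho_lt1 x b) => j; rewrite -xb.
rewrite -lerN2 -sumrN; under [leRHS]eq_bigr do rewrite -mulrN.
apply: (@le_invmx_sub R d K K0 rho_lt1 (fun j => - x j) (fun j => - b j)) => j.
by rewrite [in leLHS](xb j) opprD lerD2l -sumrN; apply: ler_sum => k _; rewrite mulrN.
Qed.

(** Replacing [mean k (t - u)] by [mean k t] in the renewal equation leaves errors of order
    [Num.min u t]; since [x <= sqrt x] on [0, 1], these are at most [t] times the weight that also
    serves for the random part. *)
Lemma mean_asymp_le i t : 0 < t ->
  `|mean i t - t * rate i| <= t * \sum_j R1 i j * \sum_k rate k * tail j k t.
Proof.
move=> t0.
pose err j := \sum_k \int[leb]_u (cau j k u * (mean k t - mean k (t - u))).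
have im j k := mean_causal_integrable j k t.
have ic j k := causal_integrable phi_ge0 phi_meas phi_int j k.
have iE j k : leb.-integrable setT (EFin \o (fun u => cau j k u * (mean k t - mean k (t - u)))).
  have := integrableB measurableT (integrableZl measurableT (mean k t) (ic j k)) (im j k).
  congr (leb.-integrable _ _); apply/funext => u /=; rewrite -EFinB; congr (_%:E).
  by rewrite mulrBr [mean k t * _]mulrC.
have errE j k : \int[leb]_u (cau j k u * (mean k t - mean k (t - u))) =
    K j k * mean k t - \int[leb]_u (cau j k u * mean k (t - u)).
  have <- : \int[leb]_u cau j k u = K j k by rewrite /Rintegral causal_integral.
  rewrite mulrC -(RintegralZl (mean k t) measurableT (ic j k)).
  rewrite -(RintegralB measurableT (integrableZl measurableT (mean k t) (ic j k)) (im j k)).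
  by congr Rintegral; apply/funext => u; rewrite mulrBr [mean k t * _]mulrC.
have mE j : mean j t = (mu j 0 * t - err j) + \sum_k K j k * mean k t.
  rewrite {1}(mean_renewal) max_l ?(ltW t0)//.
  rewrite /err; under [\sum_k \int[leb]_u (cau j k u * (_ - _))]eq_bigr do rewrite errE.
  by rewrite sumrB; move: (\sum_k _) (\sum_k _) => x y; ring.
have err0 j : 0 <= err j.
  apply: sumr_ge0 => k _; apply: Rintegral_ge0 => u _.
  have [u0|u0] := leP 0 u; last by rewrite causal_neg// mul0r.
  by rewrite mulr_ge0 ?causal_ge0// subr_ge0 mean_nd// gerBl.
have err_le j : err j <= t * \sum_k rate k * tail j k t.
  rewrite mulr_sumr; apply: ler_sum => k _; rewrite mulrA.
  have it := causal_tail_integrable phi_ge0 phi_meas phi_int j k t0.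
  rewrite -(RintegralZl (t * rate k) measurableT it).
  apply: le_Rintegral => //; first exact: (integrableZl measurableT _ it).
  move=> u _; rewrite mulrCA.
  have [u0|u0] := leP 0 u; last by rewrite causal_neg// !mul0r.
  rewrite ler_wpM2l ?causal_ge0//.
  have h1 : mean k t - mean k (t - u) <= rate k * Num.min u t.
    have [ut|tu] := leP u t.
      have tu : t - u <= t by rewrite gerBl.
      by apply: le_trans (mean_lip k tu) _; rewrite opprB addrC subrK.
    have -> : mean k (t - u) = mean k 0.
      by rewrite !(mean_le0)// subr_le0 ltW.
    by apply: le_trans (mean_lip k (ltW t0)) _; rewrite subr0.
  apply: (le_trans h1); rewrite [t * _]mulrC -mulrA ler_wpM2l//.
  have m0 : 0 <= Num.min u t by rewrite le_min u0 ltW.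
  rewrite mulrC -ler_pdivrMr//.
  have x0 : 0 <= Num.min u t / t by rewrite divr_ge0// ltW.
  have x1 := tail_weight_le1 u t0.
  by rewrite -[leLHS](sqr_sqrtr x0) expr2 ler_piMr ?sqrtr_ge0.
have -> : mean i t - t * rate i = - \sum_j R1 i j * err j.
  rewrite (solve mE i) /rate mulr_sumr -sumrB -sumrN; apply: eq_bigr => j _; ring.
rewrite normrN ger0_norm; last by apply: sumr_ge0 => j _; rewrite mulr_ge0.
rewrite mulr_sumr; apply: ler_sum => j _; rewrite mulrCA.
by rewrite ler_wpM2l.
Qed.

(** [(Id - K) X = M - rho], where [rho] averages increments of X against the kernel. Tonelli and the
    L^2 bound on increments give [rho] the size [Num.sqrt (C * t)] times the tails. *)
Lemma fluct_noise_le C : 0 <= C ->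
  (forall i s t, s <= t -> integ (fun w => (fluct i t w - fluct i s w) ^+ 2) /\
    Ex (fun w => (fluct i t w - fluct i s w) ^+ 2) <= C * (t - s)) ->
  forall i t, 0 < t ->
  Ex (fun w => `|fluct i t w - \sum_j R1 i j * noise j t w|) <=
  Num.sqrt (C * t) * \sum_j R1 i j * \sum_k tail j k t.
Proof.
move=> Cge0 hC i t t0.
pose V k s w := `|fluct k t w - fluct k s w|.
have V0 k s w : 0 <= V k s w by exact: normr_ge0.
have mV k : measurable_fun setT (fun z : R * Om => V k (t - z.1) z.2).
  apply: measurableT_comp => //; apply: measurable_funB.
    exact: (measurableT_comp (mF k t) measurable_snd).
  exact: measurable_fluct_joint.
have iV k s : s <= t -> integ (V k s) by move=> _; apply: integ_norm; exact: integB.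
(* For [s < 0] the increment is the one over [0, t], the process being zero before 0; hence the
   minimum. *)
have Vle k s : s <= t -> Ex (V k s) <= Num.sqrt (C * Num.min (t - s) t).
  move=> st.
  have core s' : s' <= t -> Ex (V k s') <= Num.sqrt (C * (t - s')).
    move=> s't; have [i2 l2] := hC k s' t s't.
    have := Ex_sqr_le (integB (iF k t) (iF k s')) i2.
    move=> h; rewrite -[leLHS]ger0_norm; last exact: Ex_ge0.
    by rewrite -sqrtr_sqr ler_wsqrtr// (le_trans h).
  have [s0|s0] := leP 0 s.
    by rewrite min_l ?gerBl//; exact: core.
  rewrite min_r ?lerBrDr ?gerDl ?(ltW s0)//.
  have -> : V k s = V k 0.
    by apply/funext => w; rewrite /V (fluct_le0 k w (ltW s0)) (fluct_le0 k w (lexx 0)).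
  by have := core 0 (ltW t0); rewrite subr0.
have pV k w : exists B, forall s, s <= t -> V k s w <= B.
  exists (2 * (count k t w + mean k t)) => s st.
  have F := @fluct_path_le k.
  have a := F t t w (lexx t); have b := F s t w st.
  rewrite (le_trans (ler_normB _ _))// (le_trans (lerD a b))// mulr_natl mulr2n//.
have VB k s : s <= t -> Ex (V k s) <= Num.sqrt (C * t).
  by move=> st; apply: le_trans (Vle k s st) _; rewrite ler_wsqrtr// ler_wpM2l// ge_min lexx orbT.
have i1 j k := integ_causal_path phi_ge0 phi_meas phi_int j k (V0 k) (mV k) (iV k) (VB k) (pV k).
have l1 j k : Ex (fun w => \int[leb]_u (cau j k u * V k (t - u) w)) <= Num.sqrt (C * t) * tail j k t.
  have it := causal_tail_integrable phi_ge0 phi_meas phi_int j k t0.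
  rewrite -lee_fin Ex_EFin; last exact: i1.
  rewrite (causal_Ex_fubini phi_ge0 phi_meas phi_int j k (V0 k) (mV k) (iV k) (pV k)).
  rewrite EFinM (EFin_Rintegral_int it) -integralZl//.
  have m1 : measurable_fun setT (fun u => (cau j k u * Ex (V k (t - u)))%:E).
    have mJ : measurable_fun setT (fun z : R * Om => (cau j k z.1 * V k (t - z.1) z.2)%:E).
      apply/measurable_EFinP; apply: measurable_funM; last exact: mV.
      by apply: (measurableT_comp (measurable_causal phi_meas j k)); exact: measurable_fst.
    have J0 (z : R * Om) : (0 <= (cau j k z.1 * V k (t - z.1) z.2)%:E)%E.
      by rewrite lee_fin mulr_ge0 ?causal_ge0.
    rewrite (_ : (fun u => _) = (fun u => \int[P]_w (cau j k u * V k (t - u) w)%:E)%E).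
      exact: (measurable_fun_fubini_tonelli_F (m2 := P) _ mJ J0).
    apply/funext => u; have [u0|u0] := leP 0 u; last first.
      by under eq_integral do rewrite causal_neg// mul0r; rewrite integral0 causal_neg// mul0r.
    have iW : integ (V k (t - u)) by apply: iV; rewrite gerBl.
    rewrite EFinM Ex_EFin// -ge0_integralZl//.
    + exact: measurable_int iW.
    + by move=> w _; rewrite lee_fin.
    + by rewrite lee_fin causal_ge0.
  apply: ge0_le_integral => //.
  - by move=> u _; rewrite lee_fin mulr_ge0 ?causal_ge0// Ex_ge0.
  - exact: measurable_int (integrableZl measurableT _ it).
  - move=> u _; rewrite -EFinM lee_fin mulrCA.
    have [u0|u0] := leP 0 u; last by rewrite causal_neg// !mul0r.
    rewrite ler_wpM2l ?causal_ge0//.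
    have tut : t - u <= t by rewrite gerBl.
    apply: le_trans (Vle k _ tut) _.
    have -> : t - (t - u) = u by rewrite opprB addrC subrK.
    have m0 : 0 <= Num.min u t / t by rewrite divr_ge0 ?(ltW t0)// le_min u0 ltW.
    have Ct0 : 0 <= C * t by rewrite mulr_ge0// ltW.
    rewrite -sqrtrM// ler_wsqrtr// -mulrA ler_wpM2l// mulrC divfK// gt_eqF//.
pose rho j w := \sum_k \int[leb]_u (cau j k u * (fluct k t w - fluct k (t - u) w)).
have ic j k := causal_integrable phi_ge0 phi_meas phi_int j k.
have iq j k w := fluct_causal_integrable j k t w.
have rhoE j w : fluct j t w = (noise j t w - rho j w) + \sum_k K j k * fluct k t w.
  have E : \sum_k \int[leb]_u (cau j k u * fluct k (t - u) w) = \sum_k K j k * fluct k t w - rho j w.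
    rewrite /rho -sumrB; apply: eq_bigr => k _.
    have <- : \int[leb]_u cau j k u = K j k by rewrite /Rintegral causal_integral.
    rewrite mulrC -(RintegralZl (fluct k t w) measurableT (ic j k)).
    have E : (fun u => cau j k u * (fluct k t w - fluct k (t - u) w)) =
       (fun u => fluct k t w * cau j k u - cau j k u * fluct k (t - u) w).
      by apply/funext => u; rewrite mulrBr [fluct k t w * _]mulrC.
    rewrite E (RintegralB measurableT (integrableZl measurableT (fluct k t w) (ic j k)) (iq j k w)).
    by rewrite opprB addrC subrK.
  rewrite {1}(fluct_eq) E.
  by move: (noise j t w) (rho j w) (\sum_k _) => x y z; ring.
have ir j k w : leb.-integrable setT (EFin \o (fun u => cau j k u * (fluct k t w - fluct k (t - u) w))).
  have := integrableB measurableT (integrableZl measurableT (fluct k t w) (ic j k)) (iq j k w).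
  congr (leb.-integrable _ _); apply/funext => u /=; rewrite -EFinB; congr (_%:E).
  by rewrite [fluct k t w * _]mulrC -mulrBr.
have rho_le j w : `|rho j w| <= \sum_k \int[leb]_u (cau j k u * V k (t - u) w).
  apply: le_trans (ler_norm_sum _ _ _) _; apply: ler_sum => k _.
  apply: le_trans (le_normr_Rintegral measurableT (ir j k w)) _.
  rewrite le_eqVlt; apply/orP; left; apply/eqP; congr Rintegral; apply/funext => u.
  by rewrite normrM ger0_norm ?causal_ge0.
have E w : fluct i t w - \sum_j R1 i j * noise j t w = - \sum_j R1 i j * rho j w.
  rewrite (solve (fun j => rhoE j w) i) -sumrB -sumrN; apply: eq_bigr => j _; ring.
apply: (@le_trans _ _ (Ex (fun w => \sum_j R1 i j * \sum_k \int[leb]_u (cau j k u * V k (t - u) w)))).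
  apply: Ex_le.
  - apply: integ_norm; apply: integB => //; apply: integ_sum => j; apply: integZ.
    exact: integ_noise.
  - by apply: integ_sum => j; apply: integZ; apply: integ_sum => k; exact: i1.
  - move=> w; rewrite E normrN; apply: le_trans (ler_norm_sum _ _ _) _.
    by apply: ler_sum => j _; rewrite normrM ger0_norm// ler_wpM2l.
rewrite Ex_sum; last by move=> j; apply: integZ; apply: integ_sum => k; exact: i1.
rewrite mulr_sumr; apply: ler_sum => j _; rewrite ExZ; last by apply: integ_sum => k; exact: i1.
rewrite mulrCA ler_wpM2l// Ex_sum; last by move=> k; exact: i1.
by rewrite mulr_sumr; apply: ler_sum => k _; exact: l1.
Qed.

Let tails_cvg0 (c : 'I_d -> R) i : \sum_j R1 i j * \sum_k c k * tail j k t @[t --> +oo] --> 0.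
Proof.
rewrite -[X in _ --> X](_ : \sum_j R1 i j * \sum_k c k * 0 = 0); last first.
  by rewrite big1// => j _; rewrite big1 ?mulr0// => k _; rewrite mulr0.
apply: cvg_big => // [|j _]; first exact: add_continuous.
apply: cvgMr; apply: cvg_big => // [|k _]; first exact: add_continuous.
apply: cvgMr.
exact: (causal_tail_cvg0 phi_ge0 phi_meas phi_int).
Qed.

Let scale_pinfty (v : R) : 0 < v -> T * v @[T --> +oo] --> +oo.
Proof. by move=> v0; apply/cvgryPge => A; near=> T; rewrite -ler_pdivrMr//; near: T; exact: nbhs_pinfty_ge. Unshelve. all: end_near. Qed.

Lemma mean_scaling i v : 0 <= v -> mean i (T * v) / T @[T --> +oo] --> v * rate i.
Proof.
rewrite le_eqVlt => /predU1P[<-|v0].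
  rewrite mul0r; under eq_fun do rewrite mulr0 (mean_le0)// mul0r.
  exact: cvg_cst.
have H : \sum_j R1 i j * \sum_k rate k * tail j k (T * v) @[T --> +oo] --> 0.
  apply: (@cvg_comp _ _ _ (fun T : R => T * v) (fun t => \sum_j R1 i j * \sum_k rate k * tail j k t) _ _ _ (scale_pinfty v0)).
  exact: tails_cvg0.
have H2 : v * \sum_j R1 i j * \sum_k rate k * tail j k (T * v) @[T --> +oo] --> 0.
  by rewrite -[X in _ --> X](mulr0 v); exact: cvgMr.
apply: cvgr_distP => e e0.
apply: filterS2 (nbhs_pinfty_gt (num_real 0)) (cvgr_dist H2 e0) => T T0 h.
have Tv : 0 < T * v by rewrite mulr_gt0.
have := mean_asymp_le i Tv; rewrite distrC => h2.
have -> : v * rate i - mean i (T * v) / T = (T * v * rate i - mean i (T * v)) / T.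
  by field; rewrite gt_eqF.
rewrite normrM (gtr0_norm (x := T^-1)) ?invr_gt0// ler_pdivrMr// (le_trans h2)//.
rewrite -mulrA mulrC ler_pM2r//; apply: le_trans h; rewrite sub0r normrN; exact: ler_norm.
Qed.

Lemma fluct_noise_cvg i v : 0 <= v ->
  Ex (fun w => `|fluct i (T * v) w - \sum_j R1 i j * noise j (T * v) w|) / Num.sqrt T @[T --> +oo] --> 0.
Proof.
rewrite le_eqVlt => /predU1P[<-|v0].
  apply: cvg_near_cst; apply: nearW => T.
  rewrite (_ : (fun w => _) = fun=> 0) ?Ex_cst ?mul0r//; apply/funext => w.
  rewrite mulr0 (fluct_le0)// big1 ?subrr ?normr0// => j _.
  by rewrite (noise_le0)// mulr0.
have [C Cge0 hC] := fluct_incr_sqr.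
have H : \sum_j R1 i j * \sum_k 1 * tail j k (T * v) @[T --> +oo] --> 0.
  apply: (@cvg_comp _ _ _ (fun T : R => T * v) (fun t => \sum_j R1 i j * \sum_k 1 * tail j k t) _ _ _ (scale_pinfty v0)).
  exact: (tails_cvg0 (fun=> 1)).
have H2 : Num.sqrt (C * v) * \sum_j R1 i j * \sum_k 1 * tail j k (T * v) @[T --> +oo] --> 0.
  by rewrite -[X in _ --> X](mulr0 (Num.sqrt (C * v))); exact: cvgMr.
apply: cvgr_distP => e e0.
apply: filterS2 (nbhs_pinfty_gt (num_real 0)) (cvgr_dist H2 e0) => T T0 h.
have Tv : 0 < T * v by rewrite mulr_gt0.
have := fluct_noise_le Cge0 hC i Tv => h2.
have sT : 0 < Num.sqrt T by rewrite sqrtr_gt0.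
rewrite sub0r normrN ger0_norm; last by rewrite divr_ge0 ?sqrtr_ge0// Ex_ge0.
rewrite ler_pdivrMr// (le_trans h2)//.
rewrite mulrCA sqrtrM ?(ltW T0)// -mulrA mulrC ler_pM2r//.
apply: le_trans h; rewrite sub0r normrN; apply: le_trans (ler_norm _).
by under [X in _ <= _ * X]eq_bigr do under eq_bigr do rewrite mul1r.
Qed.

(** The variance of the increment is of order [T], against a normalization [T^2]; [mean_scaling]
    handles the means. *)
Lemma count_lln i s t : 0 <= s -> s <= t ->
  Ex (fun w => `|(count i (T * t) w - count i (T * s) w) / T - (t - s) * rate i|) @[T --> +oo] --> 0.
Proof.
move=> s0 st; have t0 := le_trans s0 st; have ts : 0 <= t - s by rewrite subr_ge0.
have [C Cge0 hC] := fluct_incr_sqr.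
pose g T := `|mean i (T * t) / T - t * rate i| + `|mean i (T * s) / T - s * rate i|.
have gc : g T @[T --> +oo] --> 0.
  have H v : 0 <= v -> `|mean i (T * v) / T - v * rate i| @[T --> +oo] --> 0.
    move=> v0; rewrite -[X in _ --> X](_ : `|v * rate i - v * rate i| = 0); last by rewrite subrr normr0.
    by apply: cvg_norm; apply: cvgB; [exact: mean_scaling|exact: cvg_cst].
  by rewrite -[X in _ --> X](addr0 0); apply: cvgD; exact: H.
apply: cvgr_distP => e e0.
have e2 : 0 < e / 2 by rewrite divr_gt0.
pose A := C * (t - s) / (e / 2) ^+ 2.
apply: filterS3 (nbhs_pinfty_gt (num_real 0)) (nbhs_pinfty_ge (num_real A)) (cvgr_dist gc e2) => T T0 TA h.
have Tst : T * s <= T * t by rewrite ler_wpM2l// ltW.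
have [i2 l2] := hC i _ _ Tst.
have F1 : Ex (fun w => `|fluct i (T * t) w - fluct i (T * s) w|) <= e / 2 * T.
  have h1 := Ex_sqr_le (integB (iF i (T * t)) (iF i (T * s))) i2.
  have eT : 0 <= e / 2 * T by rewrite mulr_ge0// ltW.
  rewrite -(ler_sqr (x := Ex _)) ?nnegrE ?Ex_ge0//; apply: le_trans h1 (le_trans l2 _).
  rewrite exprMn expr2 -mulrBr mulrCA [leRHS]mulrCA ler_wpM2l ?(ltW T0)//.
  by rewrite [leRHS]mulrC -ler_pdivrMr ?mulr_gt0// -expr2.
have -> : (fun w => `|(count i (T * t) w - count i (T * s) w) / T - (t - s) * rate i|) =
  (fun w => `|T^-1 * (fluct i (T * t) w - fluct i (T * s) w) +
     ((mean i (T * t) / T - t * rate i) - (mean i (T * s) / T - s * rate i))|).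
  apply/funext => w; congr (`|_|).
  have fE v : fluct i v w = count i v w - mean i v by [].
  rewrite (fE (T * t)) (fE (T * s)).
  by move: (count i (T * t) w) (count i (T * s) w) (mean i (T * t)) (mean i (T * s)) T^-1 => *; ring.
set c := _ - _ - (_ - _).
have ic : integ (fun w => T^-1 * (fluct i (T * t) w - fluct i (T * s) w)) by apply: integZ; exact: integB.
rewrite sub0r normrN ger0_norm; last exact: Ex_ge0.
apply: (@le_trans _ _ (Ex (fun w => T^-1 * `|fluct i (T * t) w - fluct i (T * s) w| + `|c|))).
  apply: Ex_le.
  - by apply: integ_norm; apply: integD => //; exact/bounded_integrable/bounded_mfun_cst.
  - apply: integD; last exact/bounded_integrable/bounded_mfun_cst.
    by apply: integZ; apply: integ_norm; exact: integB.
  - move=> w; apply: le_trans (ler_normD _ _) _.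
    by rewrite normrM (gtr0_norm (x := T^-1)) ?invr_gt0.
rewrite ExD; last 2 first.
- by apply: integZ; apply: integ_norm; exact: integB.
- exact/bounded_integrable/bounded_mfun_cst.
rewrite Ex_cst ExZ; last by apply: integ_norm; exact: integB.
rewrite [leRHS]splitr; apply: lerD.
  by rewrite mulrC ler_pdivrMr.
rewrite sub0r normrN in h; apply: le_trans (ler_normB _ _) (le_trans (ler_norm _) h).
Qed.

(** * Central limit theorem *)

Let hbnd i t w : R := count i t w + (mu i 0 * t + \sum_j K i j * count j t w).

Let sC i t : square_integrable P (count i t).
Proof. by split => //; exact: integ_count_sqr. Qed.

Let sbnd i t : square_integrable P (hbnd i t).
Proof.
apply: square_integrableD => //; apply: square_integrableD.
  exact/square_integrable_bounded/bounded_mfun_cst.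
by apply: square_integrable_sum => j; exact: square_integrableZ.
Qed.

Let hbnd_ge0 i t w : 0 <= t -> 0 <= hbnd i t w.
Proof.
move=> t0; rewrite addr_ge0// addr_ge0//; first by rewrite mulr_ge0.
by apply: sumr_ge0 => j _; rewrite mulr_ge0.
Qed.

Let mart_bnd n i t w : 0 <= t -> good w -> `|M n i t w| <= hbnd i t w.
Proof.
move=> t0 gw; have -> : M n i t w = N n.+1 i t w - A n i t w by [].
rewrite (le_trans (ler_normB _ _))// lerD//.
  by rewrite ger0_norm ?jumps_ge0//; exact: cnt_le_count.
rewrite ger0_norm; last exact: (compens_ge0 mu_ge0 phi_ge0 marked).
apply: le_trans (compens_le mu_ge0 phi_ge0 phi_meas phi_int marked n i w t0) _.
rewrite lerD2l; apply: ler_sum => j _; rewrite ler_wpM2l//; exact: cnt_le_count.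
Qed.

Let mart_near i t w : 0 <= t -> good w -> \forall n \near \oo, M n i t w = noise i t w.
Proof. by move=> t0 gw; exact: noise_near. Qed.

(** Functions of the noise up to [s] need not be measurable for the history, but they are almost
    sure limits of functions of stopped martingales, which are. The bound 1 suits sines and
    cosines. *)
Definition past_limit (s : R) (H : Om -> R) := exists Hn : nat -> Om -> R,
  [/\ forall n, past_mfun s (Hn n), forall n w, `|Hn n w| <= 1, measurable_fun setT H &
   {ae P, forall w, Hn n w @[n --> \oo] --> H w}].

Let bgood : bounded_mfun (\1_(good) : Om -> R) := bounded_mfun_indic (measurable_nonexplosive).

Lemma noise_orthogonal i s t H : 0 <= s -> s <= t -> past_limit s H ->
  Ex (fun w => H w * (noise i t w - noise i s w)) = 0.
Proof.
move=> s0 st [Hn [pH H1 mH cH]]; have t0 := le_trans s0 st.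
have bH n := past_mfun_bounded (pH n).
have bD n : bounded_mfun (fun w => Hn n w * (M n i t w - M n i s w)).
  by apply: bounded_mfunM => //; apply: bounded_mfunB; exact: bM.
pose B w := hbnd i t w + hbnd i s w.
have [] := @Ex_dominated R _ _ P (fun n w => \1_(good) w * (Hn n w * (M n i t w - M n i s w)))
   (fun w => H w * (noise i t w - noise i s w)) B.
- by move=> n; exact: (bounded_mfunM bgood (bD n)).1.
- by apply: measurable_funM => //; exact: measurable_funB.
- apply: filterS2 good_ae cH => w gw cw.
  rewrite indicE mem_set//; under eq_fun do rewrite mul1r.
  apply: cvgM => //; apply: cvg_near_cst.
  by apply: filterS2 (mart_near i t0 gw) (mart_near i s0 gw) => n -> ->.
- by apply: square_integrable_integ; exact: square_integrableD.
- move=> n w; have [gw|gw] := pselect (good w); last first.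
    by rewrite indicE memNset// mul0r normr0 addr_ge0// hbnd_ge0.
  rewrite indicE mem_set// mul1r normrM; apply: (@le_trans _ _ (1 * B w)); last by rewrite mul1r.
  by apply: ler_pM => //; rewrite (le_trans (ler_normB _ _))// lerD// mart_bnd.
move=> _ cv; apply: (cvg_unique _ cv) => //; apply: cvg_near_cst; apply: nearW => n.
rewrite -[RHS](martingale_increment n i s0 st (pH n)).
apply: Ex_ae_eq.
- exact: (bounded_mfunM bgood (bD n)).1.
- exact: (bD n).1.
- by apply: filterS good_ae => w gw; rewrite indicE mem_set// mul1r.
Qed.

(** The identity for stopped martingales and test variables [Hn] passes to the limit on both sides
    by dominated convergence; the indicator of [good] is inserted because the dominating bounds hold
    there only. *)
Lemma noise_covariation i j s t H : 0 <= s -> s <= t -> past_limit s H ->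
  Ex (fun w => H w * ((noise i t w - noise i s w) * (noise j t w - noise j s w))) =
  (i == j)%:R * Ex (fun w => H w * (count i t w - count i s w)).
Proof.
move=> s0 st [Hn [pH H1 mH cH]]; have t0 := le_trans s0 st.
have bH n := past_mfun_bounded (pH n).
have bD n : bounded_mfun (fun w => Hn n w * ((M n i t w - M n i s w) * (M n j t w - M n j s w))).
  by apply: bounded_mfunM => //; apply: bounded_mfunM; apply: bounded_mfunB; exact: bM.
have bE n : bounded_mfun (fun w => Hn n w * (N n.+1 i t w - N n.+1 i s w)).
  by apply: bounded_mfunM => //; apply: bounded_mfunB; exact: bN.
pose B w := (hbnd i t w + hbnd i s w) * (hbnd j t w + hbnd j s w).
have [] := @Ex_dominated R _ _ P (fun n w => \1_(good) w * (Hn n w * ((M n i t w - M n i s w) * (M n j t w - M n j s w))))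
   (fun w => H w * ((noise i t w - noise i s w) * (noise j t w - noise j s w))) B.
- by move=> n; exact: (bounded_mfunM bgood (bD n)).1.
- by apply: measurable_funM => //; apply: measurable_funM; exact: measurable_funB.
- apply: filterS2 good_ae cH => w gw cw.
  rewrite indicE mem_set//; under eq_fun do rewrite mul1r.
  apply: cvgM => //; apply: cvgM; apply: cvg_near_cst.
    by apply: filterS2 (mart_near i t0 gw) (mart_near i s0 gw) => n -> ->.
  by apply: filterS2 (mart_near j t0 gw) (mart_near j s0 gw) => n -> ->.
- by apply: square_integrableM; exact: square_integrableD.
- move=> n w; have B0 : 0 <= B w by apply: mulr_ge0; apply: addr_ge0; exact: hbnd_ge0.
  have [gw|gw] := pselect (good w); last by rewrite indicE memNset// mul0r normr0.
  rewrite indicE mem_set// mul1r normrM; apply: (@le_trans _ _ (1 * B w)); last by rewrite mul1r.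
  apply: ler_pM => //; rewrite normrM.
  by apply: ler_pM => //; rewrite (le_trans (ler_normB _ _))// lerD// mart_bnd.
move=> _ cv.
have [] := @Ex_dominated R _ _ P (fun n w => \1_(good) w * (Hn n w * (N n.+1 i t w - N n.+1 i s w)))
   (fun w => H w * (count i t w - count i s w)) (fun w => count i t w - count i s w).
- by move=> n; exact: (bounded_mfunM bgood (bE n)).1.
- by apply: measurable_funM => //; exact: measurable_funB.
- apply: filterS2 good_ae cH => w gw cw.
  rewrite indicE mem_set//; under eq_fun do rewrite mul1r.
  apply: cvgM => //; apply: cvg_near_cst.
  have h1 := count_near i t gw; have h2 := count_near i s gw.
  move: h1 h2 => [n1 _ h1] [n2 _ h2]; exists (maxn n1 n2) => // n /=; rewrite geq_max => /andP[m1 m2].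
  by rewrite (h1 n.+1) ?(h2 n.+1)//=; exact: leqW.
- exact: integB.
- move=> n w; have B0 : 0 <= count i t w - count i s w by rewrite subr_ge0 Cnd.
  have [gw|gw] := pselect (good w); last by rewrite indicE memNset// mul0r normr0.
  rewrite indicE mem_set// mul1r normrM; apply: (@le_trans _ _ (1 * (count i t w - count i s w))); last by rewrite mul1r.
  apply: ler_pM => //; rewrite ger0_norm; first exact: cntB_le_count.
  by rewrite subr_ge0; exact: jumps_nd.
move=> _ cv2.
have cv3 : (i == j)%:R * Ex (fun w => \1_(good) w * (Hn n w * (N n.+1 i t w - N n.+1 i s w))) @[n --> \oo] -->
  (i == j)%:R * Ex (fun w => H w * (count i t w - count i s w)) by exact: cvgMr.
apply: (cvg_unique _ cv) => //; apply: cvg_trans cv3; apply: near_eq_cvg; apply: nearW => n.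
transitivity ((i == j)%:R * Ex (fun w => Hn n w * (N n.+1 i t w - N n.+1 i s w))).
  congr (_ * _); apply: Ex_ae_eq.
  - exact: (bounded_mfunM bgood (bE n)).1.
  - exact: (bE n).1.
  - by apply: filterS good_ae => w gw; rewrite indicE mem_set// mul1r.
rewrite -(martingale_covariation n s0 st i j (pH n)).
apply: Ex_ae_eq.
- exact: (bD n).1.
- exact: (bounded_mfunM bgood (bD n)).1.
- by apply: filterS good_ae => w gw; rewrite indicE mem_set// mul1r.
Qed.

Let snoise i s t : s <= t -> square_integrable P (fun w => noise i t w - noise i s w).
Proof.
move=> st; split; first exact: measurable_funB.
exact: (noise_incr_sqr i st).1.
Qed.

Lemma past_limit_trig (n : nat) (t : nat -> R) (th : nat -> 'I_d -> R) (a : R) (F : R -> R) :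
  (forall k, 0 <= t k) -> (forall k, t k <= t k.+1) -> continuous F -> (forall x, `|F x| <= 1) ->
  past_limit (t n) (fun w => F (\sum_(k < n) \sum_i th k i * (noise i (t k.+1) w - noise i (t k) w) + a)).
Proof.
move=> t0 tS cF F1; have mF' : measurable_fun setT F by exact: continuous_measurable_fun.
have tle k l : (k <= l)%N -> t k <= t l.
  by move=> kl; apply: (@homo_leq R t (fun x y => is_true (x <= y))) => // y x z; exact: le_trans.
exists (fun m w => F (\sum_(k < n) \sum_i th k i * (M m i (t k.+1) w - M m i (t k) w) + a)); split => //.
- move=> m; split; last by exists 1.
  have pM i k : (k <= n)%N -> past_mfun (t n) (M m i (t k)).
    by move=> kn; apply: (compens_mart_past) => //; exact: tle.
  apply: measurableT_comp => //; apply: measurable_funD => //.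
  apply: measurable_fun_sumr => k; apply: measurable_fun_sumr => i; apply: measurable_funM => //.
  by apply: measurable_funB; [exact: (pM i k.+1 (ltn_ord k)).1|exact: (pM i k (ltnW (ltn_ord k))).1].
- apply: measurableT_comp => //; apply: measurable_funD => //.
  apply: measurable_fun_sumr => k; apply: measurable_fun_sumr => i; apply: measurable_funM => //.
  exact: measurable_funB.
- apply: filterS good_ae => w gw; apply: continuous_cvg; first exact: cF.
  apply: cvgD; last exact: cvg_cst.
  apply: cvg_big => // [|k _]; first exact: add_continuous.
  apply: cvg_big => // [|i _]; first exact: add_continuous.
  apply: cvgMr; apply: cvg_near_cst.
  by apply: filterS2 (mart_near i (t0 k.+1) gw) (mart_near i (t0 k) gw) => m -> ->.
Qed.

(** In the expansion of the cosine the linear term vanishes by orthogonality, and the quadratic one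
    reduces to counts, without mixed terms, by covariation. Replacing counts by the constants [m i]
    gives the first error, the Taylor remainder the second. *)
Lemma noise_step (n : nat) (t : nat -> R) (th : nat -> 'I_d -> R) (a : R) (m : 'I_d -> R) :
  (forall k, 0 <= t k) -> (forall k, t k <= t k.+1) ->
  let S n w := \sum_(k < n) \sum_i th k i * (noise i (t k.+1) w - noise i (t k) w) in
  let U w := \sum_i th n i * (noise i (t n.+1) w - noise i (t n) w) in
  integ (fun w => `|U w| ^+ 3) ->
  `|Ex (fun w => cos (S n.+1 w + a)) - (1 - (\sum_i th n i ^+ 2 * m i) / 2) * Ex (fun w => cos (S n w + a))|
  <= (\sum_i th n i ^+ 2 * Ex (fun w => `|count i (t n.+1) w - count i (t n) w - m i|)) / 2 +
     2 * Ex (fun w => `|U w| ^+ 3).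
Proof.
move=> t0 tS S U iU3.
pose Dn i w := noise i (t n.+1) w - noise i (t n) w.
pose Dc i w := count i (t n.+1) w - count i (t n) w.
pose C w := cos (S n w + a); pose Sn w := sin (S n w + a).
have cos1 : forall x : R, `|cos x| <= 1 by move=> x; exact: cos_max.
have sin1 : forall x : R, `|sin x| <= 1 by move=> x; exact: sin_max.
have pC := past_limit_trig n th a t0 tS (@continuous_cos R) cos1.
have pS := past_limit_trig n th a t0 tS (@continuous_sin R) sin1.
have mS k : measurable_fun setT (S k).
  by apply: measurable_fun_sumr => l; apply: measurable_fun_sumr => i; apply: measurable_funM => //; exact: measurable_funB.
have bC k : bounded_mfun (fun w => cos (S k w + a)) by apply: bounded_mfun_cos; exact: measurable_funD.
have bS : bounded_mfun Sn by apply: bounded_mfun_sin; exact: measurable_funD.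
have sD i : square_integrable P (Dn i) by exact: snoise.
have sU : square_integrable P U by apply: square_integrable_sum => i; exact: (square_integrableZ _ (sD i)).
have iD i := square_integrable_integ (sD i).
have iDc i : integ (Dc i) by exact: integB.
have iSU : integ (fun w => Sn w * U w) by apply: integMb => //; exact: square_integrable_integ.
have iCU : integ (fun w => C w * U w ^+ 2) by exact: (integMb sU.2 (bC n)).
have E1 : Ex (fun w => Sn w * U w) = 0.
  have -> : (fun w => Sn w * U w) = (fun w => \sum_i th n i * (Sn w * Dn i w)).
    by apply/funext => w; rewrite mulr_sumr; apply: eq_bigr => i _; rewrite mulrCA.
  have iSD i : integ (fun w => Sn w * Dn i w) by exact: (integMb (iD i) bS).
  rewrite Ex_sum; last by move=> i; exact: integZ.
  rewrite big1// => i _; rewrite ExZ//.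
  by rewrite [X in _ * X](noise_orthogonal i (t0 n) (tS n) pS) mulr0.
have E2 : Ex (fun w => C w * U w ^+ 2) = \sum_i th n i ^+ 2 * Ex (fun w => C w * Dc i w).
  have -> : (fun w => C w * U w ^+ 2) = (fun w => \sum_i \sum_j th n i * th n j * (C w * (Dn i w * Dn j w))).
    apply/funext => w; rewrite expr2 /U big_distrlr/= mulr_sumr; apply: eq_bigr => i _.
    by rewrite mulr_sumr; apply: eq_bigr => j _; rewrite -/(Dn i w) -/(Dn j w); ring.
  have iDD i j : integ (fun w => C w * (Dn i w * Dn j w)) by exact: (integMb (square_integrableM (sD i) (sD j)) (bC n)).
  rewrite Ex_sum; last by move=> i; apply: integ_sum => j; exact: integZ.
  apply: eq_bigr => i _; rewrite Ex_sum; last by move=> j; exact: integZ.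
  rewrite (bigD1 i)//= big1 ?addr0; last first.
    move=> j ji; rewrite ExZ//.
    by rewrite [X in _ * X](noise_covariation i j (t0 n) (tS n) pC) eq_sym (negbTE ji) mul0r mulr0.
  rewrite ExZ// -expr2; congr (_ * _).
  by rewrite (noise_covariation i i (t0 n) (tS n) pC) eqxx mul1r.
have iCD i : integ (fun w => C w * Dc i w) by exact: (integMb (iDc i) (bC n)).
have S1 w : S n.+1 w + a = S n w + a + U w by rewrite /S big_ord_recr/= addrAC.
pose Er w := cos (S n.+1 w + a) - C w + U w * Sn w + U w ^+ 2 / 2 * C w.
have Er_le w : `|Er w| <= 2 * `|U w| ^+ 3 by rewrite /Er S1; exact: cosD_taylor.
have mU : measurable_fun setT U by exact: sU.1.
have mEr : measurable_fun setT Er.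
  apply: measurable_funD.
    apply: measurable_funD; first exact: measurable_funB (bC n.+1).1 (bC n).1.
    by apply: measurable_funM => //; exact: bS.1.
  apply: measurable_funM; last exact: (bC n).1.
  by apply: measurable_funM => //; exact: measurable_funX.
have iEr : integ Er by apply: (integ_le mEr Er_le); exact: integZ.
have icos k := bounded_integrable P (bC k).
have E3 : Ex (fun w => cos (S n.+1 w + a)) =
   Ex C - (\sum_i th n i ^+ 2 * Ex (fun w => C w * Dc i w)) / 2 + Ex Er.
  have -> : (fun w => cos (S n.+1 w + a)) = (fun w => C w - Sn w * U w - 2^-1 * (C w * U w ^+ 2) + Er w).
    apply/funext => w; rewrite /Er.
    by move: (cos (S n.+1 w + a)) (C w) (Sn w) (U w) => x y z u; field.
  have i1 : integ (fun w => C w - Sn w * U w) by apply: integB => //; exact: (icos n).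
  have i2 : integ (fun w => 2^-1 * (C w * U w ^+ 2)) by exact: integZ.
  rewrite (ExD (integB i1 i2) iEr) (ExB i1 i2) (ExB (icos n) iSU) E1 subr0 ExZ// E2.
  by rewrite [2^-1 * _]mulrC.
have E4 i : Ex (fun w => C w * Dc i w) = m i * Ex C + Ex (fun w => C w * (Dc i w - m i)).
  have i3 : integ (fun w => C w * (Dc i w - m i)).
    have i5 : integ (fun w => Dc i w - m i) by apply: integB => //; exact/bounded_integrable/bounded_mfun_cst.
    exact: (integMb i5 (bC n)).
  have i4 : integ (fun w => m i * C w) by apply: integZ; exact: (icos n).
  rewrite -ExZ; last exact: (icos n).
  rewrite -ExD//; congr Rintegral; apply/funext => w; ring.
have E5 i : `|Ex (fun w => C w * (Dc i w - m i))| <= Ex (fun w => `|Dc i w - m i|).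
  have i5 : integ (fun w => Dc i w - m i) by apply: integB => //; exact/bounded_integrable/bounded_mfun_cst.
  have i3 : integ (fun w => C w * (Dc i w - m i)) by exact: (integMb i5 (bC n)).
  apply: le_trans (Ex_norm i3) _; apply: Ex_le; [exact: integ_norm|exact: integ_norm|].
  by move=> w; rewrite normrM -[leRHS]mul1r ler_wpM2r// cos1.
have -> : Ex (fun w => cos (S n.+1 w + a)) - (1 - (\sum_i th n i ^+ 2 * m i) / 2) * Ex C =
  - ((\sum_i th n i ^+ 2 * Ex (fun w => C w * (Dc i w - m i))) / 2) + Ex Er.
  rewrite E3; under eq_bigr do rewrite E4 mulrDr mulrA.
  rewrite big_split/= -mulr_suml; move: (\sum_i _) (\sum_i _) (Ex C) (Ex Er) => x y z u; by field.
apply: le_trans (ler_normD _ _) _; apply: lerD.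
  rewrite normrN normrM (gtr0_norm (x := 2^-1)) ?invr_gt0// ler_wpM2r// ?invr_ge0//.
  apply: le_trans (ler_norm_sum _ _ _) _; apply: ler_sum => i _.
  by rewrite normrM ger0_norm ?sqr_ge0// ler_wpM2l ?sqr_ge0.
apply: le_trans (Ex_norm iEr) _; rewrite -ExZ//.
by apply: Ex_le => //; [exact: integ_norm|exact: integZ].
Qed.

Definition noise_sum (T : R) (m : nat) (th : nat -> 'I_d -> R) (j : nat) (w : Om) : R :=
  \sum_(k < j) \sum_i th k i / Num.sqrt T *
    (noise i (T * (k.+1%:R / m%:R)) w - noise i (T * (k%:R / m%:R)) w).

Let stepB (T : R) m k : (0 < m)%N -> T * (k.+1%:R / m%:R) - T * (k%:R / m%:R) = T / m%:R.
Proof. by move=> m0; rewrite -natr1; field; rewrite pnatr_eq0 -lt0n. Qed.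

Let step_le (T : R) m k : 0 < T -> (0 < m)%N -> T * (k%:R / m%:R) <= T * (k.+1%:R / m%:R).
Proof. by move=> T0 m0; rewrite -subr_ge0 stepB// divr_ge0// ltW. Qed.

(** With [h = 1 / m], second moments are of order h and fourth moments of order [h^2], the linear
    part of the latter being absorbed since [T^-1 <= h]. Interpolation with [a = Num.sqrt h] gives
    [h^(3/2)]. *)
Let cube_bound (B : R) : 0 <= B -> exists2 C, 0 <= C & forall m T k (th : nat -> 'I_d -> R),
  (0 < m)%N -> 0 < T -> m%:R <= T -> (forall k i, `|th k i| <= B) ->
  let U w := \sum_i th k i / Num.sqrt T *
    (noise i (T * (k.+1%:R / m%:R)) w - noise i (T * (k%:R / m%:R)) w) in
  integ (fun w => `|U w| ^+ 3) /\ Ex (fun w => `|U w| ^+ 3) <= C * (m%:R^-1 * Num.sqrt m%:R^-1).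
Proof.
move=> B0.
have [C4 C40 hC4] := noise_incr_pow4_le.
pose rs := \sum_i rate i; have rs0 : 0 <= rs by exact: sumr_ge0.
pose C1 := d%:R * B ^+ 2 * rs; pose C2 := d%:R ^+ 3 * (d%:R * (B ^+ 4 * C4 * 2)).
have C10 : 0 <= C1 by rewrite !mulr_ge0 ?sqr_ge0.
have C20 : 0 <= C2 by rewrite !mulr_ge0 ?pow4_ge0 ?exprn_ge0.
exists (C1 + C2); first exact: addr_ge0.
move=> m T k th m0 T0 mT thB U.
pose h : R := m%:R^-1.
have mR : 0 < m%:R :> R by rewrite ltr0n.
have h0 : 0 < h by rewrite invr_gt0.
have hT : T^-1 <= h by rewrite lef_pV2 ?posrE.
pose D i w := noise i (T * (k.+1%:R / m%:R)) w - noise i (T * (k%:R / m%:R)) w.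
have st := step_le k T0 m0.
have D2 i : integ (fun w => D i w ^+ 2) /\ Ex (fun w => D i w ^+ 2) <= rate i * (T * h).
  have := noise_incr_sqr i st.
  by rewrite stepB.
have D4 i : integ (fun w => D i w ^+ 4) /\ Ex (fun w => D i w ^+ 4) <= C4 * (T * h + (T * h) ^+ 2).
  by have := hC4 i _ _ st; rewrite stepB.
have mU : measurable_fun setT U.
  by apply: measurable_fun_sumr => i; apply: measurable_funM => //; exact: measurable_funB.
have sT : Num.sqrt T ^+ 2 = T by rewrite sqr_sqrtr// ltW.
have th2 i : (th k i / Num.sqrt T) ^+ 2 <= B ^+ 2 / T.
  rewrite exprMn exprVn sT ler_wpM2r ?invr_ge0 ?(ltW T0)//.
  by rewrite -[leLHS]real_normK ?num_real// lerXn2r ?nnegrE.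
have th4 i : (th k i / Num.sqrt T) ^+ 4 <= B ^+ 4 / T ^+ 2.
  rewrite -[4%N]/(2 * 2)%N !exprM -expr_div_n lerXn2r ?nnegrE ?sqr_ge0 ?divr_ge0 ?sqr_ge0 ?(ltW T0)//.
have U2 w : U w ^+ 2 <= d%:R * \sum_i B ^+ 2 / T * D i w ^+ 2.
  apply: le_trans (sqr_sum_le _) _; rewrite card_ord ler_wpM2l//; apply: ler_sum => i _.
  by rewrite exprMn ler_wpM2r ?sqr_ge0.
have U4 w : U w ^+ 4 <= d%:R ^+ 3 * \sum_i B ^+ 4 / T ^+ 2 * D i w ^+ 4.
  apply: le_trans (pow4_sum_le _) _; rewrite card_ord ler_wpM2l ?exprn_ge0//; apply: ler_sum => i _.
  by rewrite exprMn ler_wpM2r ?pow4_ge0.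
have i2 : integ (fun w => d%:R * \sum_i B ^+ 2 / T * D i w ^+ 2).
  by apply: integZ; apply: integ_sum => i; apply: integZ; exact: (D2 i).1.
have i4 : integ (fun w => d%:R ^+ 3 * \sum_i B ^+ 4 / T ^+ 2 * D i w ^+ 4).
  by apply: integZ; apply: integ_sum => i; apply: integZ; exact: (D4 i).1.
have iU2 : integ (fun w => U w ^+ 2).
  apply: (integ_le (measurable_funX 2 mU) _ i2) => w.
  by rewrite ger0_norm ?sqr_ge0.
have iU4 : integ (fun w => U w ^+ 4).
  apply: (integ_le (measurable_funX 4 mU) _ i4) => w.
  by rewrite ger0_norm ?pow4_ge0.
have l2 : Ex (fun w => U w ^+ 2) <= C1 * h.
  apply: le_trans (Ex_le iU2 i2 U2) _.
  rewrite ExZ; last by apply: integ_sum => i; apply: integZ; exact: (D2 i).1.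
  rewrite Ex_sum; last by move=> i; apply: integZ; exact: (D2 i).1.
  have -> : C1 * h = d%:R * \sum_i B ^+ 2 * (rate i * h).
    by rewrite /C1 /rs -mulr_sumr -mulr_suml; ring.
  rewrite ler_wpM2l//; apply: ler_sum => i _.
  rewrite ExZ; last exact: (D2 i).1.
  apply: (@le_trans _ _ (B ^+ 2 / T * (rate i * (T * h)))).
    by rewrite ler_wpM2l ?(D2 i).2// divr_ge0 ?sqr_ge0// ltW.
  by rewrite le_eqVlt; apply/orP; left; apply/eqP; field; rewrite gt_eqF.
have l4 : Ex (fun w => U w ^+ 4) <= C2 * h ^+ 2.
  apply: le_trans (Ex_le iU4 i4 U4) _.
  rewrite ExZ; last by apply: integ_sum => i; apply: integZ; exact: (D4 i).1.
  rewrite Ex_sum; last by move=> i; apply: integZ; exact: (D4 i).1.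
  rewrite /C2 -[leRHS]mulrA ler_wpM2l ?exprn_ge0//.
  apply: (@le_trans _ _ (\sum_(i < d) B ^+ 4 * C4 * 2 * h ^+ 2)); last first.
    by rewrite sumr_const card_ord -[leRHS]mulrA mulr_natl.
  apply: ler_sum => i _; rewrite ExZ; last exact: (D4 i).1.
  apply: (@le_trans _ _ (B ^+ 4 / T ^+ 2 * (C4 * (T * h + (T * h) ^+ 2)))).
    by rewrite ler_wpM2l ?(D4 i).2// divr_ge0 ?pow4_ge0 ?sqr_ge0.
  have -> : B ^+ 4 / T ^+ 2 * (C4 * (T * h + (T * h) ^+ 2)) = B ^+ 4 * C4 * (T^-1 * h + h ^+ 2).
    by field; rewrite gt_eqF.
  rewrite -[leRHS]mulrA ler_wpM2l ?mulr_ge0 ?pow4_ge0// mulr_natl mulr2n lerD2r expr2.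
  by rewrite ler_wpM2r// ltW.
have sh : 0 < Num.sqrt h by rewrite sqrtr_gt0.
have [a b] := Ex_cube_le sh iU2 iU4.
split => //; apply: le_trans b _; rewrite -/h mulrDl; apply: lerD.
  have -> : C1 * (h * Num.sqrt h) = Num.sqrt h * (C1 * h) by ring.
  by rewrite ler_wpM2l// ltW.
apply: (@le_trans _ _ ((Num.sqrt h)^-1 * (C2 * h ^+ 2))); first by rewrite ler_wpM2l// invr_ge0 ltW.
rewrite le_eqVlt; apply/orP; left; apply/eqP.
have {1}-> : h ^+ 2 = h * (Num.sqrt h * Num.sqrt h) by rewrite -expr2 sqr_sqrtr ?(ltW h0)// expr2.
by field; rewrite gt_eqF.
Qed.

(** Induction on the number of cells. The error of the law of large numbers vanishes as [T] grows on
    a fixed grid and goes into [e]; the others, of order [h^(3/2)] per cell, remain and only a finer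
    grid reduces their sum. *)
Let charfun_error (B : R) : 0 <= B -> exists2 C, 0 <= C & forall m (th : nat -> 'I_d -> R) a,
  (0 < m)%N -> (forall k i, `|th k i| <= B) ->
  forall j (e : R), 0 < e -> \forall T \near +oo,
  `|Ex (fun w => cos (noise_sum T m th j w + a)) -
    expR (- ((\sum_(k < j) \sum_i th k i ^+ 2 * rate i) / m%:R / 2)) * cos a| <=
  j%:R * (C * (m%:R^-1 * Num.sqrt m%:R^-1)) + e.
Proof.
move=> B0; have [C' C'0 hC'] := cube_bound B0.
pose rs := \sum_i rate i; have rs0 : 0 <= rs by exact: sumr_ge0.
pose C3 := B ^+ 2 * rs / 2; have C30 : 0 <= C3 by rewrite !mulr_ge0 ?sqr_ge0// invr_ge0.
exists (2 * C' + C3 ^+ 2); first by rewrite addr_ge0 ?mulr_ge0 ?sqr_ge0.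
move=> m th a m0 thB; pose h : R := m%:R^-1.
have mR : 0 < m%:R :> R by rewrite ltr0n.
have h0 : 0 < h by rewrite invr_gt0.
have h1 : h <= 1 by rewrite invf_le1// ler1n.
have sh1 : h <= Num.sqrt h.
  by rewrite -{1}[h]sqr_sqrtr ?(ltW h0)// expr2 ler_piMr ?sqrtr_ge0// -sqrtr1 ler_wsqrtr.
rewrite -/h; set C := 2 * C' + _.
elim=> [|j ih] e e0.
  apply: nearW => T; rewrite /noise_sum; under [X in Rintegral _ _ X]eq_fun do rewrite big_ord0 add0r.
  by rewrite Ex_cst big_ord0 !mul0r oppr0 expR0 mul1r subrr normr0 add0r ltW.
have e2 : 0 < e / 2 by rewrite divr_gt0.
pose s : R := j%:R / m%:R; pose t : R := j.+1%:R / m%:R.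
have s0 : 0 <= s by rewrite divr_ge0.
have st : s <= t by rewrite ler_pM2r ?invr_gt0// ler_nat.
have tsh : t - s = h by rewrite /t /s -mulrBl -natr1 addrC addKr mul1r.
pose g T := (\sum_i th j i ^+ 2 * Ex (fun w => `|(count i (T * t) w - count i (T * s) w) / T - h * rate i|)) / 2.
have gc : g T @[T --> +oo] --> 0.
  rewrite -[X in _ --> X](_ : (\sum_i th j i ^+ 2 * 0) / 2 = 0); last first.
    by rewrite big1 ?mul0r// => i _; rewrite mulr0.
  apply: cvgMl; apply: cvg_big => // [|i _]; first exact: add_continuous.
  apply: cvgMr; have := count_lln i s0 st.
  by rewrite tsh.
apply: filterS3 (filterI (ih _ e2) (cvgr_dist gc e2)) (nbhs_pinfty_gt (num_real 0))
  (nbhs_pinfty_ge (num_real m%:R)) => T [IH gT] T0 mT.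
have [iU lU] := hC' m T j th m0 T0 mT thB.
pose tt k : R := T * (k%:R / m%:R).
have tt0 k : 0 <= tt k by rewrite mulr_ge0 ?divr_ge0 ?(ltW T0).
have ttS k : tt k <= tt k.+1 by exact: step_le.
have := @noise_step
  j tt (fun k i => th k i / Num.sqrt T) a (fun i => T * (h * rate i)) tt0 ttS iU.
rewrite -/(noise_sum T m th j.+1) -/(noise_sum T m th j).
set E1 := Ex (fun w => cos (noise_sum T m th j.+1 w + a)).
set E0 := Ex (fun w => cos (noise_sum T m th j w + a)).
have sT : Num.sqrt T ^+ 2 = T by rewrite sqr_sqrtr// ltW.
pose c := (\sum_i th j i ^+ 2 * rate i) * h / 2.
have -> : (\sum_i (th j i / Num.sqrt T) ^+ 2 * (T * (h * rate i))) / 2 = c.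
  rewrite /c; congr (_ / 2); rewrite mulr_suml; apply: eq_bigr => i _; rewrite exprMn exprVn sT.
  by field; rewrite gt_eqF.
have -> : (\sum_i (th j i / Num.sqrt T) ^+ 2 *
    Ex (fun w => `|count i (tt j.+1) w - count i (tt j) w - T * (h * rate i)|)) / 2 = g T.
  rewrite /g; congr (_ / 2); apply: eq_bigr => i _; rewrite exprMn exprVn sT -mulrA; congr (_ * _).
  rewrite -ExZ; last first.
    apply: integ_norm; apply: integB; first exact: integB.
    exact/bounded_integrable/bounded_mfun_cst.
  congr Rintegral; apply/funext => w; have TV : `|T^-1| = T^-1 by rewrite gtr0_norm// invr_gt0.
  rewrite -{1}TV -normrM; congr (`|_|); rewrite /tt -/t -/s.
  by move: (count i (T * t) w) (count i (T * s) w) (h * rate i) => x y z; field; rewrite gt_eqF.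
move=> step.
have c0 : 0 <= c.
  by rewrite /c divr_ge0// mulr_ge0 ?(ltW h0)//; apply: sumr_ge0 => i _; rewrite mulr_ge0 ?sqr_ge0.
have cC : c <= C3 * h.
  rewrite /c /C3 [leRHS]mulrAC ler_pM2r ?invr_gt0// ler_pM2r// /rs mulr_sumr.
  apply: ler_sum => i _; rewrite ler_wpM2r// -[leLHS]real_normK ?num_real//.
  by rewrite lerXn2r ?nnegrE.
have c2 : c ^+ 2 <= C3 ^+ 2 * (h * Num.sqrt h).
  apply: (@le_trans _ _ ((C3 * h) ^+ 2)); first by rewrite lerXn2r ?nnegrE// mulr_ge0// ltW.
  by rewrite exprMn ler_wpM2l ?sqr_ge0// expr2 ler_wpM2l// ltW.
have E01 : `|E0| <= 1.
  have mS : measurable_fun setT (fun w => noise_sum T m th j w + a).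
    apply: measurable_funD => //; apply: measurable_fun_sumr => k; apply: measurable_fun_sumr => i.
    by apply: measurable_funM => //; exact: measurable_funB.
  have bS := bounded_mfun_cos mS.
  apply: le_trans (Ex_norm (bounded_integrable P bS)) _; rewrite -[leRHS](Ex_cst P).
  apply: Ex_le; [exact/integ_norm/bounded_integrable|exact/bounded_integrable/bounded_mfun_cst|].
  by move=> w; exact: cos_max.
have eq := expR_quadratic c0.
have ec1 : expR (- c) <= 1 by rewrite -expR0 ler_expR oppr_le0.
have -> : expR (- ((\sum_(k < j.+1) \sum_i th k i ^+ 2 * rate i) / m%:R / 2)) =
   expR (- c) * expR (- ((\sum_(k < j) \sum_i th k i ^+ 2 * rate i) / m%:R / 2)).
  by rewrite -expRD big_ord_recr/= /c -/h; congr expR; field.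
move: IH; set F := expR (- ((\sum_(k < j) _) / _ / 2)) => IH.
(* The error of the step, that of [1 - c] against the exponential, and the previous error damped by
   a factor at most 1. *)
have -> : E1 - expR (- c) * F * cos a = (E1 - (1 - c) * E0) + (1 - c - expR (- c)) * E0 +
   expR (- c) * (E0 - F * cos a) by ring.
apply: le_trans (ler_normD _ _) _.
have t1 : `|E1 - (1 - c) * E0 + (1 - c - expR (- c)) * E0| <=
   (e / 2 + 2 * (C' * (h * Num.sqrt h))) + C3 ^+ 2 * (h * Num.sqrt h).
  apply: le_trans (ler_normD _ _) _; apply: lerD.
    apply: le_trans step _; apply: lerD.
      by apply: le_trans (ler_norm _) _; rewrite -[g T]opprK normrN -[- g T]sub0r.
    by rewrite ler_wpM2l.
  rewrite normrM; apply: le_trans c2; rewrite -[leRHS]mulr1; exact: ler_pM.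
have t2 : `|expR (- c) * (E0 - F * cos a)| <= j%:R * (C * (h * Num.sqrt h)) + e / 2.
  by rewrite normrM (ger0_norm (expR_ge0 _)) -[leRHS]mul1r ler_pM ?expR_ge0.
apply: le_trans (lerD t1 t2) _.
rewrite -[j.+1%:R]natr1 /C; move: (h * Num.sqrt h) (j%:R : R) => x y.
by rewrite le_eqVlt; apply/orP; left; apply/eqP; field.
Qed.

Let noise_sum_refine T n L th w : (0 < n)%N -> (0 < L)%N ->
  noise_sum T (n * L) (fun k => th (k %/ L)%N) (n * L) w = noise_sum T n th n w.
Proof.
move=> n0 L0; rewrite /noise_sum.
rewrite (sum_blocks n L (fun k => \sum_i th (k %/ L)%N i / Num.sqrt T *
  (noise i (T * (k.+1%:R / (n * L)%:R)) w - noise i (T * (k%:R / (n * L)%:R)) w))).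
apply: eq_bigr => k _; rewrite exchange_big/=; apply: eq_bigr => i _.
under eq_bigr => l _ do rewrite divnMDl// divn_small// addn0.
rewrite -mulr_sumr; congr (_ * _).
pose f l := noise i (T * ((k * L + l)%N%:R / (n * L)%:R)) w.
rewrite (eq_bigr (fun l : 'I_L => f l.+1 - f l)); last by move=> l _; rewrite /f addnS.
rewrite sum_increments /f addn0.
have n1 : n%:R != 0 :> R by rewrite pnatr_eq0 -lt0n.
have L1 : L%:R != 0 :> R by rewrite pnatr_eq0 -lt0n.
have -> : (k * L + L)%N%:R / (n * L)%N%:R = k.+1%:R / n%:R :> R.
  by rewrite -mulSnr !natrM; field; rewrite n1.
have -> // : (k * L)%N%:R / (n * L)%N%:R = k%:R / n%:R :> R.
by rewrite !natrM; field; rewrite n1.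
Qed.

(** Refining the grid L times changes neither side, by [noise_sum_refine], while the [n L] cells
    cost [(n L)^(-3/2)] each, hence [(n L)^(-1/2)] in all, with L at will. *)
Lemma noise_charfun n (th : nat -> 'I_d -> R) a : (0 < n)%N ->
  Ex (fun w => cos (noise_sum T n th n w + a)) @[T --> +oo] -->
  expR (- ((\sum_(k < n) \sum_i th k i ^+ 2 * rate i) / n%:R / 2)) * cos a.
Proof.
move=> n0.
(* Only the weights with [k < n] enter the statement; cutting off the others makes them bounded. *)
wlog : th / exists2 B, 0 <= B & forall k i, `|th k i| <= B => [H|[B B0 thB]].
  pose th' k i := if (k < n)%N then th k i else 0.
  have thE k : (k < n)%N -> th' k = th k by move=> kn; apply/funext => i; rewrite /th' kn.
  have -> : \sum_(k < n) \sum_i th k i ^+ 2 * rate i = \sum_(k < n) \sum_i th' k i ^+ 2 * rate i.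
    by apply: eq_bigr => k _; apply: eq_bigr => i _; rewrite thE.
  have -> : (fun T => Ex (fun w => cos (noise_sum T n th n w + a))) =
     (fun T => Ex (fun w => cos (noise_sum T n th' n w + a))).
    apply/funext => T; congr Rintegral; apply/funext => w; congr (cos (_ + _)).
    by apply: eq_bigr => k _; apply: eq_bigr => i _; rewrite thE.
  apply: H; exists (\sum_(k < n) \sum_i `|th k i|).
    by apply: sumr_ge0 => k _; exact: sumr_ge0.
  move=> k i; rewrite /th'; case: ltnP => kn; last first.
    by rewrite normr0; apply: sumr_ge0 => l _; exact: sumr_ge0.
  rewrite (bigD1 (Ordinal kn))//= (bigD1 i)//= -addrA lerDl addr_ge0//; first exact: sumr_ge0.
  by apply: sumr_ge0 => l _; exact: sumr_ge0.
have [C Cge0 hC] := charfun_error B0.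
apply: cvgr_distP => e e0; have e2 : 0 < e / 2 by rewrite divr_gt0.
pose L := (Num.truncn ((C / (e / 2)) ^+ 2)).+1.
have nL : (0 < n * L)%N by rewrite muln_gt0 n0.
have := hC (n * L)%N (fun k => th (k %/ L)%N) a nL (fun k i => thB _ i) (n * L)%N _ e2.
apply: filterS => T; under [X in Rintegral _ _ X]eq_fun do rewrite noise_sum_refine//.
have -> : (\sum_(k < n * L) \sum_i th (k %/ L)%N i ^+ 2 * rate i) / (n * L)%:R =
   (\sum_(k < n) \sum_i th k i ^+ 2 * rate i) / n%:R.
  rewrite (sum_blocks n L (fun k => \sum_i th (k %/ L)%N i ^+ 2 * rate i)).
  under eq_bigr => k _ do under eq_bigr => l _ do rewrite divnMDl// divn_small// addn0.
  under eq_bigr do rewrite sumr_const card_ord.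
  rewrite sumrMnl -mulr_natr natrM; field.
  by rewrite !pnatr_eq0 -!lt0n n0.
rewrite distrC => h; apply: le_trans h _; rewrite [leRHS]splitr lerD2r.
have nLR : 0 < (n * L)%:R :> R by rewrite ltr0n.
have -> : (n * L)%:R * (C * ((n * L)%:R^-1 * Num.sqrt (n * L)%:R^-1)) = C * Num.sqrt (n * L)%:R^-1 :> R.
  by rewrite mulrCA mulVKf ?gt_eqF.
have sN : 0 < Num.sqrt (n * L)%:R :> R by rewrite sqrtr_gt0.
have -> : Num.sqrt (n * L)%:R^-1 = (Num.sqrt (n * L)%:R)^-1 :> R by rewrite sqrtrV// ltW.
rewrite ler_pdivrMr// mulrC -ler_pdivrMr//.
have Ce : 0 <= C / (e / 2) by rewrite divr_ge0// ltW.
rewrite -[leLHS](ger0_norm Ce) -sqrtr_sqr ler_wsqrtr// (le_trans (ltW (truncnS_gt _)))//.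
by rewrite ler_nat leq_pmull.
Qed.

(** * Finite dimensional convergence *)

Definition fluct_grid n (T : R) (p : 'I_n.+1 * 'I_d) (w : Om) : R :=
  fluct p.2 (T * (p.1%:R / n%:R)) w / Num.sqrt T.

Section BrownianLimit.
Context d' (Om' : measurableType d') (Q : probability Om' R) (W : R -> Om' -> 'cV[R]_d).
Hypothesis W_bm : standard_brownian_motion Q W.

Definition limit_grid n (p : 'I_n.+1 * 'I_d) (w : Om') : R :=
  \sum_j R1 p.2 j * (Num.sqrt (rate j) * W (p.1%:R / n%:R) w j 0).

Let cos_lip (x y : R) : `|cos x - cos y| <= `|x - y|.
Proof.
wlog yx : x y / y <= x => [H|].
  by have [/H//|/ltW/H] := leP y x; rewrite distrC [`|y - x|]distrC.
have [<-|yx'] := eqVneq y x; first by rewrite !subrr.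
have {yx'}yx' : y < x by rewrite lt_neqAle yx' yx.
have [z _ ->] := @MVT R cos (fun z => - sin z) y x yx' (fun z _ => is_derive_cos z)
   (continuous_subspaceT (@continuous_cos R)).
by rewrite normrM normrN ler_piMl// sin_max.
Qed.

(** Once the fluctuation is replaced by [R1] times the noise, Abel summation turns the linear form
    into a [noise_sum]. The cosine being Lipschitz, the replacement costs an L^1 error that vanishes
    after scaling. *)
Lemma fluct_grid_charfun n (xi : 'I_n.+1 * 'I_d -> R) (a : R) : (0 < n)%N ->
  Ex (fun w => cos (\sum_p xi p * fluct_grid T p w + a)) @[T --> +oo] -->
  \int[Q]_w cos (\sum_p xi p * limit_grid p w + a).
Proof.
move=> n0; have nR : 0 < n%:R :> R by rewrite ltr0n.
pose th := abel_weight xi R1.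
have -> : \int[Q]_w cos (\sum_p xi p * limit_grid p w + a) =
   expR (- ((\sum_(k < n) \sum_i th k i ^+ 2 * rate i) / n%:R / 2)) * cos a.
  have [_ W0 _ _ _] := W_bm.
  under [\sum_(k < n) _]eq_bigr => k _ do under eq_bigr => i _ do
    rewrite -[rate i]sqr_sqrtr// -exprMn.
  rewrite -(brownian_charfun W_bm (fun k i => th k i * Num.sqrt (rate i)) a n0).
  congr Rintegral; apply/funext => w; congr (cos (_ + _)).
  rewrite (abel_summation xi R1 (f := fun k j => Num.sqrt (rate j) * W (k%:R / n%:R) w j 0)); last first.
    by move=> j; rewrite mul0r W0 mxE mulr0.
  apply: eq_bigr => k _; apply: eq_bigr => j _; rewrite -mulrBr mulrA//.
pose X' T (p : 'I_n.+1 * 'I_d) w := \sum_j R1 p.2 j * noise j (T * (p.1%:R / n%:R)) w / Num.sqrt T.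
have E T w : \sum_p xi p * X' T p w = noise_sum T n th n w.
  rewrite /X'; under eq_bigr => p _ do under eq_bigr => j _ do rewrite -mulrA.
  rewrite (abel_summation xi R1 (f := fun k j => noise j (T * (k%:R / n%:R)) w / Num.sqrt T)); last first.
    by move=> j; rewrite mul0r mulr0 (noise_le0)// mul0r.
  apply: eq_bigr => k _; apply: eq_bigr => j _; rewrite -mulrBl -/th.
  by move: (noise _ _ _) (noise _ _ _) (th _ _) (Num.sqrt T)^-1 => x y z u; ring.
have H : Ex (fun w => cos (noise_sum T n th n w + a)) @[T --> +oo] -->
  expR (- ((\sum_(k < n) \sum_i th k i ^+ 2 * rate i) / n%:R / 2)) * cos a.
  exact: noise_charfun _ _ _ n0.
pose g T := \sum_p `|xi p| * (Ex (fun w => `|fluct p.2 (T * (p.1%:R / n%:R)) w -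
   \sum_j R1 p.2 j * noise j (T * (p.1%:R / n%:R)) w|) / Num.sqrt T).
have gc : g T @[T --> +oo] --> 0.
  rewrite -[X in _ --> X](_ : \sum_p `|xi p| * 0 = 0); last by rewrite big1// => p _; rewrite mulr0.
  apply: cvg_big => // [|p _]; first exact: add_continuous.
  apply: cvgMr; apply: (fluct_noise_cvg).
  by rewrite divr_ge0.
have bcos (Y : 'I_n.+1 * 'I_d -> Om -> R) : (forall p, measurable_fun setT (Y p)) ->
    bounded_mfun (fun w => cos (\sum_p xi p * Y p w + a)).
  move=> mY; apply: bounded_mfun_cos; apply: measurable_funD => //.
  by apply: measurable_fun_sumr => p; exact: measurable_funM.
have mX T p : measurable_fun setT (fluct_grid (n := n) T p) by apply: measurable_funM.
have mX' T p : measurable_fun setT (X' T p).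
  apply: measurable_fun_sumr => j; apply: measurable_funM; last exact: measurable_cst.
  by apply: measurable_funM; [exact: measurable_cst|exact: mnoise].
have iD T p : integ (fun w => fluct_grid T p w - X' T p w).
  apply: integB.
    rewrite (_ : fluct_grid T p = fun w => (Num.sqrt T)^-1 * fluct p.2 (T * (p.1%:R / n%:R)) w); first exact: integZ.
    by apply/funext => w; rewrite mulrC.
  apply: integ_sum => j.
  rewrite (_ : (fun _ => _) = fun w => R1 p.2 j / Num.sqrt T * noise j (T * (p.1%:R / n%:R)) w); first exact: integZ.
  by apply/funext => w; rewrite mulrAC.
have D_le T : `|Ex (fun w => cos (\sum_p xi p * fluct_grid T p w + a)) -
    Ex (fun w => cos (noise_sum T n th n w + a))| <= g T.
  under [X in _ - Rintegral _ _ X]eq_fun do rewrite -E.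
  have b1 := bcos _ (mX T); have b2 := bcos _ (mX' T).
  rewrite -ExB; [|exact: bounded_integrable..].
  apply: le_trans (Ex_norm (bounded_integrable P (bounded_mfunB b1 b2))) _.
  apply: (@le_trans _ _ (Ex (fun w => \sum_p `|xi p| * `|fluct_grid T p w - X' T p w|))).
    apply: Ex_le.
    - exact/integ_norm/bounded_integrable/bounded_mfunB.
    - by apply: integ_sum => p; apply: integZ; exact: integ_norm.
    - move=> w; apply: le_trans (cos_lip _ _) _.
      rewrite opprD addrACA subrr addr0 -sumrB; apply: le_trans (ler_norm_sum _ _ _) _.
      by apply: ler_sum => p _; rewrite -mulrBr normrM.
  rewrite Ex_sum; last by move=> p; apply: integZ; exact: integ_norm.
  apply: ler_sum => p _; rewrite ExZ; last exact: integ_norm.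
  rewrite ler_wpM2l// mulrC -ExZ; last first.
    apply: integ_norm; apply: integB => //; apply: integ_sum => j; exact: integZ.
  rewrite le_eqVlt; apply/orP; left; apply/eqP; congr Rintegral; apply/funext => w.
  have {1}<- : `|(Num.sqrt T)^-1| = (Num.sqrt T)^-1 by rewrite ger0_norm// invr_ge0 sqrtr_ge0.
  rewrite -normrM; congr (`|_|); rewrite /fluct_grid /X' mulrBr [_ * fluct _ _ _]mulrC; congr (_ - _).
  by rewrite mulr_sumr; apply: eq_bigr => j _; rewrite mulrC.
apply: cvgr_distP => e e0; have e2 : 0 < e / 2 by rewrite divr_gt0.
apply: filterS2 (cvgr_dist H e2) (cvgr_dist gc e2) => T h1 h2.
rewrite [leRHS]splitr; apply: le_trans (ler_distD (Ex (fun w => cos (noise_sum T n th n w + a))) _ _) _.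
apply: lerD => //; rewrite distrC; apply: le_trans (D_le T) _.
by rewrite sub0r normrN in h2; apply: le_trans (ler_norm _) h2.
Qed.

(** The second moments required by [levy_continuity] come from [fluct_incr_sqr] started at time 0,
    where the process vanishes. *)
Lemma fluct_grid_cvg n (g : ('I_n.+1 * 'I_d -> R) -> R) (L B : R) : (0 < n)%N -> 0 <= L ->
  (forall x x', `|g x - g x'| <= L * \sum_p `|x p - x' p|) -> (forall x, `|g x| <= B) ->
  Ex (fun w => g (fun p => fluct_grid T p w)) @[T --> +oo] -->
  \int[Q]_w g (fun p => limit_grid p w).
Proof.
move=> n0 L0 gL gB; have nR : 0 < n%:R :> R by rewrite ltr0n.
have [C Cge0 hC] := fluct_incr_sqr.
have [mW _ _ _ _] := W_bm.
have k01 (p : 'I_n.+1 * 'I_d) : 0 <= (p.1%:R / n%:R : R) <= 1.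
  by rewrite divr_ge0//= ler_pdivrMr// mul1r ler_nat -ltnS.
have mY (p : 'I_n.+1 * 'I_d) : measurable_fun setT (limit_grid p).
  apply: measurable_fun_sumr => j; apply: measurable_funM => //; apply: measurable_funM => //.
  exact: mW.
have sY (p : 'I_n.+1 * 'I_d) : square_integrable Q (limit_grid p).
  apply: square_integrable_sum => j; apply: square_integrableZ; apply: square_integrableZ.
  by split; [exact: mW|exact: (brownian_second_moment W_bm)].
pose CY := \sum_(p : 'I_n.+1 * 'I_d) \int[Q]_w (limit_grid p w ^+ 2).
have CY0 (p : 'I_n.+1 * 'I_d) : 0 <= \int[Q]_w (limit_grid p w ^+ 2) by apply: Rintegral_ge0 => w _; rewrite sqr_ge0.
apply: (@levy_continuity R _ _ _ _ _ P Q (@fluct_grid n) (@limit_grid n) (C + CY) _ _ _ _ _ g L B) => //.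
- by move=> T p; apply: measurable_funM.
- apply: filterS (nbhs_pinfty_gt (num_real 0)) => T T0 p; have /andP[v0 v1] := k01 p.
  have Tv0 : 0 <= T * (p.1%:R / n%:R) by rewrite mulr_ge0// ltW.
  have [i1 l1] := hC p.2 _ _ Tv0.
  have E : (fun w => fluct_grid T p w ^+ 2) = (fun w => T^-1 * (fluct p.2 (T * (p.1%:R / n%:R)) w - fluct p.2 0 w) ^+ 2).
    apply/funext => w; rewrite (fluct_le0 _ _ (lexx 0)) subr0 /fluct_grid exprMn exprVn sqr_sqrtr ?(ltW T0)//.
    by rewrite mulrC.
  rewrite E; split; first exact: integZ.
  rewrite ExZ// mulrC ler_pdivrMr//; apply: le_trans l1 _; rewrite subr0.
  apply: (@le_trans _ _ (C * T)); first by rewrite ler_wpM2l// ler_piMr// ltW.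
  by rewrite ler_wpM2r ?(ltW T0)// lerDl sumr_ge0.
- move=> p; split; first exact: (sY p).2.
  by rewrite /CY (bigD1 p)//= addrCA lerDl addr_ge0// sumr_ge0.
- by move=> xi a; exact: fluct_grid_charfun.
Qed.

End BrownianLimit.

(** * Tightness *)

(** Counts and means are both nondecreasing, so an intermediate value departs from the initial one
    by at most the end increment plus the growth of the mean. *)
Let fluct_between i a s b w : a <= s -> s <= b ->
  `|fluct i s w - fluct i a w| <= `|fluct i b w - fluct i a w| + rate i * (b - a).
Proof.
move=> as_ sb; have ab := le_trans as_ sb.
have h1 := Cnd i w as_; have h2 := Cnd i w sb; have h3 := mean_nd i as_; have h4 := mean_nd i sb.
have h5 := mean_lip i ab.
rewrite !fluctE; move: (count i a w) (count i s w) (count i b w) (mean i a) (mean i s) (mean i b) h1 h2 h3 h4 h5.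
move: (rate i * (b - a)) => v x y z x' y' z' h1 h2 h3 h4 h5.
have := ler_norm (z - z' - (x - x')); have := normr_ge0 (z - z' - (x - x')).
by rewrite ler_norml => h6 h7; apply/andP; split; lra.
Qed.

(** The chaining goes from mesh [1 / n] to a mesh comparable with [1 / T], where the quadratic term
    of the fourth moments still controls the linear one; inside the last cells [fluct_between] takes
    over. *)
Lemma fluct_tight (e : R) : 0 < e -> \forall n \near \oo, \forall T \near +oo,
  exists X : Om -> R, [/\ integ X, forall w, 0 <= X w, Ex X <= e &
    forall w t i, 0 <= t <= 1 ->
      `|fluct i (T * t) w / Num.sqrt T -
        fluct i (T * ((Num.truncn (t * n%:R))%:R / n%:R)) w / Num.sqrt T| <= X w].
Proof.
move=> e0; have [C Cge0 hC] := fluct_incr_pow4.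
(* The threshold at level l is a (9/10)^l: the thresholds are summable, and so are
   the fourth moments divided by its cube, since (10/9)^3 / 2 <= 7/10. *)
pose a := e / 80; have a0 : 0 < a by rewrite divr_gt0.
pose lam l : R := a * (9 / 10) ^+ l.
have lam0 l : 0 < lam l by rewrite mulr_gt0// exprn_gt0// divr_gt0.
pose rs := \sum_i rate i; have rs0 : 0 <= rs by exact: sumr_ge0.
pose CC : R := 2 * (d%:R * (3 * C) / a ^+ 3 * 4).
have CC0 : 0 <= CC by rewrite !mulr_ge0 ?invr_ge0 ?exprn_ge0 ?(ltW a0).
exists (Num.truncn (CC / (e / 4))).+1 => // n /= hn.
have n0 : (0 < n)%N by apply: leq_ltn_trans hn.
have nR : 0 < n%:R :> R by rewrite ltr0n.
have hCC : CC / n%:R <= e / 4.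
  rewrite ler_pdivrMr// -ler_pdivrMl ?divr_gt0// mulrC.
  by rewrite (le_trans (ltW (truncnS_gt _)))// ler_nat.
apply: filterS2 (nbhs_pinfty_ge (num_real n%:R)) (nbhs_pinfty_ge (num_real ((4 * rs / e) ^+ 2 + 1))) => T nT rT.
have T0 : 0 < T by apply: lt_le_trans nT.
have sT : 0 < Num.sqrt T by rewrite sqrtr_gt0.
have hrs : rs / Num.sqrt T <= e / 4.
  rewrite ler_pdivrMr// -ler_pdivrMl ?divr_gt0// invf_div mulrC mulrA [rs * 4]mulrC.
  rewrite -[leLHS]ger0_norm; last by rewrite divr_ge0 ?mulr_ge0// ltW.
  by rewrite -sqrtr_sqr ler_wsqrtr// (le_trans _ rT)// lerDl.
(* The last level: its cells have length between 1/2 and 1 in the original time scale. *)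
have [m nm mn] : exists2 m, (n * 2 ^ m)%:R <= 2 * T & T <= (n * 2 ^ m)%:R.
  have q1 : 1 <= T / n%:R by rewrite ler_pdivlMr// mul1r.
  have /andP[q2 q3] := truncn_itv (le_trans ler01 q1).
  set k := Num.truncn _ in q2 q3.
  have k0 : (0 < k)%N by rewrite truncn_gt0.
  have /andP[k1 k2] := trunc_log_bounds (isT : (1 < 2)%N) k0.
  exists (trunc_log 2 k).+1.
    rewrite expnS mulnCA natrM ler_pM2l// natrM mulrC -ler_pdivlMr//.
    by apply: le_trans q2; rewrite ler_nat.
  rewrite natrM mulrC -ler_pdivrMr//; apply: le_trans (ltW q3) _.
  by rewrite ler_nat.
pose N l := (n * 2 ^ l)%N.
have N0 l : 0 < (N l)%:R :> R by rewrite ltr0n muln_gt0 n0 expn_gt0.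
pose x i w t := fluct i (T * t) w / Num.sqrt T.
pose D i l j w := x i w (j.+1%:R / (N l)%:R) - x i w (j%:R / (N l)%:R).
(* The factor 3: up to level [m] the length [x = T / N l] is at least 1/2, so that
   [x + x^2 <= 3 x^2]. *)
have D4 i l j : (l <= m)%N -> integ (fun w => D i l j w ^+ 4) /\
    Ex (fun w => D i l j w ^+ 4) <= 3 * C / (N l)%:R ^+ 2.
  move=> lm; pose s := T * (j%:R / (N l)%:R); pose t := T * (j.+1%:R / (N l)%:R).
  have ts : t - s = T / (N l)%:R.
    by rewrite -mulrBr -mulrBl -[j.+1%:R]natr1 addrC addKr mul1r.
  have st : s <= t by rewrite -subr_ge0 ts divr_ge0 ?ltW.
  have [i4 l4] := hC i s t st.
  have -> : (fun w => D i l j w ^+ 4) = (fun w => (T ^+ 2)^-1 * (fluct i t w - fluct i s w) ^+ 4).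
    apply/funext => w; rewrite /D /x -/s -/t -mulrBl exprMn mulrC exprVn.
    by rewrite -[4%N]/(2 * 2)%N exprM sqr_sqrtr// ltW.
  split; first exact: integZ.
  rewrite ExZ// mulrC ler_pdivrMr ?exprn_gt0//; apply: le_trans l4 _; rewrite ts.
  have -> : 3 * C / (N l)%:R ^+ 2 * T ^+ 2 = C * (3 * (T / (N l)%:R) ^+ 2).
    by field; rewrite gt_eqF.
  rewrite ler_wpM2l//.
  have -> : 3 * (T / (N l)%:R) ^+ 2 = 2 * (T / (N l)%:R) ^+ 2 + (T / (N l)%:R) ^+ 2 by ring.
  rewrite lerD2r expr2 mulrA ler_peMl ?divr_ge0 ?(ltW T0)// mulrA ler_pdivlMr// mul1r.
  by apply: le_trans nm; rewrite ler_nat leq_mul2l leq_exp2l// lm orbT.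
pose b l := level_bound (N l) (D^~ l) (lam l).
have b0 l w : 0 <= b l w by exact: level_bound_ge0.
have Db i l j w : (j < N l)%N -> `|D i l j w| <= b l w.
  by move=> jN; exact: (level_boundP (D^~ l) (lam0 l)).
have ib l : (l <= m)%N -> integ (b l) /\ Ex (b l) <= lam l + d%:R * (3 * C) / a ^+ 3 / n%:R * (7 / 10) ^+ l.
  move=> lm; have [i1 l1] := @integ_level_bound _ _ _ P d (N l) (D^~ l) (lam l)
    (3 * C / (N l)%:R ^+ 2) (lam0 l) (fun i j _ => D4 i l j lm).
  split => //; apply: le_trans l1 _; rewrite lerD2l ler_pdivrMr ?exprn_gt0//.
  have -> : d%:R * ((N l)%:R * (3 * C / (N l)%:R ^+ 2)) = d%:R * (3 * C) / n%:R * (1 / 2) ^+ l.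
    have -> : (1 / 2) ^+ l = (2 ^+ l)^-1 :> R by rewrite div1r exprVn.
    rewrite /N natrM natrX; move: (2 ^+ l) (exprn_gt0 l (ltr0n R 2)) => z z0.
    by field; rewrite !gt_eqF.
  have -> : d%:R * (3 * C) / a ^+ 3 / n%:R * (7 / 10) ^+ l * lam l ^+ 3 =
     d%:R * (3 * C) / n%:R * (7 / 10 * (9 / 10) ^+ 3) ^+ l.
    have -> : lam l ^+ 3 = a ^+ 3 * ((9 / 10) ^+ 3) ^+ l by rewrite /lam exprMn -!exprM mulnC.
    rewrite [in RHS]exprMn; move: ((7 / 10) ^+ l) (((9 / 10) ^+ 3) ^+ l) => z1 z2.
    by field; rewrite !gt_eqF.
  rewrite ler_wpM2l ?divr_ge0 ?mulr_ge0//.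
  by apply: lerXn2r; rewrite ?nnegrE; lra.
(* The factor 2 makes room for [b m], needed in the chaining and again for the last cell; the final
   term is the growth of the mean inside that cell. *)
exists (fun w => \sum_(l < m.+1) 2 * b l w + rs / Num.sqrt T); split.
- apply: integD; last exact/bounded_integrable/bounded_mfun_cst.
  by apply: integ_sum => l; apply: integZ; have [] := ib l (ltn_ord l).
- by move=> w; rewrite addr_ge0 ?divr_ge0 ?sumr_ge0 ?(ltW sT)// => l _; rewrite mulr_ge0.
- rewrite ExD; [|by apply: integ_sum => l; apply: integZ; have [] := ib l (ltn_ord l)|
    exact/bounded_integrable/bounded_mfun_cst].
  rewrite Ex_cst Ex_sum; last by move=> l; apply: integZ; have [] := ib l (ltn_ord l).
  apply: (@le_trans _ _ (\sum_(l < m.+1) 2 * (lam l + d%:R * (3 * C) / a ^+ 3 / n%:R * (7 / 10) ^+ l) + e / 4)).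
    apply: lerD => //; apply: ler_sum => l _; have [i1 l1] := ib l (ltn_ord l).
    by rewrite ExZ// ler_wpM2l.
  rewrite -mulr_sumr big_split/= -!mulr_sumr.
  have g1 : \sum_(l < m.+1) (9 / 10 : R) ^+ l <= 10.
    have q1 : 0 <= (9 / 10 : R) < 1 by apply/andP; split; lra.
    apply: le_trans (geometric_sum_le _ q1) _.
    have -> : (1 - 9 / 10)^-1 = 10 :> R by field.
    by [].
  have g2 : \sum_(l < m.+1) (7 / 10 : R) ^+ l <= 4.
    have q1 : 0 <= (7 / 10 : R) < 1 by apply/andP; split; lra.
    apply: le_trans (geometric_sum_le _ q1) _.
    have -> : (1 - 7 / 10)^-1 = 10 / 3 :> R by field.
    by lra.
  have h1 : a * \sum_(l < m.+1) (9 / 10 : R) ^+ l <= a * 10 by rewrite ler_wpM2l// ltW.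
  have h2 : d%:R * (3 * C) / a ^+ 3 / n%:R * \sum_(l < m.+1) (7 / 10 : R) ^+ l <= d%:R * (3 * C) / a ^+ 3 / n%:R * 4.
    apply: ler_wpM2l => //; apply: divr_ge0; last exact: ltW.
    apply: divr_ge0; last by rewrite exprn_ge0// ltW.
    by apply: mulr_ge0; [exact: ler0n|rewrite mulr_ge0].
  have h3 : 2 * (d%:R * (3 * C) / a ^+ 3 / n%:R * 4) <= e / 4.
    by apply: le_trans hCC; rewrite le_eqVlt; apply/orP; left; apply/eqP; rewrite /CC mulrAC !mulrA.
  move: h1 h2 h3; rewrite /a.
  set s1 := \sum_(l < m.+1) _; set s2 := \sum_(l < m.+1) _; lra.
- move=> w t i t01.
  suff : `|x i w t - x i w ((Num.truncn (t * n%:R))%:R / n%:R)| <= \sum_(l < m.+1) 2 * b l w + rs / Num.sqrt T by [].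
  have ch := @chaining R (x i w) n (b^~ w) n0 m t t01 (b0^~ w) (fun l j lm jN => Db i l j w jN).
  rewrite expn0 muln1 in ch.
  pose p := (Num.truncn (t * (N m)%:R))%:R / (N m)%:R : R.
  have last_step : `|x i w t - x i w p| <= b m w + rs / Num.sqrt T.
    have NM0 : (0 < N m)%N by rewrite -(ltr0n R).
    have [k1 k2 k3] := truncn_itv01 NM0 t01.
    have [k4|k4] := leqP (N m) (Num.truncn (t * (N m)%:R)).
      have tp : t = p.
        apply/eqP; rewrite eq_le k2 andbT; case/andP: t01 => _ t1; apply: le_trans t1 _.
        by rewrite ler_pdivlMr// mul1r ler_nat.
      by rewrite -tp subrr normr0 addr_ge0// divr_ge0// ltW.
    set j := Num.truncn (t * (N m)%:R) in k4; pose p' := j.+1%:R / (N m)%:R : R.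
    have pE : p = j%:R / (N m)%:R by [].
    have p'p : p' - p = (N m)%:R^-1 by rewrite pE /p' -mulrBl -[j.+1%:R]natr1 addrC addKr mul1r.
    have tp' : T * t <= T * p'.
      by rewrite ler_pM2l// ltW// -[p'](subrK p) p'p addrC.
    have pt : T * p <= T * t by rewrite ler_pM2l.
    have h := fluct_between i w pt tp'.
    rewrite /x -mulrBl normrM [X in _ * X]ger0_norm ?invr_ge0 ?(ltW sT)//.
    rewrite ler_pdivrMr//; apply: le_trans h _; rewrite mulrDl divfK ?gt_eqF//; apply: lerD.
      rewrite -ler_pdivrMr//; apply: le_trans (Db i m j w k4).
      rewrite /D /x -/p' -pE -mulrBl normrM [X in _ <= _ * X]ger0_norm ?invr_ge0 ?(ltW sT)//.
    rewrite -mulrBr p'p (le_trans (ler_piMr _ _))//; first by rewrite ler_pdivrMr// mul1r.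
    by rewrite /rs (bigD1 i)//= lerDl sumr_ge0.
  have s1 : \sum_(l < m) b l.+1 w <= \sum_(l < m.+1) b l w by rewrite big_ord_recl/= lerDr.
  have s2 : b m w <= \sum_(l < m.+1) b l w by rewrite big_ord_recr/= lerDr sumr_ge0.
  apply: le_trans (ler_distD (x i w p) _ _) _.
  apply: le_trans (lerD last_step (le_trans ch s1)) _.
  rewrite -mulr_sumr addrAC lerD2r mulr_natl mulr2n.
  exact: lerD.
Qed.

(** * Conclusion *)

Let mean_cvg i (T v : R) (F : set_system R) {FF : Filter F} : F --> v ->
  mean i (T * s) @[s --> F] --> mean i (T * v).
Proof.
move=> Fv; apply: cvgr_distP => e e0.
have r0 : 0 <= rate i := rate0 i.
have c0 : 0 < `|T| * rate i + 1 by rewrite ltr_wpDl// mulr_ge0.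
have lip (a b : R) : `|mean i a - mean i b| <= rate i * `|a - b|.
  exact: (nondecreasing_lipschitz (@mean_nd i) (@mean_lip i)).
have e' : 0 < e / (`|T| * rate i + 1) by rewrite divr_gt0.
have : \forall s \near F, `|v - s| <= e / (`|T| * rate i + 1).
  by move/cvgrPdist_le : Fv; apply.
apply: filterS => s; rewrite ler_pdivlMr// => h; apply: le_trans (lip _ _) _.
rewrite -mulrBr normrM; apply: le_trans h; rewrite mulrDr mulr1.
by rewrite [leLHS]mulrC -mulrA [leLHS]mulrCA lerDl.
Qed.

Let jumpsE n i t w : N n i t w = \sum_(k < n) ((tau k w <= t%:E)%E && (Z k w == i))%:R.
Proof. by []. Qed.

Let rescaledE T v w i : good w ->
  rescaled_count P tau Z T v w i 0 = (count i (T * v) w - mean i (T * v)) / Num.sqrt T.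
Proof.
move=> gw; rewrite !mxE mulrC (mean_countE)/=.
by rewrite (jump_count_count i (T * v) gw).
Qed.

(** Without explosion the count near [v] is a finite sum of indicators of [tau k <= T s], right
    continuous in s, with left limits given by the strict inequality; the mean is continuous. *)
Lemma rescaled_cadlag T w : 0 < T -> good w -> cadlag (fun v => rescaled_count P tau Z T v w).
Proof.
move=> T0 gw.
have count_eq i v : exists n, forall s, s < v + 1 -> count i (T * s) w = N n i (T * s) w.
  have [n _ /(_ n (leqnn n)) tn] := nonexplosive_near (T * (v + 1)) gw.
  exists n => s sv; apply: (count_cnt i gw); apply: lt_trans tn.
  by rewrite lte_fin ltr_pM2l.
have right i v : count i (T * s) w @[s --> v^'+] --> count i (T * v) w.
  have [n hn] := count_eq i v; have v1 : v < v + 1 by rewrite ltrDl.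
  apply: cvg_near_cst; rewrite hn//.
  have : \forall s \near v^'+, forall k : 'I_n, (tau k w <= (T * s)%:E)%E = (tau k w <= (T * v)%:E)%E.
    by apply: filter_forall => k; exact: near_right_le.
  apply: filterS2 (nbhs_right_lt v1) => s sv h.
  by rewrite hn// !jumpsE; apply: eq_bigr => k _; rewrite h.
have left i v : exists l, count i (T * s) w @[s --> v^'-] --> (l : R).
  have [n hn] := count_eq i v.
  exists (\sum_(k < n) ((tau k w < (T * v)%:E)%E && (Z k w == i))%:R).
  apply: cvg_near_cst.
  have : \forall s \near v^'-, forall k : 'I_n, (tau k w <= (T * s)%:E)%E = (tau k w < (T * v)%:E)%E.
    by apply: filter_forall => k; exact: near_left_le.
  apply: filterS2 (nbhs_left_lt v) => s sv h.
  rewrite hn; last by rewrite (lt_le_trans sv)// lerDl.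
  by rewrite jumpsE; apply: eq_bigr => k _; rewrite h.
split=> v _.
- apply: cvg_col => i; apply: (eq_cvgr (fun s => rescaledE T s i gw) (rescaledE T v i gw)).
  apply: cvgMl; apply: cvgB; first exact: right.
  by apply: mean_cvg; exact: cvg_within.
- have /choice[l hl] i := left i v.
  apply/cvg_ex; exists (\col_i ((l i - mean i (T * v)) / Num.sqrt T)).
  apply: cvg_col => i; apply: (eq_cvgr (fun s => rescaledE T s i gw) (mxE _ _ _ _)).
  apply: cvgMl; apply: cvgB; first exact: hl.
  by apply: mean_cvg; exact: cvg_within.
Qed.

Local Notation Sigma := (diag_mx (R1 *m mu)^T).
Local Notation Sigma_half := (\matrix_(i, j) Num.sqrt (Sigma i j)).

Lemma rescaled_cvg_in_law d' (Om' : measurableType d') (Q : probability Om' R)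
  (W : R -> Om' -> 'cV[R]_d) : standard_brownian_motion Q W ->
  cvg_in_law_skorokhod P Q (rescaled_count P tau Z) (fun v w => R1 *m Sigma_half *m W v w).
Proof.
move=> W_bm; have [mW _ cW _ _] := W_bm.
have rateE j : (R1 *m mu) j 0 = rate j by rewrite mxE.
have YE v w i : (R1 *m Sigma_half *m W v w) i 0 = \sum_j R1 i j * (Num.sqrt (rate j) * W v w j 0).
  rewrite -mulmxA mxE; apply: eq_bigr => j _; congr (_ * _).
  rewrite mxE (bigD1 j)//= big1 ?addr0 => [|k kj].
    by rewrite mxE mxE eqxx mulr1n mxE rateE.
  by rewrite !mxE eq_sym (negbTE kj) mulr0n sqrtr0 mul0r.
(* A measurable version built on [count], equal to the rescaled count off the null set of
   explosions. *)
pose X T v w : 'cV[R]_d := \col_i (fluct i (T * v) w / Num.sqrt T).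
apply: (@skorokhod_cvg R d _ _ Om Om' P Q X (rescaled_count P tau Z) _ good).
- move=> T v i; under eq_fun do rewrite mxE; exact: measurable_funM.
- move=> v i v01; under eq_fun do rewrite YE.
  apply: measurable_fun_sumr => j; apply: measurable_funM => //; apply: measurable_funM => //.
  exact: mW.
- move=> w; apply/subspace_continuousP => t t01.
  by apply: cvg_mulmx; move: t t01; apply/subspace_continuousP; exact: cW.
- exact: measurable_nonexplosive.
- exact: good_ae.
- by apply: filterS (nbhs_pinfty_gt (num_real 0)) => T T0 w gw; exact: rescaled_cadlag.
- apply: nearW => T w gw v _; apply/colP => i; rewrite rescaledE// mxE.
  by rewrite fluctE.
- move=> n g L B n0 L0 gL gB.
  have := fluct_grid_cvg W_bm n0 L0 gL gB.
  have -> : (fun T => Ex (fun w => g (fun p => X T (p.1%:R / n%:R) w p.2 0))) =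
     (fun T => Ex (fun w => g (fun p => fluct_grid T p w))).
    apply/funext => T; congr Rintegral; apply/funext => w; congr g; apply/funext => p.
    by rewrite mxE.
  have -> // : (fun w => g (fun p => (R1 *m Sigma_half *m W (p.1%:R / n%:R) w) p.2 0)) =
     (fun w => g (fun p => limit_grid W p w)).
  by apply/funext => w; congr g; apply/funext => p; rewrite YE.
- move=> e e0; have := fluct_tight e0.
  apply: filterS => n; apply: filterS => T [B [iB B0 EB hB]]; exists B; split => // w t i _ t01.
  have XE s : X T s w i 0 = fluct i (T * s) w / Num.sqrt T by rewrite mxE.
  apply: le_trans (hB w t i t01); rewrite le_eqVlt; apply/orP; left; apply/eqP.
  exact: (congr2 (fun x y => `|x - y|) (XE t) (XE _)).
Qed.

End HawkesProcess.

Theorem theorem2 (R : realType) (d : nat)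
  (dO : measure_display) (Om : measurableType dO) (P : probability Om R)
  (mu : 'cV[R]_d) (phi : R -> 'M[R]_d)
  (tau : nat -> Om -> \bar R) (Z : nat -> Om -> 'I_d)
  (mu_ge0 : forall i, 0 <= mu i 0)
  (phi_ge0 : forall (t : R) i j, 0 <= t -> 0 <= phi t i j)
  (phi_meas : forall i j, measurable_fun (`[0, +oo[ : set R) (fun t => phi t i j))
  (N_hawkes : hawkes_process P mu phi tau Z)
  (phi_int : forall i j,
     (\int[lebesgue_measure]_(t in `[0%R, +oo[) (phi t i j)%:E < +oo)%E)
  (rho_lt1 : spectral_radius (kernel_mass phi) < 1) :
  let K := kernel_mass phi in
  let psi := kernel_psi phi in
  let Sigma := diag_mx (invmx (1%:M - K) *m mu)^T in
  let Sigma_half := \matrix_(i, j) Num.sqrt (Sigma i j) in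
  [/\ forall i j, lebesgue_measure.-integrable (`[0, +oo[ : set R) (fun t => psi t i j),
      forall (t : R) i, 0 <= t ->
        mean_count P tau Z i t =
        ((t * mu i 0)%:E +
         \sum_(j < d) (\int[lebesgue_measure]_(s in `[0%R, t])
                         (psi (t - s)%R i j * s%:E)) * (mu j 0)%:E)%E &
      forall (dO' : measure_display) (Om' : measurableType dO')
        (Q : probability Om' R) (W : R -> Om' -> 'cV[R]_d),
        standard_brownian_motion Q W ->
        cvg_in_law_skorokhod P Q
          (rescaled_count P tau Z)
          (fun v w => invmx (1%:M - K) *m Sigma_half *m W v w)].
Proof.
move=> K psi Sigma Sigma_half; split.
- exact: integrable_kernel_psi.
- by move=> t i; exact: mean_solution.
- move=> dO' Om' Q W; exact: rescaled_cvg_in_law.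
Qed.
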